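(* Let $n\ge2$ be an integer and let $\nu\in\mathbb C\setminus\{-1,-2,\dots\}$. Define a linear map $\mathcal M_\nu:E_n\to E_n$ by $(\mathcal M_\nu\mathbf a)_0=M_0(\nu)\mathbf a_0$ and, for $0<|k|\le n-1$, by $(\mathcal M_\nu\mathbf a)_k=M_k(\nu)\mathbf a_{-k}$. Then $$\mathcal C_\nu=\mathcal A_\infty^\nu\circ\mathcal M_\nu\circ(\mathcal A_0^\nu)^{-1}:V_0\longrightarrow V_\infty$$ is a linear isomorphism. Moreover, every formal solution $u_\lambda$ of $(\Delta-\lambda)u_\lambda=0$ with $\lambda=\nu(\nu+1)$ satisfies $$\pi_\infty(u_\lambda)=\mathcal C_\nu\,\pi_0(u_\lambda).$$
   Context: **Geometry.** Let $n\ge2$. On $\mathbb P^1$ use affine coordinates $x$ on $\mathbb P^1\setminus\{\infty\}$ and $y=x^{-1}$ on $\mathbb P^1\setminus\{0\}$; $X'=\mathbb P^1\setminus\{0,\infty\}$; polar coordinates $x=re^{i\theta}$, $y=\rho e^{i\eta}$ (so $\rho=r^{-1}$, $\eta=-\theta$). The metric is $ds_n^2=\frac{4n^2|x|^{2n-2}}{(1+|x|^{2n})^2}|dx|^2$ (the same formula holds in $y$), with area form $dA=\frac{4n^2r^{2n-1}}{(1+r^{2n})^2}dr\wedge d\theta$. The nonnegative Laplacian is $\Delta=-\frac{(1+|x|^{2n})^2}{n^2|x|^{2n-2}}\frac{\partial^2}{\partial x\partial\bar x}$, and $\mathcal D_{\max}(\Delta)=\{u\in L^2(X',dA):\Delta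 u\in L^2(X',dA)\text{ in the distributional sense on }X'\}$. A formal solution of $(\Delta-\lambda)u=0$ is an element $u\in\mathcal D_{\max}(\Delta)$ satisfying the equation in the distributional sense on $X'$. **Boundary data of a formal solution.** For a formal solution $u_\lambda$ let $u_k(r;\lambda)=\frac1{2\pi}\int_0^{2\pi}u_\lambda e^{-ik\theta}d\theta$ (in the $x$-coordinate) and $v_k(\rho;\lambda)=\frac1{2\pi}\int_0^{2\pi}u_\lambda e^{-ik\eta}d\eta$ (in the $y$-coordinate). For $|k|\le n-1$ there are unique coefficients with $u_0=c_0+c_0^\#\log r+O(r^{2n}|\log r|)$ and $u_k=c_kr^{|k|}+c_k^\#r^{-|k|}+O(r^{2n-|k|})$ ($k\ne0$) as $r\to0^+$, and $v_0=d_0+d_0^\#\log\rho+O(\rho^{2n}|\log\rho|)$ and $v_k=d_k\rho^{|k|}+d_k^\#\rho^{-|k|}+O(\rho^{2n-|k|})$ ($k\ne0$) as $\rho\to0^+$. Set $$\pi_0(u_\lambda)=c_0+c_0^\#\log r+\sum_{0<|k|\le n-1}(c_kr^{|k|}+c_k^\#r^{-|k|})e^{ik\theta},\qquad \pi_\infty(u_\lambda)=d_0+d_0^\#\log\rho+\sum_{0<|k|\le n-1}(d_k\rho^{|k|}+d_k^\#\rho^{-|k|})e^{ik\eta}.$$ **Boundary spaces.** $f_0=\frac1{\sqrt{2\pi}}$, $f_0^\#=-\frac1{\sqrt{2\pi}}\log r$, and for $1\le|j|\le n-1$, $f_j=\frac{1}{\sqrt{4\pi|j|}}r^{|j|}e^{ij\theta}$,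 $f_j^\#=\frac1{\sqrt{4\pi|j|}}r^{-|j|}e^{ij\theta}$; $g_j,g_j^\#$ are given by the same formulas with $(\rho,\eta)$ in place of $(r,\theta)$. $V_0$ and $V_\infty$ are the complex vector spaces with bases $\{f_j,f_j^\#:|j|\le n-1\}$ and $\{g_j,g_j^\#:|j|\le n-1\}$. **Coefficient space and maps.** Let $\alpha_k=|k|/n$, $\gamma_E$ the Euler constant, $\psi=\Gamma'/\Gamma$, $E_n=\bigoplus_{|k|\le n-1}\mathbb C^2$ with elements $\mathbf a=(\mathbf a_k)$, $\mathbf a_k=(A_k,B_k)^t$. Define $\mathcal A_0^\nu:E_n\to V_0$ by $$\mathcal A_0^\nu(\mathbf a)=\sqrt{2\pi}\,[A_0-B_0(\gamma_E+\psi(\nu+1))]f_0+n\sqrt{2\pi}B_0f_0^\#+\sum_{0<|k|\le n-1}\sqrt{4\pi|k|}\Big[\tfrac{A_k}{\Gamma(1+\alpha_k)}f_k+\tfrac{B_k}{\Gamma(1-\alpha_k)}f_k^\#\Big],$$ and $\mathcal A_\infty^\nu:E_n\to V_\infty$ by the same formula with $g$ in place of $f$. (These are linear isomorphisms.) Let $$M_0(\nu)=\begin{pmatrix}\cos\pi\nu&-\frac\pi2\sin\pi\nu\\-\frac2\pi\sin\pi\nu&-\cos\pi\nu\end{pmatrix},$$ and for $0<|k|\le n-1$ $$M_k(\nu)=\begin{pmatrix}\frac{\sin\pi\nu}{\sin\pi\alpha_k}&\frac{\Gamma(\nu+\alpha_k+1)}{\Gamma(\nu-\alpha_k+1)}\frac{\sin\pi(\nu+\alpha_k)}{\sin\pi\alpha_k}\\-\frac{\Gamma(\nu-\alpha_k+1)}{\Gamma(\nu+\alpha_k+1)}\frac{\sin\pi(\nu-\alpha_k)}{\sin\pi\alpha_k}&-\frac{\sin\pi\nu}{\sin\pi\alpha_k}\end{pmatrix},$$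 with entries understood by analytic continuation at removable singularities. *)

(* Defs.v *)
From HB Require Import structures.
From mathcomp Require Import all_boot all_order all_algebra.
From mathcomp Require Import all_classical all_reals all_analysis.
From mathcomp Require Import complex zify.

Set Implicit Arguments.
Unset Strict Implicit.
Unset Printing Implicit Defensive.

Import Order.TTheory GRing.Theory Num.Theory.
Import numFieldNormedType.Exports.

Local Open Scope classical_set_scope.
Local Open Scope complex_scope.
Local Open Scope ring_scope.

(* R[i] gets the topology of its norm, and is a normed module over itself,
   through its regular module R[i]^o; limits and [derive1] over R[i] are thus
   complex limits and complex derivatives. *)
HB.instance Definition _ (R : realType) :=
  PseudoPointedMetric.copy R[i] R[i]^o.
HB.instance Definition _ (R : realType) := GRing.ComAlgebra.copy R[i] R[i]^o.
HB.instance Definition _ (R : realType) := Vector.copy R[i] R[i]^o.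
HB.instance Definition _ (R : realType) := NormedModule.copy R[i] R[i]^o.

Section SpecialFunctions.
Context {R : realType}.
Implicit Types z : R[i].

Definition expi (t : R) : R[i] := cos t +i* sin t.

Definition cexp z : R[i] := (expR (complex.Re z))%:C * expi (complex.Im z).

Definition ccos z : R[i] := (cexp ('i%C * z) + cexp (- ('i%C * z))) / 2.

Definition csin z : R[i] := (cexp ('i%C * z) - cexp (- ('i%C * z))) / (2 * 'i%C).

(* Euler's limit m! m^z / (z (z + 1) ... (z + m)), valid on the whole domain
   C \ {0, -1, -2, ...} of Gamma *)
Definition Gamma z : R[i] :=
  limn (fun m : nat => m`!%:R * cexp (z * (ln m%:R)%:C)
                       / \prod_(0 <= j < m.+1) (z + j%:R)).

Definition digamma z : R[i] := derive1 Gamma z / Gamma z.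

Definition euler_gamma : R :=
  limn (fun m : nat => \sum_(1 <= k < m.+1) k%:R^-1 - ln m%:R).

(* The value at z of the function f, extended continuously if z is a removable
   singularity (the limit is taken over punctured neighbourhoods of z, and is
   f z as soon as f is continuous at z). *)
Definition removable (f : R[i] -> R[i]) z : R[i] := lim (f @ z^').

End SpecialFunctions.

(* Functions on X' = P^1 \ {0, oo} = C \ {0} are represented by functions
   R[i] -> R[i] of the affine coordinate x; their value at 0 is irrelevant. *)
Section Geometry.
Context {R : realType}.
Implicit Types u f phi : R[i] -> R[i].

Definition polar (p : R * R) : R[i] := p.1%:C * expi p.2.

Definition polar_dom : set (measurableTypeR R * measurableTypeR R) :=
  `]0, +oo[%classic `*` `[0, 2 * pi]%classic.

(* dA = area_density n r * dr dtheta *)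
Definition area_density (n : nat) (r : R) : R :=
  4 * n%:R ^+ 2 * r ^+ (2 * n - 1) / (1 + r ^+ (2 * n)) ^+ 2.

Definition cintegral d (T : measurableType d) (mu : {measure set T -> \bar R})
    (D : set T) (f : T -> R[i]) : R[i] :=
  Rintegral mu D (fun t => complex.Re (f t))
  +i* Rintegral mu D (fun t => complex.Im (f t)).

Definition area_integral (n : nat) f : R[i] :=
  cintegral (lebesgue_measure \x lebesgue_measure)%E polar_dom
    (fun p => f (polar p) * (area_density n p.1)%:C).

(* u represents an element of L^2(X', dA) *)
Definition L2 (n : nat) u : Prop :=
  [/\ measurable_fun polar_dom (fun p => complex.Re (u (polar p))),
      measurable_fun polar_dom (fun p => complex.Im (u (polar p)))
    & (\int[lebesgue_measure \x lebesgue_measure]_(p in polar_dom)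
         (complex.Re `|u (polar p)| ^+ 2 * area_density n p.1)%:E < +oo)%E].

(* real directional derivatives of a complex function *)
Definition rderivable phi (v z : R[i]) : Prop :=
  derivable (fun t : R => complex.Re (phi (z + t%:C * v))) 0 1 /\
  derivable (fun t : R => complex.Im (phi (z + t%:C * v))) 0 1.

Definition rderive (v : R[i]) phi (z : R[i]) : R[i] :=
  derive1 (fun t : R => complex.Re (phi (z + t%:C * v))) 0
  +i* derive1 (fun t : R => complex.Im (phi (z + t%:C * v))) 0.

(* a word b encodes an iterated partial derivative: true for d/d(Re x), false
   for d/d(Im x) *)
Definition smooth phi : Prop :=
  forall b : seq bool,
    let psi := foldr (fun e => rderive (if e then 1 else 'i%C)) phi b in
    continuous psi /\
    forall z, rderivable psi 1 z /\ rderivable psi 'i%C z.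

(* elements of C_c^oo(X'), extended by 0 *)
Definition test_function phi : Prop :=
  smooth phi /\
  exists K : set R[i],
    [/\ compact K, ~ K 0 & forall z, ~ K z -> phi z = 0].

(* d/dx and d/d(bar x) *)
Definition d_x phi (z : R[i]) : R[i] :=
  (rderive 1 phi z - 'i%C * rderive 'i%C phi z) / 2.

Definition d_xbar phi (z : R[i]) : R[i] :=
  (rderive 1 phi z + 'i%C * rderive 'i%C phi z) / 2.

Definition laplacian (n : nat) phi (z : R[i]) : R[i] :=
  - ((1 + `|z| ^+ (2 * n)) ^+ 2 / (n%:R ^+ 2 * `|z| ^+ (2 * n - 2)))
  * d_x (d_xbar phi) z.

(* Delta u = f in the sense of distributions on X'; the Laplacian is real and
   formally self-adjoint with respect to dA. *)
Definition weak_laplacian (n : nat) u f : Prop :=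
  forall phi, test_function phi ->
    area_integral n (fun x => u x * laplacian n phi x)
    = area_integral n (fun x => f x * phi x).

Definition Dmax (n : nat) u : Prop :=
  L2 n u /\ exists f, L2 n f /\ weak_laplacian n u f.

Definition formal_solution (n : nat) (lambda : R[i]) u : Prop :=
  Dmax n u /\ weak_laplacian n u (fun x => lambda * u x).

End Geometry.

(* The index set {k : int | |k| <= n - 1}, encoded by 'I_(2n - 1). *)
Definition mode n (i : 'I_(n.*2.-1)) : int := i%:Z - n.-1%:Z.

Lemma mode_rev n (i : 'I_(n.*2.-1)) : mode (rev_ord i) = - mode i.
Proof.
rewrite /mode /=; have := ltn_ord i; lia.
Qed.

(* E_n, the direct sum of copies of C^2; the entries 0 and 1 of [a i] are A_k
   and B_k for k = mode i. *)
Notation En R n := {ffun 'I_(n.*2.-1) -> 'cV[R[i]]_2} (only parsing).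

Section Boundary.
Context {R : realType} (n : nat).
Implicit Types (u h : R[i] -> R[i]) (k : int) (x nu : R[i]).

Definition fst_coef (a : En R n) (i : 'I_(n.*2.-1)) : R[i] := a i ord0 ord0.
Definition snd_coef (a : En R n) (i : 'I_(n.*2.-1)) : R[i] := a i ord_max ord0.

(* The polar coordinates of x: x = r e^(i theta). *)
Definition modulus x : R := complex.Re `|x|.
Definition phase x : R[i] := x / `|x|.

Definition fourier u k (r : R) : R[i] :=
  (2 * pi)^-1%:C *
  cintegral lebesgue_measure `[0, 2 * pi]%classic
    (fun t : R => u (polar (r, t)) * expi (- (k%:~R * t))).

(* F(r) = O(G(r)) as r -> 0+, for almost every r. The Fourier modes of an
   element of L^2 are only defined almost everywhere; for the smooth
   representative of a formal solution they are continuous in r, and the bound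
   then holds for every small r. *)
Definition bigO_ae0 (F : R -> R[i]) (G : R -> R) : Prop :=
  exists K : R, exists2 delta : R, 0 < delta &
    {ae lebesgue_measure, forall r : R,
       0 < r < delta -> complex.Re `|F r| <= K * G r}.

(* c lists the coefficients c_k, c_k^# of the expansions of the modes w_k. *)
Definition expansion (w : int -> R -> R[i]) (c : En R n) : Prop :=
  forall i, let k := mode i in
  if k == 0 then
    bigO_ae0 (fun r => w k r - (fst_coef c i + snd_coef c i * (ln r)%:C))
             (fun r => r ^+ (2 * n) * `|ln r|)
  else
    bigO_ae0 (fun r => w k r - (fst_coef c i * (r ^+ `|k|%N)%:C
                                + snd_coef c i * (r ^- `|k|%N)%:C))
             (fun r => r ^+ (2 * n - `|k|%N)).

Definition expansion0 u : set (En R n) := expansion (fourier u).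

(* the modes v_k are those of y |-> u (1 / y) *)
Definition expansionoo u : set (En R n) :=
  expansion (fourier (fun y => u y^-1)).

Definition boundary_part (c : En R n) x : R[i] :=
  \sum_(i < n.*2.-1) let k := mode i in
    if k == 0 then fst_coef c i + snd_coef c i * (ln (modulus x))%:C
    else (fst_coef c i * (modulus x ^+ `|k|%N)%:C
          + snd_coef c i * (modulus x ^- `|k|%N)%:C) * phase x ^ k.

Definition pi0 u x : R[i] := boundary_part (xget 0 (expansion0 u)) x.
Definition pioo u x : R[i] := boundary_part (xget 0 (expansionoo u)) x^-1.

Definition f_ k x : R[i] :=
  if k == 0 then (Num.sqrt (2 * pi))^-1%:C
  else ((Num.sqrt (4 * pi * `|k|%N%:R))^-1 * modulus x ^+ `|k|%N)%:C
       * phase x ^ k.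

Definition fs_ k x : R[i] :=
  if k == 0 then (- (Num.sqrt (2 * pi))^-1 * ln (modulus x))%:C
  else ((Num.sqrt (4 * pi * `|k|%N%:R))^-1 * modulus x ^- `|k|%N)%:C
       * phase x ^ k.

Definition g_ k x : R[i] := f_ k x^-1.
Definition gs_ k x : R[i] := fs_ k x^-1.

Definition span2 (F Fs : int -> R[i] -> R[i]) : set (R[i] -> R[i]) :=
  [set h | exists a : En R n,
     h = \sum_(i < n.*2.-1) (fst_coef a i *: F (mode i)
                             + snd_coef a i *: Fs (mode i))].

Definition V0 : set (R[i] -> R[i]) := span2 f_ fs_.
Definition Voo : set (R[i] -> R[i]) := span2 g_ gs_.

Definition alpha k : R := `|k|%N%:R / n%:R.

Definition calA (F Fs : int -> R[i] -> R[i]) nu (a : En R n) : R[i] -> R[i] :=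
  \sum_(i < n.*2.-1)
    let k := mode i in let A := fst_coef a i in let B := snd_coef a i in
    if k == 0 then
      ((Num.sqrt (2 * pi))%:C
         * (A - B * (euler_gamma%:C + digamma (nu + 1)))) *: F k
      + (n%:R * (Num.sqrt (2 * pi))%:C * B) *: Fs k
    else
      (Num.sqrt (4 * pi * `|k|%N%:R))%:C
        *: ((A / Gamma (1 + (alpha k)%:C)) *: F k
            + (B / Gamma (1 - (alpha k)%:C)) *: Fs k).

Definition calA0 : R[i] -> En R n -> R[i] -> R[i] := calA f_ fs_.
Definition calAoo : R[i] -> En R n -> R[i] -> R[i] := calA g_ gs_.

Definition mx22 (a b c d : R[i]) : 'M[R[i]]_2 :=
  \matrix_(i < 2, j < 2)
    if i == ord0 then (if j == ord0 then a else b)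
    else (if j == ord0 then c else d).

Definition M0 nu : 'M[R[i]]_2 :=
  mx22 (ccos (pi%:C * nu))                (- (pi / 2)%:C * csin (pi%:C * nu))
       (- (2 / pi)%:C * csin (pi%:C * nu)) (- ccos (pi%:C * nu)).

Definition Mk k nu : 'M[R[i]]_2 :=
  let al : R[i] := (alpha k)%:C in
  let s z := csin (pi%:C * z) in
  mx22
    (s nu / s al)
    (removable (fun z => Gamma (z + al + 1) / Gamma (z - al + 1)
                         * (s (z + al) / s al)) nu)
    (removable (fun z => - (Gamma (z - al + 1) / Gamma (z + al + 1)
                            * (s (z - al) / s al))) nu)
    (- (s nu / s al)).

(* [rev_ord i] is the index of the mode - k, see [mode_rev]. *)
Definition calM nu (a : En R n) : En R n :=
  [ffun i => if mode i == 0 then M0 nu *m a i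
             else Mk (mode i) nu *m a (rev_ord i)].

(* On V0, the function ['pinv_(fun=> 0) setT (calA0 nu)] is the inverse of the
   isomorphism [calA0 nu]. *)
Definition calC nu h : R[i] -> R[i] :=
  calAoo nu (calM nu ('pinv_(fun=> 0) setT (calA0 nu) h)).

End Boundary.

(* Main.v *)
Require Import Defs.
From HB Require Import structures.
From mathcomp Require Import all_boot all_order all_algebra.
From mathcomp Require Import all_classical all_reals all_analysis.
From mathcomp Require Import measurable_realfun.
From mathcomp Require Import complex ring lra zify.

Set Implicit Arguments.
Unset Strict Implicit.
Unset Printing Implicit Defensive.

Import Order.TTheory GRing.Theory Num.Theory.
Import numFieldNormedType.Exports.

Local Open Scope classical_set_scope.
Local Open Scope complex_scope.
Local Open Scope ring_scope.

(** In the variable [s = n ln r] the punctured sphere is a cylinder, and a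
    formal solution splits into Fourier modes. Each mode satisfies, in the weak
    sense, the Legendre equation
      [y'' = (al ^ 2 - nu (nu + 1) / cosh (s) ^ 2) y] with [al = |k| / n].
    To see this, the distributional equation is tested against products of a
    smooth bump in [ln r] with [e ^ (- i k theta)] ([radial_weak]). Variation of
    constants then shows that the mode is almost everywhere a combination of two
    given solutions ([variation_of_constants], [formal_mode]). These are
    [Phi_al] and [Phi_(- al)], hypergeometric series in
    [zeta = e ^ (2 s) / (1 + e ^ (2 s))] times [e ^ (al s)] and [e ^ (- al s)];
    for [k = 0] they are [Phi_0] and a logarithmic solution [QPhi]. As
    [s -> - oo], that is [r -> 0], one reads off their expansions, and the
    coordinates [a] of the modes in these bases give [pi0 u = calA0 nu a]
    ([power_expansion], [log_expansion], [boundary_coefs]).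

    The point at infinity is reached by [x -> 1 / x], which exchanges the modes
    [k] and [- k] and changes [s] into [- s]. The equation is even in [s], so
    that [y (- s)] is again a combination of the two basic solutions, and
    the claim is that its matrix is [Mk] or [M0]. Since [s = 0] is a fixed
    point, the matrix is determined by the values and slopes of the basis at
    [s = 0] ([osol_reflect]), through the products [2 y y'], [2 z z'],
    [y z' - y' z] and [y z' + y' z].

    The products are found as follows. The ladder relations
    between contiguous hypergeometric series show that [2 y y'] changes
    by an explicit quadratic factor when [al] increases by [1]. Iterating to
    infinity, where the series reduces to its first term, yields Euler's product
    for [1 / Gamma] twice ([wselfE]):
      [2 y y' = 2 / (Gamma (nu + al + 1) Gamma (al - nu))].
    The elementary case [al = - 1 / 2] of this identity is Euler's reflection
    formula ([rgamma_reflection]). The Wronskian is constant, and is computed at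
    [s = - oo] ([wronskian_Phi]). The square of [y z' + y' z] follows from the
    other three products, and its sign from continuity in [al], starting at
    [al = 0] ([crossEE]). The logarithmic case is the derivative of this
    picture in [al] at [0], to second order for the product [2 z z']
    ([wself_derive2]).

    The reflection formula also shows that the singularities in the
    entries of [Mk] are removable ([removable_entry]), and that every block of
    [calM] is an involution ([calM_involutive]); as the maps [calA0] and
    [calAoo] are isomorphisms onto the boundary spaces, so is [calC]. *)

(** * Complex limits and derivatives along the real line *)

Lemma cvg_near_eq (T : Type) (U : topologicalType) (F : set_system T)
    {FF : Filter F} (f g : T -> U) (l : U) :
  (\forall x \near F, f x = g x) -> f @ F --> l -> g @ F --> l.
Proof.
move=> h; apply: cvg_trans; apply: near_eq_cvg.
by apply: filterS h => x ->.
Qed.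

Section ModulusTheory.
Context {R : realType}.
Implicit Types z w : R[i].

Lemma normCE z : `|z| = (modulus z)%:C.
Proof. by rewrite /modulus normc_def. Qed.

Lemma modulusE z : modulus z = Num.sqrt (complex.Re z ^+ 2 + complex.Im z ^+ 2).
Proof. by rewrite /modulus normc_def. Qed.

Lemma modulus_ge0 z : 0 <= modulus z.
Proof. by rewrite modulusE sqrtr_ge0. Qed.

Lemma modulusM z w : modulus (z * w) = modulus z * modulus w.
Proof. by apply: complexI; rewrite rmorphM -!normCE normrM. Qed.

Lemma modulusD z w : modulus (z + w) <= modulus z + modulus w.
Proof. by rewrite -lecR rmorphD -!normCE ler_normD. Qed.

Lemma modulusN z : modulus (- z) = modulus z.
Proof. by rewrite /modulus normrN. Qed.

Lemma modulusB z w : modulus (z - w) = modulus (w - z).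
Proof. by rewrite -modulusN opprB. Qed.

Lemma modulusV z : modulus z^-1 = (modulus z)^-1.
Proof. by apply: complexI; rewrite fmorphV -!normCE normfV. Qed.

Lemma modulus0 : modulus (0 : R[i]) = 0.
Proof. by rewrite /modulus normr0. Qed.

Lemma modulus1 : modulus (1 : R[i]) = 1.
Proof. by rewrite /modulus normr1. Qed.

Lemma modulus_eq0 z : (modulus z == 0) = (z == 0).
Proof. by rewrite -(normr_eq0 z) normCE eq_complex /= eqxx andbT. Qed.

Lemma modulus_gt0 z : (0 < modulus z) = (z != 0).
Proof. by rewrite lt_def modulus_eq0 modulus_ge0 andbT. Qed.

Lemma modulusR (x : R) : modulus x%:C = `|x|.
Proof. by rewrite modulusE /= expr0n addr0 sqrtr_sqr. Qed.

Lemma real_complexN (m : nat) : (m%:R : R)%:C = m%:R :> R[i].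
Proof. by rewrite rmorph_nat. Qed.

Lemma modulus_nat (m : nat) : modulus (m%:R : R[i]) = m%:R.
Proof. by rewrite -real_complexN modulusR ger0_norm. Qed.

Lemma modulus_Re z : `|complex.Re z| <= modulus z.
Proof. by rewrite modulusE -sqrtr_sqr ler_sqrt ?lerDl ?addr_ge0 ?sqr_ge0. Qed.

Lemma modulus_Im z : `|complex.Im z| <= modulus z.
Proof. by rewrite modulusE -sqrtr_sqr ler_sqrt ?lerDr ?addr_ge0 ?sqr_ge0. Qed.

Lemma modulus_le_ReIm z : modulus z <= `|complex.Re z| + `|complex.Im z|.
Proof.
have -> : z = (complex.Re z)%:C + (complex.Im z)%:C * 'i%C by rewrite {1}[z]complexE mulrC.
apply: le_trans (modulusD _ _) _; rewrite modulusM !modulusR /=.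
rewrite [modulus 'i%C]modulusE /= expr0n add0r expr1n sqrtr1 mulr1.
by rewrite !(mul0r, mulr0, mulr1, add0r, addr0, subr0).
Qed.

Lemma cReD z w : complex.Re (z + w) = complex.Re z + complex.Re w.
Proof. by case: z; case: w. Qed.
Lemma cImD z w : complex.Im (z + w) = complex.Im z + complex.Im w.
Proof. by case: z; case: w. Qed.
Lemma cReN z : complex.Re (- z) = - complex.Re z.
Proof. by case: z. Qed.
Lemma cImN z : complex.Im (- z) = - complex.Im z.
Proof. by case: z. Qed.
Lemma cReB z w : complex.Re (z - w) = complex.Re z - complex.Re w.
Proof. by rewrite cReD cReN. Qed.
Lemma cImB z w : complex.Im (z - w) = complex.Im z - complex.Im w.
Proof. by rewrite cImD cImN. Qed.
Lemma cReM z w : complex.Re (z * w) =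
  complex.Re z * complex.Re w - complex.Im z * complex.Im w.
Proof. by case: z; case: w. Qed.
Lemma cImM z w : complex.Im (z * w) =
  complex.Re z * complex.Im w + complex.Im z * complex.Re w.
Proof. by case: z => a b; case: w => c d; rewrite /=; ring. Qed.
Lemma complex_ext z w :
  complex.Re z = complex.Re w -> complex.Im z = complex.Im w -> z = w.
Proof. by case: z; case: w => ? ? ? ? /= -> ->. Qed.
Lemma cRe_sum I (r : seq I) (P : pred I) (F : I -> R[i]) :
  complex.Re (\sum_(i <- r | P i) F i) = \sum_(i <- r | P i) complex.Re (F i).
Proof. exact: (big_morph _ cReD). Qed.
Lemma cIm_sum I (r : seq I) (P : pred I) (F : I -> R[i]) :
  complex.Im (\sum_(i <- r | P i) F i) = \sum_(i <- r | P i) complex.Im (F i).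
Proof. exact: (big_morph _ cImD). Qed.

Lemma modulus_sum I (r : seq I) (P : pred I) (F : I -> R[i]) :
  modulus (\sum_(i <- r | P i) F i) <= \sum_(i <- r | P i) modulus (F i).
Proof.
elim/big_rec2: _ => [|i y x _ h]; first by rewrite modulus0.
by apply: le_trans (modulusD _ _) _; rewrite lerD2l.
Qed.

End ModulusTheory.

Section ComplexLimits.
Context {R : realType}.
Implicit Types z w : R[i].

Lemma cvg_modulusP (T : Type) (F : set_system T) {FF : Filter F}
    (f : T -> R[i]) (l : R[i]) :
  f @ F --> l <-> modulus (f x - l) @[x --> F] --> (0 : R).
Proof.
split=> [/cvgrPdist_lt h|/cvgrPdist_lt h].
  apply/cvgrPdist_lt => e e0.
  have e0' : 0 < e%:C by rewrite ltcR.
  near=> x; rewrite sub0r normrN ger0_norm ?modulus_ge0//.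
  by rewrite -ltcR -normCE distrC; near: x; exact: h.
apply/cvgrPdist_lt => -[e e'] /[dup] e0; rewrite ltcE /= => /andP[/eqP e'0 e1].
near=> x; rewrite distrC normCE ltcE /= e'0 eqxx /=.
have : `|0 - modulus (f x - l)| < e by near: x; exact: h.
by rewrite sub0r normrN ger0_norm ?modulus_ge0.
Unshelve. all: by end_near. Qed.

Lemma cvg_modulus_le (T : Type) (F : set_system T) {FF : Filter F}
    (f : T -> R[i]) (l : R[i]) (g : T -> R) :
  (\forall x \near F, modulus (f x - l) <= g x) -> g @ F --> (0 : R) ->
  f @ F --> l.
Proof.
move=> fg g0; apply/cvg_modulusP.
apply: (squeeze_cvgr _ (cvg_cst 0) g0).
by apply: filterS fg => x ->; rewrite modulus_ge0.
Qed.

Lemma cvg_ReIm (T : Type) (F : set_system T) {FF : Filter F}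
    (f : T -> R[i]) (l : R[i]) :
  f @ F --> l <-> (complex.Re (f x) @[x --> F] --> complex.Re l /\
                   complex.Im (f x) @[x --> F] --> complex.Im l).
Proof.
split=> [/cvg_modulusP/cvgrPdist_lt h|[/cvgrPdist_lt h1 /cvgrPdist_lt h2]].
  split; apply/cvgrPdist_lt => e e0; near=> x.
    have : `|0 - modulus (f x - l)| < e by near: x; exact: h.
    rewrite sub0r normrN ger0_norm ?modulus_ge0//; apply: le_lt_trans.
    by rewrite distrC -cReB modulus_Re.
  have : `|0 - modulus (f x - l)| < e by near: x; exact: h.
  rewrite sub0r normrN ger0_norm ?modulus_ge0//; apply: le_lt_trans.
  by rewrite distrC -cImB modulus_Im.
apply/cvg_modulusP/cvgrPdist_lt => e e0.
have e20 : 0 < e / 2 by rewrite divr_gt0.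
near=> x; rewrite sub0r normrN ger0_norm ?modulus_ge0//.
apply: le_lt_trans (modulus_le_ReIm _) _; rewrite cReB cImB.
rewrite (splitr e) ltrD // distrC; near: x; [exact: h1|exact: h2].
Unshelve. all: by end_near. Qed.

Lemma cvg_realC (T : Type) (F : set_system T) {FF : Filter F}
    (f : T -> R) (l : R) :
  f @ F --> l -> (f x)%:C @[x --> F] --> l%:C.
Proof. by move=> h; apply/cvg_ReIm; split => //=; exact: cvg_cst. Qed.

Lemma cvg_modulus (T : Type) (F : set_system T) {FF : Filter F}
    (f : T -> R[i]) (l : R[i]) :
  f @ F --> l -> modulus (f x) @[x --> F] --> modulus l.
Proof.
move=> /cvg_modulusP/cvgrPdist_lt h; apply/cvgrPdist_lt => e e0; near=> x.
have : `|0 - modulus (f x - l)| < e by near: x; exact: h.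
rewrite sub0r normrN ger0_norm ?modulus_ge0//; apply: le_lt_trans.
have h1 := modulusD (f x - l) l; have h2 := modulusD (l - f x) (f x).
rewrite !subrK in h1 h2; rewrite (modulusB l) in h2.
by rewrite ler_norml; apply/andP; split; lra.
Unshelve. all: by end_near. Qed.

Lemma cvgC_lim (T : Type) (F : set_system T) {FF : ProperFilter F}
  (f : T -> R[i]) (l : R[i]) : f @ F --> l -> lim (f @ F) = l.
Proof. by move=> h; apply: cvg_lim => //; exact: norm_hausdorff. Qed.

Lemma cvgC_unique (T : Type) (F : set_system T) {FF : ProperFilter F}
  (f : T -> R[i]) (l l' : R[i]) : f @ F --> l -> f @ F --> l' -> l = l'.
Proof. by move=> /cvgC_lim <- /cvgC_lim. Qed.

Section Ops.
Context (T : Type) (F : set_system T) {FF : Filter F}.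
Implicit Types (f g : T -> R[i]) (a b : R[i]).

Lemma ccvg_cst a : (fun=> a) @ F --> a.
Proof. exact: cvg_cst. Qed.

Lemma ccvgD f g a b : f @ F --> a -> g @ F --> b ->
  (fun x => f x + g x) @ F --> a + b.
Proof. exact: cvgD. Qed.

Lemma ccvgN f a : f @ F --> a -> (fun x => - f x) @ F --> - a.
Proof. exact: cvgN. Qed.

Lemma ccvgB f g a b : f @ F --> a -> g @ F --> b ->
  (fun x => f x - g x) @ F --> a - b.
Proof. exact: cvgB. Qed.

Lemma ccvgM f g a b : f @ F --> a -> g @ F --> b ->
  (fun x => f x * g x) @ F --> a * b.
Proof. exact: cvgM. Qed.

Lemma ccvgV f a : a != 0 -> f @ F --> a -> (fun x => (f x)^-1) @ F --> a^-1.
Proof. exact: cvgV. Qed.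

Lemma ccvg_eq f a b : a = b -> f @ F --> a -> f @ F --> b.
Proof. by move=> ->. Qed.

Lemma ccvg_near0 f a : f @ F --> a -> a != 0 -> \forall x \near F, f x != 0.
Proof. exact: cvgr_neq0. Qed.

End Ops.

End ComplexLimits.

(** Componentwise, because [R[i]] is a normed module over itself and not
    over [R]. *)
Definition cder {R : realType} (f : R -> R[i]) (x : R) (d : R[i]) : Prop :=
  is_derive x 1 (fun t => complex.Re (f t)) (complex.Re d) /\
  is_derive x 1 (fun t => complex.Im (f t)) (complex.Im d).

Section ComplexDerivative.
Context {R : realType}.
Implicit Types (f g : R -> R[i]) (x : R) (d : R[i]).

Lemma cder_eq f x d d' : d = d' -> cder f x d -> cder f x d'.
Proof. by move=> ->. Qed.

Lemma cder_cst (c : R[i]) x : cder (fun=> c) x 0.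
Proof. by split; exact: is_derive_cst. Qed.

Lemma is_derive_ext (f1 f2 : R -> R) (x d : R) :
  (\forall t \near x, f1 t = f2 t) -> is_derive x 1 f1 d -> is_derive x 1 f2 d.
Proof. by move=> h h1; apply: (@near_eq_is_derive _ _ _ f1) => //; exact: oner_neq0. Qed.

Lemma cder_near f g x d : (\forall t \near x, f t = g t) ->
  cder f x d -> cder g x d.
Proof.
by move=> h [h1 h2]; split; [apply: is_derive_ext h1|apply: is_derive_ext h2];
  apply: filterS h => t ->.
Qed.

Lemma cderD f g x d d' : cder f x d -> cder g x d' ->
  cder (fun t => f t + g t) x (d + d').
Proof.
move=> [h1 h2] [h3 h4]; split.
  rewrite cReD (_ : (fun t => _) = (fun t => complex.Re (f t)) + (fun t => complex.Re (g t))).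
    exact: is_deriveD.
  by apply/funext => t; rewrite cReD.
rewrite cImD (_ : (fun t => _) = (fun t => complex.Im (f t)) + (fun t => complex.Im (g t))).
  exact: is_deriveD.
by apply/funext => t; rewrite cImD.
Qed.

Lemma cderN f x d : cder f x d -> cder (fun t => - f t) x (- d).
Proof.
move=> [h1 h2]; split.
  rewrite cReN (_ : (fun t => _) = - (fun t => complex.Re (f t))).
    exact: is_deriveN.
  by apply/funext => t; rewrite cReN.
rewrite cImN (_ : (fun t => _) = - (fun t => complex.Im (f t))).
  exact: is_deriveN.
by apply/funext => t; rewrite cImN.
Qed.

Lemma cderB f g x d d' : cder f x d -> cder g x d' ->
  cder (fun t => f t - g t) x (d - d').
Proof. by move=> h1 /cderN; exact: cderD. Qed.

Lemma is_deriveM' (f1 f2 : R -> R) (x d1 d2 : R) :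
  is_derive x 1 f1 d1 -> is_derive x 1 f2 d2 ->
  is_derive x 1 (fun t => f1 t * f2 t) (d1 * f2 x + f1 x * d2).
Proof.
move=> h1 h2; rewrite (_ : (fun t => _) = f1 * f2) //.
have := is_deriveM h1 h2; move=> h; apply: is_derive_eq h _.
by rewrite /GRing.scale /= addrC [_ * d1]mulrC.
Qed.

Lemma cderM f g x d d' : cder f x d -> cder g x d' ->
  cder (fun t => f t * g t) x (d * g x + f x * d').
Proof.
move=> [h1 h2] [h3 h4]; split.
  rewrite (_ : (fun t => _) = (fun t => complex.Re (f t) * complex.Re (g t)) -
     (fun t => complex.Im (f t) * complex.Im (g t))); last first.
    by apply/funext => t; rewrite cReM.
  have := is_deriveB (is_deriveM' h1 h3) (is_deriveM' h2 h4).
  by move=> h; apply: is_derive_eq h _; rewrite cReD !cReM; ring.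
rewrite (_ : (fun t => _) = (fun t => complex.Re (f t) * complex.Im (g t)) +
     (fun t => complex.Im (f t) * complex.Re (g t))); last first.
    by apply/funext => t; rewrite cImM.
have := is_deriveD (is_deriveM' h1 h4) (is_deriveM' h2 h3).
by move=> h; apply: is_derive_eq h _; rewrite cImD !cImM; ring.
Qed.

Lemma cderZ (c : R[i]) f x d : cder f x d -> cder (fun t => c * f t) x (c * d).
Proof. by move=> h; apply: cder_eq (cderM (cder_cst c x) h); rewrite mul0r add0r. Qed.

Lemma cder_real (f1 : R -> R) (x d1 : R) : is_derive x 1 f1 d1 ->
  cder (fun t => (f1 t)%:C) x d1%:C.
Proof. by move=> h; split => //=; exact: is_derive_cst. Qed.

Lemma cder_id x : cder (fun t => t%:C) x 1.
Proof. by apply: (@cder_real id); exact: is_derive_id. Qed.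

Lemma cder_comp f (g1 : R -> R) x d (d1 : R) : cder f (g1 x) d ->
  is_derive x 1 g1 d1 -> cder (fun t => f (g1 t)) x (d1%:C * d).
Proof.
move=> [h1 h2] h; split.
  have := is_derive1_comp h1 h; rewrite /comp => h3; apply: is_derive_eq h3 _.
  by rewrite cReM /= mul0r subr0 /GRing.scale /= mulrC.
have := is_derive1_comp h2 h; rewrite /comp => h3; apply: is_derive_eq h3 _.
by rewrite cImM /= mul0r addr0 /GRing.scale /= mulrC.
Qed.

Lemma cder_continuous f x d : cder f x d -> {for x, continuous f}.
Proof.
move=> [[h1 _] [h2 _]]; apply/cvg_ReIm; split.
  by apply: (differentiable_continuous); apply/derivable1_diffP.
by apply: (differentiable_continuous); apply/derivable1_diffP.
Qed.

Lemma cder_unique f x d d' : cder f x d -> cder f x d' -> d = d'.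
Proof.
move=> [[_ h1] [_ h2]] [[_ h3] [_ h4]].
by apply: complex_ext; [rewrite -h1 -h3|rewrite -h2 -h4].
Qed.

(** Complex values have no mean value theorem; but some number [w] of
    modulus [1] makes [w * (f b - f a)] equal to its modulus, and the real
    theorem applies to the real part of [w * f]. *)
Lemma modulus_mvt f (df : R -> R[i]) (a b M : R) : a <= b ->
  (forall x, a <= x <= b -> cder f x (df x)) ->
  (forall x, a <= x <= b -> modulus (df x) <= M) ->
  modulus (f b - f a) <= M * (b - a).
Proof.
move=> ab h hM.
have M0 : 0 <= M by apply: le_trans (hM a _); rewrite ?modulus_ge0 // lexx.
have [->|fne] := eqVneq (f b - f a) 0.
  by rewrite modulus0 mulr_ge0 // subr_ge0.
pose w : R[i] := (f b - f a)^*%C / (modulus (f b - f a))%:C.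
have wM : modulus w = 1.
  rewrite modulusM modulusV modulusR ger0_norm ?modulus_ge0//.
  rewrite [modulus _^*%C]/modulus normcJ -/(modulus _) divff //.
  by rewrite modulus_eq0.
have hw x : a <= x <= b -> cder (fun t => w * f t) x (w * df x).
  by move=> /h; exact: cderZ.
have wE : complex.Re (w * f b) - complex.Re (w * f a) = modulus (f b - f a).
  rewrite -cReB -mulrBr /w mulrAC -[_ * (f b - f a)]mulrC -sqr_normc normCE.
  rewrite expr2 mulfK //.
  by rewrite -[0]/(0%:C) (inj_eq (@complexI R)) modulus_eq0.
rewrite -wE.
have [c cab ->] : exists2 c, c \in `[a, b] &
    complex.Re (w * f b) - complex.Re (w * f a) = complex.Re (w * df c) * (b - a).
  apply: (@MVT_segment _ (fun t => complex.Re (w * f t)) (fun t => complex.Re (w * df t))) => //.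
    by move=> x xab; apply: (hw x _).1; move: xab; rewrite in_itv /= => /andP[/ltW -> /ltW ->].
  apply: derivable_within_continuous => x xab; apply: ex_derive; apply: (hw x _).1.
  by move: xab; rewrite in_itv.
rewrite ler_wpM2r ?subr_ge0//; apply: le_trans (ler_norm _) _.
apply: le_trans (modulus_Re _) _; rewrite modulusM wM mul1r.
by apply: hM; move: cab; rewrite in_itv.
Qed.

Lemma cder0_eq f (a b : R) : a <= b ->
  (forall x, a <= x <= b -> cder f x 0) -> f b = f a.
Proof.
move=> ab h; apply/eqP; rewrite -subr_eq0 -modulus_eq0 eq_le modulus_ge0 andbT.
have := @modulus_mvt f (fun=> 0) a b 0 ab h; rewrite mul0r; apply => x _.
by rewrite modulus0.
Qed.

Lemma cder0_cst f (a b : R) : (forall x, cder f x 0) -> f b = f a.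
Proof.
move=> h; have [ab|/ltW ab] := leP a b; first exact: cder0_eq.
by apply/esym/cder0_eq.
Qed.

End ComplexDerivative.

(** * Complex series and the exponential *)

Lemma is_cvg_shiftn {R : realType} (u : nat -> R) k :
  cvgn (fun m => u (m + k)%N) <-> cvgn u.
Proof.
split=> /cvg_ex [l h]; apply/cvg_ex; exists l.
  by rewrite -(@cvg_shiftn k).
by have := h; rewrite -(@cvg_shiftn k).
Qed.

Lemma big_nat_shift (V : nmodType) (F : nat -> V) k m :
  \sum_(k <= i < m + k) F i = \sum_(0 <= i < m) F (k + i)%N.
Proof.
by have := big_addn 0 (m + k) k xpredT F; rewrite add0n addnK => ->;
   apply: eq_bigr => i _; rewrite addnC.
Qed.

Section ComplexSeries.
Context {R : realType}.
Implicit Types (a b : nat -> R[i]) (M : nat -> R).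

(** Limits of real and imaginary parts; meaningful for absolutely summable
    sequences. *)
Definition csum a : R[i] :=
  limn (series (fun j => complex.Re (a j))) +i*
  limn (series (fun j => complex.Im (a j))).

Definition csummable a : Prop := cvgn (series (fun j => modulus (a j))).

Lemma csummable_le a M : (forall j, modulus (a j) <= M j) ->
  cvgn (series M) -> csummable a.
Proof.
move=> h; apply: series_le_cvg => // j; first exact: modulus_ge0.
by apply: le_trans (h j); exact: modulus_ge0.
Qed.

Lemma csummable_Re a : csummable a -> cvgn (series (fun j => complex.Re (a j))).
Proof.
move=> h; apply: normed_cvg; apply: series_le_cvg h => j //=.
- exact: modulus_ge0.
- exact: modulus_Re.
Qed.

Lemma csummable_Im a : csummable a -> cvgn (series (fun j => complex.Im (a j))).
Proof.
move=> h; apply: normed_cvg; apply: series_le_cvg h => j //=.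
- exact: modulus_ge0.
- exact: modulus_Im.
Qed.

Lemma csum_cvg a : csummable a -> series a @ \oo --> csum a.
Proof.
move=> h; apply/cvg_ReIm; split => /=.
  rewrite (_ : (fun x => _) = series (fun j => complex.Re (a j))).
    exact: csummable_Re.
  by apply/funext => m; rewrite /series /= cRe_sum.
rewrite (_ : (fun x => _) = series (fun j => complex.Im (a j))).
  exact: csummable_Im.
by apply/funext => m; rewrite /series /= cIm_sum.
Qed.

Lemma csum_eq a (l : R[i]) : series a @ \oo --> l -> csum a = l.
Proof.
move=> /cvg_ReIm [h1 h2]; apply: complex_ext => /=.
  apply: cvg_lim => //; rewrite (_ : series _ = (fun m => complex.Re (series a m))) //.
  by apply/funext => m; rewrite /series /= cRe_sum.
apply: cvg_lim => //; rewrite (_ : series _ = (fun m => complex.Im (series a m))) //.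
by apply/funext => m; rewrite /series /= cIm_sum.
Qed.

Lemma csummableZ (c : R[i]) a : csummable a -> csummable (fun j => c * a j).
Proof.
move=> ha; apply: (@csummable_le _ (fun j => modulus c * modulus (a j))).
  by move=> j; rewrite modulusM.
by have := @is_cvg_seriesZ _ _ (modulus c) ha.
Qed.

Lemma csumD a b : csummable a -> csummable b ->
  csum (fun j => a j + b j) = csum a + csum b.
Proof.
move=> ha hb; apply: csum_eq.
rewrite (_ : series _ = series a \+ series b); first by apply: cvgD; exact: csum_cvg.
by apply/funext => m; rewrite /series /= big_split.
Qed.

Lemma csumZ (c : R[i]) a : csummable a -> csum (fun j => c * a j) = c * csum a.
Proof.
move=> ha; apply: csum_eq.
rewrite (_ : series _ = (fun m => c * series a m)).
  by apply: cvgM; [exact: cvg_cst|exact: csum_cvg].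
by apply/funext => m; rewrite /series /= mulr_sumr.
Qed.

Lemma csummable_shift a k : csummable (fun j => a (k + j)%N) <-> csummable a.
Proof.
split=> [h|h].
  rewrite /csummable -(is_cvg_series_restrict k).
  have /= := h; rewrite /csummable /series /= => h'.
  apply/(is_cvg_shiftn _ k).
  rewrite (_ : (fun n : nat => _) = series (fun j => modulus (a (k + j)%N))) //.
  by apply/funext => m; rewrite /series /= big_nat_shift.
have h' := h; rewrite /csummable -(is_cvg_series_restrict k) in h'.
have {}h' := (is_cvg_shiftn _ k).2 h'.
rewrite /csummable (_ : series _ = (fun n : nat =>
   (\sum_(k <= k0 < n + k) modulus (a k0))%R)) //.
by apply/funext => m; rewrite /series /= big_nat_shift.
Qed.

Lemma csum_recl a : csummable a -> csum a = a 0%N + csum (fun j => a j.+1).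
Proof.
move=> ha; apply: csum_eq; rewrite -cvg_shiftS.
rewrite (_ : [sequence _]_n = (fun m => a 0%N + series (fun j => a j.+1) m)).
  apply: cvgD; first exact: cvg_cst.
  by apply: csum_cvg; apply/(csummable_shift a 1).
by apply/funext => m; rewrite /series /= big_nat_recl.
Qed.

Lemma csum_tail a M N : (forall j, modulus (a j) <= M j) -> cvgn (series M) ->
  modulus (csum a - series a N) <= limn (series M) - series M N.
Proof.
move=> h hM; have ha := csummable_le h hM.
have h1 : modulus (series a m - series a N) @[m --> \oo] --> modulus (csum a - series a N).
  by apply: cvg_modulus; apply: cvgB; [exact: csum_cvg|exact: cvg_cst].
have h2 : (series M m - series M N) @[m --> \oo] --> limn (series M) - series M N.
  by apply: cvgB; [exact: hM|exact: cvg_cst].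
rewrite -(cvg_lim (@Rhausdorff R) h1) -(cvg_lim (@Rhausdorff R) h2).
apply: ler_lim; [by apply/cvg_ex; eexists; exact: h1|by apply/cvg_ex; eexists; exact: h2|].
near=> m; have Nm : (N <= m)%N by near: m; exact: nbhs_infty_ge.
rewrite !sub_series_geq//; apply: le_trans (modulus_sum _ _ _) _.
by apply: ler_sum => j _.
Unshelve. all: by end_near. Qed.

Lemma csum_le a M : (forall j, modulus (a j) <= M j) -> cvgn (series M) ->
  modulus (csum a) <= limn (series M).
Proof.
move=> h hM; have := csum_tail 0 h hM.
by rewrite /series /= !big_geq // !subr0.
Qed.

(** Tannery's theorem, dominated convergence for series: the tails are
    uniformly small because of [M], and finitely many terms converge
    together. *)
Lemma csum_tannery (T : Type) (F : set_system T) {FF : ProperFilter F}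
    (f : nat -> T -> R[i]) (l : nat -> R[i]) M :
  (forall j, f j x @[x --> F] --> l j) ->
  (\forall x \near F, forall j, modulus (f j x) <= M j) ->
  cvgn (series M) -> csum (f^~ x) @[x --> F] --> csum l.
Proof.
move=> fl fM hM.
have lM j : modulus (l j) <= M j.
  have h : modulus (f j x) @[x --> F] --> modulus (l j) by exact: cvg_modulus.
  rewrite -(cvg_lim (@Rhausdorff R) h).
  by apply: limr_le; [apply/cvg_ex; eexists; exact: h|apply: filterS fM].
have fin N : (\sum_(0 <= j < N) modulus (f j x - l j)) @[x --> F] --> (0 : R).
  elim: N => [|N IH].
    by rewrite (_ : (fun x => _) = cst 0); [exact: cvg_cst|apply/funext => x; rewrite big_geq].
  rewrite (_ : (fun x => _) = (fun x => \sum_(0 <= j < N) modulus (f j x - l j)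
     + modulus (f N x - l N))); last by apply/funext => x; rewrite big_nat_recr.
  by rewrite -[X in _ --> X](addr0 0); apply: cvgD => //; apply/cvg_modulusP.
apply/cvg_modulusP/cvgrPdist_lt => e e0.
have e4 : 0 < e / 4 by lra.
have /cvgrPdist_lt/(_ _ e4) [N _ hN] := hM.
have {}hN : limn (series M) - series M N < e / 4.
  by apply: le_lt_trans (hN N (leqnn N)); exact: ler_norm.
have /cvgrPdist_lt/(_ _ e4) hfin := fin N.
near=> x.
rewrite sub0r normrN ger0_norm ?modulus_ge0//.
have fx : forall j, modulus (f j x) <= M j by near: x.
have h1 := csum_tail N fx hM; have h2 := csum_tail N lM hM.
have h3 : `|0 - \sum_(0 <= j < N) modulus (f j x - l j)| < e / 4 by near: x.
rewrite sub0r normrN ger0_norm in h3; last by apply: sumr_ge0 => j _; exact: modulus_ge0.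
have h4 : modulus (series (f^~ x) N - series l N) < e / 4.
  apply: le_lt_trans h3; rewrite /series /= -sumrB; exact: modulus_sum.
have -> : csum (f^~ x) - csum l = (csum (f^~ x) - series (f^~ x) N)
   + (series (f^~ x) N - series l N) - (csum l - series l N) by ring.
have h5 := modulusD (csum (f^~ x) - series (f^~ x) N + (series (f^~ x) N - series l N))
    (- (csum l - series l N)).
have h6 := modulusD (csum (f^~ x) - series (f^~ x) N) (series (f^~ x) N - series l N).
rewrite modulusN in h5; lra.
Unshelve. all: by end_near. Qed.

End ComplexSeries.

Section ComplexExponential.
Context {R : realType}.
Implicit Types z w : R[i].

Lemma cexpD z w : cexp (z + w) = cexp z * cexp w.
Proof.
by case: z => a b; case: w => c d; rewrite /cexp /expi /=; apply: complex_ext;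
   rewrite /= expRD cosD sinD; ring.
Qed.

Lemma cexp0 : cexp (0 : R[i]) = 1.
Proof. by rewrite /cexp /expi /= expR0 cos0 sin0 mul1r. Qed.

Lemma cexp_real (x : R) : cexp x%:C = (expR x)%:C.
Proof. by rewrite /cexp /expi /= cos0 sin0 mulr1. Qed.

Lemma cexpN z : cexp (- z) = (cexp z)^-1.
Proof.
have h : cexp (- z) * cexp z = 1 by rewrite -cexpD addNr cexp0.
have nz : cexp z != 0 by apply: contra_eq_neq h => ->; rewrite mulr0 eq_sym oner_eq0.
by apply: (mulIf nz); rewrite h mulVf.
Qed.

Lemma cexp_neq0 z : cexp z != 0.
Proof.
have h : cexp (- z) * cexp z = 1 by rewrite -cexpD addNr cexp0.
by apply: contra_eq_neq h => ->; rewrite mulr0 eq_sym oner_eq0.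
Qed.

Lemma modulus_expi (t : R) : modulus (expi t) = 1.
Proof. by rewrite modulusE /= cos2Dsin2 sqrtr1. Qed.

Lemma modulus_cexp z : modulus (cexp z) = expR (complex.Re z).
Proof. by rewrite /cexp modulusM modulusR modulus_expi mulr1 ger0_norm ?expR_ge0. Qed.

Lemma modulus_cexp_le z : modulus (cexp z) <= expR (modulus z).
Proof.
by rewrite modulus_cexp ler_expR; apply: le_trans (ler_norm _) (modulus_Re _).
Qed.

Lemma cder_cexp (g : R -> R[i]) x d : cder g x d ->
  cder (fun t => cexp (g t)) x (d * cexp (g x)).
Proof.
move=> [h1 h2].
have e1 := is_derive1_comp (is_derive_expR _) h1.
have e2 := is_derive1_comp (is_derive_cos _) h2.
have e3 := is_derive1_comp (is_derive_sin _) h2.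
rewrite /comp in e1 e2 e3.
split.
  rewrite (_ : (fun t => _) = (fun t => expR (complex.Re (g t)) * cos (complex.Im (g t)))).
    apply: is_derive_eq (is_deriveM' e1 e2) _.
    by rewrite /cexp /expi /GRing.scale /= cReM /= !(mul0r, subr0, addr0); ring.
  by apply/funext => t; rewrite /cexp /expi /= mul0r subr0.
rewrite (_ : (fun t => _) = (fun t => expR (complex.Re (g t)) * sin (complex.Im (g t)))).
  apply: is_derive_eq (is_deriveM' e1 e3) _.
  by rewrite /cexp /expi /GRing.scale /= cImM /= !(mul0r, subr0, addr0); ring.
by apply/funext => t; rewrite /cexp /expi /= mul0r addr0.
Qed.

Lemma cder_cexpl z w x : cder (fun t => cexp (t%:C * z + w)) x (z * cexp (x%:C * z + w)).
Proof.
apply: (cder_cexp (g := fun t => t%:C * z + w)).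
apply: cder_eq (cderD (cderM (cder_id x) (cder_cst z x)) (cder_cst w x)).
by rewrite mulr0 addr0 addr0 mul1r.
Qed.

Lemma modulus_cexpB1 z : modulus (cexp z - 1) <= modulus z * expR (modulus z).
Proof.
have := @modulus_mvt _ (fun t => cexp (t%:C * z)) (fun t => z * cexp (t%:C * z)) 0 1
  (modulus z * expR (modulus z)) ler01.
rewrite mul0r cexp0 mul1r subr0 mulr1; apply => x /andP[x0 x1].
  by have := cder_cexpl z 0 x; rewrite addr0 (_ : (fun t => _) = (fun t => cexp (t%:C * z))) // funeqE => t; rewrite addr0.
rewrite modulusM ler_wpM2l ?modulus_ge0//; apply: le_trans (modulus_cexp_le _) _.
by rewrite ler_expR modulusM modulusR ger0_norm// ler_piMl ?modulus_ge0.
Qed.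

Lemma modulus_cexpB1B z :
  modulus (cexp z - 1 - z) <= modulus z ^+ 2 * expR (modulus z).
Proof.
have := @modulus_mvt _ (fun t => cexp (t%:C * z) - t%:C * z) (fun t => z * (cexp (t%:C * z) - 1)) 0 1
  (modulus z ^+ 2 * expR (modulus z)) ler01.
rewrite mul0r cexp0 mul1r !subr0 mulr1 [cexp z - z - 1]addrAC; apply => x /andP[x0 x1].
  rewrite mulrBr mulr1; apply: cderB.
    by have := cder_cexpl z 0 x; rewrite addr0 (_ : (fun t => _) = (fun t => cexp (t%:C * z))) // funeqE => t; rewrite addr0.
  by apply: cder_eq (cderM (cder_id x) (cder_cst z x)); rewrite mulr0 addr0 mul1r.
rewrite modulusM expr2 -mulrA ler_wpM2l ?modulus_ge0//.
apply: le_trans (modulus_cexpB1 _) _.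
have h : modulus (x%:C * z) <= modulus z.
  by rewrite modulusM modulusR ger0_norm// ler_piMl ?modulus_ge0.
by apply: ler_pM; rewrite ?modulus_ge0 ?expR_ge0 ?ler_expR.
Qed.

Lemma cvg_subC0 (T : Type) (F : set_system T) {FF : Filter F} (g : T -> R[i]) z :
  g @ F --> z -> modulus (g x - z) @[x --> F] --> (0 : R).
Proof. by move/cvg_modulusP. Qed.

Lemma cvg_xexpx0 (T : Type) (F : set_system T) {FF : Filter F} (g : T -> R) :
  g @ F --> (0 : R) -> g x * expR (g x) @[x --> F] --> (0 : R).
Proof.
move=> h; rewrite -[X in _ --> X](mul0r (expR 0)); apply: cvgM => //.
by apply: continuous_cvg => //; exact: continuous_expR.
Qed.

Lemma cvg_cexp (T : Type) (F : set_system T) {FF : Filter F} (g : T -> R[i]) z :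
  g @ F --> z -> cexp (g x) @[x --> F] --> cexp z.
Proof.
move=> gz; apply: (cvg_modulus_le (g :=
  fun x => modulus (cexp z) * (modulus (g x - z) * expR (modulus (g x - z))))).
  near=> x; have -> : cexp (g x) - cexp z = cexp z * (cexp (g x - z) - 1).
    by rewrite mulrBr mulr1 -cexpD [z + _]addrC subrK.
  by rewrite modulusM ler_wpM2l ?modulus_ge0 ?modulus_cexpB1.
rewrite -[X in _ --> X](mulr0 (modulus (cexp z))); apply: cvgM; first exact: cvg_cst.
by apply: cvg_xexpx0; exact: cvg_subC0.
Unshelve. all: by end_near. Qed.

(** Continued by its limit at [0], so that difference quotients of
    exponentials are continuous functions of both points. *)
Definition cexpm1q w : R[i] := if w == 0 then 1 else (cexp w - 1) / w.

Lemma cexpm1qE w : cexp w - 1 = w * cexpm1q w.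
Proof.
rewrite /cexpm1q; case: eqVneq => [->|w0]; first by rewrite cexp0 subrr mul0r.
by rewrite mulrC divfK.
Qed.

Lemma modulus_cexpm1qB1 w : modulus (cexpm1q w - 1) <= modulus w * expR (modulus w).
Proof.
rewrite /cexpm1q; case: eqVneq => [->|w0].
  by rewrite subrr modulus0 mul0r.
have -> : (cexp w - 1) / w - 1 = (cexp w - 1 - w) / w by field.
rewrite modulusM modulusV ler_pdivrMr ?modulus_gt0// mulrAC -expr2.
exact: modulus_cexpB1B.
Qed.

Lemma modulus_cexpm1q w : modulus (cexpm1q w) <= expR (modulus w).
Proof.
rewrite /cexpm1q; case: eqVneq => [->|w0].
  by rewrite modulus1 modulus0 expR0.
by rewrite modulusM modulusV ler_pdivrMr ?modulus_gt0// mulrC modulus_cexpB1.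
Qed.

Lemma cvg_cexpm1q (T : Type) (F : set_system T) {FF : Filter F} (g : T -> R[i]) z :
  g @ F --> z -> cexpm1q (g x) @[x --> F] --> cexpm1q z.
Proof.
move=> gz; have [z0|z0] := eqVneq z 0.
  rewrite z0 in gz *; apply: (cvg_modulus_le (g := fun x => modulus (g x) * expR (modulus (g x)))).
    near=> x; have -> : cexpm1q (0 : R[i]) = 1 by rewrite /cexpm1q eqxx.
    exact: modulus_cexpm1qB1.
  by apply: cvg_xexpx0; rewrite -[X in _ --> X](@modulus0 R); exact: cvg_modulus.
have h : (cexp (g x) - 1) / g x @[x --> F] --> cexpm1q z.
  rewrite /cexpm1q (negPf z0); apply: cvgM.
    by apply: cvgB; [exact: cvg_cexp|exact: cvg_cst].
  exact: cvgV.
apply: cvg_near_eq h; near=> x.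
rewrite /cexpm1q ifF //; apply/negbTE; near: x.
exact: (cvgr_neq0 _ gz z0).
Unshelve. all: by end_near. Qed.

End ComplexExponential.

(** * Infinite products *)

Section InfiniteProduct.
Context {R : realType}.
Implicit Types (a b d : nat -> R[i]) (M : nat -> R).

Definition pprod a k : R[i] := \prod_(0 <= j < k) (1 + a j).

(** An infinite product as the telescoping series of its partial products:
    convergence and limits are then those of series. *)
Definition cprod a : R[i] := 1 + csum (fun k => pprod a k * a k).

Lemma pprodS a k : pprod a k.+1 = pprod a k * (1 + a k).
Proof. by rewrite /pprod big_nat_recr. Qed.

Lemma pprod0 a : pprod a 0 = 1.
Proof. by rewrite /pprod big_geq. Qed.

Lemma series_le_lim M k : (forall j, 0 <= M j) -> cvgn (series M) ->
  series M k <= limn (series M).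
Proof.
move=> M0 hM; apply: nondecreasing_cvgn_le => //.
apply/nondecreasing_seqP => m.
by rewrite /series /= big_nat_recr //= lerDl.
Qed.

Lemma modulus_bound_ge0 a M : (forall j, modulus (a j) <= M j) -> forall j, 0 <= M j.
Proof. by move=> h j; apply: le_trans (h j); exact: modulus_ge0. Qed.

Lemma modulus_pprod_prod a M k : (forall j, modulus (a j) <= M j) ->
  modulus (pprod a k) <= \prod_(0 <= j < k) (1 + M j).
Proof.
move=> h; elim: k => [|k IH]; first by rewrite pprod0 big_geq // modulus1.
rewrite pprodS big_nat_recr //= modulusM ler_pM ?modulus_ge0//.
by apply: le_trans (modulusD _ _) _; rewrite modulus1 lerD2l.
Qed.

Lemma prod_le_expR M k : (forall j, 0 <= M j) -> cvgn (series M) ->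
  \prod_(0 <= j < k) (1 + M j) <= expR (limn (series M)).
Proof.
move=> M0 hM; apply: (@le_trans _ _ (expR (series M k))); last first.
  by rewrite ler_expR series_le_lim.
elim: k => [|k IH]; first by rewrite /series /= !big_geq // expR0.
rewrite /series /= !big_nat_recr //= expRD; apply: ler_pM => //.
- by apply: prodr_ge0 => j _; rewrite addr_ge0.
- by rewrite addr_ge0.
- exact: expR_ge1Dx.
Qed.

Lemma modulus_pprod a M k : (forall j, modulus (a j) <= M j) ->
  cvgn (series M) -> modulus (pprod a k) <= expR (limn (series M)).
Proof.
move=> h hM; apply: le_trans (modulus_pprod_prod k h) _.
by apply: prod_le_expR => //; exact: modulus_bound_ge0 h.
Qed.

Lemma cvg_seriesZ M (c : R) : cvgn (series M) -> cvgn (series (fun k => c * M k)).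
Proof. by move=> hM; have := @is_cvg_seriesZ _ _ c hM. Qed.

Lemma cprod_cvg a M : (forall j, modulus (a j) <= M j) -> cvgn (series M) ->
  pprod a @ \oo --> cprod a.
Proof.
move=> h hM.
rewrite (_ : pprod a = (fun k => 1 + series (fun k => pprod a k * a k) k)).
  apply: cvgD; first exact: cvg_cst.
  apply: csum_cvg; apply: (@csummable_le _ _ (fun k => expR (limn (series M)) * M k)).
    by move=> j; rewrite modulusM ler_pM ?modulus_ge0 ?modulus_pprod.
  exact: cvg_seriesZ.
apply/funext; elim=> [|k IH]; first by rewrite pprod0 /series /= big_geq // addr0.
by rewrite pprodS mulrDr mulr1 {1}IH /series /= big_nat_recr //= addrA.
Qed.

(** The inverses [1 / (1 + a j)] again have the form [1 + b j] with [b]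
    summable, and the two products multiply to [1]. *)
Lemma cprod_neq0 a : csummable a -> (forall j, 1 + a j != 0) -> cprod a != 0.
Proof.
move=> ha hne.
have h0 := cvg_series_cvg_0 ha.
have half : 0 < 2^-1 :> R by rewrite invr_gt0.
have /cvgrPdist_lt/(_ _ half) [K _ hK] := h0.
pose b k := - a k / (1 + a k).
have hb : csummable b.
  apply/(csummable_shift _ K).
  apply: (@csummable_le _ _ (fun j => 2 * modulus (a (K + j)%N))).
    move=> j; rewrite /b modulusM modulusN modulusV.
    have := hK (K + j)%N (leq_addr _ _); rewrite sub0r normrN ger0_norm ?modulus_ge0// => hj.
    have h1 : 2^-1 <= modulus (1 + a (K + j)%N).
      have := modulusD (1 + a (K + j)%N) (- a (K + j)%N).
      rewrite addrK modulusN modulus1; lra.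
    rewrite mulrC ler_wpM2r ?modulus_ge0// -[2]invrK lef_pV2 ?posrE//.
    by apply: lt_le_trans h1.
  apply: cvg_seriesZ; exact/(csummable_shift _ K).
have ca := cprod_cvg (fun j => lexx _) ha.
have cb := cprod_cvg (fun j => lexx _) hb.
have : pprod a k * pprod b k @[k --> \oo] --> cprod a * cprod b by exact: (cvgM ca cb).
rewrite (_ : (fun k => _) = cst 1).
  move=> h; have e : cprod a * cprod b = 1 by exact: (cvgC_unique h (cvg_cst _)).
  by apply: contra_eq_neq e => ->; rewrite mul0r eq_sym oner_neq0.
apply/funext => k; rewrite /pprod -big_split /=; apply: big1 => j _.
by rewrite /b mulrDr mulr1 mulrC divfK // addrK.
Qed.

(** Difference quotient of the partial products of two sequences with [a j
    - b j = delta * d j], built by the Leibniz rule. As [delta] is never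
    divided by, the case [delta = 0] gives the derivative. *)
Fixpoint dprod a b d k : R[i] :=
  if k is k'.+1 then dprod a b d k' * (1 + a k') + pprod b k' * d k' else 0.

Definition cdprod a b d : R[i] :=
  csum (fun k => dprod a b d k * a k + pprod b k * d k).

Lemma pprodB a b d (delta : R[i]) k : (forall j, a j - b j = delta * d j) ->
  pprod a k - pprod b k = delta * dprod a b d k.
Proof.
move=> h; elim: k => [|k IH]; first by rewrite !pprod0 subrr mulr0.
have eb : b k = a k - delta * d k by rewrite -h; ring.
have ep : pprod a k = pprod b k + delta * dprod a b d k by rewrite -IH; ring.
rewrite !pprodS /= ep eb; ring.
Qed.

Lemma modulus_dprod a b d M k : (forall j, modulus (a j) <= M j) ->
  (forall j, modulus (b j) <= M j) -> (forall j, modulus (d j) <= M j) ->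
  cvgn (series M) ->
  modulus (dprod a b d k) <= limn (series M) * expR (limn (series M)).
Proof.
move=> ha hb hd hM; have M0 := modulus_bound_ge0 ha.
apply: (@le_trans _ _ (series M k * \prod_(0 <= j < k) (1 + M j))); last first.
  apply: ler_pM.
  - by rewrite /series /= sumr_ge0.
  - by apply: prodr_ge0 => j _; rewrite addr_ge0.
  - exact: series_le_lim.
  - exact: prod_le_expR.
elim: k => [|k IH].
  by rewrite /= modulus0 mulr_ge0 ?prodr_ge0 // ?sumr_ge0 // => j _; rewrite addr_ge0.
have P0 : 0 <= \prod_(0 <= j < k) (1 + M j).
  by apply: prodr_ge0 => j _; rewrite addr_ge0.
have S0 : 0 <= series M k by rewrite /series /= sumr_ge0.
rewrite /= /series /= !big_nat_recr //=; apply: le_trans (modulusD _ _) _.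
rewrite !modulusM.
have h1 : modulus (dprod a b d k) * modulus (1 + a k) <=
    series M k * \prod_(0 <= j < k) (1 + M j) * (1 + M k).
  apply: ler_pM => //; rewrite ?modulus_ge0//.
  by apply: le_trans (modulusD _ _) _; rewrite modulus1 lerD2l.
have h2 : modulus (pprod b k) * modulus (d k) <= (\prod_(0 <= j < k) (1 + M j)) * M k.
  by apply: ler_pM => //; rewrite ?modulus_ge0// modulus_pprod_prod.
have h3 : (\prod_(0 <= j < k) (1 + M j)) * M k <= (\prod_(0 <= j < k) (1 + M j)) * M k * (1 + M k).
  by rewrite ler_peMr ?mulr_ge0 // lerDl.
rewrite /series /= in h1 *; lra.
Qed.

Lemma modulus_cdprod_term a b d M k : (forall j, modulus (a j) <= M j) ->
  (forall j, modulus (b j) <= M j) -> (forall j, modulus (d j) <= M j) ->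
  cvgn (series M) ->
  modulus (dprod a b d k * a k + pprod b k * d k) <=
   ((limn (series M) + 1) * expR (limn (series M))) * M k.
Proof.
move=> ha hb hd hM; apply: le_trans (modulusD _ _) _; rewrite !modulusM.
rewrite mulrDl mul1r mulrDl lerD // ler_pM ?modulus_ge0 //.
  exact: modulus_dprod.
exact: modulus_pprod.
Qed.

(** The increment [delta] factors out exactly; with [cdprod_tannery] this
    yields the complex derivative of an infinite product. *)
Lemma cprodB a b d (delta : R[i]) M : (forall j, modulus (a j) <= M j) ->
  (forall j, modulus (b j) <= M j) -> (forall j, modulus (d j) <= M j) ->
  cvgn (series M) -> (forall j, a j - b j = delta * d j) ->
  cprod a - cprod b = delta * cdprod a b d.
Proof.
move=> ha hb hd hM hab.
have sab : csummable (fun k => dprod a b d k * a k + pprod b k * d k).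
  apply: (@csummable_le _ _ (fun k => ((limn (series M) + 1) * expR (limn (series M))) * M k)).
    by move=> k; exact: modulus_cdprod_term.
  exact: cvg_seriesZ.
have sb : csummable (fun k => pprod b k * b k).
  apply: (@csummable_le _ _ (fun k => expR (limn (series M)) * M k)).
    by move=> j; rewrite modulusM ler_pM ?modulus_ge0 ?modulus_pprod.
  exact: cvg_seriesZ.
apply/eqP; rewrite subr_eq /cprod /cdprod -csumZ //.
rewrite addrCA -csumD //; last exact: csummableZ.
apply/eqP; congr (_ + csum _); apply/funext => k.
have eb : b k = a k - delta * d k by rewrite -hab; ring.
have ep : pprod a k = pprod b k + delta * dprod a b d k by rewrite -(pprodB k hab); ring.
rewrite ep eb; ring.
Qed.

Lemma cdprod_tannery (T : Type) (F : set_system T) {FF : ProperFilter F}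
    (f g : nat -> T -> R[i]) a b d M :
  (forall j, f j x @[x --> F] --> a j) ->
  (forall j, g j x @[x --> F] --> d j) ->
  (\forall x \near F, forall j, modulus (f j x) <= M j) ->
  (\forall x \near F, forall j, modulus (g j x) <= M j) ->
  (forall j, modulus (b j) <= M j) -> cvgn (series M) ->
  cdprod (f^~ x) b (g^~ x) @[x --> F] --> cdprod a b d.
Proof.
move=> hf hg hfM hgM hb hM.
apply: (csum_tannery (f := fun k x => dprod (f^~ x) b (g^~ x) k * f k x + pprod b k * g k x)
  (M := fun k => ((limn (series M) + 1) * expR (limn (series M))) * M k)).
- have hd k : dprod (f^~ x) b (g^~ x) k @[x --> F] --> dprod a b d k.
    elim: k => [|k IH] /=; first exact: cvg_cst.
    exact: (cvgD (cvgM IH (cvgD (cvg_cst _) (hf k))) (cvgM (cvg_cst _) (hg k))).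
  move=> k; exact: (cvgD (cvgM (hd k) (hf k)) (cvgM (cvg_cst _) (hg k))).
- by near=> x => k; apply: modulus_cdprod_term => //; near: x.
- exact: cvg_seriesZ.
Unshelve. all: by end_near. Qed.

End InfiniteProduct.

(** * Complex differentiability *)

(** Continuity at [z], tested along all proper filters at once: limits
    along sequences, real intervals and punctured neighbourhoods are all
    used later. *)
Record ccont {R : realType} (D : R[i] -> R[i]) (z : R[i]) : Prop := CCont {
  ccontP : forall (T : Type) (F : set_system T), ProperFilter F ->
    forall g : T -> R[i], g @ F --> z -> D (g x) @[x --> F] --> D z }.

(** Caratheodory's form of differentiability: the difference quotient
    extends continuously to [z]. The rules of calculus become algebra. *)
Definition cdiff {R : realType} (f : R[i] -> R[i]) (z d : R[i]) : Prop :=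
  exists D : R[i] -> R[i],
    [/\ forall w, f w - f z = (w - z) * D w, D z = d & ccont D z].

Section ComplexDiff.
Context {R : realType}.
Implicit Types (f g : R[i] -> R[i]) (z w d : R[i]).

Lemma ccont_cst (c z : R[i]) : ccont (fun=> c) z.
Proof. by split=> T F FF g h; exact: ccvg_cst. Qed.

Lemma ccont_id z : ccont id z.
Proof. by split. Qed.

Lemma ccontD f g z : ccont f z -> ccont g z -> ccont (fun w => f w + g w) z.
Proof.
by move=> hf hg; split=> T F FF h hz; apply: ccvgD; [exact: (ccontP hf)|exact: (ccontP hg)].
Qed.

Lemma ccontN f z : ccont f z -> ccont (fun w => - f w) z.
Proof. by move=> hf; split=> T F FF h hz; apply: ccvgN; exact: (ccontP hf). Qed.

Lemma ccontM f g z : ccont f z -> ccont g z -> ccont (fun w => f w * g w) z.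
Proof.
by move=> hf hg; split=> T F FF h hz; apply: ccvgM; [exact: (ccontP hf)|exact: (ccontP hg)].
Qed.

Lemma ccont_comp f g z : ccont g z -> ccont f (g z) -> ccont (fun w => f (g w)) z.
Proof.
by move=> hg hf; split=> T F FF h hz; apply: (ccontP hf); exact: (ccontP hg).
Qed.

Lemma ccont_ext f g z : f =1 g -> ccont f z -> ccont g z.
Proof. by move=> /funext ->. Qed.

Lemma ccontV f z : f z != 0 -> ccont f z -> ccont (fun w => (f w)^-1) z.
Proof.
by move=> f0 hf; split=> T F FF h hz; apply: ccvgV; [exact: f0|exact: (ccontP hf)].
Qed.

Lemma ccont_cexp z : ccont cexp z.
Proof. by split=> T F FF g h; exact: cvg_cexp. Qed.

Lemma cdiff_ccont f z d : cdiff f z d -> ccont f z.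
Proof.
move=> [D [fD _ cD]]; split=> T F FF g gz.
have h : (g x - z) * D (g x) + f z @[x --> F] --> (z - z) * D z + f z.
  apply: ccvgD; last exact: ccvg_cst.
  by apply: ccvgM; [apply: ccvgB; [exact: gz|exact: ccvg_cst]|exact: (ccontP cD)].
rewrite subrr mul0r add0r in h.
by apply: cvg_near_eq h; near=> x; rewrite -fD subrK.
Unshelve. all: by end_near. Qed.

Lemma cdiff_eq f z d d' : d = d' -> cdiff f z d -> cdiff f z d'.
Proof. by move=> ->. Qed.

Lemma cdiff_ext f g z d : f =1 g -> cdiff f z d -> cdiff g z d.
Proof. by move=> /funext ->. Qed.

Lemma cdiff_cst (c z : R[i]) : cdiff (fun=> c) z 0.
Proof.
by exists (fun=> 0); split; [move=> w; rewrite subrr mulr0|reflexivity|exact: ccont_cst].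
Qed.

Lemma cdiff_id z : cdiff id z 1.
Proof.
by exists (fun=> 1); split; [move=> w; rewrite mulr1|reflexivity|exact: ccont_cst].
Qed.

Lemma cdiffD f g z d e : cdiff f z d -> cdiff g z e ->
  cdiff (fun w => f w + g w) z (d + e).
Proof.
move=> [D [fD <- cD]] [E [gE <- cE]]; exists (fun w => D w + E w).
by split; [move=> w; rewrite mulrDr -fD -gE opprD addrACA|reflexivity|exact: ccontD].
Qed.

Lemma cdiffM f g z d e : cdiff f z d -> cdiff g z e ->
  cdiff (fun w => f w * g w) z (d * g z + f z * e).
Proof.
move=> hf hg; have := cdiff_ccont hg.
case: hf => D [fD <- cD]; case: hg => E [gE <- cE] cg.
exists (fun w => D w * g w + f z * E w); split; [|reflexivity|].
  move=> w; rewrite mulrDr mulrA -fD [f z * E w]mulrC mulrA -gE; ring.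
apply: ccontD; apply: ccontM; [exact: cD|exact: cg|exact: ccont_cst|exact: cE].
Qed.

Lemma cdiffN f z d : cdiff f z d -> cdiff (fun w => - f w) z (- d).
Proof.
move=> h; have := cdiffM (cdiff_cst (-1) z) h; rewrite mul0r add0r mulN1r.
by apply: cdiff_ext => w; rewrite mulN1r.
Qed.

Lemma cdiffB f g z d e : cdiff f z d -> cdiff g z e ->
  cdiff (fun w => f w - g w) z (d - e).
Proof. by move=> h /cdiffN; exact: cdiffD. Qed.

Lemma cdiff_comp f g z d e : cdiff g z e -> cdiff f (g z) d ->
  cdiff (fun w => f (g w)) z (e * d).
Proof.
move=> hg; have := cdiff_ccont hg; case: hg => E [gE <- cE] cg [D [fD <- cD]].
exists (fun w => E w * D (g w)); split; [|reflexivity|].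
  by move=> w; rewrite fD gE mulrA.
by apply: ccontM; [exact: cE|exact: ccont_comp cg cD].
Qed.

Lemma cdiffV f z d : f z != 0 -> cdiff f z d ->
  cdiff (fun w => (f w)^-1) z (- d / f z ^+ 2).
Proof.
move=> f0 hf; have cf := cdiff_ccont hf; case: hf => D [fD <- cD].
pose E w := if f w == 0 then (0 - (f z)^-1) / (w - z) else - D w / (f w * f z).
exists E; split.
- move=> w; rewrite /E; case: eqVneq => fw.
    rewrite fw invr0; have wz : w - z != 0.
      by apply: contraNneq f0 => /eqP; rewrite subr_eq0 => /eqP <-; rewrite fw.
    by rewrite mulrC divfK.
  rewrite mulrA mulrN -fD; field.
  by rewrite fw f0.
- by rewrite /E (negPf f0) expr2.
- split=> T F FF g gz.
  have h : - D (g x) / (f (g x) * f z) @[x --> F] --> E z.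
    rewrite /E (negPf f0); apply: ccvgM; first by apply: ccvgN; exact: (ccontP cD).
    apply: ccvgV; first by rewrite mulf_neq0.
    by apply: ccvgM; [exact: (ccontP cf)|exact: ccvg_cst].
  apply: cvg_near_eq h; near=> x; rewrite /E ifF //; apply/negbTE; near: x.
  have hz : f (g x) @[x --> F] --> f z by exact: (ccontP cf).
  exact: (ccvg_near0 hz f0).
Unshelve. all: by end_near. Qed.

Lemma cdiff_cexp z : cdiff cexp z (cexp z).
Proof.
exists (fun w => cexp z * cexpm1q (w - z)); split.
- by move=> w; rewrite mulrCA -cexpm1qE mulrBr mulr1 -cexpD [z + _]addrC subrK.
- by rewrite /cexpm1q subrr eqxx mulr1.
- split=> T F FF g gz; apply: ccvgM; first exact: ccvg_cst.
  by apply: cvg_cexpm1q; apply: ccvgB; [exact: gz|exact: ccvg_cst].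
Qed.

Lemma cdiff_lim f z d : cdiff f z d ->
  h^-1 * (f (h + z) - f z) @[h --> (0 : R[i])^'] --> d.
Proof.
move=> [D [fD <- cD]].
have h1 : D (h + z) @[h --> (0 : R[i])^'] --> D z.
  apply: (ccontP cD); apply: (ccvg_eq (add0r z)); apply: ccvgD; last exact: ccvg_cst.
  exact: cvg_within.
apply: cvg_near_eq h1; near=> h.
have h0 : h != 0 by near: h; exact: nbhs_dnbhs_neq.
by rewrite fD addrK mulrA mulVf // mul1r.
Unshelve. all: by end_near. Qed.

Lemma cdiff_unique f z d d' : cdiff f z d -> cdiff f z d' -> d = d'.
Proof. by move=> /cdiff_lim h1 /cdiff_lim h2; exact: cvgC_unique h1 h2. Qed.

Lemma cdiff_derive1 f z d : cdiff f z d -> derive1 f z = d.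
Proof. by move=> /cdiff_lim h; apply: cvgC_lim. Qed.

End ComplexDiff.

(** * The reciprocal of the Gamma function *)

Section EulerProduct.
Context {R : realType}.
Implicit Types z w : R[i].

Definition gstep (k : nat) : R := ln (k.+2%:R / k.+1%:R).

(** Euler's sequence for [1 / Gamma z], see [rgamma_seq], changes from [m]
    to [m + 1] by the factor [(1 + z / (m + 1)) * (m / (m + 1)) ^ z], which
    is [1 + gfac k z] for [m = k + 1]. *)
Definition gfac k z : R[i] :=
  (1 + z / k.+2%:R) * cexp (- (z * (gstep k)%:C)) - 1.

(** The difference quotient of [gfac k] between [z] and [w], continuous
    across [w = z]. *)
Definition gfacq z k w : R[i] :=
  cexp (- (z * (gstep k)%:C)) *
   (cexp (- ((w - z) * (gstep k)%:C)) / k.+2%:R -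
    (1 + z / k.+2%:R) * ((gstep k)%:C * cexpm1q (- ((w - z) * (gstep k)%:C)))).

Lemma gfacB k z w : gfac k w - gfac k z = (w - z) * gfacq z k w.
Proof.
rewrite /gfac /gfacq.
set l := (gstep k)%:C; set d := w - z.
have -> : w = z + d by rewrite /d addrC subrK.
have -> : - ((z + d) * l) = - (z * l) + - (d * l) by ring.
rewrite cexpD.
have -> : cexp (- (d * l)) = 1 + - (d * l) * cexpm1q (- (d * l)).
  by rewrite -cexpm1qE addrC subrK.
set E := cexpm1q _.
have : (k.+2%:R : R[i]) != 0 by rewrite pnatr_eq0.
move: (k.+2%:R : R[i]) => c c0; field. exact: c0.
Qed.

Lemma gfac0 k : gfac k 0 = 0.
Proof. by rewrite /gfac !mul0r oppr0 cexp0 addr0 mulr1 subrr. Qed.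

Lemma gstep_ge0 k : 0 <= gstep k.
Proof. by rewrite /gstep ln_ge0 // ler_pdivlMr ?ltr0n // mul1r ler_nat. Qed.

Lemma gstep_le k : gstep k <= k.+1%:R^-1.
Proof.
rewrite /gstep.
have -> : k.+2%:R / k.+1%:R = 1 + k.+1%:R^-1 :> R.
  by rewrite -natr1 mulrDl divff ?pnatr_eq0 // mul1r.
by apply: le_ln1Dx; rewrite (lt_trans (ltrN10 R)) // invr_gt0 ltr0n.
Qed.

Lemma gstep_ge k : k.+2%:R^-1 <= gstep k.
Proof.
rewrite /gstep -[X in ln X]invrK lnV ?posrE ?invr_gt0 ?divr_gt0 ?ltr0n //.
rewrite invf_div.
have -> : k.+1%:R / k.+2%:R = 1 + - k.+2%:R^-1 :> R.
  have e : k.+1%:R = k.+2%:R - 1 :> R by rewrite -[k.+2%:R]natr1 addrK.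
  have h0 : k.+2%:R != 0 :> R by rewrite pnatr_eq0.
  by rewrite e; move: (k.+2%:R : R) h0 => x x0; field.
rewrite lerNr; apply: le_ln1Dx.
by rewrite ltrN2 invf_lt1 ?ltr0n // ltr1n.
Qed.

Lemma gstepB k : `|k.+2%:R^-1 - gstep k| <= k.+1%:R^-1 ^+ 2.
Proof.
rewrite distrC ger0_norm ?subr_ge0 ?gstep_ge //.
apply: (@le_trans _ _ (k.+1%:R^-1 - k.+2%:R^-1)); first by rewrite lerD2r gstep_le.
have h : 0 < k.+1%:R :> R by rewrite ltr0n.
have -> : k.+2%:R = k.+1%:R + 1 :> R by rewrite natr1.
move: (k.+1%:R : R) h => x x0.
have x1 : 0 < x + 1 by rewrite ltr_wpDr.
have -> : x^-1 - (x + 1)^-1 = x^-1 * (x + 1)^-1 by field; rewrite !gt_eqF.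
by rewrite expr2 ler_pM2l ?invr_gt0 // lef_pV2 ?posrE // lerDl.
Qed.

Definition gmaj (B : R) k : R := expR B * (5 * B * expR (2 * B) + 1) * k.+1%:R^-1 ^+ 2.

(** The first order terms [1 / (k + 2)] and [ln ((k + 2) / (k + 1))] cancel
    up to [O(k ^ - 2)]: this makes Euler's product and its derivative
    converge locally uniformly. *)
Lemma modulus_gfacq (B : R) k z w : modulus z <= B -> modulus w <= B ->
  modulus (gfacq z k w) <= gmaj B k.
Proof.
move=> zB wB; rewrite /gfacq /gmaj.
have B0 : 0 <= B by apply: le_trans zB; exact: modulus_ge0.
set l := gstep k; set h := (k.+1%:R^-1 : R).
have h0 : 0 <= h by rewrite invr_ge0.
have h1 : h <= 1 by rewrite invf_le1 ?ltr0n // ler1n.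
have l0 := gstep_ge0 k; have lh := gstep_le k; rewrite -/l -/h in l0 lh.
have l1 : l <= 1 by exact: le_trans h1.
set c := (k.+2%:R^-1 : R).
have c0 : 0 <= c by rewrite invr_ge0.
have ch : c <= h by apply: le_trans (gstep_ge k) _.
have cl : `|c - l| <= h ^+ 2 by exact: gstepB.
have -> : k.+2%:R^-1 = c%:C :> R[i] by rewrite /c fmorphV /= real_complexN.
rewrite modulusM -mulrA; apply: ler_pM; rewrite ?modulus_ge0 //.
  apply: le_trans (modulus_cexp_le _) _; rewrite ler_expR modulusN modulusM modulusR ger0_norm //.
  by rewrite -[B]mulr1 ler_pM // modulus_ge0.
have dB : modulus (w - z) <= 2 * B.
  by apply: le_trans (modulusD _ _) _; rewrite modulusN; lra.
set v := - ((w - z) * l%:C).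
have vE : modulus v = modulus (w - z) * l by rewrite /v modulusN modulusM modulusR ger0_norm.
have vh : modulus v <= 2 * B * h by rewrite vE ler_pM // modulus_ge0.
have v2 : modulus v <= 2 * B by rewrite vE -[2 * B]mulr1 ler_pM // modulus_ge0.
have ev : expR (modulus v) <= expR (2 * B) by rewrite ler_expR.
have e0 : 0 <= expR (2 * B) by exact: expR_ge0.
have -> : cexp v * c%:C - (1 + z * c%:C) * (l%:C * cexpm1q v) =
   c%:C * (cexp v - 1) + (c - l)%:C - l%:C * (cexpm1q v - 1) - z * (c%:C * (l%:C * cexpm1q v)).
  by rewrite rmorphB /=; ring.
apply: le_trans (modulusD _ _) _; rewrite modulusN.
have t1 : modulus (c%:C * (cexp v - 1)) <= h * (2 * B * h * expR (2 * B)).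
  rewrite modulusM modulusR ger0_norm // ler_pM ?modulus_ge0 //.
  by apply: le_trans (modulus_cexpB1 v) _; rewrite ler_pM ?modulus_ge0 ?expR_ge0.
have t2 : modulus (c - l)%:C <= h ^+ 2 by rewrite modulusR.
have t3 : modulus (l%:C * (cexpm1q v - 1)) <= h * (2 * B * h * expR (2 * B)).
  rewrite modulusM modulusR ger0_norm // ler_pM ?modulus_ge0 //.
  by apply: le_trans (modulus_cexpm1qB1 v) _; rewrite ler_pM ?modulus_ge0 ?expR_ge0.
have t4 : modulus (z * (c%:C * (l%:C * cexpm1q v))) <= B * (h * (h * expR (2 * B))).
  rewrite !modulusM !modulusR !ger0_norm // !ler_pM ?modulus_ge0 ?mulr_ge0 ?modulus_ge0 //.
  by apply: le_trans (modulus_cexpm1q v) _.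
have t5 := modulusD (c%:C * (cexp v - 1) + (c - l)%:C) (- (l%:C * (cexpm1q v - 1))).
have t6 := modulusD (c%:C * (cexp v - 1)) (c - l)%:C.
rewrite modulusN in t5.
have -> : (5 * B * expR (2 * B) + 1) * h ^+ 2 = h * (2 * B * h * expR (2 * B)) +
   h ^+ 2 + h * (2 * B * h * expR (2 * B)) + B * (h * (h * expR (2 * B))) by ring.
rewrite lerD //; apply: le_trans t5 _; rewrite lerD //.
by apply: le_trans t6 _; rewrite lerD.
Qed.

Lemma cvg_inv_sqr : cvgn (series (fun k : nat => k.+1%:R^-1 ^+ 2 : R)).
Proof.
pose t (k : nat) : R := k.+1%:R^-1.
have ht : cvgn (series (fun k => 2 * (t k - t k.+1))).
  apply: cvg_seriesZ.
  rewrite (_ : series _ = (fun m => 1 - t m)).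
    apply: is_cvgB; first exact: is_cvg_cst.
    by apply/cvg_ex; exists 0; exact: cvg_harmonic.
  apply/funext; elim => [|m IH]; first by rewrite /series /= big_geq // /t invr1 subrr.
  by move: IH; rewrite /series /= big_nat_recr //= => ->; rewrite addrA subrK.
apply: series_le_cvg ht => k.
- exact: sqr_ge0.
- rewrite mulr_ge0 // subr_ge0 /t lef_pV2 ?posrE ?ltr0n // ler_nat //.
- rewrite /= /t.
  have h : 1 <= k.+1%:R :> R by rewrite ler1n.
  have -> : k.+2%:R = k.+1%:R + 1 :> R by rewrite natr1.
  move: (k.+1%:R : R) h => x x1.
  have x0 : 0 < x by exact: lt_le_trans x1.
  have x10 : 0 < x + 1 by rewrite ltr_wpDr.
  have -> : 2 * (x^-1 - (x + 1)^-1) = x^-1 * (2 / (x + 1)) by field; rewrite !gt_eqF.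
  rewrite expr2 ler_pM2l ?invr_gt0 // ler_pdivlMr // mulrC ler_pdivrMr //; lra.
Qed.

Lemma cvg_gmaj B : cvgn (series (gmaj B)).
Proof. by apply: cvg_seriesZ; exact: cvg_inv_sqr. Qed.

Lemma modulus_gfac (B : R) k z : modulus z <= B -> modulus (gfac k z) <= B * gmaj B k.
Proof.
move=> zB; have B0 : 0 <= B by apply: le_trans zB; exact: modulus_ge0.
have := gfacB k 0 z; rewrite gfac0 !subr0 => ->.
by rewrite modulusM ler_pM ?modulus_ge0 // modulus_gfacq // modulus0.
Qed.

End EulerProduct.

Section ReciprocalGamma.
Context {R : realType}.
Implicit Types z w : R[i].

Definition gprod z : R[i] := cprod (fun k => gfac k z).
Definition dgprod z w : R[i] :=
  cdprod (fun k => gfac k w) (fun k => gfac k z) (fun k => gfacq z k w).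
Definition rgamma1 z : R[i] := (1 + z) * gprod z.
(** The reciprocal of [Gamma], an entire function. The formulas below use
    it instead of [Gamma], so that poles become zeros. *)
Definition rgamma z : R[i] := z * rgamma1 z.
Definition drgamma1 z : R[i] := gprod z + (1 + z) * dgprod z z.
Definition drgamma z : R[i] := rgamma1 z + z * drgamma1 z.

Lemma ccont_gfac k z : ccont (gfac k) z.
Proof.
apply: ccontD; last exact: ccont_cst.
apply: ccontM.
  by apply: ccontD; [exact: ccont_cst|apply: ccontM; [exact: ccont_id|exact: ccont_cst]].
apply: (ccont_comp (f := cexp)); last exact: ccont_cexp.
by apply: ccontN; apply: ccontM; [exact: ccont_id|exact: ccont_cst].
Qed.

Lemma ccont_cexpm1q z : ccont cexpm1q z.
Proof. by split=> T F FF g h; exact: cvg_cexpm1q. Qed.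

Lemma ccont_gfacq z k w : ccont (gfacq z k) w.
Proof.
have h : ccont (fun w => - ((w - z) * (gstep k)%:C)) w.
  apply: ccontN; apply: ccontM; last exact: ccont_cst.
  by apply: ccontD; [exact: ccont_id|exact: ccont_cst].
apply: ccontM; first exact: ccont_cst.
apply: ccontD.
  apply: ccontM; last exact: ccont_cst.
  by apply: (ccont_comp (f := cexp)); [exact: h|exact: ccont_cexp].
apply: ccontN; apply: ccontM; first exact: ccont_cst.
apply: ccontM; first exact: ccont_cst.
by apply: (ccont_comp (f := cexpm1q)); [exact: h|exact: ccont_cexpm1q].
Qed.

Definition gmaj1 (B : R) k : R := (B + 1) * gmaj B k.

Lemma cvg_gmaj1 (B : R) : cvgn (series (gmaj1 B)).
Proof. by apply: cvg_seriesZ; exact: cvg_gmaj. Qed.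

Lemma gmaj_ge0 (B : R) k : 0 <= B -> 0 <= gmaj B k.
Proof.
move=> B0; have h : modulus (0 : R[i]) <= B by rewrite modulus0.
by apply: le_trans (modulus_gfacq k h h); exact: modulus_ge0.
Qed.

Lemma modulus_gfac1 (B : R) k z : modulus z <= B -> modulus (gfac k z) <= gmaj1 B k.
Proof.
move=> zB; have B0 : 0 <= B by apply: le_trans zB; exact: modulus_ge0.
apply: le_trans (modulus_gfac k zB) _.
by rewrite ler_wpM2r ?gmaj_ge0 // lerDl.
Qed.

Lemma modulus_gfacq1 (B : R) k z w : modulus z <= B -> modulus w <= B ->
  modulus (gfacq z k w) <= gmaj1 B k.
Proof.
move=> zB wB; have B0 : 0 <= B by apply: le_trans zB; exact: modulus_ge0.
apply: le_trans (modulus_gfacq k zB wB) _.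
by rewrite -[X in X <= _]mul1r ler_wpM2r ?gmaj_ge0 // lerDr.
Qed.

Lemma cdiff_gprod z : cdiff gprod z (dgprod z z).
Proof.
exists (dgprod z); split; [|reflexivity|].
  move=> w; pose B := modulus z + modulus w.
  have zB : modulus z <= B by rewrite lerDl modulus_ge0.
  have wB : modulus w <= B by rewrite lerDr modulus_ge0.
  apply: (@cprodB _ _ _ _ _ (gmaj1 B)).
  - by move=> k; exact: modulus_gfac1.
  - by move=> k; exact: modulus_gfac1.
  - by move=> k; exact: modulus_gfacq1.
  - exact: cvg_gmaj1.
  - by move=> k; exact: gfacB.
split=> T F FF g gz; pose B := modulus z + 1.
have zB : modulus z <= B by rewrite lerDl.
have nB : \forall x \near F, modulus (g x) <= B.
  have h : modulus (g x) @[x --> F] --> modulus z by exact: cvg_modulus.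
  have /cvgrPdist_lt/(_ _ (@ltr01 R)) := h.
  apply: filterS => x; rewrite ltr_norml /B => /andP[h1 h2]; lra.
apply: (@cdprod_tannery _ _ _ _ (fun k x => gfac k (g x)) (fun k x => gfacq z k (g x))
   _ _ _ (gmaj1 B)).
- by move=> k; exact: (ccontP (ccont_gfac k z)).
- by move=> k; exact: (ccontP (ccont_gfacq z k z)).
- by apply: filterS nB => x xB k; exact: modulus_gfac1.
- by apply: filterS nB => x xB k; exact: modulus_gfacq1.
- by move=> k; exact: modulus_gfac1.
- exact: cvg_gmaj1.
Qed.

Lemma cdiff_rgamma1 z : cdiff rgamma1 z (drgamma1 z).
Proof.
have h := cdiffM (cdiffD (cdiff_cst 1 z) (cdiff_id z)) (cdiff_gprod z).
by apply: cdiff_eq h; rewrite add0r mul1r.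
Qed.

Lemma rgammaE z : rgamma z = z * rgamma1 z.
Proof. by []. Qed.

Lemma drgammaE z : drgamma z = rgamma1 z + z * drgamma1 z.
Proof. by []. Qed.

Lemma cdiff_rgamma z : cdiff rgamma z (drgamma z).
Proof.
by apply: cdiff_eq (cdiffM (cdiff_id z) (cdiff_rgamma1 z)); rewrite mul1r.
Qed.

Lemma ccont_rgamma z : ccont rgamma z.
Proof. exact: cdiff_ccont (cdiff_rgamma z). Qed.

Definition rgamma_seq z m : R[i] :=
  (\prod_(0 <= j < m.+1) (z + j%:R)) * cexp (- (z * (ln m%:R)%:C)) / m`!%:R.

Lemma rgamma_seqE z k : rgamma_seq z k.+1 = z * ((1 + z) * pprod (fun k => gfac k z) k).
Proof.
elim: k => [|k IH].
  rewrite /rgamma_seq pprod0 !big_nat_recr //= big_geq // ln1 mulr0 oppr0 cexp0.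
  by rewrite mul1r addr0 !mulr1 invr1 mulr1 [1 + z]addrC.
rewrite pprodS 2!mulrA -[z * (1 + z) * _]mulrA -IH /rgamma_seq.
rewrite [in LHS]big_nat_recr //= /gfac [1 + (_ - 1)]addrC subrK.
have -> : ln k.+2%:R = ln k.+1%:R + gstep k :> R.
  by rewrite /gstep ln_div ?posrE ?ltr0n // addrC subrK.
rewrite rmorphD /= factS natrM.
have -> : - (z * ((ln k.+1%:R)%:C + (gstep k)%:C)) =
   - (z * (ln k.+1%:R)%:C) + - (z * (gstep k)%:C) by ring.
rewrite cexpD.
have : (k.+2%:R : R[i]) != 0 by rewrite pnatr_eq0.
have : (k.+1`!%:R : R[i]) != 0 by rewrite pnatr_eq0 -lt0n fact_gt0.
move: (k.+2%:R : R[i]) (k.+1`!%:R : R[i]) => c f f0 c0.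
by field; rewrite f0 c0.
Qed.

Lemma rgamma_cvg z : rgamma_seq z @ \oo --> rgamma z.
Proof.
rewrite -cvg_shiftS.
rewrite (_ : [sequence _]_n = (fun k => z * ((1 + z) * pprod (fun k => gfac k z) k))).
  apply: ccvgM; first exact: ccvg_cst.
  apply: ccvgM; first exact: ccvg_cst.
  apply: (@cprod_cvg _ _ (gmaj1 (modulus z))); last exact: cvg_gmaj1.
  by move=> j; exact: modulus_gfac1.
by apply/funext => k /=; rewrite rgamma_seqE.
Qed.

(** Away from [0, -1, -2, ...] no factor of Euler's product vanishes. *)
Lemma rgamma_neq0 z : (forall N : nat, z != - N%:R) -> rgamma z != 0.
Proof.
move=> hz; rewrite /rgamma /rgamma1 !mulf_neq0 //.
- by have := hz 0%N; rewrite oppr0.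
- by rewrite addrC addr_eq0; exact: (hz 1%N).
- apply: cprod_neq0.
    apply: (@csummable_le _ _ (gmaj1 (modulus z))); last exact: cvg_gmaj1.
    by move=> j; exact: modulus_gfac1.
  move=> j; rewrite /gfac addrC subrK mulf_neq0 ?cexp_neq0 //.
  have j0 : (j.+2%:R : R[i]) != 0 by rewrite pnatr_eq0.
  have -> : 1 + z / j.+2%:R = (z + j.+2%:R) / j.+2%:R.
    by move: (j.+2%:R : R[i]) j0 => c c0; field.
  by rewrite mulf_neq0 ?invr_eq0 // addr_eq0; exact: (hz j.+2).
Qed.

(** At a pole the terms defining [Gamma] eventually have denominator [0],
    hence are [0], in agreement with [0^-1 = 0]. *)
Lemma Gamma_rgamma z : Gamma z = (rgamma z)^-1.
Proof.
have E : (fun m : nat => m`!%:R * cexp (z * (ln m%:R)%:C)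
              / \prod_(0 <= j < m.+1) (z + j%:R)) = (fun m => (rgamma_seq z m)^-1).
  by apply/funext => m; rewrite /rgamma_seq cexpN 2!invfM !invrK; ring.
rewrite /Gamma E; apply: cvgC_lim.
have [[N zN]|h] := pselect (exists N : nat, z = - N%:R); last first.
  have nz : rgamma z != 0.
    by apply: rgamma_neq0 => N; apply/eqP => e; apply: h; exists N.
  by apply: ccvgV; [exact: nz|exact: rgamma_cvg].
have s0 : \forall m \near \oo, rgamma_seq z m = 0.
  near=> m; rewrite /rgamma_seq.
  have Nm : (N < m.+1)%N by near: m; exact: nbhs_infty_ge.
  have -> : \prod_(0 <= j < m.+1) (z + j%:R) = 0.
    rewrite big_mkord (bigD1 (Ordinal Nm)) //= zN addNr; exact: mul0r.
  by rewrite !mul0r.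
have -> : rgamma z = 0.
  have h0 : rgamma_seq z @ \oo --> (0 : R[i]).
    apply: (cvg_near_eq (f := fun=> 0)); last exact: ccvg_cst.
    by apply: filterS s0 => m ->.
  exact: (cvgC_unique (@rgamma_cvg z) h0).
rewrite invr0; apply: (cvg_near_eq (f := fun=> 0)); last exact: ccvg_cst.
by apply: filterS s0 => m ->; rewrite invr0.
Unshelve. all: by end_near. Qed.

Lemma rgammaS z : rgamma z = z * rgamma (z + 1).
Proof.
have h1 : rgamma_seq z m * (1 + (z + 1) * (m%:R^-1)%:C) @[m --> \oo] --> rgamma z * (1 + (z + 1) * 0%:C).
  apply: ccvgM; first exact: rgamma_cvg.
  apply: ccvgD; first exact: ccvg_cst.
  apply: ccvgM; first exact: ccvg_cst.
  apply: cvg_realC; rewrite -cvg_shiftS; exact: cvg_harmonic.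
have h2 : z * rgamma_seq (z + 1) m @[m --> \oo] --> z * rgamma (z + 1).
  by apply: ccvgM; [exact: ccvg_cst|exact: rgamma_cvg].
rewrite rmorph0 mulr0 addr0 mulr1 in h1.
apply: (cvgC_unique h1); apply: cvg_near_eq h2.
near=> m; have m0 : (0 < m)%N by near: m; exact: nbhs_infty_gt.
rewrite /rgamma_seq [in LHS]big_nat_recr // [in RHS]big_nat_recl //=.
rewrite addr0 fmorphV /= real_complexN.
have -> : \prod_(0 <= i < m) (z + i.+1%:R) = \prod_(0 <= i < m) (z + 1 + i%:R).
  by apply: eq_bigr => i _; rewrite -addrA nat1r.
have -> : cexp (- ((z + 1) * (ln m%:R)%:C)) = cexp (- (z * (ln m%:R)%:C)) / m%:R.
  have -> : - ((z + 1) * (ln m%:R)%:C) = - (z * (ln m%:R)%:C) + - (ln m%:R)%:C by ring.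
  rewrite cexpD; congr (_ * _).
  by rewrite cexpN cexp_real lnK ?posrE ?ltr0n // real_complexN.
have : (m%:R : R[i]) != 0 by rewrite pnatr_eq0 -lt0n.
have : (m`!%:R : R[i]) != 0 by rewrite pnatr_eq0 -lt0n fact_gt0.
move: (m%:R : R[i]) (m`!%:R : R[i]) => c f f0 c0.
by field; rewrite f0 c0.
Unshelve. all: by end_near. Qed.

Lemma rgamma_1D z : rgamma (1 + z) = rgamma1 z.
Proof.
have [->|z0] := eqVneq z 0; last by apply: (mulfI z0); rewrite -/(rgamma z) addrC -rgammaS.
have h1 : rgamma (1 + w) @[w --> (0 : R[i])^'] --> rgamma (1 + 0).
  apply: (ccontP (ccont_rgamma _)); apply: ccvgD; first exact: ccvg_cst.
  exact: cvg_within.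
have h2 : rgamma1 w @[w --> (0 : R[i])^'] --> rgamma1 0.
  apply: (ccontP (cdiff_ccont (cdiff_rgamma1 0))); exact: cvg_within.
apply: (cvgC_unique h1); apply: cvg_near_eq h2; near=> w.
have w0 : w != 0 by near: w; exact: nbhs_dnbhs_neq.
by apply: (mulfI w0); rewrite -/(rgamma w) addrC -rgammaS.
Unshelve. all: by end_near. Qed.

Lemma gfac_0 : (fun k => gfac k 0) = (fun=> 0) :> (nat -> R[i]).
Proof. by apply/funext => k; rewrite gfac0. Qed.

Lemma pprod_0 k : pprod (fun=> 0) k = 1 :> R[i].
Proof. by rewrite /pprod big1 // => j _; rewrite addr0. Qed.

Lemma gprod0 : gprod 0 = 1.
Proof.
rewrite /gprod gfac_0 /cprod (_ : (fun k => _) = (fun=> 0)).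
  rewrite (@csum_eq _ _ 0) ?addr0 //.
  rewrite (_ : series _ = (fun=> 0)); first exact: ccvg_cst.
  by apply/funext => m; rewrite /series /= big1.
by apply/funext => k; rewrite mulr0.
Qed.

Lemma rgamma_1 : rgamma 1 = 1.
Proof. by rewrite -[X in rgamma X]addr0 rgamma_1D /rgamma1 gprod0 addr0 mulr1. Qed.

Lemma gfacq00 k : gfacq 0 k 0 = (k.+2%:R^-1 - gstep k)%:C :> R[i].
Proof.
rewrite /gfacq subrr !mul0r oppr0 cexp0 /cexpm1q eqxx addr0 !mul1r !mulr1.
by rewrite rmorphB /= fmorphV /= real_complexN.
Qed.

Lemma gstep_sum m : \sum_(0 <= k < m) gstep k = ln m.+1%:R :> R.
Proof.
elim: m => [|m IH]; first by rewrite big_geq // ln1.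
by rewrite big_nat_recr //= IH /gstep ln_div ?posrE ?ltr0n // addrC subrK.
Qed.

(** The derivative of the product at [0] is the series of [1 / (k + 2) - ln
    ((k + 2) / (k + 1))], whose partial sums define the Euler constant. *)
Lemma dgprod00 : dgprod 0 0 = (euler_gamma - 1)%:C.
Proof.
rewrite /dgprod gfac_0 /cdprod.
rewrite (_ : (fun k => _) = (fun k => (k.+2%:R^-1 - gstep k)%:C)); last first.
  by apply/funext => k; rewrite mulr0 add0r pprod_0 mul1r gfacq00.
have sb : csummable (fun k => (k.+2%:R^-1 - gstep k)%:C : R[i]).
  apply: (@csummable_le _ _ (fun k => k.+1%:R^-1 ^+ 2)); last exact: cvg_inv_sqr.
  by move=> j; rewrite modulusR gstepB.
have h := csum_cvg sb.
have /cvg_ReIm [h1 _] := h.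
have h2 : (\sum_(1 <= k < m.+1) k%:R^-1 - ln m%:R) @[m --> \oo] -->
    1 + complex.Re (csum (fun k => (k.+2%:R^-1 - gstep k)%:C : R[i])).
  rewrite -cvg_shiftS; apply: (cvg_near_eq
    (f := fun m => 1 + complex.Re (series (fun k => (k.+2%:R^-1 - gstep k)%:C : R[i]) m))).
    near=> m; rewrite /series /= cRe_sum /= sumrB gstep_sum.
    have -> : \sum_(1 <= k < m.+2) k%:R^-1 = 1 + \sum_(0 <= k < m) k.+2%:R^-1 :> R.
      by rewrite big_add1 /= big_nat_recl // invr1.
    by rewrite addrA.
  by apply: cvgD; [exact: cvg_cst|exact: h1].
have -> : euler_gamma = 1 + complex.Re (csum (fun k => (k.+2%:R^-1 - gstep k)%:C : R[i])).
  exact: cvg_lim h2.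
rewrite addrAC subrr add0r; apply: complex_ext => //=.
rewrite (_ : series _ = (fun=> 0)); first by rewrite lim_cst.
by apply/funext => m; rewrite /series /= big1.
Unshelve. all: by end_near. Qed.

Lemma drgamma_1 : drgamma 1 = euler_gamma%:C.
Proof.
apply: (@cdiff_unique _ rgamma 1); first exact: cdiff_rgamma.
have h : cdiff (fun w => rgamma1 (w - 1)) 1 (1 * drgamma1 (1 - 1)).
  apply: cdiff_comp; last exact: cdiff_rgamma1.
  by apply: cdiff_eq (cdiffB (cdiff_id 1) (cdiff_cst 1 1)); rewrite subr0.
apply: (cdiff_ext (f := fun w => rgamma1 (w - 1))).
  by move=> w; rewrite -rgamma_1D addrC subrK.
apply: cdiff_eq h; rewrite mul1r subrr /drgamma1 gprod0 addr0 mul1r dgprod00.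
by rewrite rmorphB /= addrC subrK.
Qed.

Lemma drgammaS z : drgamma z = rgamma (z + 1) + z * drgamma (z + 1).
Proof.
apply: (@cdiff_unique _ rgamma z); first exact: cdiff_rgamma.
apply: (cdiff_ext (f := fun w => w * rgamma (w + 1))).
  by move=> w; rewrite -rgammaS.
have h : cdiff (fun w => rgamma (w + 1)) z (1 * drgamma (z + 1)).
  apply: cdiff_comp; last exact: cdiff_rgamma.
  by apply: cdiff_eq (cdiffD (cdiff_id z) (cdiff_cst 1 z)); rewrite addr0.
by apply: cdiff_eq (cdiffM (cdiff_id z) h); rewrite !mul1r.
Qed.

Lemma cdiff_Gamma z : (forall N : nat, z != - N%:R) ->
  cdiff Gamma z (- drgamma z / rgamma z ^+ 2).
Proof.
move=> hz; have h := cdiffV (rgamma_neq0 hz) (cdiff_rgamma z).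
by apply: cdiff_ext h => w; rewrite Gamma_rgamma.
Qed.

Lemma digammaE z : (forall N : nat, z != - N%:R) ->
  digamma z = - drgamma z / rgamma z.
Proof.
move=> hz; rewrite /digamma (cdiff_derive1 (cdiff_Gamma hz)) Gamma_rgamma invrK.
have := rgamma_neq0 hz; move: (rgamma z) => x x0; field. exact: x0.
Qed.

End ReciprocalGamma.

(* Conversion must not unfold infinite products. *)
#[global] Opaque rgamma drgamma.

(** * Power series on the unit disc *)

Section PowerSeries.
Context {R : realType}.
Implicit Types (c d : nat -> R[i]) (x : R).

(** Radius of convergence at least [1], in a form that follows from
    estimates on single coefficients: bounded terms at every [K < 1]. *)
Definition rad1 c : Prop :=
  forall K : R, 0 < K < 1 -> exists C : R, forall j, modulus (c j) * K ^+ j <= C.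

Definition psum c x : R[i] := csum (fun j => c j * (x ^+ j)%:C).

Definition cdiffs c j : R[i] := j.+1%:R * c j.+1.

Lemma rad1_summable c x : rad1 c -> `|x| < 1 ->
  csummable (fun j => c j * (x ^+ j)%:C).
Proof.
move=> hc x1; pose K := (`|x| + 1) / 2.
have x0 := normr_ge0 x.
have K01 : 0 < K < 1 by rewrite /K; apply/andP; split; lra.
have [C hC] := hc K K01; have /andP[K0 _] := K01.
apply: (@csummable_le _ _ (geometric C (`|x| / K))).
  move=> j; rewrite modulusM modulusR normrX /geometric /=.
  rewrite expr_div_n mulrA ler_pdivlMr ?exprn_gt0 // mulrAC.
  by rewrite ler_wpM2r ?exprn_ge0.
apply: is_cvg_geometric_series.
by rewrite normrM normr_id normfV (gtr0_norm K0) ltr_pdivrMr // mul1r /K; lra.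
Qed.

Lemma linear_geometric_bounded (r : R) : 0 < r < 1 ->
  exists C : R, 0 <= C /\ forall j : nat, j%:R * r ^+ j <= C.
Proof.
move=> /andP[r0 r1]; have d0 : 0 < r^-1 - 1 by rewrite subr_gt0 invf_gt1.
exists (r^-1 - 1)^-1; split; first by rewrite invr_ge0 ltW.
move=> j; rewrite -ler_pdivlMr ?exprn_gt0 // mulrC -exprVn.
rewrite ler_pdivlMr //.
have -> : r^-1 ^+ j = (1 + (r^-1 - 1)) ^+ j by rewrite addrC subrK.
move: (r^-1 - 1) d0 => d d0; elim: j => [|j IH]; first by rewrite mul0r expr0.
rewrite exprSr mulrDr mulr1 -natr1 mulrDl mul1r lerD // ler_peMl //; first exact: ltW.
by apply: exprn_ege1; rewrite lerDl ltW.
Qed.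

(** A factor of linear growth is absorbed by a slightly larger [K]. *)
Lemma rad1_dom c d (A : R) : 0 <= A -> rad1 c ->
  (forall j, modulus (d j) <= A * j.+1%:R * modulus (c j)) -> rad1 d.
Proof.
move=> A0 hc hd K /andP[K0 K1]; pose L := (K + 1) / 2.
have L01 : 0 < L < 1 by rewrite /L; apply/andP; split; lra.
have [C hC] := hc L L01; have /andP[L0 L1] := L01.
have KL : 0 < K / L < 1 by rewrite divr_gt0 //= ltr_pdivrMr // mul1r /L; lra.
have [C' [C'0 hC']] := linear_geometric_bounded KL.
have C0 : 0 <= C by apply: le_trans (hC 0%N); rewrite mulr_ge0 ?modulus_ge0 ?exprn_ge0 ?ltW.
exists (A * (C' + 1) * C) => j.
apply: (@le_trans _ _ (A * (j.+1%:R * (K / L) ^+ j) * (modulus (c j) * L ^+ j))).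
  rewrite expr_div_n; have Lj : 0 < L ^+ j by rewrite exprn_gt0.
  have -> : A * (j.+1%:R * (K ^+ j / L ^+ j)) * (modulus (c j) * L ^+ j) =
    A * j.+1%:R * modulus (c j) * K ^+ j.
    by move: (L ^+ j) Lj => l l0; field; rewrite gt_eqF.
  by rewrite ler_wpM2r // exprn_ge0 // ltW.
apply: ler_pM => //.
- by rewrite !mulr_ge0 // exprn_ge0 // ltW //; case/andP: KL.
- by rewrite mulr_ge0 ?modulus_ge0 // exprn_ge0 // ltW.
- rewrite ler_wpM2l // -natr1 mulrDl mul1r lerD //.
  by apply: exprn_ile1; case/andP: KL => /ltW ? /ltW.
Qed.

Lemma rad1_le c d (A : R) : 0 <= A -> rad1 c ->
  (forall j, modulus (d j) <= A * modulus (c j)) -> rad1 d.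
Proof.
move=> A0 hc h; apply: (rad1_dom A0 hc) => j; apply: le_trans (h j) _.
by rewrite ler_wpM2r ?modulus_ge0 // ler_peMr // ler1n.
Qed.

Lemma rad1_shift c : rad1 c -> rad1 (fun j => c j.+1).
Proof.
move=> hc K /[dup] K01 /andP[K0 K1]; have [C hC] := hc K K01.
exists (C / K) => j; rewrite ler_pdivlMr // -mulrA -exprSr; exact: hC.
Qed.

Lemma rad1_cdiffs c : rad1 c -> rad1 (cdiffs c).
Proof.
move=> /rad1_shift hc; apply: (rad1_dom ler01 hc) => j.
by rewrite modulusM modulus_nat mul1r.
Qed.

Lemma rad1D c d : rad1 c -> rad1 d -> rad1 (fun j => c j + d j).
Proof.
move=> hc hd K K01; have [C hC] := hc K K01; have [D hD] := hd K K01.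
exists (C + D) => j; apply: le_trans (lerD (hC j) (hD j)).
rewrite -mulrDl ler_wpM2r ?modulusD // exprn_ge0 // ltW //; by case/andP: K01.
Qed.

Lemma rad1Z (a : R[i]) c : rad1 c -> rad1 (fun j => a * c j).
Proof.
by move=> hc; apply: (rad1_le (modulus_ge0 a) hc) => j; rewrite modulusM.
Qed.

(** A ratio test at the critical ratio [1]: for each [K < 1] the factor [(1
    + A / j) * K] is eventually at most [1]. *)
Lemma rad1_ratio c (A : R) (j0 : nat) : 0 <= A ->
  (forall j, (j0 <= j)%N -> modulus (c j.+1) <= (1 + A / j.+1%:R) * modulus (c j)) ->
  rad1 c.
Proof.
move=> A0 h K /andP[K0 K1].
have [N hN] : exists N : nat, forall j, (N <= j)%N -> (1 + A / j.+1%:R) * K <= 1.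
  exists (Num.truncn (A * K / (1 - K))).+1 => j Nj.
  have K1' : 0 < 1 - K by lra.
  have hj : A * K / (1 - K) <= j.+1%:R.
    apply: (@le_trans _ _ (Num.truncn (A * K / (1 - K))).+1%:R).
      by apply/ltW; exact: truncnS_gt.
    by rewrite ler_nat; apply: leq_trans Nj _.
  rewrite ler_pdivrMr // in hj.
  have j0' : 0 < j.+1%:R :> R by rewrite ltr0n.
  rewrite mulrDl mul1r -lerBrDl mulrAC ler_pdivrMr //; lra.
pose m := maxn j0 N.
pose C := \sum_(0 <= i < m.+1) modulus (c i) * K ^+ i.
exists C.
have tge0 i : 0 <= modulus (c i) * K ^+ i by rewrite mulr_ge0 ?modulus_ge0 // exprn_ge0 // ltW.
have small j : (j <= m)%N -> modulus (c j) * K ^+ j <= C.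
  move=> jm; rewrite /C big_mkord (bigD1 (Ordinal (jm : (j < m.+1)%N))) //=.
  by rewrite lerDl sumr_ge0.
elim=> [|j IH]; first exact: small.
have [jm|mj] := leqP j.+1 m; first exact: small.
apply: le_trans IH; rewrite ltnS in mj.
have j0j : (j0 <= j)%N by apply: leq_trans mj; exact: leq_maxl.
have Nj : (N <= j)%N by apply: leq_trans mj; exact: leq_maxr.
have Kj : 0 <= K ^+ j by rewrite exprn_ge0 // ltW.
rewrite exprS mulrA; apply: ler_wpM2r => //.
apply: le_trans (_ : (1 + A / j.+1%:R) * modulus (c j) * K <= _).
  by rewrite ler_wpM2r ?(ltW K0) // h.
by rewrite mulrAC -[X in _ <= X]mul1r ler_wpM2r ?modulus_ge0 // hN.
Qed.

Lemma psumD c d x : rad1 c -> rad1 d -> `|x| < 1 ->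
  psum (fun j => c j + d j) x = psum c x + psum d x.
Proof.
move=> hc hd x1; rewrite /psum -csumD; try exact: rad1_summable.
by congr csum; apply/funext => j; rewrite mulrDl.
Qed.

Lemma psumZ (a : R[i]) c x : rad1 c -> `|x| < 1 ->
  psum (fun j => a * c j) x = a * psum c x.
Proof.
move=> hc x1; rewrite /psum -csumZ; last exact: rad1_summable.
by congr csum; apply/funext => j; rewrite mulrA.
Qed.

Lemma psum_recl c x : rad1 c -> `|x| < 1 ->
  psum c x = c 0%N + x%:C * psum (fun j => c j.+1) x.
Proof.
move=> hc x1; rewrite /psum csum_recl; last exact: rad1_summable.
rewrite expr0 mulr1 -csumZ; last by apply: rad1_summable => //; exact: rad1_shift.
congr (_ + csum _); apply/funext => j.
by rewrite exprS rmorphM /=; ring.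
Qed.

Lemma psum_at0 c : psum c 0 = c 0%N.
Proof.
apply: csum_eq; rewrite -cvg_shiftS; apply: (cvg_near_eq (f := fun=> c 0%N)); last exact: ccvg_cst.
near=> m; rewrite /series /= big_nat_recl // expr0 mulr1 big1 ?addr0 // => j _.
by rewrite expr0n mulr0.
Unshelve. all: by end_near. Qed.

Lemma psum_cdiffsM c x : rad1 c -> `|x| < 1 ->
  x%:C * psum (cdiffs c) x = psum (fun j => j%:R * c j) x.
Proof.
move=> hc x1; rewrite [RHS]psum_recl //.
  by rewrite mul0r add0r.
apply: (rad1_dom ler01 hc) => j; rewrite modulusM modulus_nat mul1r.
by rewrite ler_wpM2r ?modulus_ge0 // ler_nat.
Qed.

(** The real and imaginary parts are real power series, which are
    differentiated term by term. *)
Lemma cder_psum c x : rad1 c -> `|x| < 1 -> cder (psum c) x (psum (cdiffs c) x).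
Proof.
move=> hc x1; pose K := (`|x| + 1) / 2.
have x0 := normr_ge0 x.
have K0 : 0 < K by rewrite /K; lra.
have xK : `|x| < `|K| by rewrite (gtr0_norm K0) /K; lra.
have K1 : `|K| < 1 by rewrite (gtr0_norm K0) /K; lra.
have hc' := rad1_cdiffs hc; have hc'' := rad1_cdiffs hc'.
have ReE d y : series (fun j => complex.Re (d j * (y ^+ j)%:C)) =
    pseries (fun j => complex.Re (d j)) y.
  by rewrite /pseries; congr series; apply/funext => j; rewrite cReM /= mulr0 subr0.
have ImE d y : series (fun j => complex.Im (d j * (y ^+ j)%:C)) =
    pseries (fun j => complex.Im (d j)) y.
  by rewrite /pseries; congr series; apply/funext => j; rewrite cImM /= mulr0 add0r.
have natRe (m : nat) (z : R[i]) : complex.Re (m%:R * z) = m%:R * complex.Re z.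
  by rewrite -real_complexN cReM /= mul0r subr0.
have natIm (m : nat) (z : R[i]) : complex.Im (m%:R * z) = m%:R * complex.Im z.
  by rewrite -real_complexN cImM /= mul0r addr0.
have dRe d : pseries_diffs (fun j => complex.Re (d j)) = (fun j => complex.Re (cdiffs d j)).
  by apply/funext => j; rewrite /pseries_diffs /cdiffs natRe.
have dIm d : pseries_diffs (fun j => complex.Im (d j)) = (fun j => complex.Im (cdiffs d j)).
  by apply/funext => j; rewrite /pseries_diffs /cdiffs natIm.
have cRe d : rad1 d -> cvgn (pseries (fun j => complex.Re (d j)) K).
  by move=> hd; rewrite -ReE; apply: csummable_Re; exact: rad1_summable.
have cIm d : rad1 d -> cvgn (pseries (fun j => complex.Im (d j)) K).
  by move=> hd; rewrite -ImE; apply: csummable_Im; exact: rad1_summable.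
split.
  rewrite (_ : (fun t => _) = (fun t => limn (pseries (fun j => complex.Re (c j)) t))).
    have := @pseries_snd_diffs R (fun j => complex.Re (c j)) K x; rewrite !dRe => h.
    rewrite /psum /csum /= ReE; apply: h => //; exact: cRe.
  by apply/funext => t; rewrite /psum /csum /= ReE.
rewrite (_ : (fun t => _) = (fun t => limn (pseries (fun j => complex.Im (c j)) t))).
  have := @pseries_snd_diffs R (fun j => complex.Im (c j)) K x; rewrite !dIm => h.
  rewrite /psum /csum /= ImE; apply: h => //; exact: cIm.
by apply/funext => t; rewrite /psum /csum /= ImE.
Qed.

End PowerSeries.

(** * Hypergeometric series and their ladder relations *)

(** Far from [z] the function [D] is replaced by the actual difference
    quotient. *)
Lemma cdiff_local {R : realType} (f D : R[i] -> R[i]) (z : R[i]) (r : R) : 0 < r ->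
  (forall w, modulus (w - z) < r -> f w - f z = (w - z) * D w) ->
  ccont D z -> cdiff f z (D z).
Proof.
move=> r0 h cD.
pose E w := if modulus (w - z) < r then D w else (f w - f z) / (w - z).
exists E; split.
- move=> w; rewrite /E; case: ltP => [/h -> //|rw].
  rewrite mulrC divfK // -modulus_eq0; apply: lt0r_neq0; exact: lt_le_trans rw.
- by rewrite /E subrr modulus0 r0.
- split=> T F FF g gz.
  have Ez : E z = D z by rewrite /E subrr modulus0 r0.
  have h1 : D (g x) @[x --> F] --> D z by exact: (ccontP cD).
  have h2 : modulus (g x - z) @[x --> F] --> (0 : R) by exact: cvg_subC0.
  rewrite Ez; apply: cvg_near_eq h1.
  have /cvgrPdist_lt/(_ _ r0) := h2.
  apply: filterS => x; rewrite sub0r normrN ger0_norm ?modulus_ge0 // => hx.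
  by rewrite /E hx.
Qed.

Section HypergeometricSeries.
Context {R : realType}.
Implicit Types (nu c z : R[i]) (s t : nat -> R[i]) (x : R).

(** The Pochhammer quotient [(- nu)_j (nu + 1)_j / j!]. The j-th
    coefficient of the hypergeometric series of parameters [- nu], [nu +
    1], [c] is [hcoef nu j / (c)_j]; dividing by [Gamma (c + j)] instead of
    [(c)_j] regularizes it in [c]. *)
Definition hcoef nu j : R[i] :=
  \prod_(0 <= i < j) ((i%:R - nu) * (i.+1%:R + nu) / i.+1%:R).

Lemma hcoef0 nu : hcoef nu 0 = 1.
Proof. by rewrite /hcoef big_geq. Qed.

Lemma natS_neq0 j : (j.+1%:R : R[i]) != 0.
Proof. by rewrite pnatr_eq0. Qed.

Lemma hcoefS nu j : hcoef nu j.+1 = hcoef nu j * ((j%:R - nu) * (j.+1%:R + nu) / j.+1%:R).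
Proof. by rewrite /hcoef big_nat_recr. Qed.

Lemma hcoefS' nu j :
  j.+1%:R * hcoef nu j.+1 = (j%:R - nu) * (j.+1%:R + nu) * hcoef nu j.
Proof.
rewrite hcoefS; have := natS_neq0 j; move: (j.+1%:R : R[i]) => y y0; field. exact: y0.
Qed.

(** Order of magnitude of [1 / Gamma (c + j)] and of its derivative in [c],
    see [jbd_rgseq] and [jbd_drgseq]. *)
Definition jweight (j : nat) : R := j.+1%:R / (j.-1)`!%:R.

Lemma fact_gt0R j : 0 < j`!%:R :> R.
Proof. by rewrite ltr0n fact_gt0. Qed.

Lemma jweight_ge0 j : 0 <= jweight j.
Proof. by rewrite divr_ge0. Qed.

Lemma jweightS j : jweight j.+1 <= 2 * jweight j.
Proof.
case: j => [|j]; first by rewrite /jweight /= fact0; lra.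
rewrite /jweight /= factS natrM.
rewrite ler_pdivrMr ?mulr_gt0 ?ltr0n ?fact_gt0 //.
have := fact_gt0R j; move: (j`!%:R : R) => f f0.
have -> : 2 * (j.+2%:R / f) * (j.+1%:R * f) = 2 * j.+2%:R * j.+1%:R :> R.
  by field; rewrite gt_eqF.
rewrite -[j.+3%:R]natr1 -[j.+2%:R]natr1 -[j.+1%:R]natr1.
have : 0 <= j%:R :> R by rewrite ler0n.
move: (j%:R : R) => y y0; nra.
Qed.

(** The ratios of [hcoef] grow like [j] and those of [jweight] decay like
    [1 / j], with relative error [O(1 / j)]. *)
Lemma rad1_jweight nu : rad1 (fun j => hcoef nu j * (jweight j)%:C).
Proof.
have n0 := modulus_ge0 nu; set n := modulus nu in n0.
apply: (@rad1_ratio _ _ (2 * (1 + 2 * n) * (1 + n)) 1).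
  by rewrite !mulr_ge0 // addr_ge0 // mulr_ge0.
case=> // k _.
rewrite hcoefS !modulusM !modulusR !modulusV !modulus_nat.
rewrite !(ger0_norm (jweight_ge0 _)).
have k0 : 0 <= k%:R :> R by rewrite ler0n.
have e1 : modulus (k.+1%:R - nu) <= k%:R + 1 + n.
  by apply: le_trans (modulusD _ _) _; rewrite modulusN modulus_nat -natr1.
have e2 : modulus (k.+2%:R + nu) <= k%:R + 2 + n.
  by apply: le_trans (modulusD _ _) _; rewrite modulus_nat -[k.+2%:R]natr1 -natr1 lerD2r; lra.
have e3 : jweight k.+2 = jweight k.+1 * ((k%:R + 3) / ((k%:R + 1) * (k%:R + 2))).
  rewrite /jweight /= factS natrM -[k.+3%:R]natr1 -[k.+2%:R]natr1 -[k.+1%:R]natr1.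
  have := fact_gt0R k; move: (k`!%:R : R) (k%:R : R) k0 => f y y0 f0.
  by field; rewrite !gt_eqF //; lra.
have e4 : k.+2%:R = k%:R + 1 + 1 :> R by rewrite !natr1.
rewrite e3 e4.
set h := modulus (hcoef _ _); set w := jweight _.
have hw : 0 <= h * w by rewrite mulr_ge0 ?modulus_ge0 // jweight_ge0.
move: (modulus_ge0 (k.+1%:R - nu)) (modulus_ge0 (k.+2%:R + nu)) e1 e2.
move: (modulus (k.+1%:R - nu)) (modulus (k.+2%:R + nu)) (k%:R : R) k0 => m1 m2 y y0 m10 m20 e1 e2.
have -> : h * (m1 * m2 / (y + 1 + 1)) * (w * ((y + 3) / ((y + 1) * (y + 2)))) =
  (m1 * m2 * ((y + 3) / ((y + 1) * (y + 2) ^+ 2))) * (h * w).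
  by field; rewrite !gt_eqF //; lra.
rewrite ler_wpM2r //.
apply: (@le_trans _ _ ((y + 1 + n) * (y + 2 + n) * ((y + 3) / ((y + 1) * (y + 2) ^+ 2)))).
  rewrite ler_wpM2r //; last exact: ler_pM.
  by rewrite divr_ge0 ?mulr_ge0 ?exprn_ge0 //; lra.
have -> : 1 + 2 * (1 + 2 * n) * (1 + n) / (y + 1 + 1) =
   (y + 2 + 2 * (1 + 2 * n) * (1 + n)) * (y + 1) * (y + 2) / ((y + 1) * (y + 2) ^+ 2).
  by field; rewrite !gt_eqF //; lra.
rewrite mulrA ler_wpM2r ?invr_ge0 ?mulr_ge0 ?exprn_ge0 //; try lra.
have -> : 2 * (1 + 2 * n) * (1 + n) = 2 + 6 * n + 4 * n ^+ 2 by ring.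
have yn : 0 <= y * n by rewrite mulr_ge0.
have yn2 : 0 <= y * n ^+ 2 by rewrite mulr_ge0 ?sqr_ge0.
have y2n : 0 <= y ^+ 2 * n by rewrite mulr_ge0 ?sqr_ge0.
have y2n2 : 0 <= y ^+ 2 * n ^+ 2 by rewrite mulr_ge0 ?sqr_ge0.
have n2 : 0 <= n ^+ 2 by rewrite sqr_ge0.
have y2 : 0 <= y ^+ 2 by rewrite sqr_ge0.
rewrite -subr_ge0.
have -> : (y + 2 + (2 + 6 * n + 4 * n ^+ 2)) * (y + 1) * (y + 2) -
    (y + 1 + n) * (y + 2 + n) * (y + 3) =
   2 + 3 * n + 5 * n ^+ 2 + (y * 3 + 9 * (y * n)) + 11 * (y * n ^+ 2) + y ^+ 2 + 4 * (y ^+ 2 * n) + 4 * (y ^+ 2 * n ^+ 2) by ring.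
lra.
Qed.

Definition jbd s : Prop := exists C : R, 0 <= C /\ forall j, modulus (s j) <= C * jweight j.

Lemma rad1_hcoef nu s : jbd s -> rad1 (fun j => hcoef nu j * s j).
Proof.
move=> [C [C0 hC]]; apply: (rad1_le C0 (rad1_jweight nu)) => j.
rewrite !modulusM modulusR (ger0_norm (jweight_ge0 j)) mulrCA.
by rewrite ler_wpM2l ?modulus_ge0.
Qed.

Lemma jbd_shift s : jbd s -> jbd (fun j => s j.+1).
Proof.
move=> [C [C0 hC]]; exists (C * 2); split; first by rewrite mulr_ge0.
by move=> j; apply: le_trans (hC _) _; rewrite -mulrA ler_wpM2l // jweightS.
Qed.

(** True for [0 < Re c]; it bounds the inverses of [c + j], [0 < j],
    independently of [c]. *)
Definition good c : Prop := forall j : nat, j%:R <= modulus (c + j%:R).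

Lemma good_Re c : 0 < complex.Re c -> good c.
Proof.
move=> c0 j; apply: le_trans (modulus_Re _); rewrite cReD -real_complexN /=.
by apply: le_trans (ler_norm _); rewrite lerDr ltW.
Qed.

Lemma good_neq0 c j : good c -> c + j.+1%:R != 0.
Proof. by move=> /(_ j.+1) h; rewrite -modulus_gt0; apply: lt_le_trans h; rewrite ltr0n. Qed.

(** The recurrence is that of [1 / Gamma (c + j)] (with [t = 0]) and of its
    derivative in [c] (with [t] the former). Solved for [s j.+1], it shows
    factorial decay up to a linear factor. *)
Lemma rec_bound c s t (C : R) : good c ->
  (forall j, s j = (c + j%:R) * s j.+1 + t j.+1) ->
  (forall j, modulus (t j.+1) <= C / j`!%:R) -> modulus (s 1%N) <= C ->
  forall j, modulus (s j) <= (modulus c + 1) * C * jweight j.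
Proof.
move=> gc hs ht h1.
have C0 : 0 <= C by apply: le_trans h1; exact: modulus_ge0.
have m0 := modulus_ge0 c.
have key j : modulus (s j.+1) <= C * jweight j.+1.
  elim: j => [|j IH]; first by rewrite /jweight /= fact0; apply: le_trans h1 _; lra.
  have nz := good_neq0 j gc.
  have e : s j.+2 = (s j.+1 - t j.+2) / (c + j.+1%:R).
    by rewrite (hs j.+1) addrK mulrAC divff // mul1r.
  rewrite e modulusM modulusV ler_pdivrMr ?modulus_gt0 //.
  apply: (@le_trans _ _ (C * jweight j.+2 * j.+1%:R)); last first.
    by rewrite ler_wpM2l ?mulr_ge0 ?jweight_ge0 //; exact: gc.
  apply: le_trans (modulusD _ _) _; rewrite modulusN.
  apply: le_trans (lerD IH (ht _)) _.
  rewrite /jweight /= factS natrM -[j.+3%:R]natr1 -[j.+2%:R]natr1 -[j.+1%:R]natr1.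
  have j0 : 0 <= j%:R :> R by rewrite ler0n.
  have := fact_gt0R j; move: (j`!%:R : R) (j%:R : R) j0 => f y y0 f0.
  have -> : C * ((y + 1 + 1) / f) + C / ((y + 1) * f) =
     C / f * (((y + 2) * (y + 1) + 1) / (y + 1)) by field; rewrite !gt_eqF //; lra.
  have -> : C * ((y + 1 + 1 + 1) / ((y + 1) * f)) * (y + 1) = C / f * (y + 3).
    by field; rewrite !gt_eqF //; lra.
  apply: ler_wpM2l; first by rewrite divr_ge0 // ltW.
  by rewrite ler_pdivrMr; lra.
case=> [|j].
  rewrite hs addr0; apply: le_trans (modulusD _ _) _; rewrite modulusM.
  have h2 := ht 0%N; rewrite fact0 divr1 in h2.
  rewrite /jweight /= fact0 divr1 mulr1 mulrDl mul1r lerD // ler_wpM2l //.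
apply: le_trans (key j) _; rewrite ler_wpM2r ?jweight_ge0 // ler_peMl //; lra.
Qed.

Lemma rec_fact c s : good c -> (forall j, s j = (c + j%:R) * s j.+1) ->
  forall j, modulus (s j.+1) <= modulus (s 1%N) / j`!%:R.
Proof.
move=> gc hs; elim=> [|j IH]; first by rewrite fact0 divr1.
have nz := good_neq0 j gc.
have e : s j.+2 = s j.+1 / (c + j.+1%:R).
  by rewrite (hs j.+1) mulrAC divff // mul1r.
rewrite e modulusM modulusV factS natrM invfM mulrA mulrAC.
apply: ler_pM; rewrite ?modulus_ge0 ?invr_ge0 ?modulus_ge0 //.
by rewrite lef_pV2 ?posrE ?modulus_gt0 ?ltr0n //; exact: gc.
Qed.

Definition rgseq c j : R[i] := rgamma (c + j%:R).
Definition drgseq c j : R[i] := drgamma (c + j%:R).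

Lemma rgseqS c j : rgseq c j = (c + j%:R) * rgseq c j.+1.
Proof. by rewrite /rgseq rgammaS -addrA natr1. Qed.

Lemma drgseqS c j : drgseq c j = (c + j%:R) * drgseq c j.+1 + rgseq c j.+1.
Proof. by rewrite /drgseq /rgseq drgammaS -addrA natr1 [LHS]addrC. Qed.

Lemma rgseq_shift c j : rgseq c j.+1 = rgseq (c + 1) j.
Proof. by rewrite /rgseq -addrA nat1r. Qed.

Lemma drgseq_shift c j : drgseq c j.+1 = drgseq (c + 1) j.
Proof. by rewrite /drgseq -addrA nat1r. Qed.

Lemma rgseq_fact c : good c -> forall j, modulus (rgseq c j.+1) <= modulus (rgseq c 1) / j`!%:R.
Proof. by move=> gc; apply: rec_fact => // j; exact: rgseqS. Qed.

Lemma modulus_rgseq c : good c -> forall j,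
  modulus (rgseq c j) <= (modulus c + 1) * modulus (rgseq c 1) * jweight j.
Proof.
move=> gc; apply: (@rec_bound c (rgseq c) (fun=> 0)) => //.
  by move=> j; rewrite addr0; exact: rgseqS.
by move=> j; rewrite modulus0 divr_ge0 ?modulus_ge0.
Qed.

Lemma jbd_rgseq c : good c -> jbd (rgseq c).
Proof.
move=> gc; exists ((modulus c + 1) * modulus (rgseq c 1)); split.
  by rewrite mulr_ge0 ?modulus_ge0 // addr_ge0 ?modulus_ge0.
exact: modulus_rgseq.
Qed.

Lemma jbd_drgseq c : good c -> jbd (drgseq c).
Proof.
move=> gc; pose C := modulus (rgseq c 1) + modulus (drgseq c 1).
exists ((modulus c + 1) * C); split.
  by rewrite /C mulr_ge0 ?addr_ge0 ?modulus_ge0.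
apply: (@rec_bound c (drgseq c) (rgseq c)) => //.
- exact: drgseqS.
- move=> j; apply: le_trans (rgseq_fact gc j) _.
  by rewrite ler_wpM2r ?invr_ge0 // lerDl modulus_ge0.
- by rewrite lerDr modulus_ge0.
Qed.

Definition hser nu s x : R[i] := psum (fun j => hcoef nu j * s j) x.
Definition dhser nu s x : R[i] := psum (cdiffs (fun j => hcoef nu j * s j)) x.

Lemma cder_hser nu s x : jbd s -> `|x| < 1 -> cder (hser nu s) x (dhser nu s x).
Proof. by move=> hs x1; apply: cder_psum => //; exact: rad1_hcoef. Qed.

Lemma hser_at0 nu s : hser nu s 0 = s 0%N.
Proof. by rewrite /hser psum_at0 hcoef0 mul1r. Qed.

Lemma rad1_natM (c : nat -> R[i]) : rad1 c -> rad1 (fun j => j%:R * c j).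
Proof.
move=> hc; apply: (rad1_dom ler01 hc) => j; rewrite modulusM modulus_nat mul1r.
by rewrite ler_wpM2r ?modulus_ge0 // ler_nat.
Qed.

Lemma psum_ext (c d : nat -> R[i]) x : c =1 d -> psum c x = psum d x.
Proof. by move=> /funext ->. Qed.

(** A comparison of coefficients: [x d/dx] multiplies the j-th one by [j],
    which combines with the factor [c + j] of the recurrence. With [t = 0]
    it concerns the hypergeometric functions, and with [t = rgseq c] their
    derivatives in [c]. *)
Lemma hser_lower nu c s t x : jbd s -> jbd t -> `|x| < 1 ->
  (forall j, s j = (c + j%:R) * s j.+1 + t j.+1) ->
  x%:C * dhser nu (fun j => s j.+1) x + c * hser nu (fun j => s j.+1) x =
  hser nu s x - hser nu (fun j => t j.+1) x.
Proof.
move=> hs ht x1 hst.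
have r1 := rad1_hcoef nu (jbd_shift hs); have r2 := rad1_hcoef nu (jbd_shift ht).
have r3 := rad1_hcoef nu hs.
apply/eqP; rewrite -subr_eq0 opprB addrA [_ + hser nu _ x]addrC addrA subr_eq0; apply/eqP.
have q1 := rad1_natM r1; have q2 := rad1Z c r1.
rewrite /dhser psum_cdiffsM // /hser -psumZ //.
rewrite -!psumD //; try by [exact: rad1D | apply: rad1D => //; exact: rad1D].
apply: psum_ext => j; rewrite (hst j); ring.
Qed.

Definition kap nu c : R[i] := (c + nu) * (c - 1 - nu).

Lemma kapE nu c : kap nu c = (c + nu) * (c - 1 - nu).
Proof. by []. Qed.

(** The companion of [hser_lower], now from the recurrence of [hcoef]; the
    two are the hypergeometric equation as a first order system. *)
Lemma hser_raise nu c s t x : jbd s -> jbd t -> `|x| < 1 ->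
  (forall j, s j = (c + j%:R) * s j.+1 + t j.+1) ->
  (forall j, t j = (c + j%:R) * t j.+1) ->
  (1 - x%:C) * dhser nu s x + (c - 1) * hser nu s x + hser nu t x =
  kap nu c * hser nu (fun j => s j.+1) x + (2 * c - 1) * hser nu (fun j => t j.+1) x.
Proof.
move=> hs ht x1 hst htt.
have r1 := rad1_hcoef nu (jbd_shift hs); have r2 := rad1_hcoef nu (jbd_shift ht).
have r3 := rad1_hcoef nu hs; have r4 := rad1_hcoef nu ht.
rewrite mulrBl mul1r /dhser psum_cdiffsM // /hser.
rewrite -!psumZ // -mulN1r -psumZ //; last exact: rad1_natM.
have q1 := rad1_cdiffs r3.
have q2 := rad1Z (-1) (rad1_natM r3).
have q3 := rad1Z (c - 1) r3.
have q4 := rad1Z (kap nu c) r1.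
have q5 := rad1Z (2 * c - 1) r2.
rewrite -!psumD //; try by [exact: rad1D | apply: rad1D => //; exact: rad1D].
apply: psum_ext => j; rewrite /cdiffs mulrA hcoefS' (hst j) (htt j) /kap -natr1; ring.
Qed.

End HypergeometricSeries.

#[global] Opaque hcoef kap.

(** * Values at the midpoint *)

Section MidpointValues.
Context {R : realType}.
Implicit Types (nu c z : R[i]) (s t : nat -> R[i]).

(** [F (- nu, nu + 1; c; x) / Gamma (c)]. *)
Definition hyp nu c (x : R) : R[i] := hser nu (rgseq c) x.

(** The point [1 / 2] is the fixed point of [x -> 1 - x], which corresponds
    to [s -> - s]. *)
Definition hmid nu c : R[i] := hyp nu c 2^-1.

Lemma half_lt1 : `|2^-1 : R| < 1.
Proof. by rewrite ger0_norm ?invr_ge0 // invf_lt1 // ltr1n. Qed.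

Lemma half2 : (2^-1 : R)%:C * 2 = 1 :> R[i].
Proof. by rewrite fmorphV /= real_complexN mulVf // pnatr_eq0. Qed.

Lemma hser_shift_rg nu c x : hser nu (fun j => rgseq c j.+1) x = hyp nu (c + 1) x.
Proof. by apply: psum_ext => j; rewrite rgseq_shift. Qed.

Lemma dhser_shift_rg nu c x :
  dhser nu (fun j => rgseq c j.+1) x = dhser nu (rgseq (c + 1)) x.
Proof. by apply: psum_ext => j; rewrite /cdiffs rgseq_shift. Qed.

Lemma hser0 nu x : hser nu (fun=> 0) x = 0.
Proof.
apply: csum_eq; apply: (cvg_near_eq (f := fun=> 0)); last exact: ccvg_cst.
by near=> m; rewrite /series /= big1 // => j _; rewrite mulr0 mul0r.
Unshelve. all: by end_near. Qed.

Lemma jbd0 : jbd (fun=> 0 : R[i]).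
Proof. by exists 0; split=> // j; rewrite modulus0 mul0r. Qed.

Lemma hyp_lower nu c x : good c -> `|x| < 1 ->
  x%:C * dhser nu (rgseq (c + 1)) x + c * hyp nu (c + 1) x = hyp nu c x.
Proof.
move=> gc x1.
have := @hser_lower R nu c (rgseq c) (fun=> 0) x (jbd_rgseq gc) jbd0 x1.
rewrite dhser_shift_rg hser_shift_rg hser0 subr0; apply=> j.
by rewrite addr0; exact: rgseqS.
Qed.

Lemma hyp_raise nu c x : good c -> `|x| < 1 ->
  (1 - x%:C) * dhser nu (rgseq c) x + (c - 1) * hyp nu c x = kap nu c * hyp nu (c + 1) x.
Proof.
move=> gc x1.
have := @hser_raise R nu c (rgseq c) (fun=> 0) x (jbd_rgseq gc) jbd0 x1.
rewrite hser_shift_rg !hser0 mulr0 !addr0; apply=> j.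
  by rewrite addr0; exact: rgseqS.
by rewrite mulr0.
Qed.

Lemma good1 c : 0 < complex.Re c -> 0 < complex.Re (c + 1).
Proof. by rewrite cReD /= => h; rewrite addr_gt0. Qed.

Lemma goodN c (N : nat) : 0 < complex.Re c -> 0 < complex.Re (c + N%:R).
Proof. by rewrite cReD -real_complexN /= => h; rewrite ltr_wpDr. Qed.

(** At [x = 1 - x] the lowering and raising relations involve the
    derivative in the same way, and it is eliminated. *)
Lemma hmid_step nu c : 0 < complex.Re c -> hmid nu c = kap nu (c + 1) * hmid nu (c + 2).
Proof.
move=> c0; have h1 := hyp_lower nu (good_Re c0) half_lt1.
have := hyp_raise nu (good_Re (good1 c0)) half_lt1.
have -> : 1 - (2^-1 : R)%:C = (2^-1 : R)%:C :> R[i].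
  by rewrite -[X in X - _]half2; ring.
by rewrite addrK h1 -addrA -[1 + 1]/(2 : R[i]) => h2; rewrite /hmid h2.
Qed.

(** The product [2 y y'] at [s = 0] for real [c] and the Legendre function
    [y = Phi nu (c - 1)] introduced below: its slope is [kap nu c * hmid nu
    (c + 1)]. *)
Definition wself nu c : R[i] := 2 * (kap nu c * hmid nu c * hmid nu (c + 1)).

Lemma wself_step nu c : 0 < complex.Re c -> wself nu c = kap nu c * wself nu (c + 1).
Proof. move=> c0; rewrite /wself {1}(hmid_step nu c0) -[c + 1 + 1]addrA -[1 + 1]/(2 : R[i]).
move: (hmid nu (c + 1)) (hmid nu (c + 2)) (kap nu c) (kap nu (c + 1)) => a b x y.
ring. Qed.

Lemma wself_iter nu c N : 0 < complex.Re c ->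
  wself nu c = (\prod_(0 <= j < N) kap nu (c + j%:R)) * wself nu (c + N%:R).
Proof.
move=> c0; elim: N => [|N IH]; first (rewrite (big_geq (leqnn 0)) mul1r addr0; reflexivity).
rewrite IH (big_nat_recr _ _ _ (leq0n N)) /= -mulrA; congr (_ * _).
rewrite (wself_step nu (goodN N c0)) -addrA natr1; reflexivity.
Qed.

Lemma rgamma_iter z N : rgamma z = (\prod_(0 <= j < N) (z + j%:R)) * rgamma (z + N%:R).
Proof.
elim: N => [|N IH]; first (rewrite (big_geq (leqnn 0)) mul1r addr0; reflexivity).
rewrite IH (big_nat_recr _ _ _ (leq0n N)) /= -mulrA; congr (_ * _); rewrite rgammaS -addrA natr1; reflexivity.
Qed.

Definition escale z (N : nat) : R[i] := N`!%:R * cexp (z * (ln N%:R)%:C).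

Lemma fact_neq0 N : (N`!%:R : R[i]) != 0.
Proof. by rewrite pnatr_eq0 -lt0n fact_gt0. Qed.

Lemma escale_neq0 z N : escale z N != 0.
Proof. by rewrite mulf_neq0 ?cexp_neq0 ?fact_neq0. Qed.

Lemma prod_rgamma_seq z N :
  \prod_(0 <= j < N.+1) (z + j%:R) = rgamma_seq z N * escale z N.
Proof.
rewrite /rgamma_seq /escale cexpN.
have := fact_neq0 N; have := cexp_neq0 (z * (ln N%:R)%:C).
move: (cexp _) (N`!%:R : R[i]) => a b a0 b0; field. by rewrite a0 b0.
Qed.

(** Euler's limit, read as the asymptotics [Gamma (z + N + 1) ~ N! * N ^
    z]. *)
Lemma rgamma_scaled z : rgamma z != 0 ->
  rgamma (z + N.+1%:R) * escale z N @[N --> \oo] --> (1 : R[i]).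
Proof.
move=> z0; have h : rgamma z / rgamma_seq z N @[N --> \oo] --> rgamma z / rgamma z.
  apply: ccvgM; first exact: ccvg_cst.
  by apply: ccvgV; [exact: z0|exact: rgamma_cvg].
rewrite divff // in h; apply: cvg_near_eq h.
have hz : rgamma_seq z @ \oo --> rgamma z by exact: rgamma_cvg.
have hn : \forall N \near \oo, rgamma_seq z N != 0 by exact: (ccvg_near0 hz z0).
apply: filterS hn => N hN.
rewrite (rgamma_iter z N.+1) prod_rgamma_seq.
by move: (rgamma_seq z N) (escale z N) (rgamma (z + _)) hN => a b d a0; field.
Qed.

Lemma rgamma_Re_neq0 c : 0 < complex.Re c -> rgamma c != 0.
Proof.
move=> c0; apply: rgamma_neq0 => N; apply: contraTneq c0 => ->.
by rewrite -real_complexN -rmorphN /= -leNgt oppr_le0.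
Qed.

Definition hmaj nu (j : nat) : R := modulus (hcoef nu j.+1) / j.+1`!%:R * 2^-1 ^+ j.+1.

Lemma cvg_hmaj nu : cvgn (series (hmaj nu)).
Proof.
have h : rad1 (fun j => hcoef nu j * (j`!%:R^-1 : R)%:C).
  apply: rad1_hcoef; exists 1; split=> // j; rewrite mul1r modulusR ger0_norm //.
  case: j => [|j]; first by rewrite /jweight !fact0 divr1 invr1.
  rewrite /jweight /= factS natrM invfM.
  apply: (@le_trans _ _ (1 * j`!%:R^-1)).
    by rewrite ler_wpM2r ?invr_ge0 // invf_le1 ?ltr0n // ler1n.
  by rewrite ler_wpM2r ?invr_ge0 // ler1n.
have := (csummable_shift _ 1).2 (rad1_summable h half_lt1).
rewrite /csummable (_ : (fun j => modulus _) = hmaj nu) //.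
apply/funext => j; rewrite /hmaj add1n !modulusM !modulusR.
by rewrite !ger0_norm // ?exprn_ge0 ?invr_ge0.
Qed.

(** For a large third parameter the series reduces to its first term, with
    relative error [O(1 / N)]. *)
Lemma hmid_approx nu c N : 0 < complex.Re c ->
  modulus (hmid nu (c + N.+1%:R) - rgamma (c + N.+1%:R)) <=
  modulus (rgamma (c + N.+1%:R)) / N.+1%:R * limn (series (hmaj nu)).
Proof.
move=> c0; set d := c + N.+1%:R.
have d0 : 0 < complex.Re d by exact: goodN.
have gd := good_Re d0; have gc := good_Re c0.
have N0 : 0 < N.+1%:R :> R by rewrite ltr0n.
rewrite /hmid /hyp /hser psum_recl; [|exact: rad1_hcoef (jbd_rgseq gd)|exact: half_lt1].
have -> : rgseq d 0 = rgamma d by rewrite /rgseq addr0.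
rewrite hcoef0 mul1r addrAC subrr add0r.
have rb j : modulus (rgseq d j.+1) <= modulus (rgamma d) / N.+1%:R / j.+1`!%:R.
  elim: j => [|j IH].
    rewrite [1`!]/= divr1 ler_pdivlMr //.
    have -> : rgamma d = d * rgseq d 1 by rewrite /rgseq -rgammaS.
    rewrite modulusM mulrC ler_wpM2r ?modulus_ge0 //; exact: gc.
  have e : rgseq d j.+2 = rgseq d j.+1 / (d + j.+1%:R).
    by rewrite (rgseqS d j.+1) mulrAC divff ?mul1r //; exact: good_neq0.
  rewrite e modulusM modulusV factS natrM invfM [_^-1 * _^-1]mulrC mulrA.
  apply: ler_pM; rewrite ?modulus_ge0 ?invr_ge0 ?modulus_ge0 //.
  rewrite lef_pV2 ?posrE ?modulus_gt0 ?ltr0n //; last exact: good_neq0.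
  rewrite /d -addrA -natrD; apply: le_trans (gc _).
  by rewrite ler_nat; lia.
have hs : cvgn (series (hmaj nu)) by exact: cvg_hmaj.
pose K := modulus (rgamma d) / N.+1%:R.
have hs' : cvgn (series (fun j => K * hmaj nu j)) by exact: cvg_seriesZ.
have -> : modulus (rgamma d) / N.+1%:R * limn (series (hmaj nu)) =
   limn (series (fun j => K * hmaj nu j)).
  by have -> : (fun j => K * hmaj nu j) = K *: hmaj nu by []; rewrite lim_seriesZ.
rewrite -csumZ; last first.
  apply: rad1_summable half_lt1.
  exact: (rad1_shift (rad1_hcoef nu (jbd_rgseq gd))).
apply: csum_le hs' => j.
rewrite mulrCA -rmorphM -exprS (modulusM (_ * _)) (modulusM (hcoef _ _)) modulusR ger0_norm ?exprn_ge0 ?invr_ge0 //.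
have -> : K * hmaj nu j = modulus (hcoef nu j.+1) * (K / j.+1`!%:R) * 2^-1 ^+ j.+1.
  by rewrite /hmaj; ring.
apply: ler_wpM2r; first by rewrite exprn_ge0 // invr_ge0.
by apply: ler_wpM2l; [exact: modulus_ge0|exact: rb].
Qed.

Lemma hmid_scaled nu c : 0 < complex.Re c ->
  hmid nu (c + N.+1%:R) * escale c N @[N --> \oo] --> (1 : R[i]).
Proof.
move=> c0; have h := rgamma_scaled (rgamma_Re_neq0 c0).
set L := limn (series (hmaj nu)).
have h1 : (hmid nu (c + N.+1%:R) - rgamma (c + N.+1%:R)) * escale c N @[N --> \oo] --> (0 : R[i]).
  apply: (cvg_modulus_le (g := fun N => modulus (rgamma (c + N.+1%:R) * escale c N) * N.+1%:R^-1 * L)).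
    near=> N; rewrite subr0 (modulusM (_ - _)) (modulusM (rgamma _)).
    have := hmid_approx nu N c0; rewrite -/L => hN.
    have -> : modulus (rgamma (c + N.+1%:R)) * modulus (escale c N) / N.+1%:R * L =
       modulus (rgamma (c + N.+1%:R)) / N.+1%:R * L * modulus (escale c N) by ring.
    by rewrite ler_wpM2r ?modulus_ge0.
  have h2 : modulus (rgamma (c + N.+1%:R) * escale c N) @[N --> \oo] --> modulus (1 : R[i]).
    exact: cvg_modulus.
  rewrite -(mul0r L) -(mulr0 (modulus (1 : R[i]))).
  by apply: cvgM; [apply: cvgM; [exact: h2|exact: cvg_harmonic]|exact: cvg_cst].
have h3 : (hmid nu (c + N.+1%:R) - rgamma (c + N.+1%:R)) * escale c N +
    rgamma (c + N.+1%:R) * escale c N @[N --> \oo] --> (0 + 1 : R[i]).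
  by apply: ccvgD; [exact: h1|exact: h].
rewrite add0r in h3; apply: cvg_near_eq h3.
near=> N; rewrite mulrBl subrK; reflexivity.
Unshelve. all: by end_near. Qed.

Lemma cvg_invN : (N%:R^-1 : R)%:C @[N --> \oo] --> (0 : R[i]).
Proof.
have h : (N%:R^-1 : R) @[N --> \oo] --> (0 : R).
  rewrite -cvg_shiftS; exact: cvg_harmonic.
have := cvg_realC h; exact.
Qed.

(** Each step of the ladder multiplies [wself] by [kap], a product of two
    linear factors in [c]; thus [N] steps produce the two products of
    Euler's limit, whereas [wself nu (c + N)] is known asymptotically from
    [hmid_scaled]. *)
Theorem wselfE nu c : 0 < complex.Re c ->
  wself nu c = 2 * (rgamma (c + nu) * rgamma (c - 1 - nu)).
Proof.
move=> c0; have c10 := good1 c0.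
have h : 2 * ((rgamma_seq (c + nu) N * rgamma_seq (c - 1 - nu) N) *
  ((hmid nu (c + N.+1%:R) * escale c N) * (hmid nu (c + 1 + N.+1%:R) * escale (c + 1) N)) *
  ((1 + (c + nu + 1) * (N%:R^-1 : R)%:C) * (1 + (c - nu) * (N%:R^-1 : R)%:C))) @[N --> \oo] -->
  2 * (rgamma (c + nu) * rgamma (c - 1 - nu) * (1 * 1) * ((1 + (c + nu + 1) * 0) * (1 + (c - nu) * 0))).
  apply: ccvgM; first exact: ccvg_cst.
  apply: ccvgM; [apply: ccvgM|].
  - by apply: ccvgM; exact: rgamma_cvg.
  - by apply: ccvgM; exact: hmid_scaled.
  - by apply: ccvgM; apply: ccvgD; [exact: ccvg_cst|apply: ccvgM; [exact: ccvg_cst|exact: cvg_invN]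
       |exact: ccvg_cst|apply: ccvgM; [exact: ccvg_cst|exact: cvg_invN]].
rewrite !mulr0 !addr0 !mulr1 in h.
have hc : (fun=> wself nu c) @ \oo --> wself nu c by exact: ccvg_cst.
apply: (cvgC_unique hc); apply: cvg_near_eq h.
near=> N; have N0 : (0 < N)%N by near: N; exact: nbhs_infty_gt.
rewrite (wself_iter nu N.+1 c0).
have -> : \prod_(0 <= j < N.+1) kap nu (c + j%:R) =
   (rgamma_seq (c + nu) N * escale (c + nu) N) * (rgamma_seq (c - 1 - nu) N * escale (c - 1 - nu) N).
  rewrite -!prod_rgamma_seq -big_split /=; apply: eq_bigr => j _; rewrite kapE; ring.
rewrite /wself.
have N0' : (N%:R : R[i]) != 0 by rewrite pnatr_eq0 -lt0n.
have -> : escale (c + 1) N = escale (c + nu) N * escale (c - 1 - nu) N / escale c N * N%:R ^+ 2.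
  rewrite /escale.
  have e1 : cexp (ln N%:R)%:C = N%:R :> R[i].
    by rewrite cexp_real lnK ?posrE ?ltr0n // real_complexN.
  have -> : (c + 1) * (ln N%:R)%:C = (c + nu) * (ln N%:R)%:C + (c - 1 - nu) * (ln N%:R)%:C
     + - (c * (ln N%:R)%:C) + (ln N%:R)%:C + (ln N%:R)%:C by ring.
  rewrite !cexpD cexpN e1.
  have := fact_neq0 N; have := cexp_neq0 (c * (ln N%:R)%:C).
  move: (cexp (c * _)) (cexp ((c + nu) * _)) (cexp ((c - 1 - nu) * _)) (N`!%:R : R[i]) => a b d f a0 f0.
  by field; rewrite a0 f0.
have -> : kap nu (c + N.+1%:R) = N%:R ^+ 2 * ((1 + (c + nu + 1) * (N%:R^-1 : R)%:C) * (1 + (c - nu) * (N%:R^-1 : R)%:C)).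
  rewrite kapE -natr1 fmorphV /= real_complexN.
  by move: (N%:R : R[i]) N0' => y y0; field.
have -> : c + N.+1%:R + 1 = c + 1 + N.+1%:R by ring.
have := escale_neq0 c N.
move: (escale c N) (escale _ N) (escale _ N) (hmid nu _) (hmid nu _) (rgamma_seq _ _)
  (rgamma_seq _ _) (N%:R^-1 : R)%:C => a b d e f g k l a0; field. exact: a0.
Unshelve. all: by end_near. Qed.

End MidpointValues.

(** * Complex sine and cosine *)

Section ComplexTrig.
Context {R : realType}.
Implicit Types z w m : R[i].

Let I : R[i] := 'i%C.

Lemma mulII : I * I = -1.
Proof. by have := sqr_i R; rewrite expr2. Qed.

Lemma I_neq0 : I != 0.
Proof. by apply: contra_eq_neq mulII => ->; rewrite mul0r eq_sym oppr_eq0 oner_eq0. Qed.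

Lemma two_neq0 : (2 : R[i]) != 0.
Proof. by rewrite pnatr_eq0. Qed.

Lemma invI : I^-1 = - I.
Proof. by apply: (mulfI I_neq0); rewrite mulfV ?I_neq0 // mulrN mulII opprK. Qed.

Lemma csinE z : csin z = (cexp (- (I * z)) - cexp (I * z)) * I * 2^-1.
Proof. by rewrite /csin -/I invfM invI; ring. Qed.

Lemma ccosE z : ccos z = (cexp (I * z) + cexp (- (I * z))) * 2^-1.
Proof. by []. Qed.

Lemma csin0 : csin (0 : R[i]) = 0.
Proof. by rewrite csinE mulr0 oppr0 subrr !mul0r. Qed.

Lemma ccos0 : ccos (0 : R[i]) = 1.
Proof. by rewrite ccosE mulr0 oppr0 cexp0 -mulr2n -mulr_natl mulr1 mulfV // two_neq0. Qed.

Lemma csinN z : csin (- z) = - csin z.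
Proof. by rewrite !csinE mulrN opprK; ring. Qed.

Lemma ccosN z : ccos (- z) = ccos z.
Proof. by rewrite !ccosE mulrN opprK addrC. Qed.

Lemma csinD z w : csin (z + w) = csin z * ccos w + ccos z * csin w.
Proof.
rewrite !csinE !ccosE mulrDr opprD !cexpD.
move: (cexp (I * z)) (cexp (I * w)) (cexp (- (I * z))) (cexp (- (I * w))) => a b c d.
by field.
Qed.

Lemma ccosD z w : ccos (z + w) = ccos z * ccos w - csin z * csin w.
Proof.
rewrite !csinE !ccosE mulrDr opprD !cexpD.
move: (cexp (I * z)) (cexp (I * w)) (cexp (- (I * z))) (cexp (- (I * w))) => a b c d.
have -> : (c - a) * I / 2 * ((d - b) * I / 2) = (c - a) * (d - b) * (I * I) / 2 / 2 by ring.
rewrite mulII.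
by field.
Qed.

Lemma ccos2Dcsin2 z : ccos z ^+ 2 + csin z ^+ 2 = 1.
Proof.
have := ccosD z (- z); rewrite subrr ccos0 ccosN csinN => ->; ring.
Qed.

Lemma csin_double z : csin (2 * z) = 2 * (csin z * ccos z).
Proof.
have -> : 2 * z = z + z by ring.
by rewrite csinD; ring.
Qed.

Lemma cdiff_lin (a z : R[i]) : cdiff (fun w => a * w) z a.
Proof. by apply: cdiff_eq (cdiffM (cdiff_cst a z) (cdiff_id z)); rewrite mul0r mulr1 add0r. Qed.

Lemma cdiff_cexp_lin (a z : R[i]) : cdiff (fun w => cexp (a * w)) z (a * cexp (a * z)).
Proof. by apply: cdiff_comp; [exact: cdiff_lin|exact: cdiff_cexp]. Qed.

Lemma cdiff_csin z : cdiff csin z (ccos z).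
Proof.
have h := cdiffM (cdiffM (cdiffB (cdiff_cexp_lin (- I) z) (cdiff_cexp_lin I z))
  (cdiff_cst I z)) (cdiff_cst 2^-1 z).
apply: (cdiff_ext (f := fun w => (cexp (- I * w) - cexp (I * w)) * I * 2^-1)).
  by move=> w; rewrite csinE mulNr.
apply: cdiff_eq h; rewrite ccosE [- I * z]mulNr.
move: (cexp (- (I * z))) (cexp (I * z)) => a b.
have -> : ((- I * a - I * b) * I + (a - b) * 0) / 2 + (a - b) * I * 0 = - (I * I) * (b + a) / 2.
  by ring.
by rewrite mulII opprK mul1r.
Qed.

Lemma cdiff_ccos z : cdiff ccos z (- csin z).
Proof.
have h := cdiffM (cdiffD (cdiff_cexp_lin I z) (cdiff_cexp_lin (- I) z)) (cdiff_cst 2^-1 z).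
apply: (cdiff_ext (f := fun w => (cexp (I * w) + cexp (- I * w)) * 2^-1)).
  by move=> w; rewrite ccosE mulNr.
apply: cdiff_eq h; rewrite csinE [- I * z]mulNr.
move: (cexp (- (I * z))) (cexp (I * z)) => a b; ring.
Qed.

Lemma cder_cexp_lin m (x : R) : cder (fun t => cexp (m * t%:C)) x (m * cexp (m * x%:C)).
Proof.
apply: (cder_cexp (g := fun t => m * t%:C)).
by apply: cder_eq (cderZ m (cder_id x)); rewrite mulr1.
Qed.

Lemma cder_csin m (x : R) : cder (fun t => csin (m * t%:C)) x (m * ccos (m * x%:C)).
Proof.
have h := cderM (cderM (cderB (cder_cexp_lin (- (I * m)) x) (cder_cexp_lin (I * m) x))
  (cder_cst I x)) (cder_cst 2^-1 x).
have e : (fun t : R => (cexp (- (I * m) * t%:C) - cexp (I * m * t%:C)) * I * 2^-1) =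
    (fun t => csin (m * t%:C)).
  by apply/funext => t; rewrite csinE mulNr mulrA.
rewrite e in h; apply: cder_eq h; rewrite ccosE [- (I * m) * x%:C]mulNr [I * (m * _)]mulrA.
move: (cexp (- (I * m * x%:C))) (cexp (I * m * x%:C)) => a b.
have -> : (((- (I * m)) * a - I * m * b) * I + (a - b) * 0) / 2 + (a - b) * I * 0 =
   - (I * I) * (m * (b + a)) / 2 by ring.
by rewrite mulII opprK mul1r mulrA.
Qed.

Lemma cder_ccos m (x : R) : cder (fun t => ccos (m * t%:C)) x (- (m * csin (m * x%:C))).
Proof.
have h := cderM (cderD (cder_cexp_lin (I * m) x) (cder_cexp_lin (- (I * m)) x)) (cder_cst 2^-1 x).
have e : (fun t : R => (cexp (I * m * t%:C) + cexp (- (I * m) * t%:C)) * 2^-1) =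
    (fun t => ccos (m * t%:C)).
  by apply/funext => t; rewrite ccosE mulNr mulrA.
rewrite e in h; apply: cder_eq h; rewrite csinE [- (I * m) * x%:C]mulNr [I * (m * _)]mulrA.
move: (cexp (- (I * m * x%:C))) (cexp (I * m * x%:C)) => a b; ring.
Qed.

Lemma csin_real (x : R) : csin x%:C = (sin x)%:C.
Proof.
have e1 : cexp (I * x%:C) = cos x +i* sin x.
  rewrite /cexp cReM cImM /= !(mul0r, mul1r, subr0, add0r, oppr0, addr0) expR0; exact: mul1r.
have e2 : cexp (- (I * x%:C)) = cos x -i* sin x.
  rewrite /cexp cReN cImN cReM cImM /= !(mul0r, mul1r, subr0, add0r, oppr0, addr0) expR0.
  by rewrite mul1r /expi cosN sinN.
rewrite csinE e1 e2.
have -> : ((cos x -i* sin x) - (cos x +i* sin x)) * I = (2 * sin x)%:C.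
  by apply: complex_ext; rewrite ?cReM ?cImM ?cReB ?cImB /=; ring.
by rewrite rmorphM /= real_complexN mulrAC mulfV ?two_neq0 // mul1r.
Qed.

End ComplexTrig.

(** * The reflection formula *)

Section Reflection.
Context {R : realType}.
Implicit Types (nu c z m : R[i]).

Let h : R[i] := 2^-1.

Lemma half_realE : h = (2^-1 : R)%:C.
Proof. by rewrite /h fmorphV /= real_complexN. Qed.

Lemma Re_half : 0 < complex.Re h.
Proof. by rewrite half_realE /= invr_gt0. Qed.

Lemma is_derive_sin2 (t : R) : is_derive t 1 (fun t => sin t ^+ 2) (2 * sin t * cos t).
Proof.
have := is_deriveM' (is_derive_sin t) (is_derive_sin t) => hd.
rewrite (_ : (fun t => _) = (fun t => sin t * sin t)); last by apply/funext => u; rewrite expr2.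
by apply: is_derive_eq hd _; ring.
Qed.

Lemma sin2_lt1 (t : R) : 0 < cos t -> `|sin t ^+ 2| < 1.
Proof.
move=> ct; rewrite ger0_norm ?sqr_ge0 //.
have := cos2Dsin2 t; have : 0 < cos t ^+ 2 by rewrite exprn_gt0.
lra.
Qed.

(** For [c = 1 / 2] and [x = sin (t) ^ 2] the ladder relations become the
    equations of a uniform rotation. *)
Lemma hyp_trig nu (t : R) : 0 <= t <= pi / 4 ->
  (cos t)%:C * hyp nu h (sin t ^+ 2) = rgamma h * ccos (2 * (nu + h) * t%:C) /\
  (nu + h) * ((sin t)%:C * hyp nu (h + 1) (sin t ^+ 2)) =
     rgamma h * csin (2 * (nu + h) * t%:C).
Proof.
move=> /andP[t0 t1]; set m := nu + h.
pose H (u : R) := (cos u)%:C * hyp nu h (sin u ^+ 2).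
pose V (u : R) := (sin u)%:C * hyp nu (h + 1) (sin u ^+ 2).
have gh := good_Re Re_half.
have gh1 := good_Re (good1 Re_half).
have cosu u : 0 <= u <= t -> 0 < cos u.
  move=> /andP[u0 ut]; apply: cos_gt0_pihalf; have := @pi_gt0 R => p0; apply/andP; split; lra.
have dH u : 0 <= u <= t -> cder H u (- (2 * m ^+ 2) * V u).
  move=> /cosu cu; have s1 := sin2_lt1 cu.
  have d1 := cder_comp (g1 := fun t => sin t ^+ 2) (cder_hser nu (jbd_rgseq gh) s1) (is_derive_sin2 u).
  have := cderM (cder_real (is_derive_cos u)) d1; apply: cder_eq.
  have e := hyp_raise nu gh s1.
  have e2 : 1 - (sin u ^+ 2)%:C = (cos u)%:C ^+ 2 :> R[i].
    have := congr1 (fun x : R => x%:C : R[i]) (cos2Dsin2 u).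
    by rewrite rmorphD rmorph1 !rmorphXn => <-; rewrite addrK.
  rewrite e2 in e.
  have k : kap nu h = - m ^+ 2.
    rewrite kapE /m.
    have -> : h - 1 - nu = - (nu + h).
      have hh : h + h = 1 by rewrite /h; field.
      by rewrite -[in LHS]hh; ring.
    ring.
  rewrite k in e; rewrite /V -/(hyp nu h (sin u ^+ 2)).
  move: e; rewrite !rmorphM /= real_complexN rmorphN /=.
  have hh : h - 1 = - h by rewrite -[1](_ : h + h = 1); [ring|rewrite /h; field].
  rewrite hh.
  move: (dhser nu (rgseq h) _) (hyp nu h _) (hyp nu (h + 1) _) (sin u)%:C (cos u)%:C => a b d s c e.
  have h2 : 2 * h = 1 by rewrite /h; field.
  have -> : - s * b + c * (2 * s * c * a) = 2 * s * (c ^+ 2 * a + - h * b) + s * b * (2 * h - 1) by ring.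
  by rewrite e h2 subrr mulr0 addr0; ring.
have dV u : 0 <= u <= t -> cder V u (2 * H u).
  move=> /cosu cu; have s1 := sin2_lt1 cu.
  have d1 := cder_comp (g1 := fun t => sin t ^+ 2) (cder_hser nu (jbd_rgseq gh1) s1) (is_derive_sin2 u).
  have := cderM (cder_real (is_derive_sin u)) d1; apply: cder_eq.
  have e := hyp_lower nu gh s1.
  rewrite /H -e !rmorphM /= real_complexN -/(hyp nu (h + 1) (sin u ^+ 2)).
  move: (dhser nu (rgseq (h + 1)) _) (hyp nu (h + 1) _) (sin u)%:C (cos u)%:C => a b s c.
  have h2 : 2 * h = 1 by rewrite /h; field.
  have -> : 2 * (c * (s * s * a + h * b)) = c * b * (2 * h) + s * (2 * s * c * a) by ring.
  by rewrite h2 mulr1.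
(* The pair [(H, m V)] in the rotating frame is constant. *)
pose A u := H u * ccos (2 * m * u%:C) + m * V u * csin (2 * m * u%:C).
pose B u := H u * csin (2 * m * u%:C) - m * V u * ccos (2 * m * u%:C).
have H0 : H 0 = rgamma h.
  by rewrite /H cos0 mul1r sin0 expr0n /= /hyp hser_at0 /rgseq addr0.
have V0 : V 0 = 0 by rewrite /V sin0 mul0r.
have At : A t = rgamma h.
  have -> : rgamma h = A 0 by rewrite /A V0 H0 mulr0 ccos0 mulr1 mulr0 mul0r addr0.
  apply: cder0_eq t0 _ => u ut.
  apply: cder_eq (cderD (cderM (dH u ut) (cder_ccos (2 * m) u))
     (cderM (cderZ m (dV u ut)) (cder_csin (2 * m) u))).
  move: (H u) (V u) (ccos _) (csin _) => a b c d; ring.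
have Bt : B t = 0.
  have -> : (0 : R[i]) = B 0 by rewrite /B V0 (mulr0 (2 * m)) csin0 mulr0 (mulr0 m) mul0r subr0.
  apply: cder0_eq t0 _ => u ut.
  apply: cder_eq (cderB (cderM (dH u ut) (cder_csin (2 * m) u))
     (cderM (cderZ m (dV u ut)) (cder_ccos (2 * m) u))).
  move: (H u) (V u) (ccos _) (csin _) => a b c d; ring.
have cs := ccos2Dcsin2 (2 * m * t%:C).
rewrite -/(H t) -/(V t) -At.
split.
  have -> : A t * ccos (2 * m * t%:C) = H t * (ccos (2 * m * t%:C) ^+ 2 + csin (2 * m * t%:C) ^+ 2)
     - B t * csin (2 * m * t%:C).
    by rewrite /A /B; move: (H t) (V t) (ccos _) (csin _) => a b c d; ring.
  by rewrite cs Bt mul0r subr0 mulr1.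
have -> : A t * csin (2 * m * t%:C) = m * V t * (ccos (2 * m * t%:C) ^+ 2 + csin (2 * m * t%:C) ^+ 2)
     + B t * ccos (2 * m * t%:C).
  by rewrite /A /B; move: (H t) (V t) (ccos _) (csin _) => a b c d; ring.
by rewrite cs Bt mul0r addr0 mulr1.
Qed.

(** [wselfE] at [c = 1 / 2], where [hyp_trig] makes both midpoint values
    explicit. *)
Lemma reflection_const z :
  rgamma z * rgamma (1 - z) = rgamma h ^+ 2 * csin (pi%:C * z).
Proof.
have [->|z0] := eqVneq z 0.
  by rewrite mulr0 csin0 mulr0 rgammaE !mul0r.
have pi0 := @pi_ge0 R.
have pi4 : 0 <= (pi / 4 : R) <= pi / 4 by lra.
have [e1 e2] := hyp_trig (z - h) pi4; rewrite subrK in e1 e2.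
have hh : h + h = 1 by rewrite /h; field.
have := wselfE (z - h) Re_half; rewrite /wself kapE.
have -> : h + (z - h) = z by ring.
have -> : h - 1 - (z - h) = - z by rewrite -hh; ring.
rewrite (rgammaS (- z)) [- z + 1]addrC => w.
have cs : cos (pi / 4) = sin (pi / 4) :> R.
  have -> : pi / 4 = pi / 2 - pi / 4 :> R by field.
  rewrite cosB cos_pihalf sin_pihalf mul0r add0r mul1r.
  by congr sin; field.
have ss : sin (pi / 4) ^+ 2 = 2^-1 :> R.
  have := cos2Dsin2 (pi / 4 : R); rewrite cs => e; lra.
rewrite ss cs in e1 e2.
have ss' : (sin (pi / 4))%:C * (sin (pi / 4))%:C = h :> R[i].
  by rewrite -rmorphM -expr2 ss half_realE.
have e3 : csin (pi%:C * z) = 2 * (csin (2 * z * (pi / 4)%:C) * ccos (2 * z * (pi / 4)%:C)).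
  rewrite -csin_double; congr csin.
  have -> : pi = (pi / 4) * 4 :> R by field.
  rewrite rmorphM /= mulfK // real_complexN; ring.
have h2 : 2 * h = 1 by rewrite /h; field.
rewrite e3.
have -> : rgamma h ^+ 2 * (2 * (csin (2 * z * (pi / 4)%:C) * ccos (2 * z * (pi / 4)%:C))) =
   2 * ((rgamma h * ccos (2 * z * (pi / 4)%:C)) * (rgamma h * csin (2 * z * (pi / 4)%:C))).
  by move: (csin _) (ccos _) (rgamma h) => a b c; ring.
rewrite -e1 -e2 -/(hmid _ h) -/(hmid _ (h + 1)).
have -> : forall X Y : R[i], 2 * ((sin (pi / 4))%:C * X * (z * ((sin (pi / 4))%:C * Y))) =
   2 * h * (z * X * Y) by move=> X Y; rewrite -ss'; ring.
rewrite h2 mul1r; apply: (mulfI z0); apply: (mulfI (@two_neq0 R)).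
move: w; move: (hmid _ h) (hmid _ (h + 1)) (rgamma z) (rgamma (1 - z)) => X Y a b w.
have -> : 2 * (z * (a * b)) = - (2 * (a * (- z * b))) by ring.
by rewrite -w; ring.
Qed.

(** The derivatives at [0] of the two sides of [reflection_const]. *)
Lemma rgamma_half2 : rgamma h ^+ 2 * pi%:C = 1.
Proof.
have d1 : cdiff (fun z => rgamma z * rgamma (1 - z)) 0 1.
  have h1 : cdiff (fun z => rgamma (1 - z)) 0 ((0 - 1) * drgamma (1 - 0)).
    apply: cdiff_comp; last exact: cdiff_rgamma.
    by apply: cdiffB; [exact: cdiff_cst|exact: cdiff_id].
  have := cdiffM (cdiff_rgamma 0) h1; apply: cdiff_eq.
  rewrite subr0 rgamma_1 mulr1 rgammaE mul0r mul0r addr0 drgammaE mul0r addr0.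
  by rewrite -rgamma_1D addr0 rgamma_1.
have d2 : cdiff (fun z => rgamma h ^+ 2 * csin (pi%:C * z)) 0 (rgamma h ^+ 2 * pi%:C).
  have h1 : cdiff (fun z => csin (pi%:C * z)) 0 (pi%:C * ccos (pi%:C * 0)).
    by apply: cdiff_comp; [exact: cdiff_lin|exact: cdiff_csin].
  have := cdiffM (cdiff_cst (rgamma h ^+ 2) 0) h1; apply: cdiff_eq.
  by rewrite mul0r add0r mulr0 ccos0 mulr1.
apply/esym; apply: cdiff_unique d1 _.
apply: (cdiff_ext (f := fun z => rgamma h ^+ 2 * csin (pi%:C * z))); last exact: d2.
by move=> z; rewrite reflection_const.
Qed.

Lemma piC_neq0 : (pi%:C : R[i]) != 0.
Proof. by rewrite -modulus_gt0 modulusR normr_gt0 gt_eqF // pi_gt0. Qed.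

(** Euler's reflection formula, a by-product of the midpoint values. *)
Theorem rgamma_reflection z : rgamma z * rgamma (1 - z) = csin (pi%:C * z) / pi%:C.
Proof.
rewrite reflection_const; have e : rgamma h ^+ 2 = 1 / pi%:C.
  by rewrite -rgamma_half2 mulfK // piC_neq0.
by rewrite e mul1r mulrC.
Qed.

End Reflection.

(** * Parameter derivative of the midpoint values *)

Section MidpointDerivative.
Context {R : realType}.
Implicit Types (nu c z : R[i]).

Lemma ccvg_modulus_bound (T : Type) (F : set_system T) {FF : Filter F}
    (g : T -> R[i]) z : g @ F --> z -> \forall x \near F, modulus (g x) <= modulus z + 1.
Proof.
move=> gz; have hg : modulus (g x) @[x --> F] --> modulus z by exact: cvg_modulus.
have /cvgrPdist_lt/(_ _ (@ltr01 R)) := hg.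
by apply: filterS => x; rewrite ltr_norml => /andP[h1 h2]; lra.
Qed.

(** The terms of the series have difference quotients [D j] in [c], which
    obey the recurrence of [rec_bound] with constants uniform near [c0];
    Tannery's theorem sums their limits. *)
Lemma cdiff_hmid nu c0 : 0 < complex.Re c0 ->
  cdiff (hmid nu) c0 (hser nu (drgseq c0) 2^-1).
Proof.
move=> c00; have gc0 := good_Re c00.
have [D1 [D1E D1c D1cont]] := @cdiff_rgamma R (c0 + 1).
(* [E k] is the quotient of index [k + 1]. The recurrence determines it by divisions
   by [c + j] with [j > 0] only; the quotient of index [0] needs no division. *)
pose E := fix E (k : nat) (c : R[i]) {struct k} : R[i] :=
  if k is k'.+1 then (E k' c - rgseq c0 k'.+2) / (c + k'.+1%:R) else D1 (c + 1).
pose D j c := if j is k.+1 then E k c else c * E 0%N c + rgseq c0 1.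
have Drec c j : good c -> D j c = (c + j%:R) * D j.+1 c + rgseq c0 j.+1.
  move=> gc; case: j => [|k]; first by rewrite addr0.
  rewrite /D /=; have := good_neq0 k gc; move: (c + k.+1%:R) (E k c) (rgseq _ _) => a b d a0.
  by field.
have DE c j : good c -> rgseq c j - rgseq c0 j = (c - c0) * D j c.
  move=> gc; have key k : rgseq c k.+1 - rgseq c0 k.+1 = (c - c0) * D k.+1 c.
    elim: k => [|k IH]; first by rewrite /rgseq D1E /=; ring.
    have nz := good_neq0 k gc; apply: (mulfI nz).
    have e1 := rgseqS c k.+1; have e2 := rgseqS c0 k.+1; have e3 := Drec c k.+1 gc.
    rewrite mulrBr -e1.
    have -> : (c + k.+1%:R) * ((c - c0) * D k.+2 c) = (c - c0) * (D k.+1 c - rgseq c0 k.+2).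
      by rewrite e3; move: (D k.+2 c) (rgseq c0 k.+2) (k.+1%:R : R[i]) => a b d; ring.
    rewrite mulrBr -IH e2.
    by move: (rgseq c k.+1) (rgseq c0 k.+2) (k.+1%:R : R[i]) => a b d; ring.
  case: j => [|k]; last exact: key.
  rewrite (Drec c 0%N gc) (rgseqS c 0) (rgseqS c0 0).
  have -> : rgseq c 1 = rgseq c0 1 + (c - c0) * D 1%N c by rewrite -key; ring.
  by move: (rgseq c0 1) (D 1%N c) (0%:R : R[i]) => a b d; ring.
have Dc0 j : D j c0 = drgseq c0 j.
  have key k : D k.+1 c0 = drgseq c0 k.+1.
    elim: k => [|k IH]; first by rewrite /= D1c.
    have nz := good_neq0 k gc0; apply: (mulfI nz).
    have := Drec c0 k.+1 gc0; rewrite IH drgseqS; exact: (fun e => esym (addIr _ e)).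
  case: j => [|k]; last exact: key.
  by rewrite (Drec c0 0%N gc0) drgseqS key.
have Dcont j : ccont (D j) c0.
  have key k : ccont (E k) c0.
    elim: k => [|k IH] /=.
      apply: (ccont_comp (f := D1)); last exact: D1cont.
      by apply: ccontD; [exact: ccont_id|exact: ccont_cst].
    apply: ccontM.
      by apply: ccontD; [exact: IH|exact: ccont_cst].
    apply: ccontV; first exact: good_neq0.
    by apply: ccontD; [exact: ccont_id|exact: ccont_cst].
  case: j => [|k] /=; last exact: key.
  by apply: ccontD; [apply: ccontM; [exact: ccont_id|exact: (key 0%N)]|exact: ccont_cst].
have Dbd c (C : R) : good c -> modulus (D1 (c + 1)) <= C -> modulus (rgseq c0 1) <= C ->
   forall j, modulus (D j c) <= (modulus c + 1) * C * jweight j.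
  move=> gc h1 h2; apply: (@rec_bound _ c (fun j => D j c) (rgseq c0)) => //.
  - by move=> j; exact: Drec.
  - move=> j; apply: le_trans (rgseq_fact gc0 j) _.
    by rewrite ler_wpM2r ?invr_ge0.
have Dval : hser nu (drgseq c0) 2^-1 = hser nu (fun j => D j c0) 2^-1.
  have -> : (fun j => D j c0) = drgseq c0 by apply/funext => j; exact: Dc0.
  reflexivity.
rewrite Dval.
apply: (@cdiff_local _ _ (fun c => hser nu (fun j => D j c) 2^-1) c0 (complex.Re c0) c00).
  move=> c cc0.
  have cpos : 0 < complex.Re c.
    have := modulus_Re (c - c0); rewrite cReB ler_norml => /andP[h1 h2]; lra.
  have gc := good_Re cpos.
  have jD : jbd (fun j => D j c).
    pose C := modulus (D1 (c + 1)) + modulus (rgseq c0 1).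
    have C0 : 0 <= C by rewrite addr_ge0 ?modulus_ge0.
    exists ((modulus c + 1) * C); split; first by rewrite mulr_ge0 ?addr_ge0 ?modulus_ge0.
    by apply: Dbd; rewrite // /C ?lerDl ?lerDr modulus_ge0.
  rewrite /hmid /hyp /hser -psumZ; [|exact: rad1_hcoef|exact: half_lt1].
  apply/eqP; rewrite subr_eq addrC -psumD; [|exact: rad1_hcoef (jbd_rgseq gc0)|exact: rad1Z (rad1_hcoef nu jD)|exact: half_lt1].
  apply/eqP/psum_ext => j.
  have -> : rgseq c j = rgseq c0 j + (c - c0) * D j c by rewrite -DE //; ring.
  by move: (rgseq c0 j) (D j c) (hcoef nu j) => a b d; ring.
split=> T F FF g gz.
pose C := modulus (D1 (c0 + 1)) + 1 + modulus (rgseq c0 1).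
have n1 : \forall x \near F, modulus (D1 (g x + 1)) <= modulus (D1 (c0 + 1)) + 1.
  apply: (ccvg_modulus_bound (g := fun x => D1 (g x + 1))).
  apply: (ccontP D1cont); apply: ccvgD; [exact: gz|exact: ccvg_cst].
have n2 : \forall x \near F, modulus (g x) <= modulus c0 + 1 by exact: ccvg_modulus_bound.
have n3 : \forall x \near F, 0 < complex.Re (g x).
  have hg : modulus (g x - c0) @[x --> F] --> (0 : R) by exact: cvg_subC0.
  have /cvgrPdist_lt/(_ _ c00) := hg.
  apply: filterS => x; rewrite sub0r normrN ger0_norm ?modulus_ge0 // => hx.
  have := modulus_Re (g x - c0); rewrite cReB ler_norml => /andP[h1 h2]; lra.
pose K := (modulus c0 + 2) * C.
have C0 : 0 <= C by rewrite !addr_ge0 ?modulus_ge0.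
apply: (csum_tannery (f := fun j x => hcoef nu j * D j (g x) * (2^-1 ^+ j)%:C)
   (M := fun j => K * (modulus (hcoef nu j * (jweight j)%:C * (2^-1 ^+ j)%:C)))).
- move=> j; apply: ccvgM; last exact: ccvg_cst.
  by apply: ccvgM; [exact: ccvg_cst|exact: (ccontP (Dcont j))].
- near=> x => j.
  have x3 : 0 < complex.Re (g x) by near: x.
  have x2 : modulus (g x) <= modulus c0 + 1 by near: x.
  have x1 : modulus (D1 (g x + 1)) <= modulus (D1 (c0 + 1)) + 1 by near: x.
  have b := Dbd (g x) C (good_Re x3).
  have {}b : modulus (D j (g x)) <= (modulus (g x) + 1) * C * jweight j.
    apply: b; last by rewrite /C lerDr !addr_ge0 ?modulus_ge0.
    by apply: le_trans x1 _; rewrite /C lerDl modulus_ge0.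
  have {}b : modulus (D j (g x)) <= K * jweight j.
    apply: le_trans b _; rewrite ler_wpM2r ?jweight_ge0 // ler_wpM2r //; lra.
  rewrite (modulusM (_ * _)) (modulusM (hcoef nu j)) [X in _ <= _ * X]modulusM [X in _ <= _ * (X * _)]modulusM.
  rewrite !modulusR (ger0_norm (jweight_ge0 j)).
  have -> : forall a b d : R, K * (a * b * d) = a * (K * b) * d by move=> a b' d; ring.
  apply: ler_wpM2r; first exact: normr_ge0.
  by apply: ler_wpM2l; [exact: modulus_ge0|exact: b].
- apply: cvg_seriesZ; exact: rad1_summable (rad1_jweight nu) half_lt1.
Unshelve. all: by end_near. Qed.

End MidpointDerivative.

(** * Hyperbolic functions *)

Section HyperbolicFunctions.
Context {R : realType}.
Implicit Types s : R.

(** With [s = n ln r] this is [r ^ (2 n) / (1 + r ^ (2 n))], the variable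
    of the hypergeometric series; [s -> - s] becomes [zeta -> 1 - zeta]. *)
Definition zeta s : R := expR (2 * s) / (1 + expR (2 * s)).
Definition sech s : R := 2 * expR s / (1 + expR (2 * s)).
Definition tnh s : R := 2 * zeta s - 1.

Lemma one_exp_gt0 s : 0 < 1 + expR (2 * s).
Proof. by rewrite addr_gt0 // expR_gt0. Qed.

Lemma zeta_gt0 s : 0 < zeta s.
Proof. by rewrite divr_gt0 ?expR_gt0 ?one_exp_gt0. Qed.

Lemma zeta_lt1 s : zeta s < 1.
Proof. by rewrite ltr_pdivrMr ?one_exp_gt0 // mul1r ltrDr. Qed.

Lemma zeta_norm s : `|zeta s| < 1.
Proof. by rewrite ger0_norm ?zeta_lt1 // ltW // zeta_gt0. Qed.

Lemma zeta_le s : zeta s <= expR (2 * s).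
Proof.
rewrite ler_pdivrMr ?one_exp_gt0 // ler_peMr ?expR_ge0 // lerDl; exact: expR_ge0.
Qed.

Lemma zeta_le_half s : s <= 0 -> zeta s <= 2^-1.
Proof.
move=> s0; rewrite ler_pdivrMr ?one_exp_gt0 // mulrDr.
have : expR (2 * s) <= 1 by rewrite -[X in _ <= X]expR0 ler_expR; lra.
lra.
Qed.

Lemma expR2 s : expR (2 * s) = expR s ^+ 2.
Proof. by rewrite expr2 -expRD; congr expR; ring. Qed.

Lemma sech_zeta s : sech s * expR s = 2 * zeta s.
Proof.
rewrite /sech /zeta expR2; have := one_exp_gt0 s; rewrite expR2.
move: (expR s) => e h; field; rewrite gt_eqF //.
Qed.

Lemma sech_zeta1 s : 2 * (1 - zeta s) * expR s = sech s.
Proof.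
rewrite /sech /zeta; have := one_exp_gt0 s; rewrite expR2.
move: (expR s) => e h; field; rewrite gt_eqF //.
Qed.

Lemma sech_sqr s : sech s ^+ 2 = 4 * zeta s * (1 - zeta s).
Proof.
rewrite /sech /zeta; have := one_exp_gt0 s; rewrite expR2.
move: (expR s) => e h; field; rewrite gt_eqF //.
Qed.

Lemma sechN s : sech (- s) = sech s.
Proof.
rewrite /sech mulrN !expRN expR2; have := one_exp_gt0 s; have := expR_gt0 s; rewrite expR2.
move: (expR s) => e e0 h; by field; rewrite !gt_eqF //= -?expr2 // addrC.
Qed.

Lemma zeta0 : zeta 0 = 2^-1.
Proof. by rewrite /zeta mulr0 expR0; field. Qed.

Lemma tnh0 : tnh 0 = 0.
Proof. by rewrite /tnh zeta0; field. Qed.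

Lemma sech0 : sech 0 = 1.
Proof. by rewrite /sech mulr0 expR0; field. Qed.

Lemma tnhE s : tnh s = 2 * zeta s - 1.
Proof. by []. Qed.

Lemma tnh_sqr s : tnh s ^+ 2 + sech s ^+ 2 = 1.
Proof. by rewrite sech_sqr /tnh; ring. Qed.

Lemma is_derive_expRZ (a s : R) : is_derive s 1 (fun t => expR (a * t)) (a * expR (a * s)).
Proof.
have h := is_derive1_comp (is_derive_expR (a * s)) (is_deriveZ a (is_derive_id s (1 : R))).
by apply: is_derive_eq h _; rewrite /GRing.scale /= mulr1 mulrC.
Qed.

Lemma is_derive_zeta s : is_derive s 1 zeta (2 * zeta s * (1 - zeta s)).
Proof.
have h1 := is_derive_expRZ 2 s.
have n0 : 1 + expR (2 * s) != 0 by rewrite gt_eqF // one_exp_gt0.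
have h2 : is_derive s 1 (fun t => 1 + expR (2 * t)) (2 * expR (2 * s)).
  by apply: is_derive_eq (is_deriveD (is_derive_cst (1 : R) s 1) h1) _; rewrite add0r.
have h3 : is_derive s 1 (fun t => (1 + expR (2 * t))^-1)
   (- (1 + expR (2 * s)) ^- 2 *: (2 * expR (2 * s))) by exact: is_deriveV.
apply: is_derive_eq (is_deriveM' h1 h3) _.
rewrite /zeta /GRing.scale /=; move: (expR (2 * s)) n0 => e n0; field. exact: n0.
Qed.

Lemma is_derive_sech s : is_derive s 1 sech (- (sech s * tnh s)).
Proof.
have e : sech = (fun t => 2 * ((1 - zeta t) * expR t)).
  by apply/funext => t; rewrite -sech_zeta1 mulrA.
have h1 : is_derive s 1 (fun t => 1 - zeta t) (- (2 * zeta s * (1 - zeta s))).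
  by apply: is_derive_eq (is_deriveB (is_derive_cst (1 : R) s 1) (is_derive_zeta s)) _; rewrite sub0r.
have h2 := is_deriveM' (is_derive_cst (2 : R) s 1) (is_deriveM' h1 (is_derive_expR s)).
rewrite {1}e; apply: is_derive_eq h2 _; rewrite -sech_zeta1 /tnh /cst; ring.
Qed.

Lemma is_derive_tnh s : is_derive s 1 tnh (sech s ^+ 2).
Proof.
have h1 := is_deriveM' (is_derive_cst (2 : R) s 1) (is_derive_zeta s).
apply: is_derive_eq (is_deriveB h1 (is_derive_cst (1 : R) s 1)) _.
by rewrite sech_sqr /cst; ring.
Qed.

End HyperbolicFunctions.

#[global] Opaque zeta sech tnh.

(** * Even second order equations *)

Section OdePairs.
Context {R : realType}.
Implicit Types (q y dy z dz : R -> R[i]).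

(** Carrying the derivative along makes a first order system out of the
    equation. *)
Definition osol q y dy : Prop :=
  (forall s, cder y s (dy s)) /\ (forall s, cder dy s (q s * y s)).

Lemma osol_comb q y dy z dz (a b : R[i]) : osol q y dy -> osol q z dz ->
  osol q (fun s => a * y s + b * z s) (fun s => a * dy s + b * dz s).
Proof.
move=> [h1 h2] [h3 h4]; split=> s.
  by apply: cderD; apply: cderZ; [exact: h1|exact: h3].
apply: cder_eq (cderD (cderZ a (h2 s)) (cderZ b (h4 s))).
by move: (q s) (y s) (z s) => ? ? ?; ring.
Qed.

Lemma is_derive_opp (s : R) : is_derive s 1 (fun t : R => - t) (-1).
Proof. by have := is_deriveN (is_derive_id s (1 : R)). Qed.

Lemma osol_opp q y dy : (forall s, q (- s) = q s) -> osol q y dy ->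
  osol q (fun s => y (- s)) (fun s => - dy (- s)).
Proof.
move=> qe [h1 h2]; split=> s.
  apply: cder_eq (cder_comp (h1 (- s)) (is_derive_opp s)).
  by rewrite rmorphN /= mulN1r.
apply: cder_eq (cderN (cder_comp (h2 (- s)) (is_derive_opp s))).
by rewrite rmorphN /= mulN1r opprK qe.
Qed.

Lemma wronskian_cst q y dy z dz (s t : R) : osol q y dy -> osol q z dz ->
  y s * dz s - dy s * z s = y t * dz t - dy t * z t.
Proof.
move=> [h1 h2] [h3 h4].
apply: (@cder0_cst _ (fun s => y s * dz s - dy s * z s)) => u.
apply: cder_eq (cderB (cderM (h1 u) (h4 u)) (cderM (h2 u) (h3 u))).
by move: (q u) (y u) (z u) (dy u) (dz u) => ? ? ? ? ?; ring.
Qed.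

(** Cramer's rule, with Wronskians, which are constant, evaluated at [0]. *)
Lemma osol_coord q y dy z dz w dw : osol q y dy -> osol q z dz -> osol q w dw ->
  forall W : R[i], W != 0 -> y 0 * dz 0 - dy 0 * z 0 = W -> forall s,
  w s = (w 0 * dz 0 - dw 0 * z 0) / W * y s + (y 0 * dw 0 - dy 0 * w 0) / W * z s /\
  dw s = (w 0 * dz 0 - dw 0 * z 0) / W * dy s + (y 0 * dw 0 - dy 0 * w 0) / W * dz s.
Proof.
move=> hy hz hw W W0 We s.
have e1 := wronskian_cst s 0 hy hz; have e2 := wronskian_cst s 0 hw hz.
have e3 := wronskian_cst s 0 hy hw.
rewrite We in e1; rewrite -e2 -e3 -e1; rewrite -e1 in W0.
move: W0; move: (y s) (dy s) (z s) (dz s) (w s) (dw s) => a b c d u v W0.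
by split; field.
Qed.

(** The reflection preserves the equation and the point [0], so that its
    matrix is made of values at [0]: the Wronskian [W], the mixed product
    [E], and the products [2 y y'], [2 z z']. *)
Lemma osol_reflect q y dy z dz (c1 c2 W E : R[i]) : (forall s, q (- s) = q s) ->
  osol q y dy -> osol q z dz -> W != 0 ->
  y 0 * dz 0 - dy 0 * z 0 = W -> y 0 * dz 0 + dy 0 * z 0 = E -> forall s,
  c1 * y (- s) + c2 * z (- s) =
  (c1 * E + c2 * (2 * (z 0 * dz 0))) / W * y s +
  (- (c1 * (2 * (y 0 * dy 0)) + c2 * E)) / W * z s.
Proof.
move=> qe hy hz W0 We Ee s.
have hw := osol_opp qe (osol_comb c1 c2 hy hz).
have [-> _] := osol_coord hy hz hw W0 We s.
rewrite oppr0 -Ee.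
by move: (y 0) (dy 0) (z 0) (dz 0) (y s) (z s) => a b c d u v; congr (_ / _ * _ + _ / _ * _); ring.
Qed.

End OdePairs.

(** * Legendre functions on the cylinder *)

Section LegendreSolutions.
Context {R : realType}.
Implicit Types (nu c : R[i]) (al s : R).

(** Separation of variables leads to [y'' = legq nu al * y] with [al = |k|
    / n]: the associated Legendre equation in the variable [- tanh s]. *)
Definition legq nu al s : R[i] := (al ^+ 2)%:C - nu * (nu + 1) * ((sech s) ^+ 2)%:C.

Lemma legq_even nu al s : legq nu al (- s) = legq nu al s.
Proof. by rewrite /legq sechN. Qed.

(** Two ladder relations in opposite directions compose to the second order
    equation. *)
Lemma ladder_osol nu al (y Y : R -> R[i]) :
  (forall s, cder y s (- (al * tnh s)%:C * y s + kap nu (1 + al%:C) * ((sech s)%:C * Y s))) ->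
  (forall s, cder Y s (((al + 1) * tnh s)%:C * Y s + (sech s)%:C * y s)) ->
  osol (legq nu al) y (fun s => - (al * tnh s)%:C * y s + kap nu (1 + al%:C) * ((sech s)%:C * Y s)).
Proof.
move=> hy hY; split=> [//|s].
have ht := cder_real (is_deriveM' (is_derive_cst al s 1) (is_derive_tnh s)).
have hs := cder_real (is_derive_sech s).
apply: cder_eq (cderD (cderM (cderN ht) (hy s)) (cderZ (kap nu (1 + al%:C)) (cderM hs (hY s)))).
rewrite kapE /legq /cst.
move: (y s) (Y s) (sech s) (tnh s) (tnh_sqr s) => a b c0 d0 /(congr1 (fun x : R => x%:C : R[i])).
rewrite !(rmorphD, rmorphM, rmorphN, rmorph0, rmorph1, rmorphXn) /=.
move: c0%:C d0%:C al%:C => c d e E.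
apply/eqP; rewrite -subr_eq0; apply/eqP.
transitivity (e ^+ 2 * a * (d ^+ 2 + c ^+ 2 - 1)); first by ring.
by rewrite E subrr mulr0.
Qed.

Definition tw al (f : R -> R[i]) s : R[i] := (expR (al * s))%:C * f (zeta s).

Lemma cder_tw al f df s : cder f (zeta s) df ->
  cder (tw al f) s (al%:C * tw al f s +
     (expR (al * s))%:C * (2 * (zeta s * (1 - zeta s)))%:C * df).
Proof.
move=> h; have h1 := cder_real (is_derive_expRZ al s).
apply: cder_eq (cderM h1 (cder_comp h (is_derive_zeta s))).
rewrite /tw; move: (f (zeta s)) (expR (al * s)) (zeta s) => a e z.
by rewrite !rmorphM /=; ring.
Qed.

Lemma tw_expRS al f s : tw (al + 1) f s = (expR s)%:C * tw al f s.
Proof. by rewrite /tw mulrDl mul1r expRD rmorphM /=; ring. Qed.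

(** [hser_raise] and [hser_lower] in the variable [s], here and in
    [tw_lower]; the sequence [tau] carries the extra terms of parameter
    derivatives. *)
Lemma tw_raise nu al (sg tau : nat -> R[i]) s :
  jbd sg -> jbd tau ->
  (forall j, sg j = (1 + al%:C + j%:R) * sg j.+1 + tau j.+1) ->
  (forall j, tau j = (1 + al%:C + j%:R) * tau j.+1) ->
  cder (tw al (hser nu sg)) s (- (al * tnh s)%:C * tw al (hser nu sg) s
    - (1 + tnh s)%:C * tw al (hser nu tau) s +
    (sech s)%:C * (kap nu (1 + al%:C) * tw (al + 1) (hser nu (fun j => sg j.+1)) s
      + (2 * (1 + al%:C) - 1) * tw (al + 1) (hser nu (fun j => tau j.+1)) s)).
Proof.
move=> hs ht hst htt.
have e := hser_raise nu hs ht (zeta_norm s) hst htt.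
apply: cder_eq (cder_tw al (cder_hser nu hs (zeta_norm s))).
rewrite !tw_expRS /tw tnhE; move: e.
move: (dhser nu sg (zeta s)) (hser nu sg (zeta s)) (hser nu tau (zeta s))
  (hser nu (fun j => sg j.+1) (zeta s)) (hser nu (fun j => tau j.+1) (zeta s)) (kap _ _)
  => dS S T S1 T1 k.
move: (expR (al * s)) (expR s) (sech s) (zeta s) (sech_zeta s)
  => E' e0' se' z' /(congr1 (fun x : R => x%:C : R[i])).
rewrite !(rmorphD, rmorphN, rmorphM, rmorph1) /=.
move: E'%:C e0'%:C se'%:C z'%:C al%:C => E e0 se z a e2 e.
have -> : - (a * (2 * z - 1)) * (E * S) - (1 + (2 * z - 1)) * (E * T) +
    se * (k * (e0 * (E * S1)) + (2 * (1 + a) - 1) * (e0 * (E * T1))) =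
    - (a * (2 * z - 1)) * (E * S) - (1 + (2 * z - 1)) * (E * T) +
    (se * e0) * E * (k * S1 + (2 * (1 + a) - 1) * T1) by ring.
rewrite -e e2; ring.
Qed.

Lemma tw_lower nu al (sg tau : nat -> R[i]) s :
  jbd sg -> jbd tau ->
  (forall j, sg j = (1 + al%:C + j%:R) * sg j.+1 + tau j.+1) ->
  cder (tw (al + 1) (hser nu (fun j => sg j.+1))) s
   (((al + 1) * tnh s)%:C * tw (al + 1) (hser nu (fun j => sg j.+1)) s +
    (sech s)%:C * tw al (hser nu sg) s
    - (1 - tnh s)%:C * tw (al + 1) (hser nu (fun j => tau j.+1)) s).
Proof.
move=> hs ht hst.
have e := hser_lower nu hs ht (zeta_norm s) hst.
apply: cder_eq (cder_tw (al + 1) (cder_hser nu (jbd_shift hs) (zeta_norm s))).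
rewrite !tw_expRS /tw tnhE mulrDl mul1r expRD.
move: e; move: (dhser nu (fun j => sg j.+1) (zeta s)) (hser nu sg (zeta s))
  (hser nu (fun j => sg j.+1) (zeta s)) (hser nu (fun j => tau j.+1) (zeta s)) => dS S S1 T1.
move: (expR (al * s)) (expR s) (sech s) (zeta s) (sech_zeta1 s)
  => E' e0' se' z' /(congr1 (fun x : R => x%:C : R[i])).
rewrite !(rmorphD, rmorphN, rmorphM, rmorph1) /=.
move: E'%:C e0'%:C se'%:C z'%:C al%:C => E e0 se z a e2 e.
have eS : S = z * dS + (1 + a) * S1 + T1 by rewrite e; ring.
by rewrite -e2 eS; ring.
Qed.

(** This is the Ferrers function [P_nu^(- al) (- tanh s)], with leading
    term [e ^ (al s) / Gamma (1 + al)] at [- oo]. *)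
Definition Phi nu al : R -> R[i] := tw al (hyp nu (1 + al%:C)).
Definition PhiS nu al : R -> R[i] := tw (al + 1) (hyp nu (1 + al%:C + 1)).
Definition dPhi nu al s : R[i] :=
  - (al * tnh s)%:C * Phi nu al s + kap nu (1 + al%:C) * ((sech s)%:C * PhiS nu al s).

Lemma good_1D al : -1 < al -> good (1 + al%:C).
Proof. by move=> h; apply: good_Re => /=; lra. Qed.

Lemma tw_hser0 nu al s : tw al (hser nu (fun=> 0)) s = 0.
Proof. by rewrite /tw hser0 mulr0. Qed.

Lemma PhiS_shift nu al :
  PhiS nu al = tw (al + 1) (hser nu (fun j => rgseq (1 + al%:C) j.+1)).
Proof. by apply/funext => s; rewrite /PhiS /tw hser_shift_rg. Qed.

Lemma cder_Phi nu al s : -1 < al -> cder (Phi nu al) s (dPhi nu al s).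
Proof.
move=> hal; have gc := good_1D hal.
have h : forall j, rgseq (1 + al%:C) j = (1 + al%:C + j%:R) * rgseq (1 + al%:C) j.+1 + 0.
  by move=> j; rewrite addr0; exact: rgseqS.
have h0 (j : nat) : 0 = (1 + al%:C + j%:R) * 0 :> R[i] by rewrite mulr0.
apply: cder_eq (tw_raise nu s (jbd_rgseq gc) jbd0 h h0).
rewrite (tw_hser0 nu al s) (tw_hser0 nu (al + 1) s) /dPhi /Phi PhiS_shift /hyp.
move: (tw al (hser nu (rgseq (1 + al%:C))) s) (kap nu (1 + al%:C)) (sech s)%:C
  (tw (al + 1) (hser nu (fun j => rgseq (1 + al%:C) j.+1)) s) => a b c d.
ring.
Qed.

Lemma cder_PhiS nu al s : -1 < al -> cder (PhiS nu al) s
  (((al + 1) * tnh s)%:C * PhiS nu al s + (sech s)%:C * Phi nu al s).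
Proof.
move=> hal; have gc := good_1D hal.
have h : forall j, rgseq (1 + al%:C) j = (1 + al%:C + j%:R) * rgseq (1 + al%:C) j.+1 + 0.
  by move=> j; rewrite addr0; exact: rgseqS.
rewrite PhiS_shift; apply: cder_eq (tw_lower nu s (jbd_rgseq gc) jbd0 h).
rewrite (tw_hser0 nu (al + 1) s) (mulr0 (1 - tnh s)%:C) subr0; reflexivity.
Qed.

Lemma osol_Phi nu al : -1 < al -> osol (legq nu al) (Phi nu al) (dPhi nu al).
Proof.
by move=> hal; apply: ladder_osol => s; [exact: cder_Phi|exact: cder_PhiS].
Qed.

(** The derivative of [Phi nu al] in [al] at [al = 0], where the two
    exponents [al] and [- al] collide. *)
Definition Xi nu s : R[i] := s%:C * Phi nu 0 s + tw 0 (hser nu (drgseq 1)) s.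
Definition XiS nu s : R[i] := s%:C * PhiS nu 0 s + tw 1 (hser nu (drgseq 2)) s.
Definition dXi nu s : R[i] :=
  kap nu 1 * ((sech s)%:C * XiS nu s) + (sech s)%:C * PhiS nu 0 s - (tnh s)%:C * Phi nu 0 s.

Lemma good_one : good (1 : R[i]).
Proof. by apply: good_Re => /=; exact: ltr01. Qed.

Lemma drgseq_2 : drgseq (2 : R[i]) = (fun j => drgseq 1 j.+1).
Proof. by apply/funext => j; rewrite drgseq_shift. Qed.

Lemma one0C : 1 + (0 : R)%:C = 1 :> R[i].
Proof. by rewrite addr0. Qed.

Lemma PhiS0 nu : PhiS nu 0 = tw 1 (hser nu (fun j => rgseq 1 j.+1)).
Proof. by rewrite PhiS_shift one0C add0r. Qed.

Lemma osol_Xi nu : osol (legq nu 0) (Xi nu) (dXi nu).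
Proof.
have m10 : -1 < 0 :> R by rewrite oppr_lt0 ltr01.
have hP s := cder_Phi nu s m10; have hPS s := cder_PhiS nu s m10.
have hr j := rgseqS (1 + (0 : R)%:C) j; have hd j := drgseqS (1 + (0 : R)%:C) j.
have gc := good_1D m10.
have h1 s := tw_raise nu s (jbd_drgseq gc) (jbd_rgseq gc) hd hr.
have h2 s := tw_lower nu s (jbd_drgseq gc) (jbd_rgseq gc) hd.
rewrite !one0C !add0r -!drgseq_2 in h1 h2.
have eS := PhiS0 nu.
have dX s : cder (Xi nu) s (dXi nu s).
  apply: cder_eq (cderD (cderM (cder_id s) (hP s)) (h1 s)).
  rewrite /dXi /XiS /dPhi one0C -/(hyp nu 1).
  have -> : Phi nu 0 s = tw 0 (hyp nu 1) s by rewrite /Phi one0C.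
  rewrite eS.
  move: (tw 0 (hyp nu 1) s) (tw 0 (hser nu (drgseq 1)) s) (tw 1 (hser nu (drgseq 2)) s)
    (tw 1 (hser nu (fun j => rgseq 1 j.+1)) s) (kap nu 1) (sech s) (tnh s) => a b c d e f g.
  by rewrite !(rmorphD, rmorphM, rmorph0, rmorph1) /=; ring.
have dXS s : cder (XiS nu) s ((tnh s)%:C * XiS nu s + (sech s)%:C * Xi nu s + (tnh s)%:C * PhiS nu 0 s).
  apply: cder_eq (cderD (cderM (cder_id s) (hPS s)) (h2 s)).
  rewrite /XiS /Xi.
  have -> : Phi nu 0 s = tw 0 (hyp nu 1) s by rewrite /Phi one0C.
  rewrite eS.
  move: (tw 0 (hyp nu 1) s) (tw 0 (hser nu (drgseq 1)) s) (tw 1 (hser nu (drgseq 2)) s)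
    (tw 1 (hser nu (fun j => rgseq 1 j.+1)) s) (sech s) (tnh s) => a b c d f g.
  by rewrite !(rmorphD, rmorphN, rmorphM, rmorph0, rmorph1) /=; ring.
split=> [//|s].
have hs := cder_real (is_derive_sech s); have ht := cder_real (is_derive_tnh s).
apply: cder_eq (cderB (cderD (cderZ (kap nu 1) (cderM hs (dXS s))) (cderM hs (hPS s)))
   (cderM ht (hP s))).
rewrite /dPhi one0C /legq kapE.
move: (Xi nu s) (XiS nu s) (Phi nu 0 s) (PhiS nu 0 s) (sech s) (tnh s) => a b c d e f.
by rewrite !(rmorphD, rmorphM, rmorphN, rmorph0, rmorph1, rmorphXn) /=; ring.
Qed.

End LegendreSolutions.

(** * Connection values for the exponents al and - al *)

Section ConnectionValues.
Context {R : realType}.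
Implicit Types (nu c : R[i]) (al s t : R).

Lemma tw_at0 al (f : R -> R[i]) : tw al f 0 = f 2^-1.
Proof. by rewrite /tw mulr0 expR0 zeta0 mul1r. Qed.

Lemma Phi0E nu al : Phi nu al 0 = hmid nu (1 + al%:C).
Proof. exact: tw_at0. Qed.

Definition dmid nu c : R[i] := kap nu c * hmid nu (c + 1).

Lemma dPhi0E nu al : dPhi nu al 0 = dmid nu (1 + al%:C).
Proof.
by rewrite /dPhi tnh0 mulr0 oppr0 mul0r add0r sech0 mul1r /PhiS tw_at0.
Qed.

Lemma wselfM nu c : wself nu c = 2 * (hmid nu c * dmid nu c).
Proof. by rewrite /wself /dmid; move: (hmid nu c) (hmid nu (c + 1)) (kap nu c) => a b d; ring. Qed.

Lemma zetaN_cvg0 : zeta (- (k%:R : R)) @[k --> \oo] --> (0 : R).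
Proof.
apply: (squeeze_cvgr _ (cvg_cst 0) (@cvg_harmonic R)).
near=> k; rewrite (ltW (zeta_gt0 _)) /=.
apply: le_trans (zeta_le _) _.
rewrite mulrN expRN lef_pV2 ?posrE ?expR_gt0 ?ltr0n //.
apply: le_trans (expR_ge1Dx _).
by rewrite -natr1 addrC lerD2l ler_peMl // ler1n.
Unshelve. all: by end_near. Qed.

Lemma hser_zeta_cvg nu (sg : nat -> R[i]) : jbd sg ->
  hser nu sg (zeta (- (k%:R : R))) @[k --> \oo] --> sg 0%N.
Proof.
move=> hs; rewrite -(hser_at0 nu sg).
have n0 : `|0 : R| < 1 by rewrite normr0.
have hc := cder_continuous (cder_hser nu hs n0).
exact: (cvg_comp _ _ zetaN_cvg0 hc).
Qed.

Lemma zetaC_cvg : (zeta (- (k%:R : R)))%:C @[k --> \oo] --> (0 : R[i]).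
Proof. have := cvg_realC zetaN_cvg0; exact. Qed.

Lemma ReS_1D al : -1 < al -> 0 < complex.Re (1 + al%:C).
Proof. by rewrite cReD /=; lra. Qed.

(** Computed at [s = - oo], where the exponentials cancel and only the
    leading coefficients remain; the reflection formula evaluates their
    product. *)
Lemma wronskian_Phi nu al : -1 < al < 1 ->
  Phi nu al 0 * dPhi nu (- al) 0 - dPhi nu al 0 * Phi nu (- al) 0 =
  - (2 / pi%:C) * csin (pi%:C * al%:C).
Proof.
move=> /andP[a1 a2]; have a2' : -1 < - al by lra.
pose fp k := hyp nu (1 + al%:C) (zeta (- (k%:R : R))).
pose fm k := hyp nu (1 + (- al)%:C) (zeta (- (k%:R : R))).
pose gp k := hyp nu (1 + al%:C + 1) (zeta (- (k%:R : R))).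
pose gm k := hyp nu (1 + (- al)%:C + 1) (zeta (- (k%:R : R))).
pose z (k : nat) : R[i] := (zeta (- (k%:R : R)))%:C.
(* the Wronskian at [s = - k] *)
have G k : 2 * al%:C * (2 * z k - 1) * (fp k * fm k) +
   2 * z k * (kap nu (1 + (- al)%:C) * (fp k * gm k) - kap nu (1 + al%:C) * (gp k * fm k)) =
   Phi nu al 0 * dPhi nu (- al) 0 - dPhi nu al 0 * Phi nu (- al) 0.
  rewrite (wronskian_cst 0 (- k%:R) (osol_Phi nu a1)); last first.
    by have := osol_Phi nu a2'; rewrite /legq sqrrN.
  rewrite /dPhi /Phi /PhiS !tw_expRS /tw -/(fp k) -/(fm k) -/(gp k) -/(gm k) tnhE.
  move: (kap nu (1 + al%:C)) (kap nu (1 + (- al)%:C)) => k1 k2.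
  have := sech_zeta (- (k%:R : R)).
  have : expR (al * - k%:R) * expR (- al * - k%:R) = 1 :> R by rewrite mulNr expRN divff // gt_eqF // expR_gt0.
  rewrite /z; move: (zeta _) (sech _) (expR (- k%:R)) (expR (al * - k%:R)) (expR (- al * - k%:R))
    => x y e u v /(congr1 (fun x : R => x%:C : R[i])) uv /(congr1 (fun x : R => x%:C : R[i])).
  move: uv; rewrite !(rmorphD, rmorphN, rmorphM, rmorph1) /=.
  move: (fp k) (fm k) (gp k) (gm k) x%:C y%:C e%:C u%:C v%:C al%:C
    => a b c d {}x {}y {}e {}u {}v m uv ye.
  transitivity (2 * m * (2 * x - 1) * (a * b) * (u * v) + (y * e) * (u * v) * (k2 * (a * d) - k1 * (c * b))).
    by rewrite uv ye; ring.
  ring.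
have h : 2 * al%:C * (2 * z k - 1) * (fp k * fm k) +
   2 * z k * (kap nu (1 + (- al)%:C) * (fp k * gm k) - kap nu (1 + al%:C) * (gp k * fm k)) @[k --> \oo] -->
   2 * al%:C * (2 * 0 - 1) * (rgamma (1 + al%:C) * rgamma (1 + (- al)%:C)) +
   2 * 0 * (kap nu (1 + (- al)%:C) * (rgamma (1 + al%:C) * rgamma (1 + (- al)%:C + 1))
    - kap nu (1 + al%:C) * (rgamma (1 + al%:C + 1) * rgamma (1 + (- al)%:C))).
  have hz : z k @[k --> \oo] --> (0 : R[i]) by exact: zetaC_cvg.
  have hf c : 0 < complex.Re c -> hyp nu c (zeta (- (k%:R : R))) @[k --> \oo] --> rgamma c.
    move=> c0; have := hser_zeta_cvg nu (jbd_rgseq (good_Re c0)).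
    by rewrite /rgseq addr0.
  have hfp : fp @ \oo --> rgamma (1 + al%:C) by apply: hf; exact: ReS_1D.
  have hfm : fm @ \oo --> rgamma (1 + (- al)%:C) by apply: hf; exact: ReS_1D.
  have hgp : gp @ \oo --> rgamma (1 + al%:C + 1) by apply: hf; apply: good1; exact: ReS_1D.
  have hgm : gm @ \oo --> rgamma (1 + (- al)%:C + 1) by apply: hf; apply: good1; exact: ReS_1D.
  have hz2 : 2 * z k @[k --> \oo] --> (2 * 0 : R[i]) by apply: ccvgM; [exact: ccvg_cst|exact: hz].
  apply: ccvgD; apply: ccvgM.
  - apply: ccvgM; first exact: ccvg_cst.
    by apply: ccvgB; [exact: hz2|exact: ccvg_cst].
  - by apply: ccvgM; [exact: hfp|exact: hfm].
  - exact: hz2.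
  - apply: ccvgB; apply: ccvgM; try exact: ccvg_cst.
      by apply: ccvgM; [exact: hfp|exact: hgm].
    by apply: ccvgM; [exact: hgp|exact: hfm].
rewrite mulr0 mul0r addr0 sub0r in h.
have hc : (fun=> Phi nu al 0 * dPhi nu (- al) 0 - dPhi nu al 0 * Phi nu (- al) 0) @ \oo -->
   (Phi nu al 0 * dPhi nu (- al) 0 - dPhi nu al 0 * Phi nu (- al) 0) by exact: ccvg_cst.
have h' : (fun=> Phi nu al 0 * dPhi nu (- al) 0 - dPhi nu al 0 * Phi nu (- al) 0) @ \oo -->
   2 * al%:C * -1 * (rgamma (1 + al%:C) * rgamma (1 + (- al)%:C)).
  apply: cvg_near_eq h; apply: nearW => k; exact: G.
rewrite (cvgC_unique hc h').
have := rgamma_reflection al%:C; rewrite (rgammaS al%:C) [al%:C + 1]addrC.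
have -> : 1 + (- al)%:C = 1 - al%:C :> R[i] by rewrite rmorphN.
move: (al%:C) (rgamma (1 + al%:C)) (rgamma (1 - al%:C)) (csin _) pi%:C^-1 => m a b d p e.
have -> : - (2 * p) * d = - 2 * (d * p) by ring.
by rewrite -e; ring.
Qed.

Lemma wselfE1 nu c : 0 < complex.Re c ->
  wself nu c * rgamma (2 - c + nu) = 2 / pi%:C * (rgamma (c + nu) * csin (pi%:C * (c - 1 - nu))).
Proof.
move=> c0; rewrite wselfE //.
have := rgamma_reflection (c - 1 - nu).
have -> : 1 - (c - 1 - nu) = 2 - c + nu by ring.
move: (rgamma (c + nu)) (rgamma (c - 1 - nu)) (rgamma (2 - c + nu)) (csin _) pi%:C^-1 => a b d m p e.
have -> : 2 * p * (a * m) = 2 * a * (m * p) by ring.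
by rewrite -e; ring.
Qed.

Lemma wself_one nu : wself nu 1 = - (2 / pi%:C) * csin (pi%:C * nu).
Proof.
have c1 : 0 < complex.Re (1 : R[i]) by exact: ltr01.
rewrite wselfE // subrr sub0r [1 + nu]addrC.
have := rgamma_reflection (- nu); rewrite opprK [1 + nu]addrC mulrN csinN.
move: (rgamma (nu + 1)) (rgamma (- nu)) (csin _) pi%:C^-1 => a b d p e.
have -> : 2 * (a * b) = 2 * (b * a) by ring.
by rewrite e; ring.
Qed.

(** The Gamma factors of the two closed forms pair up through the
    reflection formula. *)
Lemma wself_mul nu t : -1 < t < 1 ->
  wself nu (1 + t%:C) * wself nu (1 - t%:C) =
  (2 / pi%:C) ^+ 2 * (csin (pi%:C * nu) ^+ 2 - csin (pi%:C * t%:C) ^+ 2).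
Proof.
move=> /andP[t1 t2].
have c1 : 0 < complex.Re (1 + t%:C) by rewrite cReD /=; lra.
have c2 : 0 < complex.Re (1 - t%:C) by rewrite cReB /=; lra.
rewrite !wselfE //.
have r1 := rgamma_reflection (t%:C - nu); have r2 := rgamma_reflection (- t%:C - nu).
have e1 : 1 - (t%:C - nu) = 1 - t%:C + nu by ring.
have e2 : 1 - (- t%:C - nu) = 1 + t%:C + nu by ring.
have e3 : 1 + t%:C - 1 - nu = t%:C - nu by ring.
have e4 : 1 - t%:C - 1 - nu = - t%:C - nu by ring.
rewrite e1 in r1; rewrite e2 in r2; rewrite e3 e4.
have e5 : pi%:C * (t%:C - nu) = pi%:C * t%:C + - (pi%:C * nu) by ring.
have e6 : pi%:C * (- t%:C - nu) = - (pi%:C * t%:C) + - (pi%:C * nu) by ring.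
rewrite e5 csinD ccosN csinN in r1; rewrite e6 csinD !ccosN !csinN in r2.
have s1 := ccos2Dcsin2 (pi%:C * t%:C); have s2 := ccos2Dcsin2 (pi%:C * nu).
move: r1 r2 s1 s2.
move: (rgamma (1 + t%:C + nu)) (rgamma (t%:C - nu)) (rgamma (1 - t%:C + nu)) (rgamma (- t%:C - nu)).
move: (csin (pi%:C * t%:C)) (ccos (pi%:C * t%:C)) (csin (pi%:C * nu)) (ccos (pi%:C * nu)) pi%:C^-1.
move=> st ct sn cn p a b c d r1 r2 s1 s2.
have -> : 2 * (a * b) * (2 * (c * d)) = 4 * ((b * c) * (d * a)) by ring.
rewrite r1 r2.
have e7 : ct ^+ 2 = 1 - st ^+ 2 by rewrite -s1; ring.
have e8 : cn ^+ 2 = 1 - sn ^+ 2 by rewrite -s2; ring.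
transitivity (4 * p ^+ 2 * (ct ^+ 2 * sn ^+ 2 - st ^+ 2 * cn ^+ 2)); first by ring.
by rewrite e7 e8; ring.
Qed.

(** The product [y z' + y' z] at [s = 0] for the pair [Phi nu t], [Phi nu
    (- t)]. *)
Definition crossE nu t : R[i] :=
  hmid nu (1 + t%:C) * dmid nu (1 - t%:C) + dmid nu (1 + t%:C) * hmid nu (1 - t%:C).

Lemma cdiff_kap nu c : cdiff (kap nu) c (2 * c - 1).
Proof.
apply: (cdiff_ext (f := fun w => (w + nu) * (w - 1 - nu))); first by move=> w; rewrite kapE.
have h1 := cdiffD (cdiff_id c) (cdiff_cst nu c).
have h2 := cdiffB (cdiffB (cdiff_id c) (cdiff_cst 1 c)) (cdiff_cst nu c).
by apply: cdiff_eq (cdiffM h1 h2); ring.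
Qed.

Lemma cdiff_shift (f : R[i] -> R[i]) (a z d : R[i]) :
  cdiff f (z + a) d -> cdiff (fun w => f (w + a)) z d.
Proof.
move=> h; apply: cdiff_eq (cdiff_comp (cdiffD (cdiff_id z) (cdiff_cst a z)) h).
by rewrite addr0 mul1r.
Qed.

Lemma cdiff_dmid nu c : 0 < complex.Re c ->
  cdiff (dmid nu) c ((2 * c - 1) * hmid nu (c + 1) + kap nu c * hser nu (drgseq (c + 1)) 2^-1).
Proof.
move=> c0; apply: cdiffM; first exact: cdiff_kap.
by apply: cdiff_shift; apply: cdiff_hmid; exact: good1.
Qed.

(** From [(p + q) ^ 2 = (p - q) ^ 2 + 4 p q] with [p = y z'] and [q = y'
    z]: the difference is the Wronskian, and [4 p q] is [wself_mul]. *)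
Lemma crossE_sqr nu t : -1 < t < 1 ->
  crossE nu t ^+ 2 = (2 / pi%:C * csin (pi%:C * nu)) ^+ 2.
Proof.
move=> t1; have w := wronskian_Phi nu t1.
have := wself_mul nu t1.
rewrite !wselfM /crossE; rewrite !Phi0E !dPhi0E in w.
have e : 1 + (- t)%:C = 1 - t%:C :> R[i] by rewrite rmorphN.
rewrite e in w; move: w.
move: (hmid nu (1 + t%:C)) (dmid nu (1 + t%:C)) (hmid nu (1 - t%:C)) (dmid nu (1 - t%:C)).
move: (csin (pi%:C * t%:C)) (csin (pi%:C * nu)) pi%:C^-1 => x y p a a' b b' w m.
transitivity ((a * b' - a' * b) ^+ 2 + 2 * (a * a') * (2 * (b * b'))); first by ring.
by rewrite m w; ring.
Qed.

Lemma crossE0 nu : crossE nu 0 = - (2 / pi%:C) * csin (pi%:C * nu).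
Proof.
rewrite /crossE rmorph0 subr0 addr0 -wself_one wselfM.
by move: (hmid nu 1) (dmid nu 1) => a b; ring.
Qed.

Lemma ccont_crossE nu (z : R[i]) : `|complex.Re z| < 1 ->
  ccont (fun z => hmid nu (1 + z) * dmid nu (1 - z) + dmid nu (1 + z) * hmid nu (1 - z)) z.
Proof.
rewrite ltr_norml => /andP[z1 z2].
have c1 : 0 < complex.Re (1 + z) by rewrite cReD /=; lra.
have c2 : 0 < complex.Re (1 - z) by rewrite cReB /=; lra.
have hp : ccont (fun z => 1 + z) z by apply: ccontD; [exact: ccont_cst|exact: ccont_id].
have hm : ccont (fun z => 1 - z) z.
  by apply: ccontD; [exact: ccont_cst|apply: ccontN; exact: ccont_id].
have q1 := ccont_comp hp (cdiff_ccont (cdiff_hmid nu c1)).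
have q2 := ccont_comp hm (cdiff_ccont (cdiff_hmid nu c2)).
have q3 := ccont_comp hp (cdiff_ccont (cdiff_dmid nu c1)).
have q4 := ccont_comp hm (cdiff_ccont (cdiff_dmid nu c2)).
by apply: ccontD; apply: ccontM.
Qed.

(** The square determines the cross term up to a sign, which by the
    intermediate value theorem cannot change along the interval. *)
Lemma crossEE nu t : 0 <= t < 1 -> crossE nu t = - (2 / pi%:C) * csin (pi%:C * nu).
Proof.
move=> /andP[t0 t1]; set S := (- (2 / pi%:C) * csin (pi%:C * nu)).
have sq u : 0 <= u <= t -> crossE nu u ^+ 2 = S ^+ 2.
  by move=> /andP[u0 ut]; rewrite crossE_sqr; [rewrite /S mulNr sqrrN|lra].
have [S0|S0] := eqVneq S 0.
  have := sq t; rewrite t0 lexx S0 expr0n /= => /(_ isT) /eqP.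
  by rewrite sqrf_eq0 => /eqP.
pose r u := crossE nu u / S.
have r2 u : 0 <= u <= t -> r u = 1 \/ r u = -1.
  move=> /sq e; have : r u ^+ 2 = 1 by rewrite /r expr_div_n e divff // expf_neq0.
  by move/eqP; rewrite sqrf_eq1 => /orP[/eqP|/eqP]; [left|right].
have r0 : r 0 = 1 by rewrite /r crossE0 -/S divff.
have tt : 0 <= t <= t by rewrite t0 lexx.
have [rt|rt] := r2 t tt; first by rewrite -[LHS](divfK S0) -/(r t) rt mul1r.
have cr : {within `[0, t], continuous (fun u => complex.Re (r u))}.
  apply: continuous_in_subspaceT => u; rewrite inE /= in_itv /= => /andP[u0 ut].
  have hu : `|complex.Re u%:C| < 1 by rewrite /= ger0_norm //; lra.
  have h1 : u'%:C @[u' --> u] --> u%:C by apply: (@cvg_realC R _ _ _ id u); exact: cvg_id.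
  have h2 : r u' @[u' --> u] --> r u.
    apply: ccvgM; last exact: ccvg_cst.
    exact: (ccontP (ccont_crossE nu hu) _ h1).
  by have /cvg_ReIm [] := h2.
(* The quotient by the expected value only takes the values [1] and [-1]. *)
have [c cab rc] : exists2 c, c \in `[0, t] & complex.Re (r c) = 0.
  apply: IVT => //.
  rewrite r0 rt /=; apply/andP; split.
    by rewrite ge_min; apply/orP; right; lra.
  by rewrite le_max; apply/orP; left; lra.
move: cab; rewrite in_itv /= => /r2 [e|e]; move: rc; rewrite e /= => /eqP.
  by rewrite oner_eq0.
by rewrite oppr_eq0 oner_eq0.
Qed.

End ConnectionValues.

(** * Connection values in the logarithmic case *)

Section LogarithmicConnection.
Context {R : realType}.
Implicit Types (nu c : R[i]) (al s t : R).

Lemma cdiff_unique_local (f g : R[i] -> R[i]) (z d e : R[i]) (r : R) : 0 < r ->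
  (forall w, modulus (w - z) < r -> f w = g w) -> cdiff f z d -> cdiff g z e -> d = e.
Proof.
move=> r0 fg /cdiff_lim h1 /cdiff_lim h2.
apply: (cvgC_unique h1); apply: cvg_near_eq h2.
have hz : h @[h --> (0 : R[i])^'] --> (0 : R[i]) by exact: cvg_within.
have hm : modulus h @[h --> (0 : R[i])^'] --> (0 : R).
  by rewrite -(@modulus0 R); exact: cvg_modulus.
have /cvgrPdist_lt/(_ _ r0) := hm.
apply: filterS => h; rewrite sub0r normrN ger0_norm ?modulus_ge0 // => hr.
rewrite (fg (h + z)); last by rewrite addrK.
by rewrite (fg z) // subrr modulus0.
Qed.

Lemma Xi0E nu : Xi nu 0 = hser nu (drgseq 1) 2^-1.
Proof. by rewrite /Xi mul0r add0r tw_at0. Qed.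

Lemma dXi0E nu : dXi nu 0 = (2 * 1 - 1) * hmid nu (1 + 1) + kap nu 1 * hser nu (drgseq (1 + 1)) 2^-1.
Proof.
rewrite /dXi tnh0 mul0r subr0 sech0 !mul1r /XiS mul0r add0r /PhiS !tw_at0 one0C addrC.
have -> : 2 * 1 - 1 = 1 :> R[i] by ring.
by rewrite mul1r.
Qed.

Lemma Re1 : 0 < complex.Re (1 : R[i]).
Proof. exact: ltr01. Qed.

(** Computed at [s = - oo], where [Xi] grows like [s]. *)
Lemma wronskian_Xi nu : Phi nu 0 0 * dXi nu 0 - dPhi nu 0 0 * Xi nu 0 = 1.
Proof.
have m10 : -1 < 0 :> R by rewrite oppr_lt0 ltr01.
pose z (k : nat) : R[i] := (zeta (- (k%:R : R)))%:C.
pose f k := hyp nu 1 (zeta (- (k%:R : R))).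
pose f1 k := hyp nu (1 + 1) (zeta (- (k%:R : R))).
pose g k := hser nu (drgseq 1) (zeta (- (k%:R : R))).
pose g1 k := hser nu (drgseq 2) (zeta (- (k%:R : R))).
have G k : 2 * z k * kap nu 1 * (f k * g1 k - f1 k * g k) + 2 * z k * (f k * f1 k) -
    (2 * z k - 1) * (f k * f k) = Phi nu 0 0 * dXi nu 0 - dPhi nu 0 0 * Xi nu 0.
  rewrite (wronskian_cst 0 (- k%:R) (osol_Phi nu m10) (osol_Xi nu)).
  rewrite /dXi /dPhi /Xi /XiS /Phi /PhiS one0C.
  have e1 : tw 1 (hser nu (drgseq 2)) (- k%:R) = (expR (- k%:R))%:C * g1 k.
    by rewrite /tw mul1r.
  have e2 : tw (0 + 1) (hyp nu (1 + 1)) (- k%:R) = (expR (- k%:R))%:C * f1 k.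
    by rewrite /tw add0r mul1r.
  have e3 : tw 0 (hyp nu 1) (- k%:R) = f k by rewrite /tw mul0r expR0 mul1r.
  have e4 : tw 0 (hser nu (drgseq 1)) (- k%:R) = g k by rewrite /tw mul0r expR0 mul1r.
  rewrite e1 e2 e3 e4 mul0r oppr0 mul0r add0r tnhE.
  have := sech_zeta (- (k%:R : R)).
  rewrite /z; move: (f k) (g k) (f1 k) (g1 k) (kap nu 1) (expR (- k%:R)) => a b c d q e.
  move: (- k%:R : R) (zeta (- k%:R)) (sech (- k%:R)) => s x y /(congr1 (fun x : R => x%:C : R[i])).
  rewrite !(rmorphD, rmorphN, rmorphM, rmorph1) /=.
  move: x%:C y%:C e%:C s%:C => {}x {}y {}e {}s ye.
  transitivity ((y * e) * q * (a * d - c * b) + (y * e) * (a * c) - (2 * x - 1) * (a * a)).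
    by rewrite ye; ring.
  ring.
have hz : z k @[k --> \oo] --> (0 : R[i]) by exact: zetaC_cvg.
have hf : f @ \oo --> (1 : R[i]).
  have := hser_zeta_cvg nu (jbd_rgseq (good_Re Re1)); rewrite /rgseq addr0 rgamma_1; exact.
have hf1 : f1 @ \oo --> rgseq (1 + 1 : R[i]) 0.
  exact: (hser_zeta_cvg nu (jbd_rgseq (good_Re (good1 Re1)))).
have hg : g @ \oo --> drgseq (1 : R[i]) 0.
  exact: (hser_zeta_cvg nu (jbd_drgseq (good_Re Re1))).
have hg1 : g1 @ \oo --> drgseq (2 : R[i]) 0.
  exact: (hser_zeta_cvg nu (jbd_drgseq (good_Re (good1 Re1)))).
have hz2 : 2 * z k @[k --> \oo] --> (2 * 0 : R[i]) by apply: ccvgM; [exact: ccvg_cst|exact: hz].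
have h : 2 * z k * kap nu 1 * (f k * g1 k - f1 k * g k) + 2 * z k * (f k * f1 k) -
    (2 * z k - 1) * (f k * f k) @[k --> \oo] -->
    2 * 0 * kap nu 1 * (1 * drgseq 2 0 - rgseq (1 + 1) 0 * drgseq 1 0) + 2 * 0 * (1 * rgseq (1 + 1) 0) -
    (2 * 0 - 1) * (1 * 1).
  apply: ccvgB; [apply: ccvgD|]; apply: ccvgM.
  - by apply: ccvgM; [exact: hz2|exact: ccvg_cst].
  - by apply: ccvgB; apply: ccvgM; [exact: hf|exact: hg1|exact: hf1|exact: hg].
  - exact: hz2.
  - by apply: ccvgM; [exact: hf|exact: hf1].
  - by apply: ccvgB; [exact: hz2|exact: ccvg_cst].
  - by apply: ccvgM; exact: hf.
have -> : (1 : R[i]) = 2 * 0 * kap nu 1 * (1 * drgseq 2 0 - rgseq (1 + 1) 0 * drgseq 1 0) + 2 * 0 * (1 * rgseq (1 + 1) 0) -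
    (2 * 0 - 1) * (1 * 1) by move: (kap nu 1) (drgseq _ _) (drgseq _ _) (rgseq _ _) => ? ? ? ?; ring.
apply: (cvgC_unique (F := \oo) (f := fun=> Phi nu 0 0 * dXi nu 0 - dPhi nu 0 0 * Xi nu 0)).
  exact: ccvg_cst.
by apply: cvg_near_eq h; apply: nearW => k; exact: G.
Qed.

Let Sn nu : R[i] := csin (pi%:C * nu).
Let Cn nu : R[i] := ccos (pi%:C * nu).

Lemma cdiff_rgamma_aff (a z : R[i]) (sg : R[i]) :
  cdiff (fun w => rgamma (a + sg * w)) z (sg * drgamma (a + sg * z)).
Proof.
apply: cdiff_comp; last exact: cdiff_rgamma.
by apply: cdiff_eq (cdiffD (cdiff_cst a z) (cdiff_lin sg z)); rewrite add0r.
Qed.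

(** The closed form of [wself], differentiated in [c] at [1]. *)
Lemma wself_derive nu : let ad := Xi nu 0 in let ad' := dXi nu 0 in
  2 * (ad * dmid nu 1 + hmid nu 1 * ad') * rgamma (1 + nu) =
  2 * rgamma (1 + nu) * Cn nu - 4 / pi%:C * drgamma (1 + nu) * Sn nu.
Proof.
move=> ad ad'.
have hA : cdiff (hmid nu) 1 ad by rewrite /ad Xi0E; exact: (cdiff_hmid nu Re1).
have hB : cdiff (dmid nu) 1 ad' by rewrite /ad' dXi0E; exact: (cdiff_dmid nu Re1).
have hL : cdiff (fun c => 2 * (hmid nu c * dmid nu c) * rgamma (2 + nu + (-1) * c)) 1
   (2 * (ad * dmid nu 1 + hmid nu 1 * ad') * rgamma (2 + nu + (-1) * 1) +
    2 * (hmid nu 1 * dmid nu 1) * ((-1) * drgamma (2 + nu + (-1) * 1))).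
  apply: cdiffM; last exact: cdiff_rgamma_aff.
  by apply: cdiff_eq (cdiffM (cdiff_cst 2 1) (cdiffM hA hB)); rewrite mul0r add0r.
have hs : cdiff (fun c => csin (pi%:C * (c - 1 - nu))) 1 (pi%:C * ccos (pi%:C * (1 - 1 - nu))).
  apply: cdiff_comp; last exact: cdiff_csin.
  have h1 := cdiffM (cdiff_cst pi%:C 1) (cdiffB (cdiffB (cdiff_id 1) (cdiff_cst 1 1)) (cdiff_cst nu 1)).
  by apply: cdiff_eq h1; ring.
have hR : cdiff (fun c => 2 / pi%:C * (rgamma (nu + 1 * c) * csin (pi%:C * (c - 1 - nu)))) 1
   (2 / pi%:C * (1 * drgamma (nu + 1 * 1) * csin (pi%:C * (1 - 1 - nu)) +
       rgamma (nu + 1 * 1) * (pi%:C * ccos (pi%:C * (1 - 1 - nu))))).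
  apply: cdiff_eq (cdiffM (cdiff_cst (2 / pi%:C) 1) (cdiffM (cdiff_rgamma_aff nu 1 1) hs)).
  by rewrite mul0r add0r.
have key : forall w : R[i], modulus (w - 1) < 1 ->
   2 * (hmid nu w * dmid nu w) * rgamma (2 + nu + (-1) * w) =
   2 / pi%:C * (rgamma (nu + 1 * w) * csin (pi%:C * (w - 1 - nu))).
  move=> w w1; have w0 : 0 < complex.Re w.
    have := modulus_Re (w - 1); rewrite cReB ler_norml /= => /andP[h1 h2]; lra.
  have := wselfE1 nu w0; rewrite wselfM.
  have -> : 2 - w + nu = 2 + nu + (-1) * w by ring.
  by rewrite mul1r [nu + w]addrC.
have := cdiff_unique_local (@ltr01 R) key hL hR.
have -> : 2 + nu + (-1) * 1 = 1 + nu by ring.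
have -> : nu + 1 * 1 = 1 + nu by ring.
have -> : pi%:C * (1 - 1 - nu) = - (pi%:C * nu) by ring.
rewrite csinN ccosN -/(Sn nu) -/(Cn nu).
have := wself_one nu; rewrite wselfM -/(Sn nu).
have := @piC_neq0 R.
move: (hmid nu 1) (dmid nu 1) (rgamma _) (drgamma _) (Sn nu) (Cn nu) pi%:C => a a' r r' S C p p0 e1 e2.
have -> : 2 * (ad * a' + a * ad') * r = (2 * (ad * a' + a * ad') * r + 2 * (a * a') * (-1 * r')) + 2 * (a * a') * r' by ring.
by rewrite e2 e1; field.
Qed.

(** The first derivative of the closed form does not see the product [ad *
    ad'] of the parameter derivatives of the midpoint value and slope.
    Write [p], [q] for value and slope as functions of [c]. Then [(p (1 +
    t) - p (1 - t)) * (q (1 + t) - q (1 - t))] consists of [wself nu (1 +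
    t)], [wself nu (1 - t)] and [crossE nu t], all known; it vanishes to
    second order at [t = 0], with leading coefficient [4 * ad * ad']. *)
Lemma wself_derive2 nu : let ad := Xi nu 0 in let ad' := dXi nu 0 in
  let r := rgamma (1 + nu) in let r' := drgamma (1 + nu) in
  4 * ad * ad' * r ^+ 2 * pi%:C =
  4 * r' * r * pi%:C * Cn nu - 4 * r' ^+ 2 * Sn nu + r ^+ 2 * pi%:C ^+ 2 * Sn nu.
Proof.
move=> ad ad' r r'.
have [A [AE A1 Ac]] : cdiff (hmid nu) 1 ad by rewrite /ad Xi0E; exact: (cdiff_hmid nu Re1).
have [B [BE B1 Bc]] : cdiff (dmid nu) 1 ad' by rewrite /ad' dXi0E; exact: (cdiff_dmid nu Re1).
have [Q [QE Q1 Qc]] := @cdiff_rgamma R (1 + nu).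
have [T [TE T0 Tc]] := @cdiff_csin R 0.
pose L (t : R[i]) := (A (1 + t) + A (1 - t)) * (B (1 + t) + B (1 - t)) *
   (rgamma (1 + nu + t) * rgamma (1 + nu - t)) * pi%:C.
pose U (t : R[i]) := (Q (1 + nu + t) + Q (1 + nu - t)) * (rgamma (1 + nu + t) + rgamma (1 + nu - t)) *
     (pi%:C * T (pi%:C * t)) * Cn nu -
   (Q (1 + nu + t) + Q (1 + nu - t)) ^+ 2 * ccos (pi%:C * t) * Sn nu +
   4 * (rgamma (1 + nu + t) * rgamma (1 + nu - t)) * (pi%:C / 2 * T (pi%:C / 2 * t)) ^+ 2 * Sn nu.
have cp a : ccont (fun t : R[i] => a + t) 0 by apply: ccontD; [exact: ccont_cst|exact: ccont_id].
have cm a : ccont (fun t : R[i] => a - t) 0.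
  by apply: ccontD; [exact: ccont_cst|apply: ccontN; exact: ccont_id].
have cl a : ccont (fun t : R[i] => a * t) 0 by apply: ccontM; [exact: ccont_cst|exact: ccont_id].
have cfp (f : R[i] -> R[i]) a : ccont f a -> ccont (fun t : R[i] => f (a + t)) 0.
  by move=> hf; apply: ccont_comp (cp a) _; rewrite addr0.
have cfm (f : R[i] -> R[i]) a : ccont f a -> ccont (fun t : R[i] => f (a - t)) 0.
  by move=> hf; apply: ccont_comp (cm a) _; rewrite subr0.
have cfl (f : R[i] -> R[i]) a : ccont f 0 -> ccont (fun t : R[i] => f (a * t)) 0.
  by move=> hf; apply: ccont_comp (cl a) _; rewrite mulr0.
have cG := @ccont_rgamma R (1 + nu).
have cL : ccont L 0.
  apply: ccontM; last exact: ccont_cst.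
  apply: ccontM; [apply: ccontM|]; [apply: ccontD|apply: ccontD|apply: ccontM];
   by [apply: cfp|apply: cfm].
have cQ : ccont (fun t : R[i] => Q (1 + nu + t) + Q (1 + nu - t)) 0.
  by apply: ccontD; [apply: cfp|apply: cfm].
have cU : ccont U 0.
  apply: ccontD; [apply: ccontD|].
  - apply: ccontM; last exact: ccont_cst.
    apply: ccontM; last by apply: ccontM; [exact: ccont_cst|exact: cfl].
    apply: ccontM; first exact: cQ.
    by apply: ccontD; [apply: cfp|apply: cfm].
  - apply: ccontN; apply: ccontM; last exact: ccont_cst.
    apply: ccontM; last by apply: cfl; exact: cdiff_ccont (cdiff_ccos 0).
    by apply: (ccont_ext (f := fun t : R[i] => (Q (1 + nu + t) + Q (1 + nu - t)) * (Q (1 + nu + t) + Q (1 + nu - t))));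
      [move=> t; rewrite expr2|apply: ccontM].
  - apply: ccontM; last exact: ccont_cst.
    apply: ccontM.
      apply: ccontM; first exact: ccont_cst.
      by apply: ccontM; [apply: cfp|apply: cfm].
    have hT : ccont (fun t : R[i] => pi%:C / 2 * T (pi%:C / 2 * t)) 0.
      by apply: ccontM; [exact: ccont_cst|exact: cfl].
    by apply: (ccont_ext (f := fun t : R[i] => pi%:C / 2 * T (pi%:C / 2 * t) * (pi%:C / 2 * T (pi%:C / 2 * t))));
      [move=> t; rewrite expr2|apply: ccontM].
(* Multiplied by [t ^ 2], both sides are the same combination of values. *)
have LU (t : R) : 0 < t < 1 -> L t%:C = U t%:C.
  move=> /andP[t0 t1].
  have tC : t%:C != 0 :> R[i] by rewrite -modulus_gt0 modulusR normr_gt0 gt_eqF.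
  have c1 : 0 < complex.Re (1 + t%:C) by rewrite cReD /=; lra.
  have c2 : 0 < complex.Re (1 - t%:C) by rewrite cReB /=; lra.
  have w1 := wselfE1 nu c1; have w2 := wselfE1 nu c2.
  have t01 : 0 <= t < 1 by lra.
  have w3 := crossEE nu t01.
  have q1 : 2 - (1 + t%:C) + nu = 1 + nu - t%:C by ring.
  have q2 : 1 + t%:C + nu = 1 + nu + t%:C by ring.
  have q3 : 2 - (1 - t%:C) + nu = 1 + nu + t%:C by ring.
  have q4 : 1 - t%:C + nu = 1 + nu - t%:C by ring.
  have q5 : pi%:C * (1 + t%:C - 1 - nu) = pi%:C * t%:C + - (pi%:C * nu) by ring.
  have q6 : pi%:C * (1 - t%:C - 1 - nu) = - (pi%:C * t%:C) + - (pi%:C * nu) by ring.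
  rewrite q1 q2 q5 csinD csinN ccosN wselfM in w1.
  rewrite q3 q4 q6 csinD !csinN !ccosN wselfM in w2.
  rewrite /crossE in w3.
  have a1 := AE (1 + t%:C); have a2 := AE (1 - t%:C).
  have b1 := BE (1 + t%:C); have b2 := BE (1 - t%:C).
  have d1 := QE (1 + nu + t%:C); have d2 := QE (1 + nu - t%:C).
  have s1 := TE (pi%:C * t%:C); have s2 := TE (pi%:C / 2 * t%:C).
  rewrite csin0 !subr0 in s1 s2.
  have k1 : 1 + t%:C - 1 = t%:C by ring.
  have k2 : 1 - t%:C - 1 = - t%:C by ring.
  have k3 : 1 + nu + t%:C - (1 + nu) = t%:C by ring.
  have k4 : 1 + nu - t%:C - (1 + nu) = - t%:C by ring.
  rewrite k1 in a1 b1; rewrite k2 in a2 b2; rewrite k3 in d1; rewrite k4 in d2.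
  have dbl : ccos (pi%:C * t%:C) = 1 - 2 * csin (pi%:C / 2 * t%:C) ^+ 2.
    have -> : pi%:C * t%:C = pi%:C / 2 * t%:C + pi%:C / 2 * t%:C by field.
    rewrite ccosD -expr2.
    have -> : ccos (pi%:C / 2 * t%:C) ^+ 2 = 1 - csin (pi%:C / 2 * t%:C) ^+ 2.
      by apply/eqP; rewrite eq_sym subr_eq ccos2Dcsin2.
    ring.
  apply: (mulfI tC); apply: (mulfI tC); rewrite /L /U.
  have pn := @piC_neq0 R.
  rewrite -/(Sn nu) -/(Cn nu) in w1 w2 w3.
  move: w1 w2 w3 a1 a2 b1 b2 d1 d2 s1 s2 dbl.
  move: (hmid nu (1 + t%:C)) (hmid nu (1 - t%:C)) (dmid nu (1 + t%:C)) (dmid nu (1 - t%:C))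
    (hmid nu 1) (dmid nu 1) => pp pm qp qm p1 q0.
  move: (rgamma (1 + nu + t%:C)) (rgamma (1 + nu - t%:C)) (rgamma (1 + nu)) => rp rm r0.
  move: (Q (1 + nu + t%:C)) (Q (1 + nu - t%:C)) (A (1 + t%:C)) (A (1 - t%:C)) (B (1 + t%:C)) (B (1 - t%:C))
    => Qp Qm Ap Am Bp Bm.
  move: (T (pi%:C * t%:C)) (T (pi%:C / 2 * t%:C)) => T1 T2.
  move: (csin (pi%:C * t%:C)) (ccos (pi%:C * t%:C)) (csin (pi%:C / 2 * t%:C)) => st ct sh.
  move: (Sn nu) (Cn nu) t%:C pi%:C pn tC => S C x p pn xn w1 w2 w3 a1 a2 b1 b2 d1 d2 s1 s2 dbl.
  have e1 : x * (Ap + Am) = pp - pm by have -> : pp - pm = (pp - p1) - (pm - p1); [ring|rewrite a1 a2; ring].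
  have e2 : x * (Bp + Bm) = qp - qm by have -> : qp - qm = (qp - q0) - (qm - q0); [ring|rewrite b1 b2; ring].
  have e3 : x * (Qp + Qm) = rp - rm by have -> : rp - rm = (rp - r0) - (rm - r0); [ring|rewrite d1 d2; ring].
  transitivity ((x * (Ap + Am)) * (x * (Bp + Bm)) * (rp * rm) * p); first by ring.
  transitivity ((x * (Qp + Qm)) * (rp + rm) * (p * x * T1) * C - (x * (Qp + Qm)) ^+ 2 * ct * S +
     4 * (rp * rm) * (p / 2 * x * T2) ^+ 2 * S); last by ring.
  rewrite e1 e2 e3 -s1 -s2.
  transitivity ((2 * (pp * qp) * rm) * rp * p / 2 + (2 * (pm * qm) * rp) * rm * p / 2 -
     (pp * qm + qp * pm) * (rp * rm) * p); first by field.
  by rewrite w1 w2 w3 dbl; field.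
pose tk (k : nat) : R := k.+2%:R^-1.
have tk01 k : 0 < tk k < 1 by rewrite /tk invr_gt0 ltr0n /= invf_lt1 ?ltr0n // ltr1n.
have tk0 : (tk k)%:C @[k --> \oo] --> (0 : R[i]).
  apply: (@cvg_realC R _ _ _ tk 0).
  apply: (squeeze_cvgr _ (cvg_cst 0) (@cvg_harmonic R)); apply: nearW => k.
  by rewrite /tk invr_ge0 ler0n /= lef_pV2 ?posrE ?ltr0n // ler_nat.
have h1 : L (tk k)%:C @[k --> \oo] --> L 0 by exact: (ccontP cL _ tk0).
have h2 : U (tk k)%:C @[k --> \oo] --> U 0 by exact: (ccontP cU _ tk0).
have : L 0 = U 0.
  apply: (cvgC_unique h1); apply: (cvg_near_eq _ h2); apply: nearW => k.
  rewrite (LU _ (tk01 k)); reflexivity.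
rewrite /L /U !addr0 !subr0 !mulr0 ccos0 A1 B1 Q1 T0 ccos0 -/r -/r'.
have := @piC_neq0 R; move: (Sn nu) (Cn nu) pi%:C => S C p p0 e.
have -> : 4 * ad * ad' * r ^+ 2 * p = (ad + ad) * (ad' + ad') * (r * r) * p by ring.
by rewrite e; field.
Qed.

(** Normalized by its expansion [- s - gamma - psi (nu + 1)] at [- oo],
    which matches the first component of [calA0]. *)
Definition QPhi nu s : R[i] := (-1) * Xi nu s + (- digamma (nu + 1)) * Phi nu 0 s.
Definition dQPhi nu s : R[i] := (-1) * dXi nu s + (- digamma (nu + 1)) * dPhi nu 0 s.

Lemma osol_Phi0 nu : osol (legq nu 0) (Phi nu 0) (dPhi nu 0).
Proof. by apply: osol_Phi; rewrite oppr_lt0 ltr01. Qed.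

Lemma osol_QPhi nu : osol (legq nu 0) (QPhi nu) (dQPhi nu).
Proof. exact: osol_comb (osol_Xi nu) (osol_Phi0 nu). Qed.

Lemma wronskian_QPhi nu : Phi nu 0 0 * dQPhi nu 0 - dPhi nu 0 0 * QPhi nu 0 = -1.
Proof.
rewrite /dQPhi /QPhi; have := wronskian_Xi nu.
move: (Phi nu 0 0) (dPhi nu 0 0) (Xi nu 0) (dXi nu 0) (digamma _) => a b c d e h.
by transitivity (- (a * d - b * c)); [ring|rewrite h].
Qed.

Lemma nu_rgamma nu : (forall m : nat, nu != - (m.+1%:R)) -> rgamma (1 + nu) != 0.
Proof.
move=> hnu; apply: rgamma_neq0 => N; apply: contra_neq (hnu N) => e.
by rewrite -natr1 opprD -e; ring.
Qed.

Lemma digamma_nu nu : (forall m : nat, nu != - (m.+1%:R)) ->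
  digamma (nu + 1) = - drgamma (1 + nu) / rgamma (1 + nu).
Proof.
move=> hnu; rewrite digammaE [nu + 1]addrC // => N.
apply: contra_neq (hnu N) => e; by rewrite -natr1 opprD -e; ring.
Qed.

Lemma cross_QPhi nu : (forall m : nat, nu != - (m.+1%:R)) ->
  Phi nu 0 0 * dQPhi nu 0 + dPhi nu 0 0 * QPhi nu 0 = - Cn nu.
Proof.
move=> hnu; have r0 := nu_rgamma hnu.
have := wself_derive nu; have := wself_one nu; rewrite wselfM.
rewrite /dQPhi /QPhi (digamma_nu hnu) !Phi0E !dPhi0E one0C -/(Sn nu).
have := @piC_neq0 R; move: r0.
move: (hmid nu 1) (dmid nu 1) (Xi nu 0) (dXi nu 0) (rgamma _) (drgamma _) (Sn nu) (Cn nu) pi%:C.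
move=> a b c d r r' S C p r0 p0 e1 e2; apply: (mulfI r0); apply: (mulfI (@two_neq0 R)).
transitivity (- (2 * (c * b + a * d) * r) + 2 * r' * (2 * (a * b))); first by field.
by rewrite e2 e1; field.
Qed.

Lemma self_QPhi nu : (forall m : nat, nu != - (m.+1%:R)) ->
  2 * (QPhi nu 0 * dQPhi nu 0) = pi%:C / 2 * Sn nu.
Proof.
move=> hnu; have r0 := nu_rgamma hnu.
have := wself_derive2 nu; have := wself_derive nu; have := wself_one nu; rewrite wselfM /=.
rewrite /dQPhi /QPhi (digamma_nu hnu) !Phi0E !dPhi0E one0C -/(Sn nu).
have := @piC_neq0 R; move: r0.
move: (hmid nu 1) (dmid nu 1) (Xi nu 0) (dXi nu 0) (rgamma _) (drgamma _) (Sn nu) (Cn nu) pi%:C.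
move=> a b c d r r' S C p r0 p0 e1 e2 e3.
apply: (mulfI r0); apply: (mulfI r0); apply: (mulfI p0); apply: (mulfI (@two_neq0 R)).
transitivity (4 * c * d * r ^+ 2 * p - 2 * p * r' * (2 * (c * b + a * d) * r) + 2 * p * r' ^+ 2 * (2 * (a * b))).
  by field.
by rewrite e3 e2 e1; field.
Qed.

(** [osol_reflect] for the pair [Phi nu 0], [QPhi nu]. *)
Theorem connection_log nu (c1 c2 : R[i]) s : (forall m : nat, nu != - (m.+1%:R)) ->
  c1 * Phi nu 0 (- s) + c2 * QPhi nu (- s) =
  (Cn nu * c1 + - (pi%:C / 2 * Sn nu) * c2) * Phi nu 0 s +
  (- (2 / pi%:C * Sn nu) * c1 + - Cn nu * c2) * QPhi nu s.
Proof.
move=> hnu; have n1 : (-1 : R[i]) != 0 by rewrite oppr_eq0 oner_eq0.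
have e1 : 2 * (Phi nu 0 0 * dPhi nu 0 0) = - (2 / pi%:C) * Sn nu.
  by rewrite Phi0E dPhi0E one0C -wselfM wself_one.
have h := osol_reflect c1 c2 (legq_even nu 0) (osol_Phi0 nu) (osol_QPhi nu) n1
  (wronskian_QPhi nu) (cross_QPhi hnu) s.
rewrite (self_QPhi hnu) e1 invrN invr1 in h.
apply: (etrans h).
move: (Phi nu 0 s) (QPhi nu s) (Sn nu) (Cn nu) => a b S C.
move: pi%:C pi%:C^-1 2^-1 => q p h'; ring.
Qed.

(** The algebra of [connection_power], apart from the special functions it
    is applied to. *)
Lemma reflect_coef (F : fieldType) (c1 c2 a b g1 g2 g3 g4 S sa p X Y L : F) :
  2 != 0 :> F -> sa != 0 -> p != 0 -> X = 2 * (g1 * g2) -> Y = 2 * (g3 * g4) ->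
  L = (c1 * (- (2 / p) * S) + c2 * X) / (- (2 / p) * sa) * a +
      - (c1 * Y + c2 * (- (2 / p) * S)) / (- (2 / p) * sa) * b ->
  L = (S / sa * c1 + - (p * (g1 * g2) / sa) * c2) * a +
      (p * (g3 * g4) / sa * c1 + - (S / sa) * c2) * b.
Proof. by move=> h2 hs hp -> -> ->; field; rewrite hs hp oppr_eq0. Qed.

(** [osol_reflect] for the pair [Phi nu al], [Phi nu (- al)]. *)
Theorem connection_power nu al (c1 c2 : R[i]) s : 0 < al < 1 ->
  c1 * Phi nu al (- s) + c2 * Phi nu (- al) (- s) =
  (Sn nu / csin (pi%:C * al%:C) * c1 +
   - (pi%:C * (rgamma (1 - al%:C + nu) * rgamma (- al%:C - nu)) / csin (pi%:C * al%:C)) * c2) * Phi nu al s +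
  (pi%:C * (rgamma (1 + al%:C + nu) * rgamma (al%:C - nu)) / csin (pi%:C * al%:C) * c1 +
   - (Sn nu / csin (pi%:C * al%:C)) * c2) * Phi nu (- al) s.
Proof.
move=> /andP[a0 a1].
have sn0 : csin (pi%:C * al%:C) != 0 :> R[i].
  rewrite -rmorphM csin_real -modulus_gt0 modulusR normr_gt0 gt_eqF //.
  apply: sin_gt0_pi; have := @pi_gt0 R => p0; rewrite mulr_gt0 //=.
  by rewrite -[X in _ < X]mulr1 ltr_pM2l.
have pn := @piC_neq0 R.
have W0 : - (2 / pi%:C) * csin (pi%:C * al%:C) != 0 :> R[i].
  by rewrite mulf_neq0 // oppr_eq0 mulf_neq0 ?invr_eq0 // two_neq0.
have am : -1 < - al by lra.
have ap : -1 < al by lra.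
have ap1 : -1 < al < 1 by lra.
have h1 := osol_Phi nu ap.
have h2 : osol (legq nu al) (Phi nu (- al)) (dPhi nu (- al)).
  by have := osol_Phi nu am; rewrite /legq sqrrN.
have t01 : 0 <= al < 1 by lra.
have E : Phi nu al 0 * dPhi nu (- al) 0 + dPhi nu al 0 * Phi nu (- al) 0 = - (2 / pi%:C) * Sn nu.
  have := crossEE nu t01; rewrite /crossE !Phi0E !dPhi0E.
  by have -> : 1 + (- al)%:C = 1 - al%:C :> R[i] by rewrite rmorphN.
have c1' : 0 < complex.Re (1 + al%:C) by rewrite cReD /=; lra.
have c2' : 0 < complex.Re (1 - al%:C) by rewrite cReB /=; lra.
have e1 : 2 * (Phi nu al 0 * dPhi nu al 0) = 2 * (rgamma (1 + al%:C + nu) * rgamma (al%:C - nu)).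
  rewrite Phi0E dPhi0E -wselfM wselfE //.
  by have -> : 1 + al%:C - 1 - nu = al%:C - nu by ring.
have e2 : 2 * (Phi nu (- al) 0 * dPhi nu (- al) 0) = 2 * (rgamma (1 - al%:C + nu) * rgamma (- al%:C - nu)).
  rewrite Phi0E dPhi0E; have -> : 1 + (- al)%:C = 1 - al%:C :> R[i] by rewrite rmorphN.
  rewrite -wselfM (wselfE nu c2').
  by have -> : 1 - al%:C - 1 - nu = - al%:C - nu by ring.
have h := osol_reflect c1 c2 (legq_even nu al) h1 h2 W0 (wronskian_Phi nu ap1) E s.
exact: (reflect_coef two_neq0 sn0 pn e2 e1 h).
Qed.

End LogarithmicConnection.

(** * Test functions on the punctured plane *)

Section TestFunctions.
Context {R : realType}.
Implicit Types (z v w : R[i]) (f g : R[i] -> R[i]) (chi : R -> R[i]).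

Definition lnmod z : R := ln (modulus z).

Lemma modulus_sqr z : modulus z ^+ 2 = complex.Re z ^+ 2 + complex.Im z ^+ 2.
Proof. by rewrite modulusE sqr_sqrtr // addr_ge0 // sqr_ge0. Qed.

Lemma cderX (h : R -> R[i]) x d m : cder h x d ->
  cder (fun t => h t ^+ m) x (m%:R * d * h x ^+ m.-1).
Proof.
move=> hd; elim: m => [|m IH].
  by apply: cder_eq (cder_cst _ _); rewrite !mul0r.
have e : (fun t => h t ^+ m.+1) = (fun t => h t * h t ^+ m).
  by apply/funext => t; rewrite exprS.
rewrite e; apply: cder_eq (cderM hd IH).
case: m {IH e} => [|m]; first by rewrite /= expr0 !mul0r mulr0 addr0 mulr1 mul1r mulr1.
move: (h x) => y; rewrite /= exprS; ring.
Qed.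

Lemma cder_line z v : cder (fun t : R => z + t%:C * v) 0 v.
Proof.
by apply: cder_eq (cderD (cder_cst z 0) (cderM (cder_id 0) (cder_cst v 0)));
  rewrite mulr0 addr0 mul1r add0r.
Qed.

Lemma cvg_line z v : (fun t : R => z + t%:C * v) @ (0 : R) --> z.
Proof.
have h : (fun t : R => z + t%:C * v) @ (0 : R) --> z + (0 : R)%:C * v.
  exact: (cder_continuous (cder_line z v)).
by rewrite mul0r addr0 in h.
Qed.

Lemma line_neq0 z v : z != 0 -> \forall t \near (0 : R), z + t%:C * v != 0.
Proof. by move=> z0; exact: (@ccvg_near0 _ _ _ (nbhs_filter (0 : R)) _ _ (@cvg_line z v) z0). Qed.

Lemma is_derive_line (x y : R) : is_derive (0 : R) 1 (fun t => x + t * y) y.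
Proof.
have h1 := is_deriveM' (is_derive_id (0 : R) (1 : R)) (is_derive_cst y (0 : R) 1).
have h := is_deriveD (is_derive_cst x (0 : R) 1) h1.
apply: is_derive_eq h _; by rewrite /= mulr0 addr0 mul1r add0r.
Qed.

Lemma is_derive_lnmod z v : z != 0 ->
  is_derive (0 : R) 1 (fun t => lnmod (z + t%:C * v))
    ((complex.Re z * complex.Re v + complex.Im z * complex.Im v) / modulus z ^+ 2).
Proof.
move=> z0.
pose N t := (complex.Re z + t * complex.Re v) ^+ 2 + (complex.Im z + t * complex.Im v) ^+ 2.
have eN t : modulus (z + t%:C * v) ^+ 2 = N t.
  by rewrite modulus_sqr cReD cImD cReM cImM /= !mul0r subr0 addr0.
have hl := is_derive_line.
have hN : is_derive (0 : R) 1 N (2 * (complex.Re z * complex.Re v + complex.Im z * complex.Im v)).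
  have h := is_deriveD (is_deriveM' (hl (complex.Re z) (complex.Re v)) (hl (complex.Re z) (complex.Re v)))
                       (is_deriveM' (hl (complex.Im z) (complex.Im v)) (hl (complex.Im z) (complex.Im v))).
  by apply: is_derive_eq h _; rewrite !mul0r !addr0; ring.
have N0 : 0 < N 0 by rewrite -eN mul0r addr0 exprn_gt0 // modulus_gt0.
have hln := is_derive1_comp (is_derive1_ln N0) hN.
have h := is_deriveM' (is_derive_cst (2^-1 : R) (0 : R) 1) hln.
apply: is_derive_eq.
  apply: (is_derive_ext (f2 := fun t => lnmod (z + t%:C * v)) _ h); near=> t; rewrite /= -eN /lnmod.
  have ht : z + t%:C * v != 0 by near: t; exact: line_neq0.
  by rewrite lnXn ?modulus_gt0 //; field.
rewrite /= -!eN !mul0r addr0 add0r.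
have m0 : modulus z != 0 by rewrite modulus_eq0.
by field.
Unshelve. all: by end_near. Qed.

Definition pder v f z d : Prop := cder (fun t : R => f (z + t%:C * v)) 0 d.

Lemma pder_rderive v f z d : pder v f z d -> rderivable f v z /\ rderive v f z = d.
Proof.
move=> [[h1 h2] [h3 h4]]; split; first by split.
by rewrite /rderive !derive1E h2 h4; apply: complex_ext.
Qed.

(** Products of [z ^ a * conj z ^ b] with a smooth compactly supported
    function of [ln |z|] span a space that is stable under partial
    derivatives; this makes them explicit test functions. The value [0] at
    the origin is the smooth extension. *)
Definition mono (a b : nat) chi z : R[i] :=
  if z == 0 then 0 else chi (lnmod z) * z ^+ a * conjc z ^+ b.

Lemma conjc_line z v (t : R) : conjc (z + t%:C * v) = conjc z + t%:C * conjc v.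
Proof. by case: z => a b; case: v => c d; apply: complex_ext => /=; ring. Qed.

(** The differential of [f] is [A dz + B d(conj z)]. *)
Definition wder f A B : Prop := forall z v, pder v f z (v * A z + conjc v * B z).

Definition supported (lo hi : R) chi : Prop := forall t, ~~ (lo <= t <= hi) -> chi t = 0.

Lemma supported_der lo hi chi dchi : supported lo hi chi -> (forall t, cder chi t (dchi t)) ->
  supported lo hi dchi.
Proof.
move=> hs hd t ht; apply: cder_unique (hd t) _.
apply: (cder_near (f := fun=> 0)); last exact: cder_cst.
move: ht; rewrite negb_and -!ltNge => /orP[] ht; near=> s; apply/esym/hs.
  suff : s < lo by move=> h; rewrite negb_and -!ltNge h.
  by near: s; exact: lt_nbhsl.
suff : hi < s by move=> h; rewrite negb_and -!ltNge h orbT.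
by near: s; exact: lt_nbhsr.
Unshelve. all: by end_near. Qed.

Lemma supportedM lo hi chi (h : R -> R[i]) : supported lo hi chi ->
  supported lo hi (fun t => h t * chi t).
Proof. by move=> hs t ht; rewrite (hs t ht) mulr0. Qed.

Lemma near_modulus_lt (F : set_system R[i]) {FF : Filter F} (e : R) :
  F --> (0 : R[i]) -> 0 < e -> \forall z \near F, modulus z < e.
Proof.
move=> hF e0; have h := @cvg_modulus R _ F FF (fun z => z) 0 hF.
rewrite modulus0 in h; exact: (cvgr_lt _ h _ e0).
Qed.

Lemma lnmod_near0 lo : \forall z \near (0 : R[i]), z != 0 -> lnmod z < lo.
Proof.
have : \forall z \near (0 : R[i]), modulus z < expR lo by exact: (@near_modulus_lt _ (nbhs_filter (0 : R[i])) _ cvg_id (expR_gt0 lo)).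
apply: filterS => z hz z0; rewrite /lnmod -(expRK lo) ltr_ln ?posrE ?expR_gt0 // modulus_gt0 //.
Qed.

Lemma mono_near0 a b lo hi chi : supported lo hi chi ->
  \forall z \near (0 : R[i]), mono a b chi z = 0.
Proof.
move=> hs; apply: filterS (lnmod_near0 lo) => z hz; rewrite /mono; case: eqVneq => // z0.
by rewrite hs ?mul0r // negb_and -!ltNge hz.
Qed.

(** Radial factor in the derivatives of [chi (ln |z|)]: the one in [z] is
    [conj z / (2 |z| ^ 2)] times the derivative of [chi], and the negative
    power of [|z|] joins the radial factor. *)
Definition radial_der (dchi : R -> R[i]) (t : R) : R[i] := (2^-1 * expR (- (2 * t)))%:C * dchi t.

Lemma wder_mono a b lo hi chi dchi : supported lo hi chi ->
  (forall t, cder chi t (dchi t)) ->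
  wder (mono a b chi)
    (fun z => mono a b.+1 (radial_der dchi) z + a%:R * mono a.-1 b chi z)
    (fun z => mono a.+1 b (radial_der dchi) z + b%:R * mono a b.-1 chi z).
Proof.
move=> hs hd z v; have [->|z0] := eqVneq z 0.
  rewrite /mono eqxx !mulr0 !addr0 !mulr0 addr0.
  apply: (cder_near (f := fun=> 0)); last exact: cder_cst.
  have h0 : \forall t \near (0 : R), mono a b chi (0 + t%:C * v) = 0.
    exact: (@cvg_line 0 v _ (mono_near0 a b hs)).
  by apply: filterS h0 => t ht; symmetry; exact: ht.
rewrite /mono (negbTE z0).
have hL := is_derive_lnmod v z0.
have h0 : cder chi (lnmod (z + (0:R)%:C * v)) (dchi (lnmod z)) by rewrite mul0r addr0.
have h1 := @cder_comp R chi (fun t => lnmod (z + t%:C * v)) 0 _ _ h0 hL.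
have h2 := cderX a (cder_line z v).
have h3 : cder (fun t : R => conjc (z + t%:C * v) ^+ b) 0 (b%:R * conjc v * conjc z ^+ b.-1).
  have := cderX b (cder_line (conjc z) (conjc v)); rewrite mul0r addr0.
  by under eq_fun do rewrite -conjc_line.
have h := cderM (cderM h1 h2) h3.
apply: (cder_near (f := fun t : R => chi (lnmod (z + t%:C * v)) * (z + t%:C * v) ^+ a * conjc (z + t%:C * v) ^+ b)).
  by apply: filterS (line_neq0 v z0) => t ht; rewrite (negbTE ht).
apply: cder_eq h; rewrite !mul0r !addr0 /radial_der.
have e : ((complex.Re z * complex.Re v + complex.Im z * complex.Im v) / modulus z ^+ 2)%:C =
    (2^-1 * expR (- (2 * lnmod z)))%:C * (v * conjc z + conjc v * z).
  have -> : expR (- (2 * lnmod z)) = (modulus z ^+ 2)^-1.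
    by rewrite expRN expR2 lnK // posrE modulus_gt0.
  have m0 : complex.Re z ^+ 2 + complex.Im z ^+ 2 != 0.
    by rewrite -modulus_sqr expf_neq0 // modulus_eq0.
  rewrite modulus_sqr.
  case: z m0 {z0 hL h0 h1 h2 h3} => x y /= m0; case: v => p q.
  by apply: complex_ext => /=; [field|ring].
rewrite e; move: (chi _) (dchi _) (_)%:C (conjc z) (conjc v) => X dX E cz cv.
case: a {h2} => [|a]; case: b {h3} => [|b]; rewrite /= ?exprS; ring.
Qed.

Lemma wderD f g A B A' B' : wder f A B -> wder g A' B' ->
  wder (fun z => f z + g z) (fun z => A z + A' z) (fun z => B z + B' z).
Proof.
move=> hf hg z v; apply: cder_eq (cderD (hf z v) (hg z v)).
by move: (A z) (B z) (A' z) (B' z) (conjc v) => *; ring.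
Qed.

Lemma wderZ c f A B : wder f A B -> wder (fun z => c * f z) (fun z => c * A z) (fun z => c * B z).
Proof.
move=> hf z v; apply: cder_eq (cderZ c (hf z v)).
by move: (A z) (B z) (conjc v) => *; ring.
Qed.

Lemma wder_rderive1 f A B : wder f A B -> rderive 1 f = (fun z => A z + B z).
Proof.
move=> hf; apply/funext => z; have [_ ->] := pder_rderive (hf z 1).
by rewrite conjc1 !mul1r.
Qed.

Lemma wder_rderivei f A B : wder f A B -> rderive 'i%C f = (fun z => 'i%C * A z + - 'i%C * B z).
Proof.
move=> hf; apply/funext => z; have [_ ->] := pder_rderive (hf z 'i%C).
by congr (_ + _ * _); apply: complex_ext; rewrite /= ?oppr0.
Qed.

Lemma wder_d_x f A B : wder f A B -> d_x f = A.
Proof.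
move=> hf; apply/funext => z; rewrite /d_x (wder_rderive1 hf) (wder_rderivei hf).
have := @mulII R; have := @two_neq0 R; move: ('i%C) (A z) (B z) => I a b t2 hI.
have -> : a + b - I * (I * a + - I * b) = a + b - I * I * a + I * I * b by ring.
by rewrite hI; field.
Qed.

Lemma wder_d_xbar f A B : wder f A B -> d_xbar f = B.
Proof.
move=> hf; apply/funext => z; rewrite /d_xbar (wder_rderive1 hf) (wder_rderivei hf).
have := @mulII R; have := @two_neq0 R; move: ('i%C) (A z) (B z) => I a b t2 hI.
have -> : a + b + I * (I * a + - I * b) = a + b + I * I * a - I * I * b by ring.
by rewrite hI; field.
Qed.

Fixpoint Ck (m : nat) chi : Prop :=
  if m is m'.+1 then exists2 dchi, (forall t, cder chi t (dchi t)) & Ck m' dchi else True.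

Definition csmooth chi : Prop := forall m, Ck m chi.

Lemma CkS m chi : Ck m.+1 chi -> Ck m chi.
Proof. by elim: m chi => [//|m IH] chi [d hd /IH h]; exists d. Qed.

Lemma csmooth_der chi dchi : csmooth chi -> (forall t, cder chi t (dchi t)) -> csmooth dchi.
Proof.
move=> hs hd m; have [d h1 h2] := hs m.+1.
by rewrite (_ : dchi = d) //; apply/funext => t; apply: cder_unique (hd t) (h1 t).
Qed.

Lemma csmoothP chi : csmooth chi -> exists2 dchi, (forall t, cder chi t (dchi t)) & csmooth dchi.
Proof. by move=> hs; have [d hd _] := hs 1%N; exists d => //; exact: csmooth_der hs hd. Qed.

Lemma csmoothI chi dchi : (forall t, cder chi t (dchi t)) -> csmooth dchi -> csmooth chi.
Proof. by move=> hd hs [//|m]; exists dchi. Qed.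

Lemma CkD m chi1 chi2 : Ck m chi1 -> Ck m chi2 -> Ck m (fun t => chi1 t + chi2 t).
Proof.
elim: m chi1 chi2 => [//|m IH] chi1 chi2 [d1 h1 k1] [d2 h2 k2].
by exists (fun t => d1 t + d2 t) => [t|]; [exact: cderD|exact: IH].
Qed.

Lemma CkM m chi1 chi2 : Ck m chi1 -> Ck m chi2 -> Ck m (fun t => chi1 t * chi2 t).
Proof.
elim: m chi1 chi2 => [//|m IH] chi1 chi2 H1 H2.
have [d1 h1 k1] := H1; have [d2 h2 k2] := H2.
exists (fun t => d1 t * chi2 t + chi1 t * d2 t) => [t|]; first exact: cderM.
by apply: CkD; apply: IH => //; exact: CkS.
Qed.

Lemma Ck_cst m c : Ck m (fun=> c).
Proof. by elim: m c => [//|m IH] c; exists (fun=> 0) => [t|]; [exact: cder_cst|exact: IH]. Qed.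

Lemma csmooth_cst c : csmooth (fun=> c).
Proof. by move=> m; exact: Ck_cst. Qed.

Lemma csmoothD chi1 chi2 : csmooth chi1 -> csmooth chi2 -> csmooth (fun t => chi1 t + chi2 t).
Proof. by move=> h1 h2 m; exact: CkD. Qed.

Lemma csmoothM chi1 chi2 : csmooth chi1 -> csmooth chi2 -> csmooth (fun t => chi1 t * chi2 t).
Proof. by move=> h1 h2 m; exact: CkM. Qed.

Lemma csmooth_exp a : csmooth (fun t => (expR (a * t))%:C).
Proof.
elim=> [//|m IH]; exists (fun t => a%:C * (expR (a * t))%:C) => [t|].
  by apply: cder_eq (cder_real (is_derive_expRZ a t)); rewrite -rmorphM.
exact: (CkM (Ck_cst m _) IH).
Qed.

Lemma csmooth_continuous chi : csmooth chi -> continuous chi.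
Proof. by move=> h t; have [d hd _] := h 1%N; exact: (cder_continuous (hd t)). Qed.

Inductive lcomb (lo hi : R) : (R[i] -> R[i]) -> Prop :=
| lcomb_mono a b chi : supported lo hi chi -> csmooth chi -> lcomb lo hi (mono a b chi)
| lcombD f g : lcomb lo hi f -> lcomb lo hi g -> lcomb lo hi (fun z => f z + g z)
| lcombZ c f : lcomb lo hi f -> lcomb lo hi (fun z => c * f z).

Lemma csmooth_radial_der dchi : csmooth dchi -> csmooth (radial_der dchi).
Proof.
move=> hs; rewrite (_ : radial_der dchi = fun t => 2^-1%:C * (expR ((-2) * t))%:C * dchi t).
  exact: (csmoothM (csmoothM (csmooth_cst _) (csmooth_exp _)) hs).
by apply/funext => t; rewrite /radial_der rmorphM mulNr.
Qed.

Lemma supported_radial lo hi dchi : supported lo hi dchi -> supported lo hi (radial_der dchi).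
Proof. by move=> h; exact: (supportedM _ h). Qed.

(** Stability under derivatives, from which smoothness follows by
    induction. *)
Lemma lcomb_wder lo hi f : lcomb lo hi f ->
  exists A B, [/\ wder f A B, lcomb lo hi A & lcomb lo hi B].
Proof.
elim=> {f} [a b chi hs hc|f g _ [A [B [h1 h2 h3]]] _ [A' [B' [h1' h2' h3']]]|c f _ [A [B [h1 h2 h3]]]].
- have [dchi hd hdc] := csmoothP hc.
  have hsd := supported_radial (supported_der hs hd).
  have hcd := csmooth_radial_der hdc.
  eexists; eexists; split; first exact: (wder_mono a b hs hd).
    exact: (lcombD (lcomb_mono _ _ hsd hcd) (lcombZ _ (lcomb_mono _ _ hs hc))).
  exact: (lcombD (lcomb_mono _ _ hsd hcd) (lcombZ _ (lcomb_mono _ _ hs hc))).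
- by eexists; eexists; split; [exact: (wderD h1 h1')|exact: lcombD|exact: lcombD].
- by eexists; eexists; split; [exact: (wderZ c h1)|exact: lcombZ|exact: lcombZ].
Qed.

Lemma lcomb_rderive lo hi (e : bool) f : lcomb lo hi f -> lcomb lo hi (rderive (if e then 1 else 'i%C) f).
Proof.
move=> /lcomb_wder[A [B [hw hA hB]]]; case: e.
  by rewrite (wder_rderive1 hw); exact: lcombD.
by rewrite (wder_rderivei hw); apply: lcombD; exact: lcombZ.
Qed.

Section Limits.
Variables (F : set_system R[i]) (FF : Filter F).

Lemma ccvgX (h : R[i] -> R[i]) (l : R[i]) m : h @ F --> l -> (fun z => h z ^+ m) @ F --> l ^+ m.
Proof.
move=> hl; elim: m => [|m IH]; first by exact: (@ccvg_cst _ _ F FF 1).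
rewrite exprS (_ : (fun z => _) = fun z => h z * h z ^+ m); first exact: (ccvgM hl IH).
by apply/funext => z; rewrite exprS.
Qed.

Lemma ccvg_conj (h : R[i] -> R[i]) (l : R[i]) : h @ F --> l -> (fun z => conjc (h z)) @ F --> conjc l.
Proof.
move=> /cvg_ReIm[h1 h2]; apply/cvg_ReIm; split.
  have -> : complex.Re (conjc l) = complex.Re l by case: (l).
  rewrite (_ : (fun z => _) = fun z => complex.Re (h z)) //.
  by apply/funext => z; case: (h z).
have -> : complex.Im (conjc l) = - complex.Im l by case: (l).
rewrite (_ : (fun z => _) = fun z => - complex.Im (h z)); first exact: cvgN.
by apply/funext => z; case: (h z).
Qed.

Lemma ccvg_chi chi z : continuous chi -> z != 0 -> F --> z ->
  (fun w => chi (lnmod w)) @ F --> chi (lnmod z).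
Proof.
move=> hc z0 hF.
have h1 := @cvg_modulus R _ F FF (fun z => z) z hF.
have h2 : (@ln R \o modulus) @ F --> ln (modulus z).
  apply: cvg_comp h1 _; apply: continuous_ln; by rewrite modulus_gt0.
exact: (cvg_comp _ _ h2 (hc _)).
Qed.

Lemma ccvg_mono a b chi z : continuous chi -> z != 0 -> F --> z ->
  (fun w => chi (lnmod w) * w ^+ a * conjc w ^+ b) @ F --> chi (lnmod z) * z ^+ a * conjc z ^+ b.
Proof.
move=> hc z0 hF; apply: ccvgM; first apply: ccvgM.
- exact: ccvg_chi.
- exact: (@ccvgX (fun z => z)).
- exact: ccvgX (@ccvg_conj (fun z => z) z hF).
Qed.
End Limits.

Lemma mono_continuous a b lo hi chi : supported lo hi chi -> csmooth chi -> continuous (mono a b chi).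
Proof.
move=> hs hc z; have [->|z0] := eqVneq z 0.
  have -> : continuous_at 0 (mono a b chi) = (mono a b chi @ (0 : R[i]) --> (0 : R[i])).
    by rewrite /continuous_at {2}/mono eqxx.
  apply: (@cvg_near_eq _ _ (nbhs (0 : R[i])) (nbhs_filter _) (fun=> 0) _ 0); last first.
    exact: (@ccvg_cst _ _ _ (nbhs_filter (0 : R[i])) 0).
  by apply: filterS (mono_near0 a b hs) => w ->.
have h := @ccvg_mono (nbhs z) (nbhs_filter z) a b chi z (csmooth_continuous hc) z0 cvg_id.
rewrite /continuous_at {2}/mono (negbTE z0).
apply: cvg_near_eq h.
have : \forall w \near z, w != 0.
  by exact: (@ccvg_near0 _ _ _ (nbhs_filter z) (fun z => z) z cvg_id z0).
by apply: filterS => w w0; rewrite /mono (negbTE w0).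
Qed.

Lemma lcomb_continuous lo hi f : lcomb lo hi f -> continuous f.
Proof.
elim=> {f} [a b chi hs hc|f g _ h1 _ h2|c f _ h1] z.
- exact: mono_continuous hs hc z.
- exact: (ccvgD (h1 z) (h2 z)).
- have hc := @ccvg_cst _ _ (nbhs z) (nbhs_filter z) c.
  exact: (@ccvgM _ _ (nbhs z) (nbhs_filter z) (fun=> c) f c (f z) hc (h1 z)).
Qed.

Lemma lcomb_smooth lo hi f : lcomb lo hi f -> smooth f.
Proof.
move=> hf b; set psi := foldr _ _ _; have hpsi : lcomb lo hi psi.
  by rewrite /psi; elim: b {psi} => [//|e b IH] /=; exact: lcomb_rderive.
split; first exact: lcomb_continuous hpsi.
have [A [B [hw _ _]]] := lcomb_wder hpsi => z.
by split; [exact: (pder_rderive (hw z 1)).1|exact: (pder_rderive (hw z 'i%C)).1].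
Qed.

Lemma lcomb_supp lo hi f : lcomb lo hi f ->
  forall z, ~ (expR lo <= modulus z <= expR hi) -> f z = 0.
Proof.
move=> hf z hz; elim: hf => {f} [a b chi hs hc|f g _ -> _ ->|c f _ ->]; last 2 first.
- by rewrite addr0.
- by rewrite mulr0.
rewrite /mono; case: eqVneq => // z0; rewrite hs ?mul0r //; apply/negP => h; apply: hz.
move: h; rewrite /lnmod => /andP[h1 h2].
have mz : 0 < modulus z by rewrite modulus_gt0.
by rewrite -ler_ln ?posrE ?expR_gt0 // -[X in _ && X]ler_ln ?posrE ?expR_gt0 // !expRK h1.
Qed.

Lemma annulus_compact (a b : R) : compact [set z : R[i] | a <= modulus z <= b].
Proof.
pose D : set (R * R) := (`[- b, b] `*` `[- b, b])%classic.
have cD : compact D by apply: compact_setX; exact: segment_compact.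
pose h (p : R * R) : R[i] := p.1 +i* p.2.
have ch : continuous h.
  move=> p; apply/cvg_ReIm; split; [exact: cvg_fst|exact: cvg_snd].
have cI : compact (h @` D).
  by apply: continuous_compact => //; exact: continuous_subspaceT.
apply: (subclosed_compact _ cI).
  have cm : continuous (modulus : R[i] -> R).
    by move=> z; exact: (@cvg_modulus R _ (nbhs z) (nbhs_filter z) (fun z => z) z cvg_id).
  rewrite (_ : [set z | _] = modulus @^-1` [set x | a <= x <= b]); last by [].
  apply: preimage_closed => [z _|]; first exact: cm.
  rewrite (_ : [set x | _] = `[a, b]%classic); first exact: interval_closed.
  by apply/seteqP; split => x /=; rewrite in_itv.
move=> z /= /andP[_ hb]; exists (complex.Re z, complex.Im z); last by case: z hb.
by split; rewrite /= in_itv /= -ler_norml; apply: le_trans hb; [exact: modulus_Re|exact: modulus_Im].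
Qed.

Lemma lcomb_test lo hi f : lcomb lo hi f -> test_function f.
Proof.
move=> hf; split; first exact: lcomb_smooth hf.
exists [set z | expR lo <= modulus z <= expR hi]; split.
- exact: annulus_compact.
- by rewrite /= modulus0 leNgt expR_gt0.
- by move=> z; exact: lcomb_supp.
Qed.

End TestFunctions.

(** * Fourier modes of test functions *)

Section PolarModes.
Context {R : realType}.
Implicit Types (z : R[i]) (xi : R -> R[i]) (r th t : R) (k : int).

Lemma expiD th t : expi (th + t) = expi th * expi t.
Proof. by apply: complex_ext => /=; [rewrite cosD|rewrite sinD addrC]. Qed.

Lemma expi0 : expi (0 : R) = 1.
Proof. by apply: complex_ext; rewrite /= ?cos0 ?sin0. Qed.

Lemma expiX th m : expi th ^+ m = expi (m%:R * th).
Proof.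
elim: m => [|m IH]; first by rewrite mul0r expi0.
by rewrite exprS IH -expiD -[in RHS]natr1 mulrDl mul1r addrC.
Qed.

Lemma conjc_expi th : conjc (expi th) = expi (- th).
Proof. by rewrite /expi cosN sinN. Qed.

Lemma conjcM z w : conjc (z * w) = conjc z * conjc w.
Proof. by case: z => a b; case: w => c d; apply: complex_ext => /=; ring. Qed.

Lemma modulus_polar r th : 0 <= r -> modulus (polar (r, th)) = r.
Proof. by move=> r0; rewrite /polar modulusM modulus_expi modulusR mulr1 ger0_norm. Qed.

Lemma polar_neq0 r th : 0 < r -> polar (r, th) != 0.
Proof. by move=> r0; rewrite -modulus_gt0 modulus_polar // ltW. Qed.

Lemma polarX r th a : polar (r, th) ^+ a = (r ^+ a)%:C * expi (a%:R * th).
Proof. by rewrite /polar exprMn expiX rmorphXn. Qed.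

Lemma conjc_polar r th : conjc (polar (r, th)) = polar (r, - th).
Proof. by rewrite /polar conjcM conjc_expi; congr (_ * _); apply: complex_ext; rewrite /= ?oppr0. Qed.

(** For either sign of [k], [z ^ npart k * conj z ^ ppart k] is [|z| ^ |k|
    * e ^ (- i k theta)]. *)
Definition npart k : nat := if (0 <= k)%R then 0%N else `|k|%N.
Definition ppart k : nat := if (0 <= k)%R then `|k|%N else 0%N.

Lemma npartD k : (npart k + ppart k)%N = `|k|%N.
Proof. by rewrite /npart /ppart; case: ifP => _; rewrite ?add0n ?addn0. Qed.

Lemma npart_ppart0 k : npart k = 0%N \/ ppart k = 0%N.
Proof. by rewrite /npart /ppart; case: ifP => _; [left|right]. Qed.

Lemma part_intr k : (npart k)%:R - (ppart k)%:R = - k%:~R :> R.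
Proof.
rewrite /npart /ppart; case: ifP => h; first by rewrite sub0r -[in RHS](gez0_abs h).
rewrite subr0 -[in RHS](opprK k) rmorphN opprK -ltz0_abs //; lia.
Qed.

(** Compensates the factor [|z| ^ |k|] of [z ^ npart k * conj z ^ ppart k]. *)
Definition unmod k xi t : R[i] := (expR (- (`|k|%N%:R) * t))%:C * xi t.

(** Integration against this function, which is [xi (ln r) * e ^ (- i k
    theta)], extracts the mode [k]. *)
Definition mode_test k xi : R[i] -> R[i] := mono (npart k) (ppart k) (unmod k xi).

Lemma mono_polar a b chi r th : 0 < r -> mono a b chi (polar (r, th)) =
  (r ^+ (a + b))%:C * chi (ln r) * expi ((a%:R - b%:R) * th).
Proof.
move=> r0; rewrite /mono (negbTE (polar_neq0 th r0)) conjc_polar !polarX /lnmod modulus_polar ?ltW //.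
rewrite exprD rmorphM mulrBl expiD -[- (b%:R * th)]mulrN /=.
move: (chi _) (expi _) (expi _) (_)%:C (_)%:C => *; ring.
Qed.

Lemma mode_test_polar k xi r th : 0 < r ->
  mode_test k xi (polar (r, th)) = xi (ln r) * expi (- (k%:~R * th)).
Proof.
move=> r0; rewrite /mode_test mono_polar // npartD part_intr mulNr; congr (_ * _).
rewrite /unmod mulrA -rmorphM mulNr expRN expRM_natl lnK ?posrE // mulfV ?mul1r //.
by rewrite expf_neq0 // gt_eqF.
Qed.

Lemma cder_radial_der (dchi : R -> R[i]) d t : cder dchi t d ->
  cder (radial_der dchi) t ((2^-1 * expR (- (2 * t)))%:C * (d - 2 * dchi t)).
Proof.
move=> hd; have h := cderM (cderZ 2^-1%:C (cder_real (is_derive_expRZ (-2) t))) hd.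
have e : radial_der dchi = fun t => 2^-1%:C * (expR ((-2) * t))%:C * dchi t.
  by apply/funext => s; rewrite /radial_der rmorphM mulNr.
rewrite e; apply: cder_eq h; rewrite -mulNr !rmorphM /=.
have -> : (-2 : R)%:C = -2 :> R[i] by rewrite -(real_complexN 2) rmorphN.
move: (expR _)%:C (dchi t) (2^-1)%:C => E x q; ring.
Qed.

(** Powers of [z], and powers of [conj z], are harmonic: second derivatives
    only fall on the radial factor. *)
Lemma laplace_mono a b lo hi chi dchi ddchi z : a = 0%N \/ b = 0%N -> supported lo hi chi ->
  (forall t, cder chi t (dchi t)) -> (forall t, cder dchi t (ddchi t)) -> z != 0 ->
  d_x (d_xbar (mono a b chi)) z =
  (4^-1 * expR (- (2 * lnmod z)))%:C *
    (ddchi (lnmod z) + 2 * (a + b)%:R * dchi (lnmod z)) * z ^+ a * conjc z ^+ b.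
Proof.
move=> ab hs h1 h2 z0.
pose dchi1 t := (2^-1 * expR (- (2 * t)))%:C * (ddchi t - 2 * dchi t).
have hd1 t : cder (radial_der dchi) t (dchi1 t) by exact: cder_radial_der.
have s1 := supported_radial (supported_der hs h1).
have w1 := wder_mono a b hs h1.
have w2 := wder_mono a.+1 b s1 hd1.
have w3 := wderD w2 (wderZ b%:R (wder_mono a b.-1 hs h1)).
rewrite (wder_d_xbar w1) (wder_d_x w3) /mono (negbTE z0) /radial_der /dchi1.
have e : z * conjc z * (2^-1 * expR (- (2 * lnmod z)))%:C = 2^-1%:C.
  have -> : z * conjc z = (modulus z ^+ 2)%:C.
    by rewrite modulus_sqr; case: (z) => x y; apply: complex_ext => /=; ring.
  rewrite -rmorphM; congr (_ %:C).
  rewrite expRN expR2 lnK ?posrE ?modulus_gt0 // mulrCA mulfV ?mulr1 //.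
  by rewrite expf_neq0 // modulus_eq0.
have e4 : (4^-1 * expR (- (2 * lnmod z)))%:C = 2^-1%:C * (2^-1 * expR (- (2 * lnmod z)))%:C.
  by rewrite -rmorphM; congr (_ %:C); rewrite mulrA; congr (_ * _); field.
rewrite e4; move: (conjc z) (2^-1 * expR _)%:C (chi _) (dchi _) (ddchi _) e => cz E X dX ddX e.
have e2 : 2 * 2^-1%:C = 1 :> R[i] by rewrite -(real_complexN 2) -rmorphM mulfV.
move: (2^-1)%:C e2 e => q e2 e; have {}e2 : 1 - 2 * q = 0 by rewrite e2 subrr.
have {}e : z * cz * E - q = 0 by rewrite e subrr.
case: ab => ->.
  case: b {w1 w2 w3} => [|b] /=.
    transitivity (q * E * (ddX + 2 * (0 + 0)%:R * dX) * z ^+ 0 * cz ^+ 0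
      + (z * cz * E - q) * (E * (ddX - 2 * dX)) + (1 - 2 * q) * (E * dX)); first ring.
    by rewrite e e2 !mul0r !addr0.
  transitivity (q * E * (ddX + 2 * (0 + b.+1)%:R * dX) * z ^+ 0 * cz ^+ b.+1
    + (z * cz * E - q) * (E * (ddX - 2 * dX) * cz ^+ b.+1)
    + (1 - 2 * q) * ((1 + b.+1%:R) * E * dX * cz ^+ b.+1)); first by rewrite !exprS; ring.
  by rewrite e e2 !mul0r !addr0.
transitivity (q * E * (ddX + 2 * (a + 0)%:R * dX) * z ^+ a * cz ^+ 0
    + (z * cz * E - q) * (E * (ddX - 2 * dX) * z ^+ a)
    + (1 - 2 * q) * ((1 + a%:R) * E * dX * z ^+ a)); first by rewrite !exprS; ring.
by rewrite e e2 !mul0r !addr0.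
Qed.

Lemma supported_unmod k lo hi xi : supported lo hi xi -> supported lo hi (unmod k xi).
Proof. by move=> h; exact: supportedM. Qed.

Lemma mode_test_lcomb k lo hi xi : supported lo hi xi -> csmooth xi ->
  lcomb lo hi (mode_test k xi).
Proof.
move=> hs hc; apply: lcomb_mono; first exact: supported_unmod.
exact: (csmoothM (csmooth_exp _) hc).
Qed.

(** The conformal factor of the metric cancels the area density: in the
    coordinates [(ln r, theta)] the measure [Delta (phi) dA] comes from the
    flat Laplacian. *)
Lemma laplacian_mode_test n k lo hi xi dxi ddxi r th : (0 < n)%N -> supported lo hi xi ->
  (forall t, cder xi t (dxi t)) -> (forall t, cder dxi t (ddxi t)) -> 0 < r ->
  laplacian n (mode_test k xi) (polar (r, th)) * (area_density n r)%:C =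
  - (ddxi (ln r) - (`|k|%N%:R ^+ 2)%:C * xi (ln r)) * (r^-1)%:C * expi (- (k%:~R * th)).
Proof.
move=> n0 hs h1 h2 r0.
pose N : R := `|k|%N%:R.
pose du t := (expR (- N * t))%:C * (dxi t - N%:C * xi t).
pose ddu t := (expR (- N * t))%:C * (ddxi t - 2 * N%:C * dxi t + N%:C ^+ 2 * xi t).
have hE t := cder_real (is_derive_expRZ (- N) t).
have hu t : cder (unmod k xi) t (du t).
  apply: cder_eq (cderM (hE t) (h1 t)); rewrite /du rmorphM rmorphN /=.
  move: (expR _)%:C N%:C (xi t) (dxi t) => *; ring.
have hdu t : cder du t (ddu t).
  apply: cder_eq (cderM (hE t) (cderB (h2 t) (cderZ N%:C (h1 t)))).
  rewrite /ddu rmorphM rmorphN /=.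
  move: (expR _)%:C N%:C (xi t) (dxi t) (ddxi t) => *; ring.
have z0 := polar_neq0 th r0.
rewrite /laplacian (laplace_mono (npart_ppart0 k) (supported_unmod k hs) hu hdu z0).
rewrite conjc_polar !polarX npartD.
rewrite /lnmod modulus_polar ?(ltW r0) // /ddu /du.
have -> : expi (- (k%:~R * th)) = expi ((npart k)%:R * th) * expi ((ppart k)%:R * - th).
  by rewrite -expiD mulrN -mulrBl part_intr mulNr.
move: (expi _) (expi _) => e1 e2.
have -> : (`|k|%N%:R : R[i]) = N%:C by rewrite /N real_complexN.
have rr : (r ^+ npart k)%:C * (r ^+ ppart k)%:C * (expR (- N * ln r))%:C = 1 :> R[i].
  rewrite -!rmorphM -exprD npartD mulNr expRN expRM_natl lnK ?posrE // mulfV //.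
  by rewrite expf_neq0 // gt_eqF.
have re : (expR (- (2 * ln r))) = r ^- 2.
  by rewrite expRN expR2 lnK ?posrE.
rewrite re normCE modulus_polar ?(ltW r0) //.
move: (expR (- N * ln r))%:C (xi (ln r)) (dxi (ln r)) (ddxi (ln r)) rr => E X dX ddX.
move: (r ^+ npart k)%:C (r ^+ ppart k)%:C => p1 p2 rr.
have key : - ((1 + r%:C ^+ (2 * n)) ^+ 2 / (n%:R ^+ 2 * r%:C ^+ (2 * n - 2))) * (4^-1 * r ^- 2)%:C
   * (area_density n r)%:C = - (r^-1)%:C :> R[i].
  rewrite -(real_complexN n) -!rmorphXn -rmorphM -[1](rmorph1 (real_complex R)) -rmorphD -rmorphXn.
  rewrite -fmorphV -rmorphM -rmorphN -!rmorphM -rmorphN; congr (_ %:C).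
  rewrite /area_density.
  have [m ->] : exists m, n = m.+1 by exists n.-1; rewrite prednK.
  have -> : (2 * m.+1 - 2 = 2 * m)%N by lia.
  have -> : (2 * m.+1 - 1 = (2 * m).+1)%N by lia.
  have d0 : 1 + r ^+ (2 * m.+1) != 0 by rewrite gt_eqF // addr_gt0 // exprn_gt0.
  have q0 : r ^+ (2 * m) != 0 by rewrite expf_neq0 // gt_eqF.
  have r1 : r != 0 by rewrite gt_eqF.
  have m0 : (m.+1%:R : R) != 0 by rewrite pnatr_eq0.
  rewrite [X in X * r ^+ (2 * m)](_ : _ = m.+1%:R ^+ 2); last by rewrite rmorphXn.
  rewrite (exprS r (2 * m)); move: (r ^+ (2 * m)) (r ^+ (2 * m.+1)) (m.+1%:R) d0 q0 m0 => q d mm d0 q0 m0.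
  by field; rewrite d0 q0 r1 m0.
rewrite rmorphXn /=.
move: key; move: (- (_ / _)) (4^-1 * r ^- 2)%:C (area_density n r)%:C (r^-1)%:C => c1 c2 c3 c4 key.
transitivity (c1 * c2 * c3 * (p1 * p2 * E) * (ddX - N%:C ^+ 2 * X) * (e1 * e2)).
  move: N%:C => M; ring.
by rewrite rr key mulr1; move: N%:C => M; ring.
Qed.

End PolarModes.

(** * Integrals of complex functions *)

Section ComplexIntegral.
Context {R : realType} d (T : measurableType d) (mu : {measure set T -> \bar R}).
Implicit Types (D : set T) (f g : T -> R[i]).

Definition cmeasurable D f : Prop :=
  measurable_fun D (fun t => complex.Re (f t)) /\ measurable_fun D (fun t => complex.Im (f t)).

Definition cintegrable D f : Prop :=
  mu.-integrable D (EFin \o (fun t => complex.Re (f t))) /\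
  mu.-integrable D (EFin \o (fun t => complex.Im (f t))).

Lemma eq_cintegral D f g : {in D, f =1 g} -> cintegral mu D f = cintegral mu D g.
Proof.
by move=> fg; rewrite /cintegral; congr (_ +i* _); apply: eq_Rintegral => x xD; rewrite fg.
Qed.

Lemma eq_cintegrable D f g : measurable D -> {in D, f =1 g} -> cintegrable D f -> cintegrable D g.
Proof.
move=> mD fg [h1 h2]; split.
  by move: h1; apply: eq_integrable => // x xD /=; rewrite fg.
by move: h2; apply: eq_integrable => // x xD /=; rewrite fg.
Qed.

Lemma cintegralD D f g : measurable D -> cintegrable D f -> cintegrable D g ->
  cintegral mu D (fun t => f t + g t) = cintegral mu D f + cintegral mu D g.
Proof.
move=> mD [h1 h2] [h3 h4]; apply: complex_ext => /=.
  by rewrite -RintegralD //; apply: eq_Rintegral => x _; rewrite cReD.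
by rewrite -RintegralD //; apply: eq_Rintegral => x _; rewrite cImD.
Qed.

Lemma integrableZD D (a b : R) (f1 f2 : T -> R) : measurable D ->
  mu.-integrable D (EFin \o f1) -> mu.-integrable D (EFin \o f2) ->
  mu.-integrable D (EFin \o (fun t => f1 t * a + f2 t * b)).
Proof.
move=> mD h1 h2.
have := integrableD mD (integrableZl mD a h1) (integrableZl mD b h2).
apply: eq_integrable => // x _ /=; rewrite EFinD !EFinM.
by rewrite muleC [(b%:E * _)%E]muleC.
Qed.

Lemma RintegralZD D (a b : R) (f1 f2 : T -> R) : measurable D ->
  mu.-integrable D (EFin \o f1) -> mu.-integrable D (EFin \o f2) ->
  Rintegral mu D (fun t => f1 t * a + f2 t * b) = Rintegral mu D f1 * a + Rintegral mu D f2 * b.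
Proof.
move=> mD h1 h2.
have i0 (c : R) (h : T -> R) : mu.-integrable D (EFin \o h) ->
    mu.-integrable D (EFin \o (fun t => h t * c)).
  move=> hh; have := integrableZl mD c hh; apply: eq_integrable => // x _ /=.
  by rewrite EFinM muleC.
by rewrite RintegralD ?RintegralZr //; exact: i0.
Qed.

Lemma cintegrableD D f g : measurable D -> cintegrable D f -> cintegrable D g ->
  cintegrable D (fun t => f t + g t).
Proof.
move=> mD [h1 h2] [h3 h4]; split.
  have := integrableD mD h1 h3; apply: eq_integrable => // x _ /=.
  by rewrite cReD EFinD.
have := integrableD mD h2 h4; apply: eq_integrable => // x _ /=.
by rewrite cImD EFinD.
Qed.

Lemma cintegrableZ D c f : measurable D -> cintegrable D f -> cintegrable D (fun t => f t * c).
Proof.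
move=> mD [h1 h2]; split.
  have := integrableZD (complex.Re c) (- complex.Im c) mD h1 h2.
  by apply: eq_integrable => // x _ /=; rewrite cReM mulrN.
have := integrableZD (complex.Im c) (complex.Re c) mD h1 h2.
by apply: eq_integrable => // x _ /=; rewrite cImM addrC.
Qed.

Lemma cintegralZ D c f : measurable D -> cintegrable D f ->
  cintegral mu D (fun t => f t * c) = cintegral mu D f * c.
Proof.
move=> mD [h1 h2]; apply: complex_ext.
  rewrite cReM /= -mulrN -RintegralZD //.
  by apply: eq_Rintegral => x _; rewrite cReM mulrN.
rewrite cImM /= addrC -RintegralZD //.
by apply: eq_Rintegral => x _; rewrite cImM addrC.
Qed.

(** For [c = 0] both sides vanish, and otherwise [f] itself is integrable. *)
Lemma cintegralZ_weak D c f : measurable D -> cintegrable D (fun t => f t * c) ->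
  cintegral mu D (fun t => f t * c) = cintegral mu D f * c.
Proof.
move=> mD hf; have [c0|c0] := eqVneq c 0.
  rewrite c0 mulr0 (eq_cintegral (g := fun=> 0)).
    by rewrite /cintegral /= Rintegral_cst // mul0r.
  by move=> t _; rewrite mulr0.
apply: cintegralZ => //.
apply: (eq_cintegrable (f := fun t => f t * c * c^-1)) => //.
  by move=> t _; rewrite mulfK.
exact: cintegrableZ.
Qed.

Lemma cintegralB D f g : measurable D -> cintegrable D f -> cintegrable D g ->
  cintegral mu D (fun t => f t - g t) = cintegral mu D f - cintegral mu D g.
Proof.
move=> mD hf hg; rewrite -[X in _ = _ + X]mulrN1 -cintegralZ // -cintegralD //.
  by apply: eq_cintegral => t _; rewrite mulrN1.
exact: cintegrableZ.
Qed.

Lemma cmeasurableM D f g : cmeasurable D f -> cmeasurable D g -> cmeasurable D (fun t => f t * g t).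
Proof.
move=> [h1 h2] [h3 h4]; split.
  rewrite (_ : (fun t => _) =
    ((fun t => complex.Re (f t)) \* (fun t => complex.Re (g t)))
    \- ((fun t => complex.Im (f t)) \* (fun t => complex.Im (g t)))).
    by apply: measurable_funB; exact: measurable_funM.
  by apply/funext => t; rewrite cReM.
rewrite (_ : (fun t => _) =
    ((fun t => complex.Im (f t)) \* (fun t => complex.Re (g t)))
    \+ ((fun t => complex.Re (f t)) \* (fun t => complex.Im (g t)))).
  by apply: measurable_funD; exact: measurable_funM.
by apply/funext => t; rewrite cImM /=; ring.
Qed.

Lemma cintegrable_le D f (g : T -> R) : measurable D -> cmeasurable D f ->
  mu.-integrable D (EFin \o g) -> (forall t, D t -> modulus (f t) <= g t) -> cintegrable D f.
Proof.
move=> mD [h1 h2] hg hle; split.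
  apply: (le_integrable mD _ _ hg); first exact/measurable_EFinP.
  move=> t Dt; rewrite /= lee_fin; apply: le_trans (modulus_Re _) _.
  by apply: le_trans (hle t Dt) _; exact: ler_norm.
apply: (le_integrable mD _ _ hg); first exact/measurable_EFinP.
move=> t Dt; rewrite /= lee_fin; apply: le_trans (modulus_Im _) _.
by apply: le_trans (hle t Dt) _; exact: ler_norm.
Qed.

End ComplexIntegral.

Section FubiniRectangle.
Context {R : realType}.
Local Notation leb := (@lebesgue_measure R).
Local Notation leb2 := (leb \x leb)%E.
Variables (A B : set (measurableTypeR R)).
Hypotheses (mA : measurable A) (mB : measurable B).

Section RealFubini.
Variable h : measurableTypeR R * measurableTypeR R -> R.
Hypothesis ih : leb2.-integrable (A `*` B) (EFin \o h).

Let H := (EFin \o h) \_ (A `*` B).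

Let imf : leb2.-integrable setT H.
Proof. exact: (integrable_mkcond _ (measurableX mA mB)).1 ih. Qed.

Let sliceE x : A x -> (fun y => H (x, y)) = (fun y => (h (x, y))%:E) \_ B.
Proof.
move=> Ax; apply/funext => y; rewrite /H !patchE.
have -> : ((x, y) \in A `*` B) = (y \in B) by apply/idP/idP; rewrite !inE /=; [case|split].
by [].
Qed.

Let FE : fubini_F leb H = (fun x => \int[leb]_(y in B) (h (x, y))%:E)%E \_ A.
Proof.
apply/funext => x; rewrite /fubini_F patchE; case: ifPn => [|/negP xA].
  by rewrite inE => Ax; rewrite [RHS]integral_mkcond -sliceE.
rewrite integral0_eq // => y _; rewrite /H patchE ifF //.
by apply/negP; rewrite inE /= => -[Ax _]; apply: xA; rewrite inE.
Qed.

Let iF : leb.-integrable A (fun x => \int[leb]_(y in B) (h (x, y))%:E)%E.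
Proof. by apply: (integrable_mkcond _ mA).2; rewrite -FE; exact: (integrable_fubini_F imf). Qed.

Lemma fubini_slice : {ae leb, forall x, A x -> leb.-integrable B (EFin \o (fun y => h (x, y)))}.
Proof.
apply: filterS (ae_integrable1 imf) => x hx Ax.
by apply: (integrable_mkcond _ mB).2; rewrite -(sliceE Ax).
Qed.

Lemma fubini_integrable :
  leb.-integrable A (EFin \o (fun x => Rintegral leb B (fun y => h (x, y)))).
Proof.
apply: (le_integrable mA _ _ iF).
  apply/measurable_EFinP; apply: (measurableT_comp (fine_measurable measurableT)).
  exact: (measurable_int _ iF).
move=> x _ /=; rewrite /Rintegral.
by case: (\int[leb]_(y in B) (h (x, y))%:E)%E => [r| |] //=; rewrite normr0 leey.
Qed.

Lemma fubini_Rintegral : Rintegral leb2 (A `*` B) h =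
  Rintegral leb A (fun x => Rintegral leb B (fun y => h (x, y))).
Proof.
rewrite {1 2}/Rintegral integral_mkcond -(integral12_prod_meas1 imf); congr fine.
have -> : (\int[leb]_x fubini_F leb H x)%E =
    (\int[leb]_(x in A) (\int[leb]_(y in B) (h (x, y))%:E))%E.
  by rewrite FE -integral_mkcond.
apply: ae_eq_integral => //; first exact: (measurable_int _ iF).
  exact: (measurable_int _ fubini_integrable).
apply: filterS (integrable_ae mA iF) => x hx Ax /=.
by rewrite /Rintegral fineK // hx.
Qed.

End RealFubini.

Variable f : measurableTypeR R * measurableTypeR R -> R[i].
Hypothesis intf : cintegrable leb2 (A `*` B) f.

Lemma cfubini_slice : {ae leb, forall x, A x -> cintegrable leb B (fun y => f (x, y))}.
Proof.
have [h1 h2] := intf.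
by apply: filterS2 (fubini_slice h1) (fubini_slice h2) => x k1 k2 Ax; split; [exact: k1|exact: k2].
Qed.

Lemma cfubini_integrable : cintegrable leb A (fun x => cintegral leb B (fun y => f (x, y))).
Proof. by have [h1 h2] := intf; split; exact: (fubini_integrable (h := fun p => _ (f p))). Qed.

Lemma cfubini : cintegral leb2 (A `*` B) f =
  cintegral leb A (fun x => cintegral leb B (fun y => f (x, y))).
Proof.
have [h1 h2] := intf; rewrite /cintegral /=; congr (_ +i* _).
  exact: (fubini_Rintegral h1).
exact: (fubini_Rintegral h2).
Qed.

End FubiniRectangle.

Section AeEqual.
Context {R : realType} d (T : measurableType d) (mu : {measure set T -> \bar R}).

Lemma cintegral_ae_eq (D : set T) (f g : T -> R[i]) : measurable D ->
  cintegrable mu D f -> cintegrable mu D g -> {ae mu, forall x, D x -> f x = g x} ->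
  cintegral mu D f = cintegral mu D g.
Proof.
move=> mD [h1 h2] [h3 h4] hae; rewrite /cintegral /Rintegral; congr (fine _ +i* fine _).
  apply: ae_eq_integral => //; [exact: (measurable_int _ h1)|exact: (measurable_int _ h3)|].
  by apply: filterS hae => x hx Dx; rewrite hx.
apply: ae_eq_integral => //; [exact: (measurable_int _ h2)|exact: (measurable_int _ h4)|].
by apply: filterS hae => x hx Dx; rewrite hx.
Qed.
End AeEqual.

(** * The radial equation in weak form *)

Section RadialWeak.
Context {R : realType}.
Local Notation leb := (@lebesgue_measure R).
Local Notation leb2 := (leb \x leb)%E.
Local Notation half := (`]0, +oo[%classic : set (measurableTypeR R)).
Local Notation circ := (`[0, 2 * pi]%classic : set (measurableTypeR R)).
Variables (n : nat) (k : int) (u : R[i] -> R[i]).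
Hypotheses (n0 : (0 < n)%N) (hu : L2 n u).

Local Notation F := (fourier u k).
Let e (th : R) : R[i] := expi (- (k%:~R * th)).

(** Radial amplitudes against which [u] is integrable for [dr dtheta]:
    their support avoids [0] and [oo], where the area density degenerates. *)
Definition radial_amp (a b C : R) (P : R -> R[i]) : Prop :=
  [/\ cmeasurable half P, forall r, 0 < r -> modulus (P r) <= C
    & forall r, 0 < r -> ~~ (a <= r <= b) -> P r = 0].

Lemma continuous_area_density : continuous (area_density n : R -> R).
Proof.
move=> r; have hX m : (fun x : R => x ^+ m) @ r --> r ^+ m by exact: exprn_continuous.
have hd : (fun x : R => (1 + x ^+ (2 * n)) ^+ 2) @ r --> (1 + r ^+ (2 * n)) ^+ 2.
  have h1 : (fun x : R => 1 + x ^+ (2 * n)) @ r --> 1 + r ^+ (2 * n).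
    by apply: cvgD; [exact: cvg_cst|exact: hX].
  exact: (cvgM h1 h1).
apply: cvgM; first by apply: cvgM; [exact: cvg_cst|exact: hX].
apply: cvgV hd; rewrite expf_neq0 // gt_eqF // ltr_pwDl // mulnC exprM sqr_ge0 //.
Qed.

Lemma measurable_fst_half (f : R -> R) : measurable_fun half f ->
  measurable_fun (polar_dom : set (measurableTypeR R * measurableTypeR R)) (fun p => f p.1).
Proof.
move=> mf; apply: (measurable_comp (F := half) _ _ mf) => //.
  by move=> _ [p [p1 _] <-].
exact: (measurable_funTS measurable_fst).
Qed.

Lemma measurable_snd_circ (f : R -> R) : measurable_fun setT f ->
  measurable_fun (polar_dom : set (measurableTypeR R * measurableTypeR R)) (fun p => f p.2).
Proof. by move=> mf; apply: measurable_funTS; apply: (measurableT_comp mf). Qed.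

Lemma measurable_polar_dom : measurable (polar_dom : set (measurableTypeR R * measurableTypeR R)).
Proof. exact: measurableX. Qed.

Lemma cmeasurable_mode :
  cmeasurable (polar_dom : set (measurableTypeR R * measurableTypeR R)) (fun p => e p.2).
Proof.
have cs (f : R -> R) : continuous f -> measurable_fun
   (polar_dom : set (measurableTypeR R * measurableTypeR R)) (fun p => f (- (k%:~R * p.2))).
  move=> cf; apply: (@measurable_snd_circ (fun x => f (- (k%:~R * x)))).
  apply: continuous_measurable_fun => x; apply: (@continuous_comp _ _ _ (fun x : R => - (k%:~R * x)) f).
    by apply: cvgN; apply: cvgM; [exact: cvg_cst|exact: cvg_id].
  exact: cf.
split; rewrite /e /expi /=.
  by apply: (cs (@cos R)); exact: continuous_cos.
by apply: (cs (@sin R)); exact: continuous_sin.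
Qed.

Lemma integrable_L2 : leb2.-integrable polar_dom
  (EFin \o (fun p => modulus (u (polar p)) ^+ 2 * area_density n p.1)).
Proof.
have [h1 h2 h3] := hu; apply/integrableP; split.
  apply/measurable_EFinP; apply: measurable_funM.
    rewrite (_ : (fun p => _) = (fun p => complex.Re (u (polar p)) ^+ 2) \+ (fun p => complex.Im (u (polar p)) ^+ 2)).
      by apply: measurable_funD; exact: measurable_funX.
    by apply/funext => p; rewrite modulus_sqr.
  apply: measurable_fst_half; apply: measurable_funTS.
  exact: continuous_measurable_fun continuous_area_density.
apply: le_lt_trans h3; rewrite le_eqVlt; apply/orP; left; apply/eqP.
apply: eq_integral => p; rewrite inE => -[/= p1 _].
rewrite ger0_norm // mulr_ge0 ?sqr_ge0 // /area_density.
move: p1; rewrite in_itv /= andbT => p1.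
by rewrite divr_ge0 ?sqr_ge0 // mulr_ge0 ?exprn_ge0 ?(ltW p1) // mulr_ge0 ?sqr_ge0.
Qed.

Lemma integrable_annulus a b : leb2.-integrable polar_dom
  (EFin \o (\1_(`[a, b] `*` circ) : measurableTypeR R * measurableTypeR R -> R)).
Proof.
apply: (integrableS measurableT measurable_polar_dom (@subsetT _ _)).
pose E : set (measurableTypeR R * measurableTypeR R) := `[a, b]%classic `*` circ.
have mE : measurable E by exact: measurableX.
apply/integrableP; split; first exact/measurable_EFinP/measurable_indic.
rewrite (eq_integral (fun x => (\1_E x)%:E)); last first.
  by move=> t _; rewrite gee0_abs // lee_fin.
rewrite integral_indic // setIT.
suff h : (leb2 E < +oo)%E by exact: h.
have -> : leb2 E = (leb (`[a, b]%classic : set R) * leb (`[0%R, (2 * pi)%R]%classic : set R))%E.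
  exact: product_measure1E.
rewrite !lebesgue_measure_itv /= !lte_fin.
by case: ifP => _; case: ifP => _; rewrite -?EFinB ?mule0 ?mul0e // -EFinM ltry.
Qed.

Lemma area_density_lower (a b r : R) : 0 < a -> a <= r <= b ->
  0 < 4 * n%:R ^+ 2 * a ^+ (2 * n - 1) / (1 + b ^+ (2 * n)) ^+ 2 <= area_density n r.
Proof.
move=> a0 /andP[ar rb]; have r0 := lt_le_trans a0 ar; have b0 := lt_le_trans r0 rb.
have d0 (x : R) : 0 < x -> 0 < 1 + x ^+ (2 * n) by move=> x0; rewrite addr_gt0 // exprn_gt0.
apply/andP; split.
  by rewrite divr_gt0 ?exprn_gt0 ?d0 // mulr_gt0 ?exprn_gt0 // mulr_gt0 ?exprn_gt0 // ltr0n.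
apply: ler_pM.
- by rewrite mulr_ge0 ?exprn_ge0 ?(ltW a0) // mulr_ge0 ?exprn_ge0.
- by rewrite invr_ge0 exprn_ge0 // (ltW (d0 _ b0)).
- by rewrite ler_wpM2l ?mulr_ge0 ?exprn_ge0 // lerXn2r ?nnegrE ?(ltW a0) ?(ltW r0).
- rewrite lef_pV2 ?posrE ?exprn_gt0 ?d0 // lerXn2r ?nnegrE ?(ltW (d0 _ r0)) ?(ltW (d0 _ b0)) // lerD2l.
  by rewrite lerXn2r ?nnegrE ?(ltW b0) ?(ltW r0).
Qed.

(** On an annulus the area density is bounded below, and [|u| <= 1 + |u| ^
    2]. *)
Lemma annulus_cintegrable (a b C : R) (P : R -> R[i]) : 0 < a -> radial_amp a b C P ->
  cintegrable leb2 polar_dom (fun p => u (polar p) * e p.2 * P p.1).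
Proof.
move=> a0 [mP bP sP]; have [h1 h2 _] := hu.
have C0 : 0 <= C by apply: le_trans (bP 1 ltr01); exact: modulus_ge0.
pose w0 := 4 * n%:R ^+ 2 * a ^+ (2 * n - 1) / (1 + b ^+ (2 * n)) ^+ 2.
pose g p := C * (\1_(`[a, b] `*` circ) : measurableTypeR R * measurableTypeR R -> R) p
  + (C / w0) * (modulus (u (polar p)) ^+ 2 * area_density n p.1).
have mpd := measurable_polar_dom.
have ig : leb2.-integrable polar_dom (EFin \o g).
  have := integrableD mpd (integrableZl mpd C (integrable_annulus a b)) (integrableZl mpd (C / w0) integrable_L2).
  by apply: eq_integrable => // p _ /=; rewrite /g EFinD !EFinM.
apply: (cintegrable_le mpd _ ig).
  apply: cmeasurableM; last first.
    by have [m1 m2] := mP; split; [exact: (@measurable_fst_half (fun r => complex.Re (P r)))|exact: (@measurable_fst_half (fun r => complex.Im (P r)))].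
  by apply: cmeasurableM; [split|exact: cmeasurable_mode].
move=> [r th] [/= hr hth]; move: (hr); rewrite in_itv /= andbT => r0.
have wr : 0 <= area_density n r.
  by rewrite divr_ge0 ?sqr_ge0 // mulr_ge0 ?exprn_ge0 ?(ltW r0) // mulr_ge0 ?sqr_ge0.
rewrite /g /=; have [hab|hab] := boolP (a <= r <= b); last first.
  rewrite sP // mulr0 modulus0 indicE.
  have h : 0 <= (modulus (u (polar (r, th))) ^+ 2 * area_density n r) by rewrite mulr_ge0 ?sqr_ge0.
  have w0' : 0 <= w0.
    by rewrite divr_ge0 ?sqr_ge0 // mulr_ge0 ?exprn_ge0 ?(ltW a0) // mulr_ge0 ?sqr_ge0.
  by rewrite addr_ge0 // mulr_ge0 // divr_ge0.
have /andP[w0' wr'] := area_density_lower a0 hab.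
rewrite indicE mem_set /=; last by split => //=; rewrite in_itv.
rewrite !modulusM /e modulus_expi !mulr1 -/w0 in w0' wr' *.
move: (modulus_ge0 (u (polar (r, th)))) (modulus_ge0 (P r)) (bP r r0).
move: (modulus (u _)) (modulus (P r)) => x y x0 y0 yC.
have hx : x <= 1 + x ^+ 2 by nra.
have hxw : x ^+ 2 <= x ^+ 2 * (area_density n r / w0).
  by rewrite ler_peMr ?sqr_ge0 // ler_pdivlMr // mul1r.
have -> : C / w0 * (x ^+ 2 * area_density n r) = C * (x ^+ 2 * (area_density n r / w0)).
  by move: (w0^-1) (area_density n r) => i A; ring.
by nra.
Qed.

Lemma fourierE r : 2 * pi != 0 :> R ->
  cintegral leb circ (fun th => u (polar (r, th)) * e th) = (2 * pi)%:C * F r.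
Proof.
move=> p0; rewrite /fourier mulrA -rmorphM mulfV // mul1r.
by apply: eq_cintegral.
Qed.

Let pi2 : 2 * pi != 0 :> R.
Proof. by rewrite mulf_neq0 // gt_eqF // pi_gt0. Qed.

Lemma fourier_annulus (a b : R) : 0 < a ->
  cintegrable leb half (fun r => F r * (\1_(`[a, b]%classic) r)%:C).
Proof.
move=> a0; pose P r : R[i] := (\1_(`[a, b]%classic) r)%:C.
have hP : radial_amp a b 1 P.
  split.
  - split; last exact: measurable_cst.
    by apply: measurable_funTS; exact: measurable_indic.
  - by move=> r _; rewrite modulusR indicE; case: (_ \in _); rewrite ?normr1 ?normr0.
  - by move=> r _ hr; rewrite /P indicE memNset //= in_itv /=; exact/negP.
have mh : measurable half by [].
have mc : measurable circ by [].
have h := cfubini_integrable mh mc (annulus_cintegrable a0 hP).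
have h' := cintegrableZ (2 * pi)^-1%:C mh h.
apply: (eq_cintegrable mh _ h') => r _; rewrite /= /P indicE.
case: (r \in _); last first.
  by rewrite mulr0 (eq_cintegral leb (g := fun=> 0)) => [|th _]; rewrite ?mulr0 // /cintegral Rintegral_cst // !mul0r.
rewrite mulr1 (eq_cintegral leb (g := fun th => u (polar (r, th)) * e th)) => [|th _]; last by rewrite mulr1.
by rewrite fourierE // mulrC mulrA -rmorphM mulVf // mul1r.
Qed.

Lemma fourier_amp (a b C : R) (P : R -> R[i]) : 0 < a -> radial_amp a b C P -> cintegrable leb half (fun r => F r * P r).
Proof.
move=> a0 [mP bP sP]; have mh : measurable half by [].
have [i1 i2] := fourier_annulus b a0.
have C0 : 0 <= C by apply: le_trans (bP 1 ltr01); exact: modulus_ge0.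
have eF r : 0 < r -> F r * P r = F r * (\1_(`[a, b]%classic) r)%:C * P r.
  move=> r0; rewrite indicE; have [hab|hab] := boolP (a <= r <= b).
    by rewrite mem_set ?mulr1 //= in_itv.
  by rewrite sP // !mulr0.
pose f r := F r * (\1_(`[a, b]%classic) r)%:C : R[i].
pose g r := C * (`|complex.Re (f r)| + `|complex.Im (f r)|).
have ig : leb.-integrable half (EFin \o g).
  have := integrableZl mh C (integrableD mh (integrable_abse i1) (integrable_abse i2)).
  by apply: eq_integrable.
have mf : cmeasurable half f by split; apply/measurable_EFinP; [exact: (measurable_int _ i1)|exact: (measurable_int _ i2)].
have hh : cintegrable leb half (fun r => f r * P r).
  apply: (cintegrable_le mh (cmeasurableM mf mP) ig) => r; rewrite /= in_itv /= andbT => r0.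
  rewrite modulusM /g mulrC; apply: ler_pM; rewrite ?modulus_ge0 ?bP //; exact: modulus_le_ReIm.
apply: (eq_cintegrable mh _ hh) => r; rewrite inE /= in_itv /= andbT => r0.
by rewrite eF.
Qed.

(** By the theorem of Fubini, since the angular integral is the Fourier
    mode. *)
Lemma annulus_cintegral (a b C : R) (P : R -> R[i]) : 0 < a -> radial_amp a b C P ->
  cintegral leb2 polar_dom (fun p => u (polar p) * e p.2 * P p.1) =
  (2 * pi)%:C * cintegral leb half (fun r => F r * P r).
Proof.
move=> a0 hP; have hi := annulus_cintegrable a0 hP.
have mh : measurable half by [].
have mc : measurable circ by [].
rewrite (cfubini mh mc hi) [RHS]mulrC -cintegralZ //; last exact: (fourier_amp a0 hP).
apply: cintegral_ae_eq => //.
- exact: (cfubini_integrable mh mc hi).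
- by apply: cintegrableZ => //; exact: (fourier_amp a0 hP).
apply: filterS (cfubini_slice mh mc hi) => r hr Hr.
have hz := @cintegralZ_weak R _ _ leb circ (P r) (fun th => u (polar (r, th)) * e th) mc (hr Hr).
rewrite [LHS]hz fourierE //; move: (F r) (P r) ((2 * pi)%:C : R[i]) => x y z; ring.
Qed.

(** The potential of the radial equation in [t = ln r]; for [lambda = nu
    (nu + 1)] it is [n ^ 2 * legq nu (|k| / n) (n t)]. *)
Definition qrad (lambda : R[i]) (t : R) : R[i] :=
  (`|k|%N%:R ^+ 2)%:C - lambda * ((n%:R * sech (n%:R * t)) ^+ 2)%:C.

#[local] Transparent sech.
Lemma area_density_sech (r : R) : 0 < r ->
  area_density n r = (n%:R * sech (n%:R * ln r)) ^+ 2 * r^-1.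
Proof.
move=> r0; rewrite /area_density /sech expR2 expRM_natl lnK ?posrE //.
have [m ->] : exists m, n = m.+1 by exists n.-1; rewrite prednK.
have -> : (2 * m.+1 - 1 = (2 * m).+1)%N by lia.
have -> : r ^+ (2 * m).+1 = r * (r ^+ m) ^+ 2 by rewrite exprS mulnC exprM.
have -> : r ^+ (2 * m.+1) = (r * r ^+ m) ^+ 2 by rewrite mulnC exprM (exprS r m).
rewrite !(exprS r m).
have d0 : 1 + (r * r ^+ m) ^+ 2 != 0 by rewrite gt_eqF // ltr_pwDl // sqr_ge0.
have r1 : r != 0 by rewrite gt_eqF.
move: (r ^+ m) (m.+1%:R) d0 => q mm d0.
by field; rewrite r1 d0.
Qed.
#[local] Opaque sech.

Lemma continuous_supported_bounded lo hi (p : R -> R[i]) : continuous p -> supported lo hi p ->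
  exists C, forall t, modulus (p t) <= C.
Proof.
move=> cp sp; have cm : continuous (modulus \o p).
  by move=> t; exact: (@cvg_modulus R _ (nbhs t) (nbhs_filter t) p (p t) (cp t)).
have [lh|lh] := leP lo hi; last first.
  exists 0 => t; rewrite sp ?modulus0 //; apply/negP => /andP[h1 h2].
  by have := le_lt_trans (le_trans h1 h2) lh; rewrite ltxx.
have [c _ hc] := EVT_max lh (continuous_subspaceT cm).
exists (modulus (p c)) => t; have [ht|ht] := boolP (lo <= t <= hi); last by rewrite sp // modulus0 modulus_ge0.
by apply: hc; rewrite in_itv.
Qed.

Lemma cmeasurable_ln (p : R -> R[i]) : continuous p -> cmeasurable half (fun r => p (ln r)).
Proof.
move=> cp; have cR : continuous (fun t => complex.Re (p t)).
  by move=> t; exact: ((@cvg_ReIm R _ (nbhs t) (nbhs_filter t) p (p t)).1 (cp t)).1.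
have cI : continuous (fun t => complex.Im (p t)).
  by move=> t; exact: ((@cvg_ReIm R _ (nbhs t) (nbhs_filter t) p (p t)).1 (cp t)).2.
split; apply: measurable_funTS.
  exact: (measurableT_comp (continuous_measurable_fun cR) (@measurable_ln R)).
exact: (measurableT_comp (continuous_measurable_fun cI) (@measurable_ln R)).
Qed.

Lemma measurable_inv_half : measurable_fun half (fun r : R => r^-1).
Proof.
apply: open_continuous_measurable_fun; first exact: interval_open.
move=> r; rewrite inE /= in_itv /= andbT => r0.
by apply: cvgV; [rewrite gt_eqF|exact: cvg_id].
Qed.

Lemma radial_amp_ln lo hi (p : R -> R[i]) : continuous p -> supported lo hi p ->
  exists C, radial_amp (expR lo) (expR hi) C (fun r => p (ln r) * (r^-1)%:C).
Proof.
move=> cp sp; have [C hC] := continuous_supported_bounded cp sp.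
have C0 : 0 <= C by apply: le_trans (hC 0); exact: modulus_ge0.
have sup r : 0 < r -> ~~ (expR lo <= r <= expR hi) -> p (ln r) = 0.
  move=> r0 hr; apply: sp; apply: contra hr => /andP[h1 h2].
  by rewrite -[X in _ <= X <= _]lnK ?posrE // !ler_expR h1.
exists (C / expR lo); split.
- apply: cmeasurableM; first exact: cmeasurable_ln.
  by split; [exact: measurable_inv_half|exact: measurable_cst].
- move=> r r0; have [hr|hr] := boolP (expR lo <= r <= expR hi); last first.
    by rewrite (sup r r0 hr) mul0r modulus0 divr_ge0 // expR_ge0.
  rewrite modulusM modulusR; apply: ler_pM => //; rewrite ?modulus_ge0 //.
  by rewrite ger0_norm ?invr_ge0 ?(ltW r0) // lef_pV2 ?posrE ?expR_gt0 //; case/andP: hr.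
- by move=> r r0 hr; rewrite (sup r r0 hr) mul0r.
Qed.

Lemma continuous_qrad lambda : continuous (qrad lambda).
Proof.
move=> t; have h : cder (qrad lambda) t (0 - lambda * (n%:R * (n%:R * - (sech (n%:R * t) * tnh (n%:R * t))) * (n%:R * sech (n%:R * t)) + n%:R * sech (n%:R * t) * (n%:R * (n%:R * - (sech (n%:R * t) * tnh (n%:R * t)))))%:C).
  apply: cderB; first exact: cder_cst.
  apply: cderZ; apply: cder_real.
  have h1 := is_derive1_comp (is_derive_sech (n%:R * t)) (is_deriveZ (n%:R : R) (is_derive_id t (1 : R))).
  have h2 : is_derive t 1 (fun t => n%:R * sech (n%:R * t)) (n%:R * (n%:R * - (sech (n%:R * t) * tnh (n%:R * t)))).
    have h := is_deriveM' (is_derive_cst (n%:R : R) t 1) h1.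
    apply: (is_derive_eq h); rewrite /= mul0r add0r; congr (_ * _).
    by rewrite mulrC; congr (_ * _); rewrite /GRing.scale /= mulr1.
  have := is_deriveM' h2 h2.
  by under eq_fun do rewrite -expr2.
exact: (cder_continuous h).
Qed.

(** The distributional equation tested against [mode_test k xi]. *)
Lemma radial_weak lambda lo hi (xi dxi ddxi : R -> R[i]) :
  weak_laplacian n u (fun x => lambda * u x) ->
  csmooth xi -> supported lo hi xi ->
  (forall t, cder xi t (dxi t)) -> (forall t, cder dxi t (ddxi t)) ->
  cintegral leb half (fun r => F r * ((ddxi (ln r) - qrad lambda (ln r) * xi (ln r)) * (r^-1)%:C)) = 0.
Proof.
move=> hw hc hs h1 h2.
have c1 := csmooth_der hc h1; have c2 := csmooth_der c1 h2.
have s2 := supported_der (supported_der hs h1) h2.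
have ht := lcomb_test (mode_test_lcomb k hs hc).
have := hw _ ht; rewrite /area_integral.
pose p1 t := - (ddxi t - (`|k|%N%:R ^+ 2)%:C * xi t).
pose p2 t := lambda * ((n%:R * sech (n%:R * t)) ^+ 2)%:C * xi t.
have cxi := csmooth_continuous hc; have cdd := csmooth_continuous c2.
have cq : continuous (fun t => qrad lambda t * xi t).
  by move=> t; exact: (ccvgM (@continuous_qrad lambda t) (cxi t)).
have e2 t : p2 t = (`|k|%N%:R ^+ 2)%:C * xi t + - (qrad lambda t * xi t).
  by rewrite /p2 /qrad; move: (_%:C) (_%:C) => a b; ring.
have ck : continuous (fun t => (`|k|%N%:R ^+ 2)%:C * xi t).
  by move=> t; exact: (ccvgM (@ccvg_cst _ _ _ (nbhs_filter t) _) (cxi t)).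
have cp1 : continuous p1 by move=> t; exact: (ccvgN (ccvgB (cdd t) (ck t))).
have cp2 : continuous p2.
  rewrite (_ : p2 = fun t => (`|k|%N%:R ^+ 2)%:C * xi t + - (qrad lambda t * xi t)).
    by move=> t; exact: (ccvgD (ck t) (ccvgN (cq t))).
  by apply/funext => t; exact: e2.
have sp1 : supported lo hi p1 by move=> t ht'; rewrite /p1 s2 // hs // mulr0 subr0 oppr0.
have sp2 : supported lo hi p2 by exact: (supportedM _ hs).
have [C1 a1] := radial_amp_ln cp1 sp1.
have [C2 a2] := radial_amp_ln cp2 sp2.
have lo0 := expR_gt0 lo.
rewrite (eq_cintegral leb2 (g := fun p => u (polar p) * e p.2 * (p1 (ln p.1) * (p.1^-1)%:C))); last first.
  move=> [r th]; rewrite inE => -[/= + _]; rewrite in_itv /= andbT => r0.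
  rewrite -[LHS]mulrA; have /= -> := laplacian_mode_test k th n0 hs h1 h2 r0; rewrite /p1 /e /=.
  by rewrite -[RHS]mulrA; congr (_ * _); exact: mulrC.
rewrite (annulus_cintegral lo0 a1).
rewrite (eq_cintegral leb2 (g := fun p => u (polar p) * e p.2 * (p2 (ln p.1) * (p.1^-1)%:C))); last first.
  move=> [r th]; rewrite inE => -[/= + _]; rewrite in_itv /= andbT => r0.
  rewrite /= mode_test_polar // area_density_sech // rmorphM /= /p2 /e.
  move: (u _) (expi _) (xi _) (_%:C) (_%:C) => x y z v w; ring.
rewrite (annulus_cintegral lo0 a2) => /eqP; rewrite -subr_eq0 -mulrBr mulf_eq0.
have -> : ((2 * pi)%:C == 0 :> R[i]) = false by rewrite -modulus_eq0 modulusR normr_eq0; apply/negbTE.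
have mh : measurable half by [].
rewrite /= -cintegralB //; [|exact: (fourier_amp lo0 a1)|exact: (fourier_amp lo0 a2)].
move=> /eqP h0.
have -> : (fun r => F r * ((ddxi (ln r) - qrad lambda (ln r) * xi (ln r)) * (r^-1)%:C)) =
  (fun r => (F r * (p1 (ln r) * (r^-1)%:C) - F r * (p2 (ln r) * (r^-1)%:C)) * -1).
  apply/funext => r; rewrite e2 /p1 /=.
  move: (F r) (qrad lambda (ln r)) (ddxi (ln r)) (xi (ln r)) (r^-1)%:C ((`|k|%N%:R ^+ 2)%:C : R[i]).
  move=> *; ring.
rewrite cintegralZ // ?h0 ?mul0r //.
have h3 := cintegrableZ (-1) mh (fourier_amp lo0 a2).
apply: (eq_cintegrable mh _ (cintegrableD mh (fourier_amp lo0 a1) h3)) => r _.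
by rewrite mulrN1.
Qed.

End RadialWeak.

(** * Smooth bumps and steps *)

Section Bumps.
Context {R : realType}.
Implicit Types (t x : R) (j m : nat).

Definition flat j t : R := if 0 < t then t ^- j * expR (- t^-1) else 0.

Lemma flat_ge0 j t : 0 <= flat j t.
Proof.
by rewrite /flat; case: ifP => // t0; rewrite mulr_ge0 ?expR_ge0 // invr_ge0 exprn_ge0 // ltW.
Qed.

(** Comparison of [expR] with a single term of its series; the quadratic
    bound gives the derivative [0] at the origin. *)
Lemma flat_le j t : flat j t <= (j.+2)`!%:R * t ^+ 2.
Proof.
rewrite /flat; case: ifP => t0; last by rewrite mulr_ge0 ?sqr_ge0.
have f0 : 0 < ((j.+2)`!%:R : R) by rewrite ltr0n fact_gt0.
have ti : 0 <= t^-1 by rewrite invr_ge0 ltW.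
have h : t^-1 ^+ j.+2 / (j.+2)`!%:R <= expR t^-1.
  by apply: le_trans (expR_ge1Dxn j.+1 ti); rewrite lerDr.
rewrite expRN ler_pdivrMr ?expR_gt0 //.
have -> : t ^- j = (j.+2)`!%:R * t ^+ 2 * (t^-1 ^+ j.+2 / (j.+2)`!%:R).
  have t1 : t != 0 by rewrite gt_eqF.
  rewrite -[j.+2]addn2 exprD exprVn exprVn addn2.
  have : t ^+ j != 0 by rewrite expf_neq0.
  have : (j.+2)`!%:R != 0 :> R by rewrite gt_eqF.
  move: (t ^+ j) ((j.+2)`!%:R) => a b b0 a0.
  by field; rewrite t1 a0 b0.
by rewrite ler_wpM2l // mulr_ge0 ?sqr_ge0 ?ltW.
Qed.

Lemma flat_nderiv0 (f : R -> R) (C : R) : f 0 = 0 -> (forall t, `|f t| <= C * t ^+ 2) ->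
  is_derive (0 : R) 1 f 0.
Proof.
move=> f0 hf.
have h : (fun h => h^-1 *: ((f \o shift 0) (h *: (1 : R)) - f 0)) @ (0 : R)^' --> (0 : R).
  apply/norm_cvg0P.
  apply: (@squeeze_cvgr _ _ _ _ (fun=> 0) (fun h : R => C * `|h|)).
  - near=> t; rewrite normr_ge0 /= f0 subr0 addr0 /GRing.scale /= mulr1 normrM normfV.
    have t0 : t != 0 by near: t; exact: nbhs_dnbhs_neq.
    rewrite ler_pdivrMl ?normr_gt0 //; apply: le_trans (hf t) _.
    by rewrite [leRHS]mulrCA -normrM -expr2 ger0_norm ?sqr_ge0.
  - exact: cvg_cst.
  - have hn : (fun h : R => `|h|) @ (0 : R)^' --> `|0 : R|.
      by apply: cvg_norm; apply: cvg_within_filter; exact: cvg_id.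
    have hm : (fun h : R => C * `|h|) @ (0 : R)^' --> C * `|0 : R|.
      by apply: cvgM; [exact: cvg_cst|exact: hn].
    by rewrite normr0 mulr0 in hm.
apply: DeriveDef; first by apply/cvg_ex; exists 0; exact: h.
by apply/cvg_lim.
Unshelve. all: by end_near. Qed.

Lemma is_derive_pow j t : is_derive t 1 (fun s : R => s ^+ j) (j%:R * t ^+ j.-1).
Proof.
elim: j => [|j IH].
  rewrite mul0r (_ : (fun s : R => s ^+ 0) = fun=> 1); first exact: is_derive_cst.
  by apply/funext => s; rewrite expr0.
rewrite (_ : (fun s : R => s ^+ j.+1) = fun s => s * s ^+ j).
  apply: is_derive_eq (is_deriveM' (is_derive_id t (1 : R)) IH) _.
  rewrite mul1r; case: j {IH} => [|j]; first by rewrite !mul0r mulr0 addr0 mul1r.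
  rewrite /= !exprS; ring.
by apply/funext => s; rewrite exprS.
Qed.

Lemma is_derive_flat j t : is_derive t 1 (flat j) (flat j.+2 t - j%:R * flat j.+1 t).
Proof.
have [t0|t0|->] := ltgtP t 0.
- apply: is_derive_eq; first apply: (is_derive_ext (f1 := fun=> 0)).
    near=> s; rewrite /flat ifF //; apply/negbTE; rewrite -leNgt ltW //.
    by near: s; exact: lt_nbhsl.
  by rewrite /flat !ifF ?mulr0 ?subr0 //; apply/negbTE; rewrite -leNgt ltW.
- have t1 : t != 0 by rewrite gt_eqF.
  have hi := is_deriveV t1 (is_derive_id t (1 : R)).
  have hn : is_derive t 1 (fun s : R => - s^-1) (- (- t ^- 2 *: 1)) by exact: (is_deriveN hi).
  have he := is_derive1_comp (g := fun s : R => - s^-1) (is_derive_expR (- t^-1)) hn.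
  have hX : is_derive t 1 (fun s : R => s ^- j) (- (j%:R * t ^- j.+1)).
    have tj : t ^+ j != 0 by rewrite expf_neq0.
    have hV : is_derive t 1 (fun s : R => s ^- j) (- t ^+ j ^- 2 *: (j%:R * t ^+ j.-1)).
      exact: (is_deriveV (f := fun s : R => s ^+ j) tj (is_derive_pow j t)).
    apply: (is_derive_eq hV).
    rewrite /GRing.scale /=; case: j tj {hV} => [|j] tj; first by rewrite !mul0r mulr0 oppr0.
    move: tj; rewrite !exprS /=; move: (t ^+ j) (j.+1%:R) => a b.
    rewrite mulf_eq0 negb_or => /andP[_ a0].
    by field; rewrite t1 a0.
  apply: is_derive_eq; first apply: (is_derive_ext _ (is_deriveM' hX he)).
    near=> s; rewrite /flat ifT //.
    by near: s; exact: lt_nbhsr.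
  rewrite /= /flat t0 /GRing.scale /= mulr1.
  have : t ^+ j != 0 by rewrite expf_neq0.
  rewrite !exprS; move: (t ^+ j) (j%:R) (expR _) => a b E a0.
  by field; rewrite t1 a0.
- rewrite /flat !ltxx mulr0 subr0 -/(flat j); apply: flat_nderiv0.
    by rewrite /flat ltxx.
  by move=> s; rewrite ger0_norm ?flat_ge0 //; exact: flat_le.
Unshelve. all: by end_near. Qed.

(** The derivative of a flat function is a combination of flat functions. *)
Lemma csmooth_flat j : csmooth (fun t => (flat j t)%:C).
Proof.
move=> m; elim: m j => [//|m IH] j.
exists (fun t => (flat j.+2 t)%:C + (- j%:R)%:C * (flat j.+1 t)%:C) => [t|].
  apply: cder_eq (cder_real (is_derive_flat j t)).
  by rewrite rmorphB rmorphM /= rmorphN mulNr.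
exact: (CkD (IH _) (CkM (Ck_cst m _) (IH _))).
Qed.

Lemma csmooth_affine (f : R -> R[i]) (a b : R) : csmooth f -> csmooth (fun t => f (a * t + b)).
Proof.
move=> hf m; elim: m f hf => [//|m IH] f hf.
have [df hd hs] := csmoothP hf.
exists (fun t => a%:C * df (a * t + b)) => [t|].
  apply: (@cder_comp R f (fun t => a * t + b)); first exact: hd.
  have h1 := is_deriveM' (is_derive_cst a t 1) (is_derive_id t (1 : R)).
  have h := is_deriveD h1 (is_derive_cst b t 1).
  by apply: (is_derive_eq h); rewrite /= mul0r add0r mulr1 addr0.
exact: (CkM (Ck_cst m _) (IH _ hs)).
Qed.

(** A smooth approximation from below of the indicator of the open
    interval: both factors tend to [1] inside it as [m] grows. *)
Definition bump (lo hi : R) m t : R := flat 0 (m.+1%:R * t - m.+1%:R * lo) * flat 0 (m.+1%:R * hi - m.+1%:R * t).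

Lemma csmooth_bump lo hi m : csmooth (fun t => (bump lo hi m t)%:C).
Proof.
rewrite (_ : (fun t => _) = fun t => (flat 0 (m.+1%:R * t + - (m.+1%:R * lo)))%:C *
   (flat 0 (- m.+1%:R * t + m.+1%:R * hi))%:C).
  by apply: csmoothM; apply: (csmooth_affine (f := fun t => (flat 0 t)%:C)); exact: csmooth_flat.
by apply/funext => t; rewrite /bump rmorphM /= mulNr [- _ + _]addrC.
Qed.

Lemma flat0_le1 t : 0 <= flat 0 t <= 1.
Proof.
rewrite flat_ge0 /= /flat; case: ifP => // t0.
by rewrite expr0 invr1 mul1r -expR0 ler_expR oppr_le0 invr_ge0 ltW.
Qed.

Lemma bump_le1 lo hi m t : 0 <= bump lo hi m t <= 1.
Proof.
have /andP[a0 a1] := flat0_le1 (m.+1%:R * t - m.+1%:R * lo).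
have /andP[b0 b1] := flat0_le1 (m.+1%:R * hi - m.+1%:R * t).
by rewrite /bump mulr_ge0 //=; apply: le_trans (ler_pM a0 b0 a1 b1) _; rewrite mulr1.
Qed.

Lemma bump_out lo hi m t : ~~ (lo < t < hi) -> bump lo hi m t = 0.
Proof.
have m0 : 0 < (m.+1%:R : R) by rewrite ltr0n.
rewrite negb_and -!leNgt /bump /flat => /orP[] h.
  by rewrite [X in X * _]ifF ?mul0r //; apply/negbTE; rewrite -leNgt -mulrBr pmulr_rle0 // subr_le0.
by rewrite [X in _ * X]ifF ?mulr0 //; apply/negbTE; rewrite -leNgt -mulrBr pmulr_rle0 // subr_le0.
Qed.

Lemma bump_cvg lo hi t : lo < t < hi -> (fun m => bump lo hi m t) @ \oo --> (1 : R).
Proof.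
move=> /andP[h1 h2].
have key d : 0 < d -> (fun m => flat 0 (m.+1%:R * d)) @ \oo --> (1 : R).
  move=> d0; have e m : flat 0 (m.+1%:R * d) = expR (- (m.+1%:R^-1 * d^-1)).
    by rewrite /flat ifT ?mulr_gt0 ?ltr0n // expr0 invr1 mul1r invfM.
  have h : (fun m : nat => expR (- (m.+1%:R^-1 * d^-1))) @ \oo --> expR (- (0 * d^-1) : R).
    apply: continuous_cvg; first exact: continuous_expR.
    apply: cvgN; apply: cvgM; last exact: cvg_cst.
    exact: cvg_harmonic.
  by rewrite mul0r oppr0 expR0 in h; rewrite (funext e).
have e : (fun m => bump lo hi m t) = (fun m => flat 0 (m.+1%:R * (t - lo)) * flat 0 (m.+1%:R * (hi - t))).
  by apply/funext => m; rewrite /bump !mulrBr.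
have h : (fun m => flat 0 (m.+1%:R * (t - lo)) * flat 0 (m.+1%:R * (hi - t))) @ \oo --> (1 * 1 : R).
  by apply: cvgM; apply: key; rewrite subr_gt0.
by rewrite e -[X in _ --> X]mulr1.
Qed.

Lemma cRe_conj (z : R[i]) : complex.Re (conjc z) = complex.Re z.
Proof. by case: z. Qed.

Lemma cIm_conj (z : R[i]) : complex.Im (conjc z) = - complex.Im z.
Proof. by case: z. Qed.

(** The derivatives of [1 / f] are polynomials in [1 / f] and the
    derivatives of [f]. *)
Lemma csmoothV (f : R -> R[i]) : (forall t, f t != 0) -> csmooth f -> csmooth (fun t => (f t)^-1).
Proof.
move=> f0 hf; have [df hd hs] := csmoothP hf.
have cderV t : cder (fun t => (f t)^-1) t (- df t * (f t)^-1 * (f t)^-1).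
  pose a s := (complex.Re (f s)) ^+ 2 + (complex.Im (f s)) ^+ 2.
  have [h1 h2] := hd t.
  have ha : is_derive t 1 a (2 * (complex.Re (f t) * complex.Re (df t) + complex.Im (f t) * complex.Im (df t))).
    apply: is_derive_eq (is_deriveD (is_deriveM' h1 h1) (is_deriveM' h2 h2)) _; ring.
  have a0 s : a s != 0 by rewrite /a -modulus_sqr expf_neq0 // modulus_eq0.
  have fE s : (f s)^-1 = ((a s)^-1)%:C * conjc (f s).
    apply: (mulIf (f0 s)); rewrite mulVf // -mulrA.
    have -> : conjc (f s) * f s = (a s)%:C.
      by rewrite /a; case: (f s) => x y; apply: complex_ext => /=; ring.
    by rewrite -rmorphM mulVf.
  have hc : cder (fun s => conjc (f s)) t (conjc (df t)).
    split.
      by rewrite cRe_conj; under eq_fun do rewrite cRe_conj.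
    rewrite cIm_conj; under eq_fun do rewrite cIm_conj; exact: is_deriveN.
  have := cderM (cder_real (is_deriveV (a0 t) ha)) hc.
  move=> h; rewrite (funext fE); apply: cder_eq h; rewrite !fE /GRing.scale /=.
  have := a0 t; rewrite /a; case: (f t) (df t) => x y [p q] /= b0.
  by apply: complex_ext => /=; field.
elim=> [//|m IH]; exists (fun t => - df t * (f t)^-1 * (f t)^-1) => [t|]; first exact: cderV.
by apply: CkM => //; apply: CkM => //; rewrite (_ : (fun t => - df t) = fun t => (-1) * df t);
  [exact: (CkM (Ck_cst m _) (hs m))|apply/funext => t; rewrite mulN1r].
Qed.

Definition step t : R := flat 0 t / (flat 0 t + flat 0 (1 - t)).

Lemma step_den t : 0 < flat 0 t + flat 0 (1 - t).
Proof.
have [t0|t0] := ltP 0 t.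
  apply: ltr_wpDr; first exact: flat_ge0.
  by rewrite /flat t0 expr0 invr1 mul1r expR_gt0.
apply: ltr_wpDl; first exact: flat_ge0.
by rewrite /flat ifT ?subr_gt0 ?(le_lt_trans t0) // expr0 invr1 mul1r expR_gt0.
Qed.

Lemma step0 t : t < 0 -> step t = 0.
Proof. by move=> t0; rewrite /step {1}/flat ifF ?mul0r //; apply/negbTE; rewrite -leNgt ltW. Qed.

Lemma step1 t : 1 < t -> step t = 1.
Proof.
move=> t1; have h := step_den t; move: h; rewrite /step.
have -> : flat 0 (1 - t) = 0 by rewrite /flat ifF //; apply/negbTE; rewrite -leNgt subr_le0 ltW.
by rewrite addr0 => h; rewrite divff // gt_eqF.
Qed.

Lemma csmooth_step : csmooth (fun t => (step t)%:C).
Proof.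
have h1 := csmooth_flat 0.
have h2 : csmooth (fun t => (flat 0 (1 - t))%:C).
  rewrite (_ : (fun t => _) = fun t => (flat 0 (-1 * t + 1))%:C).
    exact: (csmooth_affine (f := fun t => (flat 0 t)%:C)).
  by apply/funext => t; rewrite mulN1r addrC.
rewrite (_ : (fun t => _) = fun t => (flat 0 t)%:C * ((flat 0 t)%:C + (flat 0 (1 - t))%:C)^-1).
  apply: csmoothM => //; apply: csmoothV; last exact: csmoothD.
  by move=> t; rewrite -rmorphD -modulus_gt0 modulusR normr_gt0 gt_eqF // step_den.
by apply/funext => t; rewrite /step rmorphM fmorphV rmorphD.
Qed.

End Bumps.

(** * Variation of constants *)

Section Antiderivative.
Context {R : realType}.
Local Notation leb := (@lebesgue_measure R).
Local Notation half := (`]0, +oo[%classic : set (measurableTypeR R)).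

(** The integral of [f] in the variable [t = ln r]. *)
Definition logint (f : R -> R[i]) : R[i] := cintegral leb half (fun r => f (ln r) * (r^-1)%:C).

Lemma radial_amp_cintegrable (a b C : R) (P : R -> R[i]) : radial_amp a b C P -> cintegrable leb half P.
Proof.
move=> [mP bP sP]; have mh : measurable half by [].
pose g (r : measurableTypeR R) := C * \1_(`[a, b]%classic) r.
have ig : leb.-integrable half (EFin \o g).
  have h : leb.-integrable half (EFin \o \1_(`[a, b]%classic)).
    by apply: (integrableS measurableT) => //; exact: integrable_indic_itv.
  by have := integrableZl mh C h; apply: eq_integrable => // r _ /=; rewrite EFinM.
apply: (cintegrable_le mh mP ig); rewrite /g.
move=> r; rewrite /= in_itv /= andbT => r0; rewrite indicE.
have [hr|hr] := boolP (a <= r <= b); first by rewrite mem_set /= ?mulr1 ?bP // in_itv.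
by rewrite sP // modulus0 mulr_ge0 //; apply: le_trans (bP 1 ltr01); exact: modulus_ge0.
Qed.

(** The primitive is taken in [r], from [0], and then read in [t = ln r]. *)
Lemma real_antiderivative (f : R -> R) lo hi : continuous f ->
  (forall t, ~~ (lo <= t <= hi) -> f t = 0) ->
  leb.-integrable half (EFin \o (fun r => f (ln r) * r^-1)) ->
  exists G : R -> R, [/\ forall t : R, is_derive t 1 G (f t), forall t, t < lo -> G t = 0 &
    forall t, hi < t -> G t = Rintegral leb half (fun r => f (ln r) * r^-1)].
Proof.
move=> cf sf hint; have mh : measurable half by [].
pose phi r := f (ln r) * r^-1.
pose Ga x := (\int[leb]_(r in [set` Interval (BRight 0) (BRight x)]) phi r)%R.
have intx y : leb.-integrable [set` Interval (BRight 0) (BRight y)] (EFin \o phi).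
  apply: (integrableS mh) => //; move=> r /=; rewrite !in_itv /= andbT => /andP[] //.
have dGa (x : R) : 0 < x -> is_derive x 1 Ga (phi x).
  move=> x0.
  have cphi : {for x, continuous phi}.
    apply: cvgM; last by apply: cvgV; [rewrite gt_eqF|exact: cvg_id].
    apply: (@continuous_comp _ _ _ (@ln R) f); [exact: continuous_ln|exact: cf].
  have xx1 : x < x + 1 by rewrite ltrDl.
  have a0 : (BRight 0 < BRight x)%O by rewrite bnd_simp.
  have [h1 h2] := continuous_FTC1 xx1 (intx (x + 1)) a0 cphi.
  by apply: DeriveDef; [exact: h1|rewrite -derive1E; exact: h2].
exists (fun t => Ga (expR t)); split.
- move=> t; have h := is_derive1_comp (dGa (expR t) (expR_gt0 t)) (is_derive_expR t).
  by apply: (is_derive_eq h); rewrite /phi expRK mulfVK // gt_eqF // expR_gt0.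
- move=> t ht; rewrite /Ga.
  transitivity (Rintegral leb [set` Interval (BRight 0) (BRight (expR t))] (fun=> 0)); last first.
    by rewrite Rintegral_cst // mul0r.
  apply: eq_Rintegral => r; rewrite inE /= in_itv /= => /andP[r0 rt]; rewrite /phi sf ?mul0r //.
  by rewrite negb_and -!ltNge; apply/orP; left; apply: le_lt_trans ht; rewrite -[t]expRK ler_ln // posrE expR_gt0.
- move=> t ht; rewrite /Ga /Rintegral; congr fine.
  rewrite [LHS]integral_mkcond [RHS]integral_mkcond; apply: eq_integral => r _.
  rewrite !patchE; have [r0|r0] := leP r 0.
    by rewrite !memNset //= in_itv /= ?andbT; [rewrite ltNge r0|rewrite ltNge r0].
  rewrite [r \in half]mem_set ?in_itv /= ?andbT //; last by rewrite in_itv /= andbT.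
  have [rt|rt] := leP r (expR t); first by rewrite mem_set //= in_itv /= r0.
  rewrite memNset ?in_itv /= ?r0 //= ?leNgt ?rt //.
  rewrite /phi sf ?mul0r // negb_and -!ltNge; apply/orP; right; apply: lt_trans ht _.
  by rewrite -[t]expRK ltr_ln // posrE expR_gt0.
  by rewrite /= in_itv /= r0 leNgt rt.
Qed.

Lemma antiderivative (f : R -> R[i]) lo hi : continuous f -> supported lo hi f ->
  exists G : R -> R[i], [/\ forall t, cder G t (f t), forall t, t < lo -> G t = 0 &
    forall t, hi < t -> G t = logint f].
Proof.
move=> cf sf; have [C hC] := radial_amp_ln cf sf.
have [i1 i2] := radial_amp_cintegrable hC.
have cR : continuous (fun t => complex.Re (f t)).
  by move=> t; exact: ((@cvg_ReIm R _ (nbhs t) (nbhs_filter t) f (f t)).1 (cf t)).1.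
have cI : continuous (fun t => complex.Im (f t)).
  by move=> t; exact: ((@cvg_ReIm R _ (nbhs t) (nbhs_filter t) f (f t)).1 (cf t)).2.
have mh : measurable half by [].
have eR r : complex.Re (f (ln r) * (r^-1)%:C) = complex.Re (f (ln r)) * r^-1.
  by rewrite cReM /= mulr0 subr0.
have eI r : complex.Im (f (ln r) * (r^-1)%:C) = complex.Im (f (ln r)) * r^-1.
  by rewrite cImM /= mulr0 ?addr0 ?add0r.
have [G1 [h1 h2 h3]] : exists G : R -> R, [/\ forall t : R, is_derive t 1 G (complex.Re (f t)), forall t, t < lo -> G t = 0 &
    forall t, hi < t -> G t = Rintegral leb half (fun r => complex.Re (f (ln r)) * r^-1)].
  apply: (real_antiderivative cR (lo := lo)); first by move=> t ht; rewrite sf.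
  by move: i1; apply: eq_integrable => // r _ /=; rewrite eR.
have [G2 [k1 k2 k3]] : exists G : R -> R, [/\ forall t : R, is_derive t 1 G (complex.Im (f t)), forall t, t < lo -> G t = 0 &
    forall t, hi < t -> G t = Rintegral leb half (fun r => complex.Im (f (ln r)) * r^-1)].
  apply: (real_antiderivative cI (lo := lo)); first by move=> t ht; rewrite sf.
  by move: i2; apply: eq_integrable => // r _ /=; rewrite eI.
exists (fun t => G1 t +i* G2 t); split.
- by move=> t; split; [exact: h1|exact: k1].
- by move=> t ht; rewrite h2 // k2.
- move=> t ht; rewrite h3 // k3 // /logint /cintegral.
  by congr (_ +i* _); apply: eq_Rintegral => r _; rewrite ?eR ?eI.
Qed.

End Antiderivative.

Section VariationOfConstants.
Context {R : realType}.
Local Notation leb := (@lebesgue_measure R).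
Local Notation half := (`]0, +oo[%classic : set (measurableTypeR R)).
Variables (F : R -> R[i]) (q Y1 dY1 Y2 dY2 : R -> R[i]) (W : R[i]).
Hypotheses (cq : csmooth q) (o1 : osol q Y1 dY1) (o2 : osol q Y2 dY2) (W0 : W != 0).
Hypothesis HW : forall t, Y1 t * dY2 t - dY1 t * Y2 t = W.
Hypothesis Fint : forall lo hi (p : R -> R[i]), continuous p -> supported lo hi p ->
  cintegrable leb half (fun r => F r * (p (ln r) * (r^-1)%:C)).
Hypothesis Fweak : forall lo hi (xi dxi ddxi : R -> R[i]), csmooth xi -> supported lo hi xi ->
  (forall t, cder xi t (dxi t)) -> (forall t, cder dxi t (ddxi t)) ->
  cintegral leb half (fun r => F r * ((ddxi (ln r) - q (ln r) * xi (ln r)) * (r^-1)%:C)) = 0.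

Lemma osol_csmooth y dy : osol q y dy -> csmooth y /\ csmooth dy.
Proof.
move=> [h1 h2]; suff h m : Ck m y /\ Ck m dy by split=> m; case: (h m).
elim: m => [//|m [k1 k2]]; split; first by exists dy.
by exists (fun t => q t * y t) => //; exact: CkM.
Qed.

Definition pairing (p : R -> R[i]) : R[i] := cintegral leb half (fun r => F r * (p (ln r) * (r^-1)%:C)).

Lemma continuousMC (f g : R -> R[i]) : continuous f -> continuous g -> continuous (fun t => f t * g t).
Proof. by move=> hf hg t; exact: (ccvgM (hf t) (hg t)). Qed.

Lemma continuousDC (f g : R -> R[i]) : continuous f -> continuous g -> continuous (fun t => f t + g t).
Proof. by move=> hf hg t; exact: (ccvgD (hf t) (hg t)). Qed.

Lemma continuousZC c (f : R -> R[i]) : continuous f -> continuous (fun t => f t * c).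
Proof. by move=> hf; apply: (continuousMC hf) => t; exact: (@ccvg_cst _ _ _ (nbhs_filter t) c). Qed.

Lemma pairingD lo hi p p' : continuous p -> continuous p' -> supported lo hi p -> supported lo hi p' ->
  pairing (fun t => p t + p' t) = pairing p + pairing p'.
Proof.
move=> c1 c2 s1 s2; have mh : measurable half by [].
rewrite /pairing -cintegralD //; [|exact: (Fint c1 s1)|exact: (Fint c2 s2)].
by apply: eq_cintegral => r _; rewrite mulrDl mulrDr.
Qed.

Lemma pairingZ lo hi c p : continuous p -> supported lo hi p ->
  pairing (fun t => p t * c) = pairing p * c.
Proof.
move=> c1 s1; have mh : measurable half by [].
rewrite /pairing -cintegralZ //; last exact: (Fint c1 s1).
by apply: eq_cintegral => r _; move: (F r) (p _) (_%:C) => *; ring.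
Qed.

Lemma supportedW lo hi lo' hi' (p : R -> R[i]) : lo' <= lo -> hi <= hi' -> supported lo hi p -> supported lo' hi' p.
Proof.
move=> h1 h2 s t ht; apply: s; apply: contra ht => /andP[k1 k2].
by rewrite (le_trans h1 k1) (le_trans k2 h2).
Qed.

(** Variation of constants solves [xi'' - q xi = g] by a [xi] whose support
    is compact if [g * Y1] and [g * Y2] have vanishing integrals. In
    general the primitives of these two functions are corrected by their
    integrals times one fixed smooth step; the right-hand side then
    acquires these integrals times two fixed functions [Ei], whose pairings
    with [F] are the constants. *)
Lemma variation_of_constants : exists a1 a2 : R[i], forall lo hi (g : R -> R[i]),
  csmooth g -> supported lo hi g ->
  pairing g = a1 * logint (fun t => g t * Y1 t) + a2 * logint (fun t => g t * Y2 t).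
Proof.
pose th t : R[i] := (step t)%:C.
have sth : csmooth th by exact: csmooth_step.
have [dth hth cth] := csmoothP sth; have [ddth hdth cdth] := csmoothP cth.
have [cY1 cdY1] := osol_csmooth o1; have [cY2 cdY2] := osol_csmooth o2.
have supd : supported 0 1 dth.
  move=> t; rewrite negb_and -!ltNge => /orP[] ht; apply: cder_unique (hth t) _.
    apply: (cder_near (f := fun=> 0)); last exact: cder_cst.
    near=> s; rewrite /th step0 //; near: s; exact: lt_nbhsl.
  apply: (cder_near (f := fun=> 1)); last exact: cder_cst.
  near=> s; rewrite /th step1 //; near: s; exact: lt_nbhsr.
have supdd := supported_der supd hdth.
pose Ei (Y dY : R -> R[i]) t := 2 * (dth t * dY t) + ddth t * Y t.
have cE Y dY : csmooth Y -> csmooth dY -> continuous (Ei Y dY).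
  move=> c1 c2; apply: csmooth_continuous; apply: csmoothD; last exact: csmoothM.
  by apply: csmoothM; [exact: csmooth_cst|exact: csmoothM].
have sE Y dY : supported 0 1 (Ei Y dY).
  by move=> t ht; rewrite /Ei supd // supdd // !mul0r mulr0 addr0.
(* The constants must not depend on [g]. *)
exists (pairing (Ei Y2 dY2) / W), (- pairing (Ei Y1 dY1) / W) => lo hi g cg sg.
have sgY (Y : R -> R[i]) : supported lo hi (fun t => g t * Y t).
  by move=> t ht; rewrite sg // mul0r.
have cgY (Y : R -> R[i]) : csmooth Y -> csmooth (fun t => g t * Y t) by exact: csmoothM.
have [G1 [d1 l1 r1]] := antiderivative (csmooth_continuous (cgY _ cY1)) (sgY Y1).
have [G2 [d2 l2 r2]] := antiderivative (csmooth_continuous (cgY _ cY2)) (sgY Y2).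
move: r1 r2; set c1 := logint _; set c2 := logint _ => r1 r2.
(* primitives, corrected so as to have compact support *)
pose T1 t := G1 t - c1 * th t; pose T2 t := G2 t - c2 * th t.
pose dT1 t := g t * Y1 t - c1 * dth t; pose dT2 t := g t * Y2 t - c2 * dth t.
have hT1 t : cder T1 t (dT1 t) by apply: cderB; [exact: d1|apply: cderZ; exact: hth].
have hT2 t : cder T2 t (dT2 t) by apply: cderB; [exact: d2|apply: cderZ; exact: hth].
have smT1 : csmooth T1.
  apply: (csmoothI hT1); rewrite (_ : dT1 = fun t => g t * Y1 t + (- c1) * dth t).
    by apply: csmoothD; [exact: cgY|apply: csmoothM => //; exact: csmooth_cst].
  by apply/funext => t; rewrite /dT1 mulNr.
have smT2 : csmooth T2.
  apply: (csmoothI hT2); rewrite (_ : dT2 = fun t => g t * Y2 t + (- c2) * dth t).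
    by apply: csmoothD; [exact: cgY|apply: csmoothM => //; exact: csmooth_cst].
  by apply/funext => t; rewrite /dT2 mulNr.
pose lo' := Num.min lo 0; pose hi' := Num.max hi 1.
have sT (G : R -> R[i]) c : (forall t, t < lo -> G t = 0) -> (forall t, hi < t -> G t = c) ->
    supported lo' hi' (fun t => G t - c * th t).
  move=> hl hr t; rewrite negb_and -!ltNge lt_min gt_max => /orP[] /andP[k1 k2].
    by rewrite hl // /th step0 // mulr0 subr0.
  by rewrite hr // /th step1 // mulr1 subrr.
have sT1 := sT _ _ l1 r1; have sT2 := sT _ _ l2 r2.
pose xi t := W^-1 * (Y2 t * T1 t + (-1) * (Y1 t * T2 t)).
pose dxi t := W^-1 * (dY2 t * T1 t - dY1 t * T2 t - dth t * (c1 * Y2 t - c2 * Y1 t)).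
pose ddxi t := g t + q t * xi t + (Ei Y2 dY2 t * - (c1 / W) + Ei Y1 dY1 t * (c2 / W)).
have sxi : supported lo' hi' xi.
  by move=> t ht; rewrite /xi (sT1 t ht : T1 t = 0) (sT2 t ht : T2 t = 0) !mulr0 addr0 mulr0.
have cxi : csmooth xi.
  apply: csmoothM; first exact: csmooth_cst.
  apply: csmoothD; first exact: csmoothM.
  by apply: csmoothM; [exact: csmooth_cst|exact: csmoothM].
case: (o1) => o11 o12; case: (o2) => o21 o22.
have hxi t : cder xi t (dxi t).
  apply: cder_eq (cderZ W^-1 (cderD (cderM (o21 t) (hT1 t)) (cderZ (-1) (cderM (o11 t) (hT2 t))))).
  rewrite /dxi /dT1 /dT2; congr (_ * _).
  move: (Y1 t) (Y2 t) (dY1 t) (dY2 t) (T1 t) (T2 t) (dth t) (g t) => *; ring.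
have hdxi t : cder dxi t (ddxi t).
  have k1 := cderM (o22 t) (hT1 t); have k2 := cderM (o12 t) (hT2 t).
  have k3 := cderM (hdth t) (cderB (cderZ c1 (o21 t)) (cderZ c2 (o11 t))).
  apply: cder_eq (cderZ W^-1 (cderB (cderB k1 k2) k3)).
  rewrite /ddxi /dT1 /dT2 /xi /Ei.
  have hW1 : W^-1 * (Y1 t * dY2 t - dY1 t * Y2 t) - 1 = 0 by rewrite HW mulVf // subrr.
  move: hW1; move: (Y1 t) (Y2 t) (dY1 t) (dY2 t) (T1 t) (T2 t) (dth t) (ddth t) (g t) (q t) W^-1.
  move=> a b da db x y e f z w Wi hW1.
  transitivity (z + w * (Wi * (b * x + -1 * (a * y))) +
    ((2 * (e * db) + f * b) * - (c1 * Wi) + (2 * (e * da) + f * a) * (c2 * Wi))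
    + z * (Wi * (a * db - da * b) - 1)); first ring.
  by rewrite hW1 mulr0 addr0.
have := Fweak cxi sxi hxi hdxi.
have -> : (fun r => F r * ((ddxi (ln r) - q (ln r) * xi (ln r)) * (r^-1)%:C)) =
    (fun r => F r * ((g (ln r) + (Ei Y2 dY2 (ln r) * - (c1 / W) + Ei Y1 dY1 (ln r) * (c2 / W))) * (r^-1)%:C)).
  apply/funext => r; congr (_ * (_ * _)); rewrite /ddxi.
  by rewrite addrAC addrK.
rewrite -/(pairing (fun t => g t + (Ei Y2 dY2 t * - (c1 / W) + Ei Y1 dY1 t * (c2 / W)))).
have w0 : lo' <= 0 by rewrite ge_min lexx orbT.
have w1 : 1 <= hi' by rewrite le_max lexx orbT.
have wl : lo' <= lo by rewrite ge_min lexx.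
have wh : hi <= hi' by rewrite le_max lexx.
have sE1 := supportedW w0 w1 (sE Y1 dY1); have sE2 := supportedW w0 w1 (sE Y2 dY2).
have sg' := supportedW wl wh sg; have ccg := csmooth_continuous cg.
have sZ (p : R -> R[i]) c : supported lo' hi' p -> supported lo' hi' (fun t => p t * c).
  by move=> hp t ht; rewrite hp // mul0r.
have cE1 := cE _ _ cY1 cdY1; have cE2 := cE _ _ cY2 cdY2.
have z2 : supported lo' hi' (fun t => Ei Y2 dY2 t * - (c1 / W)).
  by move=> t ht; rewrite (sE2 t ht) mul0r.
have z1 : supported lo' hi' (fun t => Ei Y1 dY1 t * (c2 / W)).
  by move=> t ht; rewrite (sE1 t ht) mul0r.
have z12 : supported lo' hi' (fun t => Ei Y2 dY2 t * - (c1 / W) + Ei Y1 dY1 t * (c2 / W)).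
  by move=> t ht; rewrite (z2 t ht) (z1 t ht) addr0.
have k2 : continuous (fun t => Ei Y2 dY2 t * - (c1 / W)) by exact: (@continuousZC (- (c1 / W)) (Ei Y2 dY2) cE2).
have k1 : continuous (fun t => Ei Y1 dY1 t * (c2 / W)) by exact: (@continuousZC (c2 / W) (Ei Y1 dY1) cE1).
have k12 : continuous (fun t => Ei Y2 dY2 t * - (c1 / W) + Ei Y1 dY1 t * (c2 / W)) by exact: (@continuousDC (fun t => Ei Y2 dY2 t * - (c1 / W)) (fun t => Ei Y1 dY1 t * (c2 / W)) k2 k1).
rewrite (pairingD ccg k12 sg' z12) (pairingD k2 k1 z2 z1).
rewrite (pairingZ _ cE2 sE2) (pairingZ _ cE1 sE1).
have alg (P P1 P2 a b Wi : R[i]) : P + (P2 * - (a * Wi) + P1 * (b * Wi)) = 0 ->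
    P = P2 * Wi * a + - P1 * Wi * b.
  by move=> /eqP; rewrite addr_eq0 => /eqP ->; ring.
exact: alg.
Unshelve. all: by end_near. Qed.

End VariationOfConstants.

(** * The modes of a formal solution *)

Section AeZero.
Context {R : realType}.
Local Notation leb := (@lebesgue_measure R).

(** The primitive vanishes, and its derivative is [phi] almost everywhere. *)
Lemma ae_zero_itv (phi : R -> R) (a b : R) : a < b ->
  leb.-integrable `[a, b]%classic (EFin \o phi) ->
  (forall x, a < x -> x <= b -> Rintegral leb `]a, x[%classic phi = 0) ->
  {ae leb, forall r, a < r < b -> phi r = 0}.
Proof.
move=> ab hi h0; pose f := phi \_ `]a, b[%classic.
have mo : measurable (`]a, b[%classic : set (measurableTypeR R)) by [].
have io : leb.-integrable `]a, b[%classic (EFin \o phi).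
  apply: (integrableS _ _ _ hi) => //; exact: subset_itv_oo_cc.
have locf : locally_integrable setT f by exact: (integrable_locally mo io).
have fT : leb.-integrable setT (EFin \o f).
  rewrite /f -restrict_EFin; exact: (integrable_mkcond _ mo).1 io.
have intf y : leb.-integrable [set` Interval (BRight a) (BRight y)] (EFin \o f).
  by apply: (integrableS measurableT).
have F0 x : (\int[leb]_(t in [set` Interval (BRight a) (BRight x)]) (f t))%R = 0.
  have [ax|xa] := ltP a x; last first.
    by rewrite set_itv_ge ?Rintegral_set0 // bnd_simp -leNgt.
  rewrite /f -Rintegral_mkcondr.
  have [xb|bx] := ltP x b.
    have -> : [set` Interval (BRight a) (BRight x)] `&` `]a, b[%classic = [set` Interval (BRight a) (BRight x)].
      apply/seteqP; split => t /=; first by case.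
      by rewrite !in_itv /= => /andP[h1 h2]; rewrite h1 h2 (le_lt_trans h2 xb).
    rewrite -Rintegral_itv_bndo_bndc; first exact: h0 ax (ltW xb).
    apply: (integrableS _ _ _ hi) => // t; rewrite /= !in_itv /= => /andP[/ltW -> /=].
    by move=> h; rewrite ltW // (lt_trans h xb).
  have -> : [set` Interval (BRight a) (BRight x)] `&` `]a, b[%classic = `]a, b[%classic.
    apply/seteqP; split => t /=; first by case.
    by rewrite !in_itv /= => /andP[h1 h2]; rewrite h1 h2 ltW // (lt_le_trans h2 bx).
  exact: h0.
have := FTC1 intf locf; apply: (@filterS _ _ (ae_filter_ringOfSetsType leb)) => x hx /andP[ax xb].
have ax' : (BRight a < BRight x)%O by rewrite bnd_simp.
have [_ ] := hx ax'.
rewrite (_ : (fun x0 => _) = fun=> 0); last by apply/funext => y; exact: F0.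
rewrite derive1_cst /f patchE mem_set; first by move=> <-.
by rewrite /= in_itv /= ax.
Qed.

Lemma ae_zero (phi : R -> R) :
  (forall a b, 0 < a -> a < b -> leb.-integrable `[a, b]%classic (EFin \o phi)) ->
  (forall a b, 0 < a -> a < b -> Rintegral leb `]a, b[%classic phi = 0) ->
  {ae leb, forall r, 0 < r -> phi r = 0}.
Proof.
move=> hi h0.
have h : {ae leb, forall r, forall m : nat, m.+2%:R^-1 < r < m.+2%:R -> phi r = 0}.
  apply: ae_foralln => m; have m0 : 0 < (m.+2%:R^-1 : R) by rewrite invr_gt0 ltr0n.
  have m1 : (m.+2%:R^-1 : R) < m.+2%:R.
    by apply: (@lt_trans _ _ 1); rewrite ?invf_lt1 ?ltr0n // ltr1n.
  by apply: ae_zero_itv => //; [exact: hi|move=> x h1 _; exact: h0].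
apply: (@filterS _ _ (ae_filter_ringOfSetsType leb) _ _ _ h) => r hr r0.
have [m1 /ltW hm1] : exists m : nat, r < m%:R.
  by exists (Num.truncn r).+1; exact: truncnS_gt.
have [m2 hm2] : exists m : nat, r^-1 < m%:R.
  by exists (Num.truncn r^-1).+1; exact: truncnS_gt.
apply: (hr (m1 + m2)%N); apply/andP; split.
  rewrite -[r]invrK ltf_pV2 ?posrE ?invr_gt0 ?ltr0n //.
  by apply: lt_le_trans hm2 _; rewrite ler_nat; lia.
by apply: le_lt_trans hm1 _; rewrite ltr_nat; lia.
Qed.

End AeZero.

Section ModeIsSolution.
Context {R : realType}.
Local Notation leb := (@lebesgue_measure R).
Local Notation half := (`]0, +oo[%classic : set (measurableTypeR R)).
Section Defect.
Variable H : R -> R[i].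
Hypothesis Hint : forall lo hi (p : R -> R[i]), csmooth p -> supported lo hi p ->
  cintegrable leb half (fun r => H r * (p (ln r) * (r^-1)%:C)).
Hypothesis Hzero : forall lo hi (p : R -> R[i]), csmooth p -> supported lo hi p ->
  cintegral leb half (fun r => H r * (p (ln r) * (r^-1)%:C)) = 0.

Let plateau lo hi t : R[i] := (step (t - lo + 2))%:C * (step (hi + 2 - t))%:C.

Let csmooth_plateau lo hi : csmooth (plateau lo hi).
Proof.
apply: csmoothM.
  rewrite (_ : (fun t => _) = fun t => (step (1 * t + (2 - lo)))%:C).
    exact: (csmooth_affine (f := fun t => (step t)%:C)) csmooth_step.
  by apply/funext => t; congr ((step _)%:C); ring.
rewrite (_ : (fun t => _) = fun t => (step (-1 * t + (hi + 2)))%:C).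
  exact: (csmooth_affine (f := fun t => (step t)%:C)) csmooth_step.
by apply/funext => t; congr ((step _)%:C); ring.
Qed.

Let supported_plateau lo hi : supported (lo - 2) (hi + 2) (plateau lo hi).
Proof.
move=> t; rewrite negb_and -!ltNge /plateau => /orP[] h.
  by rewrite step0 ?mul0r //; lra.
by rewrite [step (hi + 2 - t)]step0 ?mulr0 //; lra.
Qed.

Let plateau1 lo hi t : lo <= t <= hi -> plateau lo hi t = 1.
Proof. by move=> /andP[h1 h2]; rewrite /plateau !step1 ?mul1r //; lra. Qed.

Variable part : R[i] -> R.
Hypothesis partM : forall z (x : R), part (z * x%:C) = part z * x.
Hypothesis part_int : forall f : R -> R[i], cintegrable leb half f -> leb.-integrable half (EFin \o (part \o f)).
Hypothesis part_cint : forall f : R -> R[i], cintegral leb half f = 0 -> Rintegral leb half (part \o f) = 0.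

Let phi r := part (H r) * r^-1.

Let phi_integrable a b : 0 < a -> a < b -> leb.-integrable `[a, b]%classic (EFin \o phi).
Proof.
move=> a0 ab; have b0 := lt_trans a0 ab.
have h := part_int (Hint (csmooth_plateau (ln a) (ln b)) (@supported_plateau (ln a) (ln b))).
have sub : (`[a, b]%classic : set R) `<=` half.
  by move=> r /=; rewrite !in_itv /= andbT => /andP[h1 _]; exact: lt_le_trans a0 h1.
have mab : measurable (`[a, b]%classic : set (measurableTypeR R)) by [].
have mh : measurable half by [].
have := integrableS mh mab sub h; apply: eq_integrable => // r; rewrite inE /= in_itv /= => /andP[h1 h2].
have r0 : 0 < r by exact: lt_le_trans a0 h1.
by rewrite plateau1 ?mul1r ?partM // !ler_ln ?posrE // h1.
Qed.

Let phi_bump a b m : 0 < a -> a < b ->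
  (\int[leb]_(r in `[a, b]%classic) (phi r * bump (ln a) (ln b) m (ln r))%:E)%E = 0%E.
Proof.
move=> a0 ab; have b0 := lt_trans a0 ab.
have cb := csmooth_bump (ln a) (ln b) m.
have sb : supported (ln a) (ln b) (fun t => (bump (ln a) (ln b) m t)%:C).
  move=> t ht; rewrite bump_out //; apply: contra ht => /andP[/ltW -> /ltW ->] //.
have e r : part (H r * ((bump (ln a) (ln b) m (ln r))%:C * (r^-1)%:C)) = phi r * bump (ln a) (ln b) m (ln r).
  by rewrite -rmorphM partM /phi mulrA mulrAC.
have h := part_cint (Hzero cb sb).
have hint := part_int (Hint cb sb).
have fn := integrable_fin_num _ hint.
have -> : (\int[leb]_(r in `[a, b]%classic) (phi r * bump (ln a) (ln b) m (ln r))%:E)%E =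
  (\int[leb]_(r in half) ((part \o (fun r => H r * ((bump (ln a) (ln b) m (ln r))%:C * (r^-1)%:C))) r)%:E)%E.
  rewrite [LHS]integral_mkcond [RHS]integral_mkcond; apply: eq_integral => r _.
  rewrite !patchE /=; have [r0|r0] := leP r 0.
    have n1 : r \notin (half : set R) by rewrite notin_setE /= in_itv /= andbT; apply/negP; rewrite -leNgt.
    have n2 : r \notin (`[a, b]%classic : set R).
      by rewrite notin_setE /= in_itv /=; apply/negP; rewrite negb_and -!ltNge (le_lt_trans r0 a0).
    by rewrite (negbTE n1) (negbTE n2).
  rewrite [r \in half]mem_set; last by rewrite /= in_itv /= andbT.
  case: ifPn => [_|]; first by rewrite e.
  rewrite notin_setE /= in_itv /= => /negP hr; rewrite e bump_out ?mulr0 //.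
  by apply: contra hr => /andP[/ltW h1 /ltW h2]; move: h1 h2; rewrite !ler_ln ?posrE // => -> ->.
by rewrite -[LHS]fineK; [rewrite -[fine _]/(Rintegral leb half _) h|exact: fn].
Qed.

(** The bumps tend boundedly to the indicator of the interval. *)
Let phi_zero a b : 0 < a -> a < b -> Rintegral leb `]a, b[%classic phi = 0.
Proof.
move=> a0 ab; have b0 := lt_trans a0 ab.
have mab : measurable (`[a, b]%classic : set (measurableTypeR R)) by [].
have ip := phi_integrable a0 ab.
have mphi : measurable_fun (`[a, b]%classic : set (measurableTypeR R)) phi.
  by apply/measurable_EFinP; exact: (measurable_int _ ip).
pose f_ (m : nat) (r : measurableTypeR R) := (phi r * bump (ln a) (ln b) m (ln r))%:E.
pose f (r : measurableTypeR R) := ((phi \_ `]a, b[%classic) r)%:E.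
have mbump m : measurable_fun (`[a, b]%classic : set (measurableTypeR R)) (fun r => bump (ln a) (ln b) m (ln r)).
  apply: measurable_funTS; apply: (measurableT_comp (f := bump (ln a) (ln b) m)); last exact: measurable_ln.
  apply: continuous_measurable_fun => t.
  have := csmooth_continuous (csmooth_bump (ln a) (ln b) m) (x := t).
  by move=> /(@cvg_ReIm R _ (nbhs t) (nbhs_filter t))[].
have mf_ m : measurable_fun (`[a, b]%classic : set (measurableTypeR R)) (f_ m).
  by apply/measurable_EFinP; apply: measurable_funM.
have mf : measurable_fun (`[a, b]%classic : set (measurableTypeR R)) f.
  apply/measurable_EFinP; apply/measurable_restrict => //.
  by apply: measurable_funS mphi => //; exact: subIsetl.
have cv : {ae leb, forall r, `[a, b]%classic r -> f_ ^~ r @ \oo --> f r}.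
  apply: aeW => r /=; rewrite in_itv /= => /andP[h1 h2].
  have r0 : 0 < r by exact: lt_le_trans a0 h1.
  apply: cvg_EFin; first exact: nearW.
  rewrite /f /f_ /= patchE; case: ifPn => hr.
    rewrite -[X in _ --> X]mulr1; apply: cvgM; first exact: cvg_cst.
    apply: bump_cvg; move: hr; rewrite inE /= in_itv /= => /andP[k1 k2].
    by rewrite !ltr_ln ?posrE // k1.
  rewrite (_ : (fun m => _) = fun=> 0); first exact: cvg_cst.
  apply/funext => m; rewrite /= bump_out ?mulr0 //.
  apply: contra hr => /andP[]; rewrite !ltr_ln ?posrE // => k1 k2.
  by rewrite inE /= in_itv /= k1.
have dom : {ae leb, forall r m, `[a, b]%classic r -> (`|f_ m r| <= `|(phi r)%:E|)%E}.
  apply: aeW => r m _; rewrite /f_ /= lee_fin normrM ler_piMr //.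
  by have /andP[k0 k1] := bump_le1 (ln a) (ln b) m (ln r); rewrite ger0_norm.
have [_ _ h] := dominated_convergence mab mf_ mf cv (integrable_abse ip) dom.
have h' : [sequence (\int[leb]_(x in `[a, b]%classic) (f_ n x))%E]_n @ \oo --> (0%E : \bar R).
  rewrite (_ : [sequence _]_n = fun=> 0%E); first exact: cvg_cst.
  by apply/funext => m; exact: phi_bump.
have e := cvg_unique _ h h'.
rewrite /Rintegral; have -> : (\int[leb]_(x in `]a, b[%classic) (phi x)%:E)%E = (\int[leb]_(x in `[a, b]%classic) f x)%E.
  rewrite /f [RHS](_ : _ = (\int[leb]_(x in `[a, b]%classic) (((EFin \o phi) \_ `]a, b[%classic) x))%E).
    by rewrite -integral_mkcondr; congr (integral _ _ _); apply/esym/setIidr; exact: subset_itv_oo_cc.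
  by apply: eq_integral => x _; rewrite restrict_EFin.
by rewrite e.
Qed.

Lemma part_zero : {ae leb, forall r, 0 < r -> part (H r) = 0}.
Proof.
apply: (@filterS _ _ (ae_filter_ringOfSetsType leb) _ _ _ (ae_zero phi_integrable phi_zero)) => r hr r0.
by have /eqP := hr r0; rewrite mulf_eq0 invr_eq0 (gt_eqF r0) orbF => /eqP.
Qed.

End Defect.

Variables (F : R -> R[i]) (q Y1 dY1 Y2 dY2 : R -> R[i]) (W : R[i]).
Hypotheses (cq : csmooth q) (o1 : osol q Y1 dY1) (o2 : osol q Y2 dY2) (W0 : W != 0).
Hypothesis HW : forall t, Y1 t * dY2 t - dY1 t * Y2 t = W.
Hypothesis Fint : forall lo hi (p : R -> R[i]), continuous p -> supported lo hi p ->
  cintegrable leb half (fun r => F r * (p (ln r) * (r^-1)%:C)).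
Hypothesis Fweak : forall lo hi (xi dxi ddxi : R -> R[i]), csmooth xi -> supported lo hi xi ->
  (forall t, cder xi t (dxi t)) -> (forall t, cder dxi t (ddxi t)) ->
  cintegral leb half (fun r => F r * ((ddxi (ln r) - q (ln r) * xi (ln r)) * (r^-1)%:C)) = 0.

(** The difference between [F] and the combination found in
    [variation_of_constants] is orthogonal to all bumps. *)
Lemma mode_is_solution : exists a1 a2 : R[i],
  {ae leb, forall r, 0 < r -> F r = a1 * Y1 (ln r) + a2 * Y2 (ln r)}.
Proof.
have [a1 [a2 hv]] := variation_of_constants cq o1 o2 W0 HW Fint Fweak.
exists a1, a2; have mh : measurable half by [].
pose Z t := a1 * Y1 t + a2 * Y2 t; pose H r := F r - Z (ln r).
have [[sY1 _] [sY2 _]] := (osol_csmooth cq o1, osol_csmooth cq o2).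
have sZ : csmooth Z by apply: csmoothD; apply: csmoothM => //; exact: csmooth_cst.
have iP lo hi (p Y : R -> R[i]) : csmooth p -> csmooth Y -> supported lo hi p ->
    cintegrable leb half (fun r => (p (ln r) * Y (ln r)) * (r^-1)%:C).
  move=> cp cY sp; have spY : supported lo hi (fun t => p t * Y t) by move=> t ht; rewrite sp // mul0r.
  have [C hC] := radial_amp_ln (csmooth_continuous (csmoothM cp cY)) spY.
  exact: (radial_amp_cintegrable hC).
have HE (p : R -> R[i]) r : H r * (p (ln r) * (r^-1)%:C) =
    F r * (p (ln r) * (r^-1)%:C) - p (ln r) * Z (ln r) * (r^-1)%:C.
  by rewrite /H; move: (F r) (Z _) (p _) (_%:C) => *; ring.
have iH lo hi (p : R -> R[i]) : csmooth p -> supported lo hi p ->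
    cintegrable leb half (fun r => H r * (p (ln r) * (r^-1)%:C)).
  move=> cp sp; rewrite (funext (HE p)).
  have h1 := Fint (csmooth_continuous cp) sp.
  have h2 := cintegrableZ (-1) mh (iP _ _ _ _ cp sZ sp).
  by apply: (eq_cintegrable mh _ (cintegrableD mh h1 h2)) => r _; rewrite mulrN1.
have zH lo hi (p : R -> R[i]) : csmooth p -> supported lo hi p ->
    cintegral leb half (fun r => H r * (p (ln r) * (r^-1)%:C)) = 0.
  move=> cp sp; rewrite (funext (HE p)) cintegralB //; [|exact: (Fint (csmooth_continuous cp) sp)|exact: (iP _ _ _ _ cp sZ sp)].
  have := hv _ _ _ cp sp; rewrite /pairing => ->; rewrite /logint.
  have e1 := cintegralZ a1 mh (iP _ _ _ _ cp sY1 sp); have e2 := cintegralZ a2 mh (iP _ _ _ _ cp sY2 sp).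
  rewrite mulrC -e1 [a2 * _]mulrC -e2 -cintegralD //; last 2 first.
  - exact: (cintegrableZ a1 mh (iP _ _ _ _ cp sY1 sp)).
  - exact: (cintegrableZ a2 mh (iP _ _ _ _ cp sY2 sp)).
  apply/eqP; rewrite subr_eq0; apply/eqP; apply: eq_cintegral => r _; rewrite /Z.
  by move: (p _) (Y1 _) (Y2 _) (_%:C) => *; ring.
have hRe : {ae leb, forall r, 0 < r -> complex.Re (H r) = 0}.
  apply: (part_zero iH zH (part := @complex.Re R)).
  - by move=> z x; rewrite cReM /= mulr0 subr0.
  - by move=> f [].
  - by move=> f hf; have := congr1 (@complex.Re R) hf.
have hIm : {ae leb, forall r, 0 < r -> complex.Im (H r) = 0}.
  apply: (part_zero iH zH (part := @complex.Im R)).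
  - by move=> z x; rewrite cImM /= mulr0 ?addr0 ?add0r.
  - by move=> f [].
  - by move=> f hf; have := congr1 (@complex.Im R) hf.
apply: (@filterS2 _ _ (ae_filter_ringOfSetsType leb) _ _ _ _ hRe hIm) => r h1 h2 r0.
by apply/eqP; rewrite -subr_eq0; apply/eqP; apply: complex_ext; [exact: h1|exact: h2].
Qed.

End ModeIsSolution.

Section FormalModes.
Context {R : realType}.
Local Notation leb := (@lebesgue_measure R).

Lemma csmooth_sech_tnh m : Ck m (fun t : R => (sech t)%:C) /\ Ck m (fun t : R => (tnh t)%:C).
Proof.
elim: m => [//|m [h1 h2]]; split.
  exists (fun t => (-1) * ((sech t)%:C * (tnh t)%:C)) => [t|].
    by apply: cder_eq (cder_real (is_derive_sech t)); rewrite mulN1r rmorphN rmorphM.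
  exact: (CkM (Ck_cst m _) (CkM h1 h2)).
exists (fun t => (sech t)%:C * (sech t)%:C) => [t|]; last exact: CkM.
by apply: cder_eq (cder_real (is_derive_tnh t)); rewrite expr2 rmorphM.
Qed.

Lemma csmooth_qrad n k (lambda : R[i]) : csmooth (qrad n k lambda).
Proof.
have hs : csmooth (fun t : R => (sech t)%:C) by move=> m; case: (csmooth_sech_tnh m).
have hn := csmooth_affine n%:R 0 hs.
rewrite (_ : qrad n k lambda = fun t => (`|k|%N%:R ^+ 2)%:C +
  (- lambda * (n%:R ^+ 2)%:C) * ((sech (n%:R * t + 0))%:C * (sech (n%:R * t + 0))%:C)).
  exact: (csmoothD (csmooth_cst _) (csmoothM (csmooth_cst _) (csmoothM hn hn))).
apply/funext => t; rewrite /qrad addr0.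
have -> : ((n%:R * sech (n%:R * t)) ^+ 2)%:C = (n%:R ^+ 2)%:C * ((sech (n%:R * t))%:C * (sech (n%:R * t))%:C) :> R[i].
  by rewrite -!rmorphM; congr (_ %:C); rewrite exprMn expr2.
by move: ((sech _)%:C) ((n%:R ^+ 2)%:C) ((`|k|%N%:R ^+ 2)%:C) => a b c; ring.
Qed.

Lemma osol_scale (q y dy : R -> R[i]) (a : R) : osol q y dy ->
  osol (fun t => (a ^+ 2)%:C * q (a * t)) (fun t => y (a * t)) (fun t => a%:C * dy (a * t)).
Proof.
move=> [h1 h2].
have hd (t : R) : is_derive t 1 (fun t => a * t) a.
  have h := is_deriveM' (is_derive_cst a t 1) (is_derive_id t (1 : R)).
  by apply: (is_derive_eq h); rewrite /= mul0r add0r mulr1.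
split=> t; first exact: (@cder_comp R y (fun t => a * t) t _ _ (h1 _) (hd t)).
apply: cder_eq (cderZ a%:C (@cder_comp R dy (fun t => a * t) t _ _ (h2 _) (hd t))).
by rewrite !rmorphM !mulrA.
Qed.

(** The dilation [s = n t] turns the potential [qrad] into [legq]. *)
Lemma formal_mode (n : nat) (k : int) (nu : R[i]) (u : R[i] -> R[i]) (y1 dy1 y2 dy2 : R -> R[i]) (W : R[i]) :
  (0 < n)%N -> formal_solution n (nu * (nu + 1)) u ->
  osol (legq nu (alpha n k)) y1 dy1 -> osol (legq nu (alpha n k)) y2 dy2 ->
  W != 0 -> y1 0 * dy2 0 - dy1 0 * y2 0 = W ->
  exists c1 c2 : R[i], {ae leb, forall r, 0 < r ->
    fourier u k r = c1 * y1 (n%:R * ln r) + c2 * y2 (n%:R * ln r)}.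
Proof.
move=> n0 [[hL2 _] hw] h1 h2 W0 HW.
have nn : (n%:R : R) != 0 by rewrite pnatr_eq0 -lt0n.
have eq : qrad n k (nu * (nu + 1)) = fun t => (n%:R ^+ 2)%:C * legq nu (alpha n k) (n%:R * t).
  apply/funext => t; rewrite /qrad /legq /alpha mulrBr -rmorphM exprMn; congr (_ %:C - _).
    by rewrite -exprMn mulrCA mulfV // mulr1.
  by rewrite rmorphM /= mulrCA.
have o1 := osol_scale n%:R h1; have o2 := osol_scale n%:R h2.
rewrite -eq in o1 o2.
have n0C : (n%:R : R)%:C != 0 :> R[i] by rewrite -modulus_gt0 modulusR normr_gt0.
have HW' t : y1 (n%:R * t) * ((n%:R)%:C * dy2 (n%:R * t)) - (n%:R)%:C * dy1 (n%:R * t) * y2 (n%:R * t)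
    = (n%:R)%:C * W :> R[i].
  rewrite -HW -(wronskian_cst (n%:R * t) 0 h1 h2).
  by move: (_%:C) (y1 _) (y2 _) (dy1 _) (dy2 _) => *; ring.
have [] := @mode_is_solution R (fourier u k) (qrad n k (nu * (nu + 1))) _ _ _ _ ((n%:R)%:C * W)
  (csmooth_qrad n k _) o1 o2 (mulf_neq0 n0C W0) HW'.
- move=> lo hi p cp sp; have [C hC] := radial_amp_ln cp sp.
  exact: (@fourier_amp R n k u n0 hL2 _ _ _ _ (expR_gt0 lo) hC).
- by move=> lo hi xi dxi ddxi cx sx d1 d2; exact: (@radial_weak R n k u n0 hL2 _ lo hi xi dxi ddxi hw cx sx d1 d2).
- by move=> a1 [a2 h]; exists a1, a2.
Qed.

End FormalModes.

(** * Boundary expansions *)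

Section Asymptotics.
Context {R : realType}.
Implicit Types (nu : R[i]) (al s r : R).
Local Notation leb := (@lebesgue_measure R).

Lemma psum_bounded (c : nat -> R[i]) : rad1 c ->
  exists2 K : R, 0 <= K & forall x, 0 <= x <= 2^-1 -> modulus (psum c x) <= K.
Proof.
move=> hc; have h0 : (0 : R) <= 2^-1 by rewrite invr_ge0.
have cm : {within `[(0 : R), 2^-1], continuous (modulus \o psum c)}.
  apply: continuous_in_subspaceT => x; rewrite inE /= in_itv /= => /andP[x0 x1].
  have x2 : `|x| < 1 by rewrite ger0_norm //; apply: le_lt_trans x1 _; rewrite invf_lt1 ?ltr1n.
  exact: (@cvg_modulus R _ (nbhs x) (nbhs_filter x) _ _ (cder_continuous (cder_psum hc x2))).
have [y _ hy] := EVT_max h0 cm.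
exists (modulus (psum c y)); first exact: modulus_ge0.
by move=> x hx; apply: hy; rewrite in_itv.
Qed.

(** Beyond its first term the series is [zeta] times a bounded one, and
    [zeta s <= e ^ (2 s)]. *)
Lemma hser_bound nu (sg : nat -> R[i]) : jbd sg ->
  exists2 K : R, 0 <= K & forall s, s <= 0 ->
    modulus (hser nu sg (zeta s) - sg 0%N) <= K * expR (2 * s).
Proof.
move=> hs; have hr := rad1_hcoef nu hs.
have [K K0 hK] := psum_bounded (rad1_shift hr).
exists K => // s s0.
rewrite /hser psum_recl ?zeta_norm // hcoef0 mul1r addrAC subrr add0r modulusM modulusR.
rewrite mulrC; apply: ler_pM; rewrite ?modulus_ge0 //.
  by apply: hK; rewrite (ltW (zeta_gt0 s)) zeta_le_half.
by rewrite ger0_norm ?zeta_le // ltW // zeta_gt0.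
Qed.

Lemma Phi_asymptotics nu al : -1 < al -> exists2 K : R, 0 <= K & forall s, s <= 0 ->
  modulus (Phi nu al s - (expR (al * s))%:C * rgamma (1 + al%:C)) <= K * (expR (al * s) * expR (2 * s)).
Proof.
move=> hal; have [K K0 hK] := hser_bound nu (jbd_rgseq (good_1D hal)).
exists K => // s s0; rewrite /Phi /tw /hyp -mulrBr modulusM modulusR ger0_norm ?expR_ge0 //.
rewrite mulrCA ler_wpM2l ?expR_ge0 //.
by have := hK s s0; rewrite {2}/rgseq addr0.
Qed.

Lemma Xi_asymptotics nu : exists2 K : R, 0 <= K & forall s, s <= 0 ->
  modulus (tw 0 (hser nu (drgseq 1)) s - euler_gamma%:C) <= K * expR (2 * s).
Proof.
have [K K0 hK] := hser_bound nu (jbd_drgseq (@good_one R)).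
exists K => // s s0; rewrite /tw mul0r expR0 mul1r.
by have := hK s s0; rewrite {2}/drgseq addr0 drgamma_1.
Qed.

Lemma expR_scaled_ln (n : nat) r : 0 < r -> expR (n%:R * ln r) = r ^+ n.
Proof. by move=> r0; rewrite expRM_natl lnK ?posrE. Qed.

(** As [e ^ (2 s) = r ^ (2 n)], the errors of [Phi_al] and [Phi_(- al)] are
    [O(r ^ (2 n + m))] and [O(r ^ (2 n - m))]. *)
Lemma power_expansion (n m : nat) nu (A B : R[i]) (w : R -> R[i]) :
  (0 < n)%N -> (0 < m < n)%N ->
  {ae leb, forall r, 0 < r ->
    w r = A * Phi nu (m%:R / n%:R) (n%:R * ln r) + B * Phi nu (- (m%:R / n%:R)) (n%:R * ln r)} ->
  bigO_ae0 (fun r => w r - (A * rgamma (1 + (m%:R / n%:R)%:C) * (r ^+ m)%:C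
                            + B * rgamma (1 - (m%:R / n%:R)%:C) * (r ^- m)%:C))
           (fun r => r ^+ (2 * n - m)).
Proof.
move=> n0 /andP[m0 mn].
have m2n : (m <= 2 * n)%N by lia.
have m2n' : (2 * n - m <= m + 2 * n)%N by lia.
move=> hw; set al := m%:R / n%:R.
have nn : (0 : R) < n%:R by rewrite ltr0n.
have al0 : 0 < al by rewrite divr_gt0 ?ltr0n.
have al1 : al < 1 by rewrite ltr_pdivrMr // mul1r ltr_nat.
have h1 : -1 < al by lra.
have h2 : -1 < - al by lra.
have [K1 K10 hK1] := Phi_asymptotics nu h1; have [K2 K20 hK2] := Phi_asymptotics nu h2.
exists (modulus A * K1 + modulus B * K2), 1 => //.
apply: (@filterS _ _ (ae_filter_ringOfSetsType leb) _ _ _ hw) => r hr /andP[r0 r1].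
rewrite hr //; set s := n%:R * ln r.
have s0 : s <= 0 by rewrite pmulr_rle0 // -ln1 ler_ln ?posrE // ltW.
have eals : al * s = m%:R * ln r by rewrite /al /s mulrA divfK // gt_eqF.
have e1 : expR (al * s) = r ^+ m by rewrite eals expR_scaled_ln.
have e2 : expR (- al * s) = r ^- m by rewrite mulNr expRN e1.
have e3 : expR (2 * s) = r ^+ (2 * n).
  by rewrite expR2 /s expR_scaled_ln // mulnC exprM.
have k1 := hK1 s s0; have k2 := hK2 s s0; rewrite e1 e3 in k1; rewrite e2 e3 rmorphN /= in k2.
have r2 : r ^- m * r ^+ (2 * n) = r ^+ (2 * n - m).
  rewrite -[in LHS](subnK m2n).
  by rewrite exprD mulrCA mulVf ?mulr1 // expf_neq0 // gt_eqF.
have r3 : r ^+ m * r ^+ (2 * n) <= r ^+ (2 * n - m).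
  by rewrite -exprD ler_wiXn2l ?(ltW r0) ?(ltW r1) // m2n'.
rewrite r2 in k2.
have {}k1 : modulus (Phi nu al s - (r ^+ m)%:C * rgamma (1 + al%:C)) <= K1 * r ^+ (2 * n - m).
  by apply: le_trans k1 _; rewrite ler_wpM2l.
have -> : A * Phi nu al s + B * Phi nu (- al) s -
   (A * rgamma (1 + al%:C) * (r ^+ m)%:C + B * rgamma (1 - al%:C) * (r ^- m)%:C) =
   A * (Phi nu al s - (r ^+ m)%:C * rgamma (1 + al%:C)) + B * (Phi nu (- al) s - (r ^- m)%:C * rgamma (1 - al%:C)).
  move: (Phi nu al s) (Phi nu (- al) s) (rgamma (1 + al%:C)) (rgamma (1 - al%:C)) (r ^+ m)%:C (r ^- m)%:C.
  by move=> p1 p2 g1 g2 x y; ring.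
apply: le_trans (modulusD _ _) _; rewrite (modulusM A) (modulusM B) mulrDl -!mulrA.
by apply: lerD; rewrite ler_wpM2l ?modulus_ge0.
Qed.

(** The logarithm in the error comes from the term [s * Phi nu 0 s] of
    [Xi]. *)
Lemma log_expansion (n : nat) nu (A B : R[i]) (w : R -> R[i]) :
  (0 < n)%N ->
  {ae leb, forall r, 0 < r ->
    w r = A * Phi nu 0 (n%:R * ln r) + B * QPhi nu (n%:R * ln r)} ->
  bigO_ae0 (fun r => w r - (A - B * (euler_gamma%:C + digamma (nu + 1)) + (- (n%:R * B)) * (ln r)%:C))
           (fun r => r ^+ (2 * n) * `|ln r|).
Proof.
move=> n0 hw.
have nn : (0 : R) < n%:R by rewrite ltr0n.
have h1 : -1 < 0 :> R by rewrite oppr_lt0.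
have [K1 K10 hK1] := Phi_asymptotics nu h1; have [K2 K20 hK2] := Xi_asymptotics nu.
set ps := digamma (nu + 1).
exists (modulus (A - B * ps) * K1 + modulus B * (n%:R * K1 + K2)), (expR (-1)); first exact: expR_gt0.
apply: (@filterS _ _ (ae_filter_ringOfSetsType leb) _ _ _ hw) => r hr /andP[r0 r1].
have lr : ln r < -1 by rewrite -[X in _ < X]expRK ltr_ln ?posrE ?expR_gt0.
rewrite hr //; set s := n%:R * ln r.
have s0 : s <= 0 by rewrite pmulr_rle0 //; lra.
have e3 : expR (2 * s) = r ^+ (2 * n).
  by rewrite expR2 /s expR_scaled_ln // mulnC exprM.
have k1 := hK1 s s0; have k2 := hK2 s s0; rewrite mul0r expR0 mul1r e3 one0C rgamma_1 mul1r in k1; rewrite e3 in k2.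
have l1 : 1 <= `|ln r| by rewrite ltr0_norm; lra.
have -> : A * Phi nu 0 s + B * QPhi nu s -
   (A - B * (euler_gamma%:C + ps) + (- (n%:R * B)) * (ln r)%:C) =
   (A - B * ps) * (Phi nu 0 s - 1) - B * ((n%:R * ln r)%:C * (Phi nu 0 s - 1) + (tw 0 (hser nu (drgseq 1)) s - euler_gamma%:C)).
  rewrite /QPhi /Xi -/ps -/s.
  have -> : s%:C = n%:R * (ln r)%:C :> R[i] by rewrite /s rmorphM /= real_complexN.
  move: (Phi nu 0 s) (tw 0 _ s) (euler_gamma%:C) ((ln r)%:C) (n%:R : R[i]) => *; ring.
have p0 : 0 <= r ^+ (2 * n) by rewrite exprn_ge0 // ltW.
apply: le_trans (modulusD _ _) _; rewrite modulusN (modulusM (A - B * ps)) (modulusM B) mulrDl -!mulrA.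
apply: lerD; apply: ler_wpM2l; rewrite ?modulus_ge0 //.
  apply: le_trans k1 _; apply: ler_wpM2l => //; by rewrite ler_peMr.
apply: le_trans (modulusD _ _) _; rewrite modulusM modulusR normrM (ger0_norm (ltW nn)) mulrDl.
apply: lerD.
  rewrite -!mulrA; apply: ler_wpM2l; first exact: ltW.
  by rewrite [leRHS]mulrA [leRHS]mulrC; apply: ler_wpM2l => //; exact: normr_ge0.
apply: le_trans k2 _; apply: ler_wpM2l => //; by rewrite ler_peMr.
Qed.

(** A null set contains no interval. *)
Lemma ae_small (P : R -> Prop) (e : R) : {ae leb, forall r, P r} -> 0 < e -> exists2 r, 0 < r < e & P r.
Proof.
move=> [N [mN N0 sub]] e0; apply: contrapT => hn.
have : (leb (`]0%R, e[%classic : set R) <= leb N)%E.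
  apply: le_measure; rewrite ?inE // => r /=; rewrite in_itv /= => hr; apply: sub => /= Pr; apply: hn.
  by exists r.
by rewrite N0 lebesgue_measure_itv /= lte_fin e0 -EFinB lee_fin subr0 leNgt e0.
Qed.

Lemma bigO_ae0_sub (f g : R -> R[i]) (G : R -> R) : (forall r, 0 < r -> 0 <= G r) -> bigO_ae0 f G -> bigO_ae0 g G ->
  exists2 K : R, 0 <= K & forall e : R, 0 < e -> exists2 r, 0 < r < e & modulus (f r - g r) <= K * G r.
Proof.
move=> G0 [K1 [d1 d10 h1]] [K2 [d2 d20 h2]].
exists (`|K1| + `|K2|); first by rewrite addr_ge0.
move=> e e0; have e1 : 0 < Num.min e (Num.min d1 d2) by rewrite !lt_min e0 d10.
have h := @filterS2 _ _ (ae_filter_ringOfSetsType leb) _ _ (fun r => (0 < r < d1 -> complex.Re `|f r| <= K1 * G r) /\ (0 < r < d2 -> complex.Re `|g r| <= K2 * G r))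
   (fun r a b => conj a b) h1 h2.
have [r /andP[r0]] := ae_small h e1; rewrite !lt_min => /and3P[re rd1 rd2] [k1 k2].
exists r; first by rewrite r0.
apply: le_trans (modulusD _ _) _; rewrite modulusN mulrDl.
have l1 : modulus (f r) <= K1 * G r by apply: k1; rewrite r0.
have l2 : modulus (g r) <= K2 * G r by apply: k2; rewrite r0.
apply: lerD; [apply: le_trans l1 _|apply: le_trans l2 _]; rewrite ler_wpM2r ?G0 //; exact: ler_norm.
Qed.

Lemma small_eq0 (z : R[i]) (C : R) : (forall e : R, 0 < e -> exists2 r, 0 < r < e & modulus z <= C * r) -> z = 0.
Proof.
move=> h; apply/eqP; rewrite -modulus_eq0; apply: contraT => z0.
have zp : 0 < modulus z by rewrite lt_def z0 modulus_ge0.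
have C1 : 0 < `|C| + 1 by rewrite ltr_pwDr.
have [r /andP[r0 re] hr] := h (modulus z / (`|C| + 1)) (divr_gt0 zp C1).
move: re; rewrite ltr_pdivlMr // => re.
have : modulus z < modulus z.
  apply: le_lt_trans hr _; apply: le_lt_trans re; rewrite mulrC ler_wpM2l ?(ltW r0) //.
  by apply: le_trans (ler_norm _) _; rewrite lerDl.
by rewrite ltxx.
Qed.

Lemma ln_lt_inv r : 0 < r < 1 -> r * `|ln r| <= 1.
Proof.
move=> /andP[r0 r1]; have l0 : ln r < 0 by rewrite -ln1 ltr_ln ?posrE.
rewrite ltr0_norm // -lnV ?posrE //.
have h : ln r^-1 <= r^-1.
  by have := expR_ge1Dx (ln r^-1); rewrite lnK ?posrE ?invr_gt0 //; lra.
by apply: le_trans (ler_wpM2l (ltW r0) h) _; rewrite mulfV // gt_eqF.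
Qed.

(** Since [2 n - m > m], the error is negligible against both terms: the
    coefficient of the dominant [r ^ - m] is isolated first. *)
Lemma expansion_power_unique (n m : nat) (c1 c2 d1 d2 : R[i]) (w : R -> R[i]) : (0 < m < n)%N ->
  bigO_ae0 (fun r => w r - (c1 * (r ^+ m)%:C + c2 * (r ^- m)%:C)) (fun r => r ^+ (2 * n - m)) ->
  bigO_ae0 (fun r => w r - (d1 * (r ^+ m)%:C + d2 * (r ^- m)%:C)) (fun r => r ^+ (2 * n - m)) ->
  c1 = d1 /\ c2 = d2.
Proof.
move=> /andP[m0 mn].
have j1 : (0 < 2 * n - m + m)%N by lia.
have j2 : (m <= 2 * n - m)%N by lia.
have j3 : (2 * n - m - m = 2 * n - 2 * m)%N by lia.
have j4 : (0 < 2 * n - 2 * m)%N by lia.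
move=> h1 h2; have G0 r : 0 < r -> 0 <= r ^+ (2 * n - m) by move=> r0; rewrite exprn_ge0 // ltW.
have [K K0 hK] := bigO_ae0_sub G0 h1 h2.
have ed r : (w r - (c1 * (r ^+ m)%:C + c2 * (r ^- m)%:C)) - (w r - (d1 * (r ^+ m)%:C + d2 * (r ^- m)%:C)) =
   (d1 - c1) * (r ^+ m)%:C + (d2 - c2) * (r ^- m)%:C.
  by move: (w r) (_%:C) (_%:C) => *; ring.
have e2 : d2 - c2 = 0.
  apply: (@small_eq0 _ (K + modulus (d1 - c1))) => e e0.
  have e1 : 0 < Num.min e 1 by rewrite lt_min e0 ltr01.
  have [r /andP[r0]] := hK _ e1; rewrite lt_min => /andP[re r1]; rewrite ed => h.
  exists r; first by rewrite r0.
  have rm : r ^+ m != 0 by rewrite expf_neq0 // gt_eqF.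
  have rC : (r ^- m)%:C * (r ^+ m)%:C = 1 :> R[i] by rewrite -rmorphM mulVf.
  have -> : d2 - c2 = ((d1 - c1) * (r ^+ m)%:C + (d2 - c2) * (r ^- m)%:C) * (r ^+ m)%:C - (d1 - c1) * ((r ^+ m)%:C * (r ^+ m)%:C).
    rewrite mulrDl -[X in _ + X - _]mulrA rC mulr1; move: (_%:C) => *; ring.
  apply: le_trans (modulusD _ _) _; rewrite modulusN !modulusM !modulusR (ger0_norm (exprn_ge0 m (ltW r0))) [leRHS]mulrDl.
  have ple j : (0 < j)%N -> r ^+ j <= r by move=> j0; rewrite -[leRHS]expr1 ler_wiXn2l ?(ltW r0) ?(ltW r1).
  apply: lerD; last by rewrite -exprD ler_wpM2l ?modulus_ge0 // ple // addn_gt0 m0.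
  apply: le_trans (ler_wpM2r (exprn_ge0 m (ltW r0)) h) _.
  by rewrite -mulrA -exprD ler_wpM2l // ple.
have e1 : d1 - c1 = 0.
  apply: (@small_eq0 _ K) => e e0.
  have e1 : 0 < Num.min e 1 by rewrite lt_min e0 ltr01.
  have [r /andP[r0]] := hK _ e1; rewrite lt_min => /andP[re r1]; rewrite ed e2 mul0r addr0 => h.
  exists r; first by rewrite r0.
  move: h; rewrite modulusM modulusR (ger0_norm (exprn_ge0 m (ltW r0))).
  rewrite -ler_pdivlMr ?exprn_gt0 // => h; apply: le_trans h _.
  rewrite -mulrA ler_wpM2l //.
  have -> : r ^+ (2 * n - m) / r ^+ m = r ^+ (2 * n - 2 * m).
    rewrite -[in LHS](subnK j2).
    by rewrite exprD mulfK ?j3 // expf_neq0 // gt_eqF.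
  by rewrite -[leRHS]expr1 ler_wiXn2l ?(ltW r0) ?(ltW r1).
by split; apply/esym/eqP; rewrite -subr_eq0; apply/eqP.
Qed.

(** The dominant coefficient, that of [ln r], is isolated first. *)
Lemma expansion_log_unique (n : nat) (c1 c2 d1 d2 : R[i]) (w : R -> R[i]) : (0 < n)%N ->
  bigO_ae0 (fun r => w r - (c1 + c2 * (ln r)%:C)) (fun r => r ^+ (2 * n) * `|ln r|) ->
  bigO_ae0 (fun r => w r - (d1 + d2 * (ln r)%:C)) (fun r => r ^+ (2 * n) * `|ln r|) ->
  c1 = d1 /\ c2 = d2.
Proof.
move=> n0 h1 h2.
have G0 r : 0 < r -> 0 <= r ^+ (2 * n) * `|ln r| by move=> r0; rewrite mulr_ge0 // exprn_ge0 // ltW.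
have [K K0 hK] := bigO_ae0_sub G0 h1 h2.
have ed r : (w r - (c1 + c2 * (ln r)%:C)) - (w r - (d1 + d2 * (ln r)%:C)) =
   (d1 - c1) + (d2 - c2) * (ln r)%:C.
  by move: (w r) (_%:C) => *; ring.
have small r : 0 < r < 1 -> r ^+ (2 * n) * `|ln r| <= r.
  move=> /andP[r0 r1]; have [p ->] : exists p, (2 * n = p.+2)%N by exists (2 * n - 2)%N; lia.
  rewrite exprSr -mulrA; apply: le_trans (_ : r ^+ p.+1 * 1 <= _).
    by rewrite ler_wpM2l ?exprn_ge0 ?(ltW r0) // ln_lt_inv // r0.
  by rewrite mulr1 -[leRHS]expr1 ler_wiXn2l ?(ltW r0) ?(ltW r1).
have e2 : d2 - c2 = 0.
  apply/eqP; rewrite -modulus_eq0; apply: contraT => z0.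
  have zp : 0 < modulus (d2 - c2) by rewrite lt_def z0 modulus_ge0.
  pose C := modulus (d1 - c1) + K + 1.
  have e1 : 0 < Num.min 1 (expR (- (C / modulus (d2 - c2)))) by rewrite lt_min ltr01 expR_gt0.
  have [r /andP[r0]] := hK _ e1; rewrite lt_min => /andP[r1 re]; rewrite ed => h.
  have lr : C / modulus (d2 - c2) < `|ln r|.
    rewrite ltr0_norm; last by rewrite -ln1 ltr_ln ?posrE.
    by rewrite ltrNr -[ltRHS]expRK ltr_ln ?posrE ?expR_gt0.
  rewrite ltr_pdivrMr // in lr.
  have r01 : 0 < r < 1 by rewrite r0.
  have := small r r01 => hs.
  have : modulus ((d2 - c2) * (ln r)%:C) <= K * 1 + modulus (d1 - c1).
    have -> : (d2 - c2) * (ln r)%:C = ((d1 - c1) + (d2 - c2) * (ln r)%:C) - (d1 - c1) by move: (_%:C) => *; ring.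
    apply: le_trans (modulusD _ _) _; rewrite modulusN lerD2r; apply: le_trans h _.
    by rewrite ler_wpM2l // (le_trans hs) // ltW.
  by rewrite modulusM modulusR mulrC /C in lr *; lra.
have e1 : d1 - c1 = 0.
  apply: (@small_eq0 _ K) => e e0.
  have e1 : 0 < Num.min e 1 by rewrite lt_min e0 ltr01.
  have [r /andP[r0]] := hK _ e1; rewrite lt_min => /andP[re r1]; rewrite ed e2 mul0r addr0 => h.
  exists r; first by rewrite r0.
  by apply: le_trans h _; rewrite ler_wpM2l // small // r0.
by split; apply/esym/eqP; rewrite -subr_eq0; apply/eqP.
Qed.

End Asymptotics.

(** * Inversion of the sphere *)

Section Inversion.
Context {R : realType}.
Local Notation leb := (@lebesgue_measure R).
Local Notation half := (`]0, +oo[%classic : set (measurableTypeR R)).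

(** Away from [0] the inversion is Lipschitz. *)
Lemma inv_cell_measure (a b p q : R) : 0 < a -> a <= b -> p < q ->
  measurable ([set r | a <= r <= b /\ p < r^-1 <= q] : set (measurableTypeR R)) ->
  (leb [set r : R | (a <= r <= b)%R /\ (p < r^-1 <= q)%R] <= (b ^+ 2 * (q - p))%:E)%E.
Proof.
move=> a0 ab pq mJ; have b0 := lt_le_trans a0 ab.
have rhs0 : 0 <= b ^+ 2 * (q - p) by apply: mulr_ge0; [exact: sqr_ge0|rewrite subr_ge0 ltW].
pose p' := Num.max p b^-1; pose q' := Num.min q a^-1.
have p'0 : 0 < p' by rewrite lt_max invr_gt0 b0 orbT.
have [qp|pq'] := ltP q' p'.
  rewrite (_ : [set r : R | _] = set0) ?measure0 ?lee_fin //.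
  apply/seteqP; split=> // r /= [/andP[h1 h2] /andP[h3 h4]].
  have r0 := lt_le_trans a0 h1.
  have : p' <= q'.
    apply: (@le_trans _ _ r^-1).
      by rewrite ge_max (ltW h3) lef_pV2 ?posrE.
    by rewrite le_min h4 lef_pV2 ?posrE.
  by rewrite leNgt qp.
have q'0 := lt_le_trans p'0 pq'.
apply: (@le_trans _ _ (leb (`[q'^-1, p'^-1]%classic : set R))).
  apply: le_measure; rewrite ?inE // => r /= [/andP[h1 h2] /andP[h3 h4]].
  have r0 := lt_le_trans a0 h1.
  rewrite in_itv /=; apply/andP; split.
    rewrite -[leRHS]invrK lef_pV2 ?posrE ?invr_gt0 // le_min h4 lef_pV2 ?posrE //.
  by rewrite -[leLHS]invrK lef_pV2 ?posrE ?invr_gt0 // ge_max (ltW h3) lef_pV2 ?posrE.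
rewrite lebesgue_measure_itv /= lte_fin; case: ifP => _; last by rewrite lee_fin.
rewrite -EFinB lee_fin.
have -> : p'^-1 - q'^-1 = (p'^-1 * q'^-1) * (q' - p').
  by field; rewrite (gt_eqF p'0) (gt_eqF q'0).
have bp : p'^-1 <= b by rewrite -[leRHS]invrK lef_pV2 ?posrE ?invr_gt0 // le_max lexx orbT.
have bq : q'^-1 <= b by apply: le_trans bp; rewrite lef_pV2 ?posrE.
apply: ler_pM; rewrite ?mulr_ge0 ?invr_ge0 ?subr_ge0 ?(ltW p'0) ?(ltW q'0) //.
  by rewrite expr2 ler_pM ?invr_ge0 ?(ltW p'0) ?(ltW q'0).
by apply: lerB; [rewrite ge_min lexx|rewrite le_max lexx].
Qed.

Lemma measurable_inv_preimage (a b : R) (N : set (measurableTypeR R)) : 0 < a -> measurable N ->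
  measurable ([set r | a <= r <= b /\ N r^-1] : set (measurableTypeR R)).
Proof.
move=> a0 mN; have mab : measurable (`[a, b]%classic : set (measurableTypeR R)) by [].
have mi : measurable_fun (`[a, b]%classic : set (measurableTypeR R)) (fun r : R => r^-1).
  apply: (measurable_funS _ _ (@measurable_inv_half R)) => // r /=; rewrite !in_itv /= andbT => /andP[h _].
  exact: lt_le_trans a0 h.
have := mi mab N mN; rewrite (_ : _ `&` _ = [set r | a <= r <= b /\ N r^-1]) //.
Qed.

Lemma inv_null (a b : R) (N : set (measurableTypeR R)) : 0 < a -> a <= b -> measurable N -> leb N = 0%E ->
  leb [set r : R | a <= r <= b /\ N r^-1] = 0%E.
Proof.
move=> a0 ab mN N0; have b0 := lt_le_trans a0 ab.
apply/eqP; rewrite eq_le measure_ge0 andbT; apply/lee_addgt0Pr => e e0; rewrite add0e.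
have b2 : 0 < b ^+ 2 by rewrite exprn_gt0.
have /ereal_inf_lt[z [/= M covM sMz ze]] : (leb N < (e / b ^+ 2)%:E)%E.
  by rewrite N0 lte_fin divr_gt0.
have [mM subM] := covM.
pose J k : set (measurableTypeR R) := [set r | a <= r <= b /\ M k r^-1].
have oM k : ocitv (M k) by exact: mM.
have mMk k : measurable (M k : set (measurableTypeR R)) by apply: sub_sigma_algebra; exact: mM.
have mJ k : measurable (J k) by exact: measurable_inv_preimage.
apply: (@le_trans _ _ (\sum_(0 <= k <oo) leb (J k))%E).
  apply: measure_sigma_subadditive => //; first exact: measurable_inv_preimage.
  by move=> r /= [h1 /subM [k _ hk]]; exists k.
apply: (@le_trans _ _ (\sum_(0 <= k <oo) ((b ^+ 2)%:E * leb (M k : set R)))%E).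
  apply: lee_nneseries => [*|k *]; first exact: measure_ge0.
  have /ocitvP[M0|[[p q] /= pq Me]] := oM k.
    by rewrite /J M0 (_ : [set r | _] = set0) ?measure0 ?mule0 //; apply/seteqP; split => // r [].
  have mJ' := mJ k; rewrite /J Me in mJ' *.
  have eJ : [set r : R | a <= r <= b /\ [set` `]p, q]] r^-1] = [set r : R | a <= r <= b /\ (p < r^-1 <= q)%R].
    by apply/seteqP; split => r /=; rewrite in_itv.
  rewrite eJ in mJ' *; apply: le_trans (inv_cell_measure a0 ab pq mJ') _.
  by rewrite lebesgue_measure_itv /= lte_fin pq -EFinB -EFinM.
rewrite nneseriesZl; last by move=> k _; exact: measure_ge0.
have sz : (\sum_(0 <= k <oo) leb (M k : set R))%E = z.
  rewrite -sMz; apply: eq_eseriesr => k _.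
  by have /ocitvP[->|[[p q] /= pq ->]] := oM k; rewrite ?measure0 ?wlength0 // lebesgue_measure_itv wlength_itv.
rewrite sz; apply: (@le_trans _ _ ((b ^+ 2)%:E * (e / b ^+ 2)%:E)%E).
  by rewrite lee_pmul2l ?lte_fin // ltW.
by rewrite -EFinM mulrCA mulfV ?mulr1 // gt_eqF.
Qed.

Lemma ae_inv (P : R -> Prop) : {ae leb, forall r, 0 < r -> P r} -> {ae leb, forall r, 0 < r -> P r^-1}.
Proof.
move=> [N [mN N0 sub]].
have h : {ae leb, forall r, forall m : nat, m.+1%:R^-1 <= r <= m.+1%:R -> P r^-1}.
  apply: ae_foralln => m; have m0 : 0 < (m.+1%:R^-1 : R) by rewrite invr_gt0 ltr0n.
  have m1 : (m.+1%:R^-1 : R) <= m.+1%:R.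
    by apply: (@le_trans _ _ 1); rewrite ?invf_le1 ?ltr0n // ler1n.
  exists [set r | m.+1%:R^-1 <= r <= m.+1%:R /\ N r^-1]; split.
  - exact: measurable_inv_preimage.
  - exact: inv_null.
  - move=> r /= /not_implyP[hr nP]; split => //; apply: sub => /= hP; apply: nP; apply: hP.
    by rewrite invr_gt0; case/andP: hr => hr _; exact: lt_le_trans m0 hr.
apply: (@filterS _ _ (ae_filter_ringOfSetsType leb) _ _ _ h) => r hr r0.
have [m1 hm1] : exists m : nat, r < m%:R by exists (Num.truncn r).+1; exact: truncnS_gt.
have [m2 hm2] : exists m : nat, r^-1 < m%:R by exists (Num.truncn r^-1).+1; exact: truncnS_gt.
apply: (hr (m1 + m2)%N); apply/andP; split.
  rewrite -[leRHS]invrK lef_pV2 ?posrE ?invr_gt0 ?ltr0n //.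
  by apply: ltW; apply: lt_le_trans hm2 _; rewrite ler_nat; lia.
by apply: ltW; apply: lt_le_trans hm1 _; rewrite ler_nat; lia.
Qed.

Section Reflection.
Variable c : R.
Let refl (t : measurableTypeR R) : measurableTypeR R := c - t.
Let mrefl : measurable_fun setT refl.
Proof.
by apply: continuous_measurable_fun => t; apply: cvgB; [exact: cvg_cst|exact: cvg_id].
Qed.
HB.instance Definition _ := isMeasurableFun.Build _ _ _ _ refl mrefl.

Let refl_measure (A : set (measurableTypeR R)) : measurable A -> pushforward leb refl A = leb A.
Proof.
move=> mA; apply/esym/lebesgue_measure_unique => //= _ [[a b]] _ <-.
rewrite /pushforward (_ : refl @^-1` _ = `[c - b, c - a[%classic); last first.
  apply/seteqP; split => t /=; rewrite /refl !in_itv /= => /andP[h1 h2]; apply/andP; split; lra.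
rewrite !lebesgue_measure_itv /= !lte_fin; have -> : (c - b < c - a) = (a < b) by apply/idP/idP; lra.
by case: ifP => // _; rewrite -!EFinB; congr (_%:E); ring.
Qed.

Lemma integral_reflect (f : R -> R) : measurable_fun (`[0, c]%classic : set (measurableTypeR R)) f ->
  Rintegral leb `[0, c]%classic (fun t => f (c - t)) = Rintegral leb `[0, c]%classic f.
Proof.
move=> mf; rewrite /Rintegral; congr fine.
have mc : measurable (`[0, c]%classic : set (measurableTypeR R)) by [].
have pre : refl @^-1` `[0, c]%classic = `[0, c]%classic.
  by apply/seteqP; split => t /=; rewrite /refl !in_itv /= => /andP[h1 h2]; apply/andP; split; lra.
have key (g : R -> \bar R) : measurable_fun (`[0, c]%classic : set (measurableTypeR R)) g -> (forall t, 0 <= g t)%E ->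
    (\int[leb]_(t in `[0%R, c]) g (c - t)%R = \int[leb]_(t in `[0%R, c]) g t)%E.
  move=> mg g0; transitivity (\int[pushforward leb refl]_(t in `[0%R, c]) g t)%E.
    by rewrite (ge0_integral_pushforward mrefl) // pre.
  by apply: eq_measure_integral => A mA _; exact: refl_measure.
rewrite [LHS]integralE [RHS]integralE; congr (_ - _)%E.
  rewrite -(key (EFin \o f)^\+%E); [|by apply: measurable_funepos; exact/measurable_EFinP|by move=> t; exact: funepos_ge0].
  by apply: eq_integral => t _; rewrite !funeposE.
rewrite -(key (EFin \o f)^\-%E); [|by apply: measurable_funeneg; exact/measurable_EFinP|by move=> t; exact: funeneg_ge0].
by apply: eq_integral => t _; rewrite !funenegE.
Qed.

End Reflection.

Lemma polarV (r t : R) : (polar (r, t))^-1 = polar (r^-1, - t).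
Proof.
rewrite /polar invfM fmorphV; congr (_ * _); rewrite /=.
have e : expi t * expi (- t) = 1 by rewrite -expiD subrr expi0.
by apply: (mulfI (_ : expi t != 0)); rewrite ?e ?mulfV // -modulus_gt0 modulus_expi.
Qed.

Lemma expi_2pi (t : R) (k : int) : expi (k%:~R * (2 * pi) + t) = expi t.
Proof.
have h (m : nat) : expi (m%:R * (2 * pi)) = 1 :> R[i].
  rewrite -expiX (_ : expi (2 * pi) = 1) ?expr1n //.
  by apply: complex_ext => /=; rewrite mulr_natl ?cos2pi ?sin2pi.
rewrite expiD; case: k => m; first by rewrite -pmulrn h mul1r.
rewrite NegzE rmorphN /= mulNr -conjc_expi -pmulrn h.
by rewrite conjc1 mul1r.
Qed.

Lemma cintegral_reflect c (f : R -> R[i]) : cmeasurable (`[0, c]%classic : set (measurableTypeR R)) f ->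
  cintegral leb `[0, c]%classic (fun t => f (c - t)) = cintegral leb `[0, c]%classic f.
Proof. by move=> [h1 h2]; rewrite /cintegral -(integral_reflect h1) -(integral_reflect h2). Qed.

(** In polar coordinates [x -> 1 / x] is [(r, t) -> (1 / r, - t)], and by
    periodicity [- t] may be replaced by [2 pi - t]. *)
Lemma fourier_inv n (u : R[i] -> R[i]) (k : int) r : L2 n u -> 0 < r ->
  fourier (fun y => u y^-1) k r = fourier u (- k) r^-1.
Proof.
move=> [m1 m2 _] r0; rewrite /fourier; congr (_ * _).
pose f (t : R) : R[i] := u (polar (r^-1, t)) * expi (- ((- k)%:~R * t)).
have mc : measurable (`[0, 2 * pi]%classic : set (measurableTypeR R)) by [].
have slice (g : R * R -> R) : measurable_fun (polar_dom : set (measurableTypeR R * measurableTypeR R)) g ->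
    measurable_fun (`[0, 2 * pi]%classic : set (measurableTypeR R)) (fun t => g (r^-1, t)).
  move=> mg; apply: (measurable_comp (F := polar_dom) (measurable_polar_dom) _ mg).
    move=> _ [t ht <-]; split => //=; by rewrite in_itv /= andbT invr_gt0.
  by apply: measurable_funTS; exact: pair1_measurable.
have mf : cmeasurable (`[0, 2 * pi]%classic : set (measurableTypeR R)) f.
  apply: cmeasurableM; first by split; [exact: (slice (fun p => complex.Re (u (polar p))))|exact: (slice (fun p => complex.Im (u (polar p))))].
  have [e1 e2] := @cmeasurable_mode R (- k).
  by split; [exact: (slice (fun p => complex.Re (expi (- ((- k)%:~R * p.2)))))|exact: (slice (fun p => complex.Im (expi (- ((- k)%:~R * p.2)))))].
rewrite -[RHS](cintegral_reflect mf); apply: eq_cintegral => t _.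
rewrite /f polarV /=; have e0 : polar (r^-1, 2 * pi - t) = polar (r^-1, - t).
  by rewrite /polar /= -[2 * pi]mul1r -[1 * _]/(1%:~R * _) expi_2pi.
rewrite e0; congr (_ * _); rewrite -[RHS](expi_2pi _ (- k)); congr expi.
by rewrite rmorphN /=; ring.
Qed.

End Inversion.

(** * The connection matrices *)

Section Removable.
Context {R : realType}.
Implicit Types (z nu : R[i]).

Lemma removable_eq (f h : R[i] -> R[i]) z : (\forall w \near z^', f w = h w) -> ccont h z -> removable f z = h z.
Proof.
move=> e hc; rewrite /removable.
have hid : id @ z^' --> z by apply: cvg_within_filter; exact: cvg_id.
have hh : h @ z^' --> h z by exact: (ccontP hc).
apply: (@cvgC_lim _ _ _ (Proper_dnbhs_numFieldType (z : R[i]))).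
apply: (@cvg_near_eq _ _ _ (dnbhs_filter z) _ _ _ _ hh).
by apply: filterS e => w ->.
Qed.

(** The zeros of [rgamma] are at distance at least [1] from each other. *)
Lemma rgamma_near_neq0 (be z : R[i]) : \forall w \near z^', rgamma (w + be) != 0.
Proof.
have [z0|z0] := eqVneq (rgamma (z + be)) 0; last first.
  have hid : (fun w => w + be) @ z^' --> z + be.
    apply: (@ccvgD _ _ _ (dnbhs_filter z)); last exact: (@ccvg_cst _ _ _ (dnbhs_filter z)).
    by apply: cvg_within_filter; exact: cvg_id.
  have hr : (fun w => rgamma (w + be)) @ z^' --> rgamma (z + be).
    by apply: (ccontP (ccont_rgamma (z + be))); exact: hid.
  exact: (@ccvg_near0 _ _ _ (dnbhs_filter z) _ _ hr z0).
have [N0 hN0] : exists N : nat, z + be = - N%:R.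
  apply: contrapT => h; move/eqP: z0; apply/negP; apply: rgamma_neq0 => N.
  by apply/eqP => e; apply: h; exists N.
have hid : id @ z^' --> z by apply: cvg_within_filter; exact: cvg_id.
have hm := (@cvg_modulusP _ _ _ (dnbhs_filter z) _ _).1 hid.
have h1 : \forall w \near z^', modulus (w - z) < 1 by exact: (cvgr_lt _ hm _ ltr01).
have h2 : \forall w \near z^', w != z by exact: nbhs_dnbhs_neq.
apply: filterS2 h1 h2 => w w1 wz; apply: rgamma_neq0 => N; apply/eqP => e.
have ez : w - z = N0%:R - N%:R.
  have -> : w - z = (w + be) - (z + be) by ring.
  by rewrite e hN0; ring.
have : w - z != 0 by rewrite subr_eq0.
move: w1; rewrite ez; have [hN|hN] := leqP N N0.
  by rewrite -natrB // modulus_nat -[1]/(1%:R) ltr_nat ltnS leqn0 => /eqP ->; rewrite eqxx.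
rewrite -opprB modulusN -natrB ?(ltnW hN) // modulus_nat -[1]/(1%:R) ltr_nat ltnS leqn0 => /eqP h.
by move: hN; rewrite -subn_gt0 h.
Qed.

Lemma csin_pi1 z : csin (pi%:C * (z + 1)) = - csin (pi%:C * z).
Proof.
rewrite mulrDr mulr1 csinD.
have e1 : csin (pi%:C : R[i]) = 0 by rewrite csin_real sinpi.
have e2 : ccos (pi%:C : R[i]) = -1.
  have h1 := cder_ccos 1 (0 : R).
  have : ccos (pi%:C : R[i]) = (cos pi)%:C.
    rewrite /ccos /cexp /expi /= !mulr0 !mul0r !mul1r ?subr0 ?add0r ?addr0 ?oppr0 expR0 !mul1r.
    by apply: complex_ext => /=; rewrite ?cosN ?sinN ?cospi ?sinpi; field.
  by rewrite cospi => ->; rewrite rmorphN.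
by rewrite e1 e2 mulr0 addr0 mulrN1.
Qed.

Lemma Gamma_sin (w : R[i]) : rgamma (w + 1) != 0 -> (rgamma (w + 1))^-1 * csin (pi%:C * w) = - (pi%:C * rgamma (- w)).
Proof.
move=> h; have := rgamma_reflection (w + 1); rewrite csin_pi1.
have -> : 1 - (w + 1) = - w by ring.
move: h (@piC_neq0 R); move: (rgamma (w + 1)) (rgamma (- w)) (csin _); move: pi%:C => p g g' s g0 p0 e.
have -> : s = - (g * g' * p) by rewrite e; field.
by field.
Qed.

(** By the reflection formula the zeros of the sine cancel the poles of the
    first factor: off a discrete set the entry agrees with an entire
    function. *)
Lemma removable_entry (be ga c z : R[i]) :
  removable (fun w => Gamma (w + be + 1) / Gamma (w + ga + 1) * (csin (pi%:C * (w + be)) / c)) z =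
  - (pi%:C * (rgamma (1 + ga + z) * rgamma (- be - z)) / c).
Proof.
apply: (@removable_eq _ (fun w => - (pi%:C * (rgamma (1 + ga + w) * rgamma (- be - w)) / c))).
  apply: filterS (rgamma_near_neq0 (be + 1) z) => w; rewrite addrA => hw.
  rewrite !Gamma_rgamma invrK; have := Gamma_sin hw.
  have -> : 1 + ga + w = w + ga + 1 by ring.
  have -> : - be - w = - (w + be) by ring.
  move: (rgamma (w + be + 1)) (rgamma (w + ga + 1)) (rgamma (- _)) (csin _); move: pi%:C => p g1 g2 g3 s e.
  have -> : g1^-1 * g2 * (s / c) = (g1^-1 * s) * g2 / c by rewrite -!mulrA; congr (_ * _); rewrite mulrCA.
  by rewrite e; move: c^-1 => ci; ring.
apply: ccontN; apply: ccontM; last exact: ccont_cst.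
apply: ccontM; first exact: ccont_cst.
apply: ccontM.
  apply: (@ccont_comp R rgamma (fun w => 1 + ga + w)); last exact: ccont_rgamma.
  by apply: ccontD; [exact: ccont_cst|exact: ccont_id].
apply: (@ccont_comp R rgamma (fun w => - be - w)); last exact: ccont_rgamma.
by apply: ccontD; [exact: ccont_cst|apply: ccontN; exact: ccont_id].
Qed.

End Removable.

Section ConnectionMatrices.
Context {R : realType} (n : nat).
Implicit Types (nu : R[i]) (k : int) (v : 'cV[R[i]]_2).

Lemma mx22_mul0 (a b c d : R[i]) v : (mx22 a b c d *m v) ord0 ord0 = a * v ord0 ord0 + b * v ord_max ord0.
Proof.
rewrite mxE big_ord_recl big_ord1 !mxE /=; congr (_ * _ + _ * v _ _); exact: val_inj.
Qed.

Lemma mx22_mul1 (a b c d : R[i]) v : (mx22 a b c d *m v) ord_max ord0 = c * v ord0 ord0 + d * v ord_max ord0.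
Proof.
rewrite mxE big_ord_recl big_ord1 !mxE /=; congr (_ * _ + _ * v _ _); exact: val_inj.
Qed.

Lemma cV2_ext (v w : 'cV[R[i]]_2) : v ord0 ord0 = w ord0 ord0 -> v ord_max ord0 = w ord_max ord0 -> v = w.
Proof.
move=> h0 h1; apply/colP => i; have [->|hi] := eqVneq i ord0; first exact: h0.
have -> : i = ord_max by apply: val_inj => /=; case: i hi => [[|[|?]]].
exact: h1.
Qed.

(** This and [entry21] are the values of the off-diagonal entries of [Mk]
    for [al = |k| / n], with the singularities removed; they are the
    coefficients of [connection_power]. *)
Definition entry12 nu (al : R[i]) : R[i] :=
  - (pi%:C * (rgamma (1 - al + nu) * rgamma (- al - nu)) / csin (pi%:C * al)).
Definition entry21 nu (al : R[i]) : R[i] :=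
  pi%:C * (rgamma (1 + al + nu) * rgamma (al - nu)) / csin (pi%:C * al).

Lemma MkE k nu : let al : R[i] := (alpha n k)%:C in
  Mk n k nu = mx22 (csin (pi%:C * nu) / csin (pi%:C * al)) (entry12 nu al) (entry21 nu al)
                   (- (csin (pi%:C * nu) / csin (pi%:C * al))).
Proof.
move=> al; rewrite /Mk -/al; congr mx22; first exact: (removable_entry al (- al)).
have h := removable_entry (- al) al (- csin (pi%:C * al)) nu.
rewrite opprK in h; rewrite /entry21; transitivity (removable (fun w : R[i] => Gamma (w - al + 1) / Gamma (w + al + 1) *
  (csin (pi%:C * (w - al)) / - csin (pi%:C * al))) nu).
  congr removable; apply/funext => w; by rewrite invrN !mulrN.
by rewrite h invrN mulrN opprK.
Qed.

Lemma csin_alpha_neq0 (al : R) : 0 < al < 1 -> csin (pi%:C * al%:C) != 0 :> R[i].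
Proof.
move=> /andP[a0 a1]; rewrite -rmorphM csin_real -modulus_gt0 modulusR normr_gt0 gt_eqF //.
apply: sin_gt0_pi; have := @pi_gt0 R => p0; rewrite mulr_gt0 //=.
by rewrite -[X in _ < X]mulr1 ltr_pM2l.
Qed.

(** The reflection formula reduces the product of the entries to that of
    the sines of [pi (nu + al)] and [pi (nu - al)], which is [sin (pi nu) ^
    2 - sin (pi al) ^ 2] up to sign. *)
Lemma entries_det nu (al : R) : 0 < al < 1 -> let sa := csin (pi%:C * al%:C) in
  (csin (pi%:C * nu) / sa) * (csin (pi%:C * nu) / sa) + entry12 nu al%:C * entry21 nu al%:C = 1.
Proof.
move=> /csin_alpha_neq0 s0 sa; rewrite /entry12 /entry21 -/sa; rewrite -/sa in s0.
have r1 := rgamma_reflection (1 + al%:C + nu); have r2 := rgamma_reflection (1 - al%:C + nu).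
have e1 : 1 - (1 + al%:C + nu) = - al%:C - nu by ring.
have e2 : 1 - (1 - al%:C + nu) = al%:C - nu by ring.
have e3 : pi%:C * (1 + al%:C + nu) = pi%:C * ((nu + al%:C) + 1) by ring.
have e4 : pi%:C * (1 - al%:C + nu) = pi%:C * ((nu - al%:C) + 1) by ring.
rewrite e1 e3 csin_pi1 mulrDr csinD -/sa in r1.
rewrite e2 e4 csin_pi1 mulrBr csinD csinN ccosN -/sa in r2.
have t1 := ccos2Dcsin2 (pi%:C * nu); have t2 := ccos2Dcsin2 (pi%:C * al%:C); rewrite -/sa in t2.
move: r1 r2 t1 t2 s0 (@piC_neq0 R).
move: (rgamma (1 + al%:C + nu)) (rgamma (- al%:C - nu)) (rgamma (1 - al%:C + nu)) (rgamma (al%:C - nu)).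
move: (csin (pi%:C * nu)) (ccos (pi%:C * nu)) (ccos (pi%:C * al%:C)) sa; move: pi%:C.
move=> p S C c s g1 g2 g3 g4 r1 r2 t1 t2 s0 p0.
have -> : - (p * (g3 * g2) / s) * (p * (g1 * g4) / s) = - (p * (g1 * g2)) * (p * (g3 * g4)) / (s * s) by field.
rewrite r1 r2.
have -> : S / s * (S / s) + - (p * (- (S * c + C * s) / p)) * (p * (- (S * c + C * - s) / p)) / (s * s) =
   (S * S * (1 - (c ^+ 2 + s ^+ 2)) + S * S * s ^+ 2 + C ^+ 2 * s ^+ 2) / (s * s) by field; rewrite s0 p0.
rewrite t2 subrr mulr0 add0r -expr2 -mulrDl addrC t1 mul1r expr2 mulfV // mulf_neq0 //.
Qed.

Lemma M0_involutive nu v : M0 nu *m (M0 nu *m v) = v.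
Proof.
have t1 := ccos2Dcsin2 (pi%:C * nu); have p0 := @piC_neq0 R; have t0 := @two_neq0 R.
have e1 : (pi / 2)%:C * (2 / pi)%:C = 1 :> R[i].
  by rewrite -rmorphM mulrA divfK ?mulfV // gt_eqF // pi_gt0.
rewrite /M0; apply: cV2_ext; rewrite ?mx22_mul0 ?mx22_mul1 ?mx22_mul0 ?mx22_mul1.
  move: t1 e1; move: (v _ _) (v _ _) (csin _) (ccos _) ((pi / 2)%:C) ((2 / pi)%:C) => x y S C p q t1 e1.
  transitivity ((C ^+ 2 + S ^+ 2) * y + (p * q - 1) * S ^+ 2 * y); first ring.
  by rewrite t1 e1 subrr !mul0r mul1r addr0.
move: t1 e1; move: (v _ _) (v _ _) (csin _) (ccos _) ((pi / 2)%:C) ((2 / pi)%:C) => x y S C p q t1 e1.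
transitivity ((C ^+ 2 + S ^+ 2) * x + (p * q - 1) * S ^+ 2 * x); first ring.
by rewrite t1 e1 subrr !mul0r mul1r addr0.
Qed.

Lemma alpha01 k : k != 0 -> (`|k| < n)%N -> 0 < (alpha n k : R) < 1.
Proof.
move=> k0 kn; have n0 : (0 : R) < n%:R by rewrite ltr0n; exact: leq_ltn_trans kn.
apply/andP; split; rewrite /alpha; first by apply: divr_gt0 => //; rewrite ltr0n absz_gt0.
by rewrite ltr_pdivrMr // mul1r ltr_nat.
Qed.

Lemma Mk_involutive k nu v : k != 0 -> (`|k| < n)%N -> Mk n k nu *m (Mk n k nu *m v) = v.
Proof.
move=> k0 kn; have /= d := entries_det nu (alpha01 k0 kn).
rewrite MkE; apply: cV2_ext; rewrite ?mx22_mul0 ?mx22_mul1 ?mx22_mul0 ?mx22_mul1.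
  move: d; move: (v _ _) (v _ _) (entry12 _ _) (entry21 _ _) (csin (pi%:C * nu) / csin (pi%:C * (alpha n k)%:C)) => x y p q t d.
  transitivity ((t * t + p * q) * y); first ring.
  by rewrite d mul1r.
move: d; move: (v _ _) (v _ _) (entry12 _ _) (entry21 _ _) (csin (pi%:C * nu) / csin (pi%:C * (alpha n k)%:C)) => x y p q t d.
transitivity ((t * t + p * q) * x); first ring.
by rewrite d mul1r.
Qed.

Lemma mode_lt (i : 'I_(n.*2.-1)) : (`|mode i| < n)%N.
Proof. have := ltn_ord i; rewrite /mode; lia. Qed.

Lemma alpha_rev (i : 'I_(n.*2.-1)) : alpha n (mode (rev_ord i)) = alpha n (mode i) :> R.
Proof. by rewrite /alpha mode_rev abszN. Qed.

Lemma Mk_rev (i : 'I_(n.*2.-1)) nu : Mk n (mode (rev_ord i)) nu = Mk n (mode i) nu.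
Proof. by rewrite !MkE alpha_rev. Qed.

(** Each block has trace [0] and determinant [-1], and the blocks of [k]
    and [- k] coincide. This reflects that inverting the sphere twice is
    the identity. *)
Lemma calM_involutive nu (a : En R n) : calM nu (calM nu a) = a.
Proof.
apply/ffunP => i; rewrite ffunE; case: ifPn => [h|h]; first by rewrite ffunE h M0_involutive.
rewrite ffunE mode_rev oppr_eq0 (negbTE h) rev_ordK -mode_rev Mk_rev Mk_involutive //.
exact: mode_lt.
Qed.

End ConnectionMatrices.

(** * Boundary spaces and connection map *)

Section BoundaryAlgebra.
Context {R : realType} (n : nat) (nu : R[i]).
Hypothesis hn : (2 <= n)%N.
Hypothesis hnu : forall m : nat, nu != - (m.+1%:R).
Local Notation E := (En R n).
Implicit Types (a b c : E) (i : 'I_(n.*2.-1)).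

Definition pairE (p q : 'I_(n.*2.-1) -> R[i]) : E :=
  [ffun i => \col_j (if j == ord0 then p i else q i)].

Lemma pairE_fst p q i : fst_coef (pairE p q) i = p i.
Proof. by rewrite /fst_coef ffunE mxE. Qed.

Lemma pairE_snd p q i : snd_coef (pairE p q) i = q i.
Proof. by rewrite /snd_coef ffunE mxE. Qed.

Lemma En_ext a b : (forall i, fst_coef a i = fst_coef b i) -> (forall i, snd_coef a i = snd_coef b i) -> a = b.
Proof. by move=> h0 h1; apply/ffunP => i; apply: cV2_ext; [exact: h0|exact: h1]. Qed.

(** Coefficients of [calA0 nu a] on [r ^ |k|] and [r ^ - |k|], or on [1]
    and [ln r]: the normalizing constants of [calA] and of the basis
    functions cancel. *)
Definition coefs a : E := pairE
  (fun i => if mode i == 0 then fst_coef a i - snd_coef a i * (euler_gamma%:C + digamma (nu + 1))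
            else fst_coef a i * rgamma (1 + (alpha n (mode i))%:C))
  (fun i => if mode i == 0 then - (n%:R * snd_coef a i)
            else snd_coef a i * rgamma (1 - (alpha n (mode i))%:C)).

Let n0 : (n%:R : R[i]) != 0.
Proof. by rewrite pnatr_eq0 -lt0n (leq_trans _ hn). Qed.

Lemma rgamma_1B_neq0 (al : R) : 0 < al < 1 -> rgamma (1 - al%:C) != 0.
Proof. by move=> /andP[a0 a1]; apply: rgamma_Re_neq0; rewrite cReB /=; lra. Qed.

Lemma rgamma_1D_neq0 (al : R) : 0 < al < 1 -> rgamma (1 + al%:C) != 0.
Proof. by move=> /andP[a0 a1]; apply: rgamma_Re_neq0; rewrite cReD /=; lra. Qed.

Lemma coefs_inj a b : coefs a = coefs b -> a = b.
Proof.
move=> e.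
have e1 i : fst_coef (coefs a) i = fst_coef (coefs b) i by rewrite e.
have e2 i : snd_coef (coefs a) i = snd_coef (coefs b) i by rewrite e.
have h2 i : snd_coef a i = snd_coef b i.
  have := e2 i; rewrite !pairE_snd; case: ifPn => k0.
    by move/oppr_inj/(mulfI n0).
  exact: (mulIf (rgamma_1B_neq0 (alpha01 k0 (mode_lt i)))).
apply: En_ext => // i; have := e1 i; rewrite !pairE_fst; case: ifPn => k0.
  by rewrite h2 => /addIr.
exact: (mulIf (rgamma_1D_neq0 (alpha01 k0 (mode_lt i)))).
Qed.

Let s2 : (Num.sqrt (2 * pi))%:C != 0 :> R[i].
Proof.
by rewrite -modulus_gt0 modulusR normr_gt0 gt_eqF // sqrtr_gt0 mulr_gt0 // pi_gt0.
Qed.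

Let s4 i : mode i != 0 -> (Num.sqrt (4 * pi * `|mode i|%N%:R))%:C != 0 :> R[i].
Proof.
move=> k0; rewrite -modulus_gt0 modulusR normr_gt0 gt_eqF // sqrtr_gt0.
by rewrite !mulr_gt0 ?pi_gt0 // ltr0n absz_gt0.
Qed.

Lemma boundary_coefs a : boundary_part (coefs a) = calA0 nu a.
Proof.
apply/funext => x; rewrite /boundary_part /calA0 /calA fct_sumE; apply: eq_bigr => i _ /=.
rewrite pairE_fst pairE_snd; case: (boolP (mode i == 0)) => k0 /=.
  rewrite /f_ /fs_ k0 /=; rewrite -[RHS]/(_ * _ + _ * _).
  have h : (Num.sqrt (2 * pi))%:C * ((Num.sqrt (2 * pi))^-1)%:C = 1 :> R[i].
    by rewrite fmorphV mulfV // s2.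
  rewrite [(- _ * _)%:C]rmorphM rmorphN /=.
  move: h; move: (fst_coef a i) (snd_coef a i) (euler_gamma%:C + digamma (nu + 1)) => p q g.
  move: (Num.sqrt _)%:C (Num.sqrt _)^-1%:C (ln _)%:C => s si l h.
  have hs : s * si - 1 = 0 by rewrite h subrr.
  transitivity (s * (p - q * g) * si + n%:R * s * q * (- si * l) - (s * si - 1) * ((p - q * g) - n%:R * q * l)).
    ring.
  by rewrite hs mul0r subr0.
rewrite /f_ /fs_ (negbTE k0) /= !Gamma_rgamma !invrK; rewrite -[RHS]/(_ * (_ * _ + _ * _)).
rewrite ![((Num.sqrt _)^-1 * _)%:C]rmorphM /=.
have h : (Num.sqrt (4 * pi * `|mode i|%N%:R))%:C * ((Num.sqrt (4 * pi * `|mode i|%N%:R))^-1)%:C = 1 :> R[i].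
  by rewrite fmorphV mulfV // s4.
move: h; move: (Num.sqrt _)%:C (Num.sqrt _)^-1%:C => s si h.
move: (fst_coef a i) (snd_coef a i) (rgamma (1 + _)) (rgamma (1 - _)) (modulus x ^+ _)%:C (modulus x ^- _)%:C (phase x ^ _) => p q g1 g2 x1 x2 w.
have hs : s * si - 1 = 0 by rewrite h subrr.
transitivity (s * (p * g1 * (si * x1 * w) + q * g2 * (si * x2 * w)) - (s * si - 1) * ((p * g1 * x1 + q * g2 * x2) * w)).
  ring.
by rewrite hs mul0r subr0.
Qed.

Definition mode_part c i (r : R) : R[i] :=
  if mode i == 0 then fst_coef c i + snd_coef c i * (ln r)%:C
  else fst_coef c i * (r ^+ `|mode i|%N)%:C + snd_coef c i * (r ^- `|mode i|%N)%:C.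

Let w_ (m : nat) : R[i] := (1 + m%:R * 'i%C) / (1 - m%:R * 'i%C).

Let w_den m : 1 - m%:R * 'i%C != 0 :> R[i].
Proof.
rewrite -modulus_gt0; apply: lt_le_trans (modulus_Re _).
by rewrite cReB cReM -real_complexN /= mulr0 mul0r subrr subr0 normr1.
Qed.

Let w_mod m : modulus (w_ m) = 1.
Proof.
rewrite /w_ modulusM modulusV; have -> : modulus (1 + m%:R * 'i%C) = modulus (1 - m%:R * 'i%C : R[i]).
  by rewrite !modulusE !cReD !cImD !cReN !cImN !cReM !cImM -real_complexN /=; congr Num.sqrt; ring.
by rewrite mulfV // modulus_eq0 w_den.
Qed.

Let w_inj : injective w_.
Proof.
move=> m m' /eqP; rewrite /w_ eqr_div ?w_den // -subr_eq0.
have -> : (1 + m%:R * 'i%C) * (1 - m'%:R * 'i%C) - (1 + m'%:R * 'i%C) * (1 - m%:R * 'i%C) =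
   2 * 'i%C * (m%:R - m'%:R) :> R[i] by ring.
rewrite !mulf_eq0 (negbTE (@two_neq0 R)) (negbTE (@I_neq0 R)) /= subr_eq0.
by rewrite eqr_nat => /eqP.
Qed.

(** On a circle the boundary part is a trigonometric polynomial; a power of
    [w] clears its negative exponents. *)
Lemma boundary_part_polar c r w : 0 < r -> modulus w = 1 ->
  boundary_part c (r%:C * w) * w ^+ n.-1 = \sum_i mode_part c i r * w ^+ i.
Proof.
move=> r0 w1; have w0 : w != 0 by rewrite -modulus_gt0 w1.
have mx : modulus (r%:C * w) = r by rewrite modulusM w1 mulr1 modulusR gtr0_norm.
have px : phase (r%:C * w) = w.
  rewrite /phase normCE mx mulrAC mulfV ?mul1r //.
  by rewrite -modulus_gt0 modulusR normr_gt0 gt_eqF.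
rewrite /boundary_part big_distrl /=; apply: eq_bigr => i _ /=.
rewrite /mode_part mx px.
have hw : w ^ (mode i) * w ^+ n.-1 = w ^+ i.
  by rewrite /mode expfzDr // -mulrA -[w ^+ n.-1]/(w ^ n.-1%:Z) -expfzDr // addNr expr0z mulr1.
case: ifPn => k0; last by rewrite -mulrA hw.
by congr (_ * _); rewrite -hw (eqP k0) expr0z mul1r.
Qed.

(** On each circle, the difference of the two trigonometric polynomials has
    too many zeros. *)
Lemma boundary_part_inj c c' : boundary_part c = boundary_part c' -> c = c'.
Proof.
move=> e.
have key i r : 0 < r -> mode_part c i r = mode_part c' i r.
  move=> r0; pose G (j : nat) : R[i] := if insub j is Some l then mode_part c l r - mode_part c' l r else 0.
  pose p := \poly_(j < n.*2.-1) G j.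
  have p0 : p = 0.
    apply/eqP; apply: contraT => pn0.
    have hroot : all (root p) (map w_ (iota 0 n.*2.-1)).
      apply/allP => z /mapP[m _ ->]; rewrite /root /p horner_poly; apply/eqP.
      rewrite (eq_bigr (fun i : 'I_(n.*2.-1) => mode_part c i r * w_ m ^+ i - mode_part c' i r * w_ m ^+ i)).
        by rewrite sumrB -!boundary_part_polar ?w_mod // e subrr.
      by move=> l _; rewrite /G valK mulrBl.
    have huniq : uniq (map w_ (iota 0 n.*2.-1)) by rewrite (map_inj_uniq w_inj) iota_uniq.
    have := max_poly_roots pn0 hroot huniq.
    by rewrite size_map size_iota ltnNge size_poly.
  have : p`_i = 0 by rewrite p0 coef0.
  by rewrite coef_poly ltn_ord /G valK => /eqP; rewrite subr_eq0 => /eqP.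
(* The radii [1] and [e], respectively [1] and [2], separate the two radial
   functions of a mode. *)
have r1 := ltr01 : 0 < 1 :> R.
suff h i : fst_coef c i = fst_coef c' i /\ snd_coef c i = snd_coef c' i.
  by apply: En_ext => i; case: (h i).
have h1 := key i 1 r1; rewrite /mode_part in h1.
case: ifPn (h1) => k0 {}h1.
  rewrite ln1 !mulr0 !addr0 in h1; split=> //.
  have := key i (expR 1) (expR_gt0 1); rewrite /mode_part k0 expRK h1 !mulr1.
  by move/addrI.
rewrite !expr1n !invr1 !mulr1 in h1.
have := key i 2 (ltr0Sn R 1); rewrite /mode_part (negbTE k0) => h2.
have m0 : (0 < `|mode i|)%N by rewrite absz_gt0.
pose x : R := 2 ^+ `|mode i|; have x1 : 1 < x by rewrite exprn_egt1 // ?ltr1n // -lt0n.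
have xy : (x^-1)%:C != x%:C :> R[i].
  apply/eqP => /complexI/eqP; apply/negP; rewrite lt_eqF //; apply: (lt_trans _ x1).
  by rewrite invf_lt1 // (lt_trans ltr01 x1).
rewrite -/x in h2; move: h1 h2 xy; move: (fst_coef c i) (snd_coef c i) (fst_coef c' i) (snd_coef c' i) => p q p' q' h1 h2 xy.
have hq : (q - q') * ((x^-1)%:C - x%:C) = 0.
  have -> : (q - q') * ((x^-1)%:C - x%:C) = (p * x%:C + q * (x^-1)%:C) - (p' * x%:C + q' * (x^-1)%:C) - ((p + q) - (p' + q')) * x%:C by ring.
  by rewrite h1 h2 !subrr mul0r subr0.
have qq : q = q'.
  by move/eqP: hq; rewrite mulf_eq0 !subr_eq0 (negbTE xy) orbF => /eqP.
by split=> //; move: h1; rewrite qq => /addIr.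
Qed.

Lemma calA0_inj : injective (calA0 nu : E -> R[i] -> R[i]).
Proof. by move=> a b; rewrite -!boundary_coefs => /boundary_part_inj/coefs_inj. Qed.

Definition norm_coefs a : E := pairE
  (fun i => if mode i == 0 then (Num.sqrt (2 * pi))%:C * (fst_coef a i - snd_coef a i * (euler_gamma%:C + digamma (nu + 1)))
     else (Num.sqrt (4 * pi * `|mode i|%N%:R))%:C * (fst_coef a i / Gamma (1 + (alpha n (mode i))%:C)))
  (fun i => if mode i == 0 then n%:R * (Num.sqrt (2 * pi))%:C * snd_coef a i
     else (Num.sqrt (4 * pi * `|mode i|%N%:R))%:C * (snd_coef a i / Gamma (1 - (alpha n (mode i))%:C))).

Lemma calA_span (F Fs : int -> R[i] -> R[i]) a : calA F Fs nu a =
  \sum_(i < n.*2.-1) (fst_coef (norm_coefs a) i *: F (mode i) + snd_coef (norm_coefs a) i *: Fs (mode i)).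
Proof.
apply: eq_bigr => i _ /=; rewrite pairE_fst pairE_snd; case: ifP => _ //.
by rewrite scalerDr !scalerA.
Qed.

Lemma calA_at (F Fs : int -> R[i] -> R[i]) a x : calA F Fs nu a x =
  \sum_(i < n.*2.-1) (fst_coef (norm_coefs a) i * F (mode i) x + snd_coef (norm_coefs a) i * Fs (mode i) x).
Proof. by rewrite calA_span fct_sumE. Qed.

Lemma calAooE a : calAoo nu a = (fun x => calA0 nu a x^-1).
Proof. by apply/funext => x; rewrite /calAoo /calA0 !calA_at; exact: eq_bigr. Qed.

Lemma calAoo_inj : injective (calAoo nu : E -> R[i] -> R[i]).
Proof.
move=> a b; rewrite !calAooE => e; apply: calA0_inj; apply/funext => x.
by have := congr1 (fun h : R[i] -> R[i] => h x^-1) e; rewrite invrK.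
Qed.

Lemma norm_coefs_surj b : exists a, norm_coefs a = b.
Proof.
pose q i := if mode i == 0 then snd_coef b i / (n%:R * (Num.sqrt (2 * pi))%:C)
  else snd_coef b i / (Num.sqrt (4 * pi * `|mode i|%N%:R))%:C / rgamma (1 - (alpha n (mode i))%:C).
pose p i := if mode i == 0 then fst_coef b i / (Num.sqrt (2 * pi))%:C + q i * (euler_gamma%:C + digamma (nu + 1))
  else fst_coef b i / (Num.sqrt (4 * pi * `|mode i|%N%:R))%:C / rgamma (1 + (alpha n (mode i))%:C).
exists (pairE p q); apply: En_ext => i.
  rewrite pairE_fst pairE_fst pairE_snd /p; case: (boolP (mode i == 0)) => k0 /=.
    by rewrite addrK mulrCA mulfV ?mulr1 // s2.
  rewrite Gamma_rgamma invrK divfK; last exact: (rgamma_1D_neq0 (alpha01 k0 (mode_lt i))).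
  by rewrite mulrCA mulfV ?mulr1 // s4.
rewrite pairE_snd pairE_snd /q; case: (boolP (mode i == 0)) => k0 /=.
  by rewrite mulrCA mulfV ?mulr1 // mulf_neq0 // s2.
rewrite Gamma_rgamma invrK divfK; last exact: (rgamma_1B_neq0 (alpha01 k0 (mode_lt i))).
by rewrite mulrCA mulfV ?mulr1 // s4.
Qed.

Lemma span_calA (F Fs : int -> R[i] -> R[i]) h : span2 n F Fs h <-> exists a, h = calA F Fs nu a.
Proof.
split=> [[b ->]|[a ->]]; last by exists (norm_coefs a); exact: calA_span.
by have [a <-] := norm_coefs_surj b; exists a; rewrite calA_span.
Qed.

Lemma fst_coef_lin (t : R[i]) a b i : fst_coef (t *: a + b) i = t * fst_coef a i + fst_coef b i.
Proof. by rewrite /fst_coef !ffunE !mxE. Qed.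

Lemma snd_coef_lin (t : R[i]) a b i : snd_coef (t *: a + b) i = t * snd_coef a i + snd_coef b i.
Proof. by rewrite /snd_coef !ffunE !mxE. Qed.

Lemma calA_linear (F Fs : int -> R[i] -> R[i]) (t : R[i]) a b :
  calA F Fs nu (t *: a + b) = t *: calA F Fs nu a + calA F Fs nu b.
Proof.
have h1 i : fst_coef (norm_coefs (t *: a + b)) i = t * fst_coef (norm_coefs a) i + fst_coef (norm_coefs b) i.
  rewrite !pairE_fst fst_coef_lin snd_coef_lin; case: (mode i == 0).
    move: (euler_gamma%:C + digamma (nu + 1)) (fst_coef a i) (snd_coef a i) (fst_coef b i) (snd_coef b i) => g p q p' q'.
    by move: (Num.sqrt _)%:C => s; ring.
  move: (Gamma _)^-1 (fst_coef a i) (fst_coef b i) => g p p'.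
  by move: (Num.sqrt _)%:C => s; ring.
have h2 i : snd_coef (norm_coefs (t *: a + b)) i = t * snd_coef (norm_coefs a) i + snd_coef (norm_coefs b) i.
  rewrite !pairE_snd snd_coef_lin; case: (mode i == 0).
    move: (snd_coef a i) (snd_coef b i) => q q'.
    by move: (Num.sqrt _)%:C => s; ring.
  move: (Gamma _)^-1 (snd_coef a i) (snd_coef b i) => g p p'.
  by move: (Num.sqrt _)%:C => s; ring.
rewrite !calA_span scaler_sumr -big_split; apply: eq_bigr => i _ /=.
by rewrite h1 h2 !scalerDl scalerDr !scalerA addrACA.
Qed.

Lemma calM_linear (t : R[i]) a b : calM nu (t *: a + b) = t *: calM nu a + calM nu b :> E.
Proof.
by apply/ffunP => i; rewrite !ffunE; case: ifP => _; rewrite mulmxDr -scalemxAr.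
Qed.

Lemma calA0K a : 'pinv_(fun=> 0) setT (calA0 nu) (calA0 nu a) = a :> E.
Proof. by rewrite pinvKV // ?inE //; move=> x y _ _; exact: calA0_inj. Qed.

Lemma calC_calA0 a : calC n nu (calA0 nu a) = calAoo nu (calM nu a).
Proof. by rewrite /calC calA0K. Qed.

Lemma calC_linear (t : R[i]) (h1 h2 : R[i] -> R[i]) : V0 n h1 -> V0 n h2 ->
  calC n nu (t *: h1 + h2) = t *: calC n nu h1 + calC n nu h2.
Proof.
move=> /span_calA[a ->] /span_calA[b ->].
have key c : calC n nu (calA f_ fs_ nu c) = calA g_ gs_ nu (calM nu c) := calC_calA0 c.
transitivity (calC n nu (calA f_ fs_ nu (t *: a + b))).
  by congr (calC n nu _); symmetry; exact: calA_linear.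
rewrite (key (t *: a + b)) (key a) (key b) calM_linear; exact: calA_linear.
Qed.

(** Through [calA0] and [calAoo] the map becomes the involution [calM]. *)
Lemma calC_bij : set_bij (V0 n) (Voo n) (calC n nu).
Proof.
split.
- move=> h /span_calA[a ->]; rewrite calC_calA0; apply/span_calA; by exists (calM nu a).
- move=> h1 h2; rewrite !inE => /span_calA[a ->] /span_calA[b ->]; rewrite !calC_calA0 => /calAoo_inj e.
  by rewrite -(calM_involutive nu a) e calM_involutive.
- move=> g /span_calA[b ->]; exists (calA0 nu (calM nu b)); first by apply/span_calA; exists (calM nu b).
  by rewrite calC_calA0 calM_involutive.
Qed.

End BoundaryAlgebra.

(** * From formal solutions to boundary data *)

Section Solutions.
Context {R : realType} (n : nat) (nu : R[i]) (u : R[i] -> R[i]).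
Hypothesis hn : (2 <= n)%N.
Hypothesis hnu : forall m : nat, nu != - (m.+1%:R).
Hypothesis hu : formal_solution n (nu * (nu + 1)) u.
Local Notation E := (En R n).
Local Notation leb := (@lebesgue_measure R).

Definition sol1 (i : 'I_(n.*2.-1)) : R -> R[i] :=
  if mode i == 0 then Phi nu 0 else Phi nu (alpha n (mode i)).
Definition sol2 (i : 'I_(n.*2.-1)) : R -> R[i] :=
  if mode i == 0 then QPhi nu else Phi nu (- alpha n (mode i)).

Let sol1_0 i : mode i == 0 -> sol1 i = Phi nu 0.
Proof. by rewrite /sol1 => ->. Qed.

Let sol2_0 i : mode i == 0 -> sol2 i = QPhi nu.
Proof. by rewrite /sol2 => ->. Qed.

Let sol1_k i : mode i != 0 -> sol1 i = Phi nu (alpha n (mode i)).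
Proof. by rewrite /sol1 => /negbTE ->. Qed.

Let sol2_k i : mode i != 0 -> sol2 i = Phi nu (- alpha n (mode i)).
Proof. by rewrite /sol2 => /negbTE ->. Qed.

Definition represents (w : int -> R -> R[i]) (a : E) : Prop := forall i,
  {ae leb, forall r, 0 < r -> w (mode i) r =
    fst_coef a i * sol1 i (n%:R * ln r) + snd_coef a i * sol2 i (n%:R * ln r)}.

Let n0 : (0 < n)%N := leq_trans (isT : (0 < 2)%N) hn.

Lemma fourier_represented : exists a, represents (fourier u) a.
Proof.
have h (i : 'I_(n.*2.-1)) : exists p : R[i] * R[i], {ae leb, forall r, 0 < r -> fourier u (mode i) r =
    p.1 * sol1 i (n%:R * ln r) + p.2 * sol2 i (n%:R * ln r)}.
  suff [c1 [c2 hc]] : exists c1 c2 : R[i], {ae leb, forall r, 0 < r -> fourier u (mode i) r =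
      c1 * sol1 i (n%:R * ln r) + c2 * sol2 i (n%:R * ln r)} by exists (c1, c2).
  have [k0|k0] := boolP (mode i == 0).
    rewrite (sol1_0 k0) (sol2_0 k0).
    have e0 : alpha n (mode i) = 0 :> R by rewrite /alpha (eqP k0) mul0r.
    have W0 : (-1 : R[i]) != 0 by rewrite oppr_eq0 oner_eq0.
    apply: (formal_mode n0 hu _ _ W0 (wronskian_QPhi nu)); rewrite e0.
      exact: osol_Phi0.
    exact: osol_QPhi.
  rewrite (sol1_k k0) (sol2_k k0).
  have al := alpha01 k0 (mode_lt i) : 0 < (alpha n (mode i) : R) < 1.
  have /andP[a0 a1] := al.
  have ap : -1 < (alpha n (mode i) : R) by lra.
  have am : -1 < - (alpha n (mode i) : R) by lra.
  have W0 : - (2 / pi%:C) * csin (pi%:C * (alpha n (mode i))%:C) != 0 :> R[i].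
    by rewrite mulf_neq0 ?csin_alpha_neq0 // oppr_eq0 mulf_neq0 ?invr_eq0 ?piC_neq0 // two_neq0.
  apply: (formal_mode n0 hu (osol_Phi nu ap) _ W0 (wronskian_Phi nu _)); last by rewrite ap a1.
  by have := osol_Phi nu am; rewrite /legq sqrrN.
have [p hp] := choice h.
exists (pairE (fun i => (p i).1) (fun i => (p i).2)) => i.
by rewrite pairE_fst pairE_snd; exact: hp.
Qed.

(** The connection formulas, in the form in which [calM] packages them. *)
Lemma connection_sol (a : E) i s :
  (let v := if mode i == 0 then a i else a (rev_ord i) in v ord0 ord0 * sol1 i (- s) + v ord_max ord0 * sol2 i (- s)) =
  fst_coef (calM nu a) i * sol1 i s + snd_coef (calM nu a) i * sol2 i s.
Proof.
rewrite /fst_coef /snd_coef ffunE; have [k0|k0] := boolP (mode i == 0).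
  rewrite (sol1_0 k0) (sol2_0 k0) /=.
  rewrite (connection_log (a i ord0 ord0) (a i ord_max ord0) s hnu) /M0 mx22_mul0 mx22_mul1.
  have e1 : (pi / 2)%:C = pi%:C / 2 :> R[i] by rewrite rmorphM fmorphV (rmorph_nat _ 2).
  have e2 : (2 / pi)%:C = 2 / pi%:C :> R[i] by rewrite rmorphM fmorphV (rmorph_nat _ 2).
  rewrite e1 e2.
  by rewrite !mulNr.
have hc := connection_power nu (a (rev_ord i) ord0 ord0) (a (rev_ord i) ord_max ord0) s (alpha01 k0 (mode_lt i)).
rewrite (sol1_k k0) (sol2_k k0) hc MkE mx22_mul0 mx22_mul1 /entry12 /entry21.
by rewrite !mulNr.
Qed.

(** The inversion sends the mode [k] to the mode [- k] and [s] to [- s]. *)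
Lemma reflected_represents a : represents (fourier u) a -> represents (fourier (fun y => u y^-1)) (calM nu a).
Proof.
move=> ha i; have [[hL _] _] := hu.
have h := ae_inv (ha (rev_ord i)).
have h' : {ae leb, forall r, 0 < r -> fourier u (mode i) r = fst_coef a i * sol1 i (n%:R * ln r) + snd_coef a i * sol2 i (n%:R * ln r)} := ha i.
have [es1 es2] : sol1 (rev_ord i) = sol1 i /\ sol2 (rev_ord i) = sol2 i.
  have [k0|k0] := boolP (mode i == 0); have := k0; rewrite -oppr_eq0 -mode_rev => k0r.
    by rewrite (sol1_0 k0) (sol2_0 k0) (sol1_0 k0r) (sol2_0 k0r).
  by rewrite (sol1_k k0) (sol2_k k0) (sol1_k k0r) (sol2_k k0r) alpha_rev.
have h0 := ae_inv h'.
apply: (@filterS2 _ _ (ae_filter_ringOfSetsType leb) _ _ _ _ h h0) => r k1 k2 r0.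
have r1 : 0 < r^-1 by rewrite invr_gt0.
have es : - (n%:R * ln r) = n%:R * ln r^-1 by rewrite -mulrN lnV ?posrE.
have cs := connection_sol a i (n%:R * ln r); rewrite /= es in cs.
rewrite (fourier_inv (mode i) hL r0) -cs.
case: ifPn => m0 /=; first by rewrite (eqP m0) oppr0 -(eqP m0) k2.
rewrite -mode_rev (k1 r0) es1 es2; reflexivity.
Qed.

Lemma represents_expansion w a : represents w a -> expansion w (coefs nu a).
Proof.
move=> ha i /=; rewrite pairE_fst pairE_snd.
have := ha i; have [k0|k0] := boolP (mode i == 0).
  rewrite (sol1_0 k0) (sol2_0 k0) => h; exact: (log_expansion n0 h).
have m0 : (0 < `|mode i| < n)%N by rewrite absz_gt0 k0 mode_lt.
rewrite (sol1_k k0) (sol2_k k0) => h.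
exact: (power_expansion n0 m0 h).
Qed.

Lemma expansion_unique w (c d : E) : expansion w c -> expansion w d -> c = d.
Proof.
move=> hc hd; have h i : fst_coef c i = fst_coef d i /\ snd_coef c i = snd_coef d i.
  have := hc i; have := hd i => /=; case: ifPn => k0 h1 h2.
    exact: (expansion_log_unique n0 h2 h1).
  have m0 : (0 < `|mode i| < n)%N by rewrite absz_gt0 k0 mode_lt.
  exact: (expansion_power_unique m0 h2 h1).
by apply: En_ext => i; case: (h i).
Qed.

(** As the expansion is unique, the coefficients chosen in [pi0] and [pioo]
    are the ones found here. *)
Lemma xget_expansion w (c : E) : expansion w c -> xget 0 (expansion w) = c.
Proof.
by move=> hc; apply: (expansion_unique _ hc); exact: (xgetPex 0 (ex_intro _ c hc)).
Qed.

Lemma formal_solution_boundary :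
  [/\ exists! c : E, expansion0 u c, exists! d : E, expansionoo u d
    & pioo n u = calC n nu (pi0 n u)].
Proof.
have [a ha] := fourier_represented.
have hc := represents_expansion ha.
have hd := represents_expansion (reflected_represents ha).
split.
- exists (coefs nu a); split; first exact: hc.
  by move=> c' hc'; exact: (expansion_unique hc hc').
- exists (coefs nu (calM nu a)); split; first exact: hd.
  by move=> c' hc'; exact: (expansion_unique hd hc').
- have -> : pi0 n u = calA0 nu a.
    by rewrite -(boundary_coefs nu a) /pi0 /expansion0 (xget_expansion hc).
  rewrite (calC_calA0 nu hn a) calAooE -(boundary_coefs nu (calM nu a)).
  by rewrite /pioo /expansionoo (xget_expansion hd).
Qed.

End Solutions.

Theorem lemma2p7 (R : realType) (n : nat) (nu : R[i])
    (hn : (2 <= n)%N) (hnu : forall m : nat, nu != - (m.+1%:R)) :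
  [/\ forall (a : R[i]) (h1 h2 : R[i] -> R[i]), V0 n h1 -> V0 n h2 ->
        calC n nu (a *: h1 + h2) = a *: calC n nu h1 + calC n nu h2,
      set_bij (V0 n) (Voo n) (calC n nu)
    & forall u : R[i] -> R[i], formal_solution n (nu * (nu + 1)) u ->
        [/\ exists! c : En R n, expansion0 u c,
            exists! d : En R n, expansionoo u d
          & pioo n u = calC n nu (pi0 n u)]].
Proof.
split.
- by move=> a h1 h2; exact: calC_linear.
- exact: calC_bij.
- by move=> u hu; exact: formal_solution_boundary.
Qed.
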